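(* Let $k$ be a field and let $\Lambda$ be a finite dimensional basic non-negatively graded Artin-Schelter Gorenstein $k$-algebra with $\Lambda_0=\Lambda/\operatorname{rad}(\Lambda)$, where $\operatorname{rad}(\Lambda)$ denotes the ungraded (Jacobson) radical, and with $n$ simple modules, all of which are $1$-dimensional. Then for any $\mathbb{A}^1$-homotopy invariant $\mathbb{E}$ we have $$\mathbb{E}(\underline{\mathsf{mod}}\,\Lambda)\cong \operatorname{cone}\bigl(\mathbb{E}(k)^{\oplus n}\xrightarrow{\ C_\Lambda\ }\mathbb{E}(k)^{\oplus n}\bigr),$$ where $C_\Lambda$ is the Cartan matrix of $\Lambda$.
   Context: Fix a base field $k$; DG-categories are over $k$, modules are right modules. $\mathbb{A}^1$-homotopy invariants. Let $\mathsf{DGcat}_k$ be the category of essentially small DG-categories over $k$, with morphisms the isomorphism classes of DG-functors, and let $\mathsf{T}$ be a triangulated category. $\mathsf{Perf}(\mathsf{C})$ is the DG-category of perfect DG-modules over $\mathsf{C}$. A localization sequence of DG-categories is, up to derived Morita equivalence, the inclusion of a thick subcategory followed by the corresponding Verdier quotient. A functor $\mathbb{E}\colon \mathsf{DGcat}_k\to\mathsf{T}$ is an $\mathbb{A}^1$-homotopy invariant if: (1) $\mathbb{E}$ sends derived Morita equivalences to isomorphisms (in particular $\mathsf{C}\to\mathsf{Perf}(\mathsf{C})$ is sent to an isomorphism); (2) $\mathbb{E}$ sends localization sequences of DG-categories to distinguished triangles; (3) $\mathbb{E}$ inverts the canonical inclusion $\mathsf{C}\to\mathsf{C}[t]=\mathsf{C}\otimes_k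 k[t]$ for every $\mathsf{C}$, with $k[t]$ in degree $0$. $\mathbb{E}(k)$ is the value on $k$ viewed as a DG-category with one object. A graded $k$-algebra $\Lambda$ is Artin-Schelter Gorenstein if it has finite injective dimension as a left and as a right $\Lambda$-module and $\mathbf{R}\underline{\mathrm{Hom}}_\Lambda(\Lambda_0,\Lambda)\cong\Sigma^d\Lambda_0(a)$ for some integers $d$ and $a$, where $\mathbf{R}\underline{\mathrm{Hom}}$ is the right derived functor of the graded hom-functor and $M(i)_j=M_{i+j}$; $a$ is the Gorenstein parameter. Under the hypotheses above $\Lambda$ is self-injective. $\underline{\mathsf{mod}}\,\Lambda$ is the stable category of finitely generated (ungraded) $\Lambda$-modules, equivalently the singularity category $\mathsf{D}^{\mathrm b}(\mathsf{mod}\,\Lambda)/\mathsf{D}^{\mathrm{perf}}(\mathsf{mod}\,\Lambda)$, with the DG-enhancement induced by this quotient; $\mathbb{E}(\underline{\mathsf{mod}}\,\Lambda)$ means $\mathbb{E}$ of this enhancement. The Cartan matrix $C_\Lambda$ is the $n\times n$ integer matrix with $(i,j)$ entry $\dim_k\operatorname{Hom}_\Lambda(P_i,P_j)$, for some fixed arbitrary order on the simples, where $P_i$ is the indecomposable projective with top the $i$th simple. An integer matrix acts on $\mathbb{E}(k)^{\oplus n}$ since $\mathsf{T}$ is additive. *)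

(* Defs.v *)
From HB Require Import structures.
From mathcomp Require Import all_boot all_order all_algebra all_field.
From mathcomp Require Import boolp zify.

Set Implicit Arguments.
Unset Strict Implicit.
Unset Printing Implicit Defensive.
#[local] Obligation Tactic := idtac.

Import Order.TTheory GRing.Theory Num.Theory.
Local Open Scope ring_scope.

(* Categories carry an equivalence relation [ceq] on morphisms, to be read as
   equality; this avoids forming quotients of sets of morphisms. *)
Record category := Category {
  cobj :> Type;
  chom : cobj -> cobj -> Type;
  ceq : forall X Y, chom X Y -> chom X Y -> Prop;
  cid : forall X, chom X X;
  ccomp : forall X Y Z, chom Y Z -> chom X Y -> chom X Z;
  ceq_refl : forall X Y (f : chom X Y), ceq f f;
  ceq_sym : forall X Y (f g : chom X Y), ceq f g -> ceq g f;
  ceq_trans : forall X Y (f g h : chom X Y), ceq f g -> ceq g h -> ceq f h;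
  ccomp_ceq : forall X Y Z (g g' : chom Y Z) (f f' : chom X Y),
    ceq g g' -> ceq f f' -> ceq (ccomp g f) (ccomp g' f');
  ccompA : forall W X Y Z (h : chom Y Z) (g : chom X Y) (f : chom W X),
    ceq (ccomp (ccomp h g) f) (ccomp h (ccomp g f));
  ccomp1l : forall X Y (f : chom X Y), ceq (ccomp (cid Y) f) f;
  ccomp1r : forall X Y (f : chom X Y), ceq (ccomp f (cid X)) f }.

Notation "g \oc f" := (ccomp g f) (at level 40, left associativity).
Notation "f =c g" := (ceq f g) (at level 70, no associativity).

Definition inverse_morphisms (C : category) (X Y : C) (f : chom X Y)
    (g : chom Y X) : Prop :=
  g \oc f =c cid X /\ f \oc g =c cid Y.

Definition is_iso (C : category) (X Y : C) (f : chom X Y) : Prop :=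
  exists g : chom Y X, inverse_morphisms f g.

Definition isomorphic (C : category) (X Y : C) : Prop :=
  exists f : chom X Y, is_iso f.

Record functor (C D : category) := Functor {
  fobj :> C -> D;
  fmor : forall X Y, chom X Y -> chom (fobj X) (fobj Y);
  fmor_ceq : forall X Y (f g : chom X Y), f =c g -> fmor f =c fmor g;
  fmor_id : forall X, fmor (cid X) =c cid (fobj X);
  fmor_comp : forall X Y Z (g : chom Y Z) (f : chom X Y),
    fmor (g \oc f) =c fmor g \oc fmor f }.

Section FunctorComp.
Variables (C D E : category) (G : functor D E) (F : functor C D).

Fact functor_comp_ceq X Y (f g : @chom C X Y) :
  f =c g -> fmor G (fmor F f) =c fmor G (fmor F g).
Proof. by move=> fg; do 2!apply: fmor_ceq. Qed.

Fact functor_comp_id X : fmor G (fmor F (cid X)) =c cid (G (F X)).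
Proof. by apply: ceq_trans (fmor_id G _); apply: fmor_ceq; apply: fmor_id. Qed.

Fact functor_comp_comp X Y Z (g : @chom C Y Z) (f : chom X Y) :
  fmor G (fmor F (g \oc f)) =c fmor G (fmor F g) \oc fmor G (fmor F f).
Proof. by apply: ceq_trans (fmor_comp G _ _); apply: fmor_ceq; apply: fmor_comp. Qed.

Definition functor_comp : functor C E :=
  Functor functor_comp_ceq functor_comp_id functor_comp_comp.
End FunctorComp.

Definition naturally_isomorphic (C D : category) (F G : functor C D) : Prop :=
  exists eta : forall X, chom (F X) (G X),
    (forall X, is_iso (eta X)) /\
    (forall X Y (f : chom X Y), eta Y \oc fmor F f =c fmor G f \oc eta X).

Definition is_equivalence (C D : category) (F : functor C D) : Prop :=
  [/\ forall X Y (f g : chom X Y), fmor F f =c fmor F g -> f =c g,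
      forall X Y (h : chom (F X) (F Y)), exists f, fmor F f =c h
    & forall Y, exists X, isomorphic (F X) Y].

(* The localization C[W^-1]: morphisms are formal composites of morphisms of C
   and of formal inverses of morphisms in W. *)
Section Localization.
Variables (C : category) (W : forall X Y : C, chom X Y -> Prop).

Inductive loc_hom : C -> C -> Type :=
| loc_in X Y of chom X Y : loc_hom X Y
| loc_inv X Y (f : chom X Y) of W f : loc_hom Y X
| loc_comp X Y Z of loc_hom Y Z & loc_hom X Y : loc_hom X Z.

Inductive loc_eq : forall X Y, loc_hom X Y -> loc_hom X Y -> Prop :=
| loc_refl X Y (f : loc_hom X Y) : loc_eq f f
| loc_sym X Y (f g : loc_hom X Y) of loc_eq f g : loc_eq g f
| loc_trans X Y (f g h : loc_hom X Y) of loc_eq f g & loc_eq g h : loc_eq f h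
| loc_cong X Y Z (g g' : loc_hom Y Z) (f f' : loc_hom X Y) of
    loc_eq g g' & loc_eq f f' : loc_eq (loc_comp g f) (loc_comp g' f')
| loc_assoc V X Y Z (h : loc_hom Y Z) (g : loc_hom X Y) (f : loc_hom V X) :
    loc_eq (loc_comp (loc_comp h g) f) (loc_comp h (loc_comp g f))
| loc_id_l X Y (f : loc_hom X Y) : loc_eq (loc_comp (loc_in (cid Y)) f) f
| loc_id_r X Y (f : loc_hom X Y) : loc_eq (loc_comp f (loc_in (cid X))) f
| loc_in_ceq X Y (f g : chom X Y) of f =c g : loc_eq (loc_in f) (loc_in g)
| loc_in_comp X Y Z (g : chom Y Z) (f : chom X Y) :
    loc_eq (loc_in (g \oc f)) (loc_comp (loc_in g) (loc_in f))
| loc_inv_l X Y (f : chom X Y) (w : W f) :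
    loc_eq (loc_comp (loc_inv w) (loc_in f)) (loc_in (cid X))
| loc_inv_r X Y (f : chom X Y) (w : W f) :
    loc_eq (loc_comp (loc_in f) (loc_inv w)) (loc_in (cid Y)).

Definition localization : category :=
  @Category C loc_hom loc_eq (fun X => loc_in (cid X)) loc_comp
    loc_refl loc_sym loc_trans loc_cong loc_assoc loc_id_l loc_id_r.

Definition to_localization : functor C localization :=
  @Functor C localization id loc_in loc_in_ceq
    (fun X => loc_refl (loc_in (cid X))) loc_in_comp.
End Localization.

Definition exhibits_localization (C D : category)
    (W : forall X Y : C, chom X Y -> Prop) (F : functor C D) : Prop :=
  exists G : functor (localization W) D,
    is_equivalence G /\
    naturally_isomorphic (functor_comp G (to_localization W)) F.

Section LinearConstructions.
Variable k : fieldType.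

Record subspace (V : lmodType k) := Subspace {
  subspace_mem :> V -> Prop;
  subspace0 : subspace_mem 0;
  subspaceZD : forall a u v,
    subspace_mem u -> subspace_mem v -> subspace_mem (a *: u + v) }.

Section SubspaceType.
Variables (V : lmodType k) (S : subspace V).

Definition in_subspace : {pred V} := fun v => `[< S v >].

Fact in_subspace_closed : submod_closed in_subspace.
Proof.
split=> [|a u v /asboolP Su /asboolP Sv]; apply/asboolP; first exact: subspace0.
exact: subspaceZD.
Qed.
HB.instance Definition _ := GRing.isSubmodClosed.Build k V in_subspace in_subspace_closed.

Record subspace_type := SubspaceElt {
  sv : V;
  _ : sv \in in_subspace }.

HB.instance Definition _ := [isSub for sv].
HB.instance Definition _ := [Choice of subspace_type by <:].
HB.instance Definition _ := [SubChoice_isSubLmodule of subspace_type by <:].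

Definition mks v (Sv : S v) : subspace_type := SubspaceElt (asboolT Sv : v \in in_subspace).

Lemma svP (x : subspace_type) : S (sv x).
Proof. by case: x => v /= /asboolP. Qed.

Lemma sv_inj : injective sv. Proof. exact: val_inj. Qed.
Lemma sv_linear : linear sv. Proof. by []. Qed.
End SubspaceType.

Definition dprod (I : Type) (V : I -> lmodType k) : Type := forall i, V i.

Section DProd.
Variables (I : Type) (V : I -> lmodType k).
Implicit Types f g h : dprod V.

HB.instance Definition _ := gen_eqMixin (dprod V).
HB.instance Definition _ := gen_choiceMixin (dprod V).

Let dadd f g : dprod V := fun i => f i + g i.
Let dopp f : dprod V := fun i => - f i.
Let dzero : dprod V := fun i => 0.
Let dscale a f : dprod V := fun i => a *: f i.

Fact dprod_addA : associative dadd.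
Proof. by move=> f g h; apply: functional_extensionality_dep => i; apply: addrA. Qed.
Fact dprod_addC : commutative dadd.
Proof. by move=> f g; apply: functional_extensionality_dep => i; apply: addrC. Qed.
Fact dprod_add0 : left_id dzero dadd.
Proof. by move=> f; apply: functional_extensionality_dep => i; apply: add0r. Qed.
Fact dprod_addN : left_inverse dzero dopp dadd.
Proof. by move=> f; apply: functional_extensionality_dep => i; apply: addNr. Qed.
HB.instance Definition _ := GRing.isZmodule.Build (dprod V)
  dprod_addA dprod_addC dprod_add0 dprod_addN.

Fact dprod_scaleA a b f : dscale a (dscale b f) = dscale (a * b) f.
Proof. by apply: functional_extensionality_dep => i; apply: scalerA. Qed.
Fact dprod_scale1 : left_id 1 dscale.
Proof. by move=> f; apply: functional_extensionality_dep => i; apply: scale1r. Qed.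
Fact dprod_scaleDr : right_distributive dscale +%R.
Proof. by move=> a f g; apply: functional_extensionality_dep => i; apply: scalerDr. Qed.
Fact dprod_scaleDl f : {morph dscale^~ f : a b / a + b}.
Proof. by move=> a b; apply: functional_extensionality_dep => i; apply: scalerDl. Qed.
HB.instance Definition _ := GRing.Zmodule_isLmodule.Build k (dprod V)
  dprod_scaleA dprod_scale1 dprod_scaleDr dprod_scaleDl.

Lemma dprod_zd a f g i : (a *: f + g : dprod V) i = a *: f i + g i.
Proof. by []. Qed.
End DProd.

End LinearConstructions.

(* A degree of a composite is never the literal sum of the degrees: it is any
   integer provably equal to it, so that no transport along an equation between
   degrees is needed. *)
Record dgcat (k : fieldType) := DGCat {
  dg_ob :> Type;
  dg_hom : dg_ob -> dg_ob -> int -> lmodType k;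
  dg_d : forall X Y i j, i + 1 = j -> dg_hom X Y i -> dg_hom X Y j;
  dg_id : forall X, dg_hom X X 0;
  dg_comp : forall X Y Z i j l, i + j = l ->
    dg_hom Y Z i -> dg_hom X Y j -> dg_hom X Z l;
  dg_d_linear : forall X Y i j (e : i + 1 = j), linear (@dg_d X Y i j e);
  dg_comp_linear_l : forall X Y Z i j l (e : i + j = l) (f : dg_hom X Y j),
    linear (fun g : dg_hom Y Z i => dg_comp e g f);
  dg_comp_linear_r : forall X Y Z i j l (e : i + j = l) (g : dg_hom Y Z i),
    linear (fun f : dg_hom X Y j => dg_comp e g f);
  dg_dd : forall X Y i j l (e1 : i + 1 = j) (e2 : j + 1 = l) (f : dg_hom X Y i),
    dg_d e2 (dg_d e1 f) = 0;
  dg_leibniz : forall X Y Z i j l i' j' l' (e : i + j = l) (ei : i + 1 = i')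
      (ej : j + 1 = j') (el : l + 1 = l') (e1 : i' + j = l') (e2 : i + j' = l')
      (g : dg_hom Y Z i) (f : dg_hom X Y j),
    dg_d el (dg_comp e g f) =
    dg_comp e1 (dg_d ei g) f + (-1 : k) ^ i *: dg_comp e2 g (dg_d ej f);
  dg_compA : forall W X Y Z a b c ab bc abc (e1 : a + b = ab) (e2 : ab + c = abc)
      (e3 : b + c = bc) (e4 : a + bc = abc)
      (h : dg_hom Y Z a) (g : dg_hom X Y b) (f : dg_hom W X c),
    dg_comp e2 (dg_comp e1 h g) f = dg_comp e4 h (dg_comp e3 g f);
  dg_comp1l : forall X Y i (e : 0 + i = i) (f : dg_hom X Y i),
    dg_comp e (dg_id Y) f = f;
  dg_comp1r : forall X Y i (e : i + 0 = i) (f : dg_hom X Y i),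
    dg_comp e f (dg_id X) = f }.

Arguments dg_id {k d} X.
Arguments dg_d {k d X Y i j} e f : rename.
Arguments dg_comp {k d X Y Z i j l} e g f : rename.

Section LinearLemmas.
Variables (k : fieldType) (U V : lmodType k) (f : U -> V).
Hypothesis Lf : linear f.
Lemma lin0 : f 0 = 0.
Proof. by have := Lf (-1) 0 0; rewrite scaler0 addr0 scaleN1r addNr. Qed.
Lemma linZ a u : f (a *: u) = a *: f u.
Proof. by have := Lf a u 0; rewrite lin0 !addr0. Qed.
Lemma linD u v : f (u + v) = f u + f v.
Proof. by have := Lf 1 u v; rewrite !scale1r. Qed.
Lemma linN u : f (- u) = - f u.
Proof. by rewrite -scaleN1r linZ scaleN1r. Qed.
Lemma linB u v : f (u - v) = f u - f v.
Proof. by rewrite linD linN. Qed.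
Lemma lin_sum (I : Type) (r : seq I) (P : pred I) (F : I -> U) :
  f (\sum_(i <- r | P i) F i) = \sum_(i <- r | P i) f (F i).
Proof. by apply: (big_morph f linD lin0). Qed.
End LinearLemmas.

Section DGBasics.
Variables (k : fieldType) (A : dgcat k).
Implicit Types X Y Z : A.

Definition dg_closed X Y i (f : dg_hom X Y i) : Prop :=
  forall j (e : i + 1 = j), dg_d e f = 0.

Lemma dg_closedP X Y i j (e : i + 1 = j) (f : dg_hom X Y i) :
  dg_d e f = 0 -> dg_closed f.
Proof. by move=> df j' e'; subst j; subst j'. Qed.

Lemma dg_comp0l X Y Z i j l (e : i + j = l) (f : dg_hom X Y j) :
  dg_comp e (0 : dg_hom Y Z i) f = 0.
Proof. exact: (lin0 (dg_comp_linear_l e f)). Qed.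

Lemma dg_comp0r X Y Z i j l (e : i + j = l) (g : dg_hom Y Z i) :
  dg_comp e g (0 : dg_hom X Y j) = 0.
Proof. exact: (lin0 (dg_comp_linear_r e g)). Qed.

Lemma dg_id_closed X : dg_closed (dg_id X).
Proof.
apply: (@dg_closedP _ _ _ _ (add0r (1 : int))).
have := dg_leibniz (addr0 0) (add0r 1) (add0r 1) (add0r 1) (addr0 1) (add0r 1)
  (dg_id X) (dg_id X).
rewrite dg_comp1l dg_comp1r dg_comp1l expr0z scale1r => /eqP.
by rewrite -subr_eq0 opprD addrA subrr add0r oppr_eq0 => /eqP.
Qed.

Lemma dg_comp_closed X Y Z i j l (e : i + j = l) (g : dg_hom Y Z i) (f : dg_hom X Y j) :
  dg_closed g -> dg_closed f -> dg_closed (dg_comp e g f).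
Proof.
move=> cg cf l' el; have e1 : (i + 1) + j = l' by rewrite -el -e addrAC.
have e2 : i + (j + 1) = l' by rewrite -el -e addrA.
rewrite (dg_leibniz e erefl erefl el e1 e2) cg cf.
by rewrite dg_comp0l dg_comp0r scaler0 addr0.
Qed.

Definition dg_homotopic X Y (f g : dg_hom X Y 0) : Prop :=
  exists h : dg_hom X Y (-1), f - g = dg_d (addNr 1) h.

Lemma dg_homotopic_refl X Y (f : dg_hom X Y 0) : dg_homotopic f f.
Proof. by exists 0; rewrite subrr (lin0 (dg_d_linear _)). Qed.

Lemma dg_homotopic_sym X Y (f g : dg_hom X Y 0) :
  dg_homotopic f g -> dg_homotopic g f.
Proof. by case=> h E; exists (- h); rewrite (linN (dg_d_linear _)) -E opprB. Qed.

Lemma dg_homotopic_trans X Y (f g h : dg_hom X Y 0) :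
  dg_homotopic f g -> dg_homotopic g h -> dg_homotopic f h.
Proof.
case=> s Es [t Et]; exists (s + t).
by rewrite (linD (dg_d_linear _)) -Es -Et addrA subrK.
Qed.

Definition h0_hom X Y : Type := {f : dg_hom X Y 0 | dg_closed f}.
Definition h0_eq X Y (f g : h0_hom X Y) : Prop := dg_homotopic (sval f) (sval g).
Definition h0_id X : h0_hom X X := exist _ (dg_id X) (dg_id_closed X).
Definition h0_comp X Y Z (g : h0_hom Y Z) (f : h0_hom X Y) : h0_hom X Z :=
  exist _ (dg_comp (addr0 0) (sval g) (sval f))
    (dg_comp_closed (addr0 0) (svalP g) (svalP f)).

Fact h0_comp_ceq X Y Z (g g' : h0_hom Y Z) (f f' : h0_hom X Y) :
  h0_eq g g' -> h0_eq f f' -> h0_eq (h0_comp g f) (h0_comp g' f').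
Proof.
case: g g' f f' => [g cg] [g' cg'] [f cf] [f' cf'] [/= s Es] [/= t Et].
exists (dg_comp (addr0 (-1)) s f + dg_comp (add0r (-1)) g' t) => /=.
rewrite (linD (dg_d_linear _)).
rewrite (dg_leibniz (addr0 (-1)) (addNr 1) (add0r 1) (addNr 1) (addr0 0) (addNr 1)).
rewrite (dg_leibniz (add0r (-1)) (add0r 1) (addNr 1) (addNr 1) (subrr 1) (addr0 0)).
rewrite cf cg' dg_comp0l dg_comp0r scaler0 addr0 add0r expr0z scale1r -Es -Et.
by rewrite (linB (dg_comp_linear_l _ _)) (linB (dg_comp_linear_r _ _)) addrA subrK.
Qed.

Fact h0_compA W X Y Z (h : h0_hom Y Z) (g : h0_hom X Y) (f : h0_hom W X) :
  h0_eq (h0_comp (h0_comp h g) f) (h0_comp h (h0_comp g f)).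
Proof.
by rewrite /h0_eq /= (dg_compA _ _ (addr0 0) (addr0 0)); apply: dg_homotopic_refl.
Qed.

Fact h0_comp1l X Y (f : h0_hom X Y) : h0_eq (h0_comp (h0_id Y) f) f.
Proof. by rewrite /h0_eq /= dg_comp1l; apply: dg_homotopic_refl. Qed.

Fact h0_comp1r X Y (f : h0_hom X Y) : h0_eq (h0_comp f (h0_id X)) f.
Proof. by rewrite /h0_eq /= dg_comp1r; apply: dg_homotopic_refl. Qed.

Definition h0 : category :=
  @Category A h0_hom h0_eq h0_id h0_comp
    (fun X Y f => dg_homotopic_refl (sval f))
    (fun X Y f g => @dg_homotopic_sym X Y (sval f) (sval g))
    (fun X Y f g h => @dg_homotopic_trans X Y (sval f) (sval g) (sval h))
    h0_comp_ceq h0_compA h0_comp1l h0_comp1r.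
End DGBasics.

Record dgfunctor (k : fieldType) (A B : dgcat k) := DGFunctor {
  dgf_ob :> A -> B;
  dgf_hom : forall X Y i, dg_hom X Y i -> dg_hom (dgf_ob X) (dgf_ob Y) i;
  dgf_linear : forall X Y i, linear (@dgf_hom X Y i);
  dgf_d : forall X Y i j (e : i + 1 = j) (f : dg_hom X Y i),
    dgf_hom (dg_d e f) = dg_d e (dgf_hom f);
  dgf_id : forall X, dgf_hom (dg_id X) = dg_id (dgf_ob X);
  dgf_comp : forall X Y Z i j l (e : i + j = l) (g : dg_hom Y Z i) (f : dg_hom X Y j),
    dgf_hom (dg_comp e g f) = dg_comp e (dgf_hom g) (dgf_hom f) }.

Lemma dgf_closed (k : fieldType) (A B : dgcat k) (F : dgfunctor A B) X Y i
    (f : dg_hom X Y i) :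
  dg_closed f -> dg_closed (dgf_hom F f).
Proof. by move=> cf j e; rewrite -dgf_d cf (lin0 (@dgf_linear _ _ _ _ _ _ _)). Qed.

Section DGCategoryOfDGCategories.
Variable k : fieldType.
Implicit Types A B C D : dgcat k.

Definition dgf_idf A : dgfunctor A A :=
  @DGFunctor k A A id (fun X Y i f => f) (fun X Y i a u v => erefl)
    (fun X Y i j e f => erefl) (fun X => erefl) (fun X Y Z i j l e g f => erefl).

Section Comp.
Variables (A B C : dgcat k) (G : dgfunctor B C) (F : dgfunctor A B).
Let H X Y i (f : dg_hom X Y i) := dgf_hom G (dgf_hom F f).
Fact dgf_comp_linear X Y i : linear (@H X Y i).
Proof. by move=> a u v; rewrite /H !dgf_linear. Qed.
Fact dgf_comp_d X Y i j (e : i + 1 = j) (f : dg_hom X Y i) : H (dg_d e f) = dg_d e (H f).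
Proof. by rewrite /H !dgf_d. Qed.
Fact dgf_comp_id X : H (dg_id X) = dg_id (G (F X)).
Proof. by rewrite /H !dgf_id. Qed.
Fact dgf_comp_comp X Y Z i j l (e : i + j = l) (g : dg_hom Y Z i) (f : dg_hom X Y j) :
  H (dg_comp e g f) = dg_comp e (H g) (H f).
Proof. by rewrite /H !dgf_comp. Qed.
Definition dgf_compf : dgfunctor A C :=
  DGFunctor dgf_comp_linear dgf_comp_d dgf_comp_id dgf_comp_comp.
End Comp.

(* Isomorphism of DG-functors: a natural isomorphism whose components are closed
   of degree 0. *)
Definition dgf_iso A B (F G : dgfunctor A B) : Prop :=
  exists (a : forall X, dg_hom (F X) (G X) 0) (b : forall X, dg_hom (G X) (F X) 0),
  [/\ forall X, dg_closed (a X) /\ dg_closed (b X),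
      forall X, dg_comp (addr0 0) (b X) (a X) = dg_id (F X),
      forall X, dg_comp (addr0 0) (a X) (b X) = dg_id (G X)
    & forall X Y i (f : dg_hom X Y i),
        dg_comp (add0r i) (a Y) (dgf_hom F f) = dg_comp (addr0 i) (dgf_hom G f) (a X)].

Fact dgf_iso_refl A B (F : dgfunctor A B) : dgf_iso F F.
Proof.
exists (fun X => dg_id (F X)), (fun X => dg_id (F X)); split=> *.
- by split; apply: dg_id_closed.
- by rewrite dg_comp1l.
- by rewrite dg_comp1l.
- by rewrite dg_comp1l dg_comp1r.
Qed.

Fact dgf_iso_sym A B (F G : dgfunctor A B) : dgf_iso F G -> dgf_iso G F.
Proof.
case=> a [b [cl ba ab nat]]; exists b, a; split=> // [X|X Y i f].
  by have [] := cl X.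
have := congr1 (fun u => dg_comp (add0r i) (b Y) (dg_comp (addr0 i) u (b X)))
  (nat _ _ _ f).
rewrite (dg_compA _ _ (addr0 0) (addr0 i)) // ab dg_comp1r => <-.
rewrite (dg_compA _ _ (addr0 i) (add0r i)).
by rewrite -(dg_compA (addr0 0) (add0r i)) ba dg_comp1l.
Qed.

Fact dgf_iso_trans A B (F G H : dgfunctor A B) :
  dgf_iso F G -> dgf_iso G H -> dgf_iso F H.
Proof.
case=> a [b [cl ba ab nat]] [a' [b' [cl' ba' ab' nat']]].
exists (fun X => dg_comp (addr0 0) (a' X) (a X)).
exists (fun X => dg_comp (addr0 0) (b X) (b' X)).
split=> [X|X|X|X Y i f].
- by have [? ?] := cl X; have [? ?] := cl' X; split; apply: dg_comp_closed.
- rewrite (dg_compA _ _ (addr0 0) (addr0 0)).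
  by rewrite -(dg_compA (addr0 0) (addr0 0) _ _ (b' X)) ba' dg_comp1l.
- rewrite (dg_compA _ _ (addr0 0) (addr0 0)).
  by rewrite -(dg_compA (addr0 0) (addr0 0) _ _ (a X)) ab dg_comp1l.
- rewrite (dg_compA _ _ (add0r i) (add0r i)) nat.
  by rewrite -(dg_compA (add0r i) (addr0 i)) nat' (dg_compA _ _ (addr0 0) (addr0 i)).
Qed.

Fact dgf_iso_comp A B C (G G' : dgfunctor B C) (F F' : dgfunctor A B) :
  dgf_iso G G' -> dgf_iso F F' -> dgf_iso (dgf_compf G F) (dgf_compf G' F').
Proof.
move=> isoG isoF; apply: (@dgf_iso_trans _ _ _ (dgf_compf G' F)).
  case: isoG => a [b [cl ba ab nat]].
  by exists (fun X => a (F X)), (fun X => b (F X)); split=> *; rewrite /= ?nat.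
case: isoF => a [b [cl ba ab nat]].
exists (fun X => dgf_hom G' (a X)), (fun X => dgf_hom G' (b X)); split=> [X|X|X|X Y i f].
- have [ca cb] := cl X.
  by split; [exact: (dgf_closed G' ca) | exact: (dgf_closed G' cb)].
- by rewrite /= -dgf_comp ba dgf_id.
- by rewrite /= -dgf_comp ab dgf_id.
- by rewrite /= -!dgf_comp nat.
Qed.

Fact dgf_comp1l A B (F : dgfunctor A B) : dgf_iso (dgf_compf (dgf_idf B) F) F.
Proof. by case: F => *; apply: dgf_iso_refl. Qed.
Fact dgf_comp1r A B (F : dgfunctor A B) : dgf_iso (dgf_compf F (dgf_idf A)) F.
Proof. by case: F => *; apply: dgf_iso_refl. Qed.
Fact dgf_compA A B C D (H : dgfunctor C D) (G : dgfunctor B C) (F : dgfunctor A B) :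
  dgf_iso (dgf_compf (dgf_compf H G) F) (dgf_compf H (dgf_compf G F)).
Proof.
exists (fun X => dg_id _), (fun X => dg_id _); split=> *.
- by split; apply: dg_id_closed.
- by rewrite dg_comp1l.
- by rewrite dg_comp1l.
- by rewrite dg_comp1l dg_comp1r.
Qed.

(* Isomorphic DG-functors count as equal. Smallness is relative to the universe:
   objects and morphisms of a [dgcat] live in the universe of [lmodType k], which
   is also that of the DG-modules below. *)
Definition DGcat : category :=
  @Category (dgcat k) (@dgfunctor k) dgf_iso dgf_idf dgf_compf
    dgf_iso_refl dgf_iso_sym dgf_iso_trans dgf_iso_comp dgf_compA
    dgf_comp1l dgf_comp1r.

Section H0Functor.
Variables (A B : dgcat k) (F : dgfunctor A B).

Definition h0f_mor X Y (f : h0_hom X Y) : h0_hom (F X) (F Y) :=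
  exist _ (dgf_hom F (sval f)) (dgf_closed F (svalP f)).
Fact h0f_ceq X Y (f g : h0_hom X Y) : h0_eq f g -> h0_eq (h0f_mor f) (h0f_mor g).
Proof.
case=> h E; exists (dgf_hom F h).
by rewrite /= -(linB (@dgf_linear _ _ _ _ _ _ _)) E dgf_d.
Qed.
Fact h0f_id X : h0_eq (h0f_mor (h0_id X)) (h0_id (F X)).
Proof. by rewrite /h0_eq /= dgf_id; apply: dg_homotopic_refl. Qed.
Fact h0f_comp X Y Z (g : h0_hom Y Z) (f : h0_hom X Y) :
  h0_eq (h0f_mor (h0_comp g f)) (h0_comp (h0f_mor g) (h0f_mor f)).
Proof. by rewrite /h0_eq /= dgf_comp; apply: dg_homotopic_refl. Qed.
Definition h0_functor : functor (h0 A) (h0 B) :=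
  @Functor (h0 A) (h0 B) F h0f_mor h0f_ceq h0f_id h0f_comp.
End H0Functor.
End DGCategoryOfDGCategories.

(* Right DG-modules. *)
Record dgmod (k : fieldType) (A : dgcat k) := DGMod {
  mod_ob :> A -> int -> lmodType k;
  mod_d : forall X i j, i + 1 = j -> mod_ob X i -> mod_ob X j;
  mod_act : forall X Y i j l, i + j = l -> mod_ob Y i -> dg_hom X Y j -> mod_ob X l;
  mod_d_linear : forall X i j (e : i + 1 = j), linear (@mod_d X i j e);
  mod_act_linear_l : forall X Y i j l (e : i + j = l) (f : dg_hom X Y j),
    linear (fun m : mod_ob Y i => mod_act e m f);
  mod_act_linear_r : forall X Y i j l (e : i + j = l) (m : mod_ob Y i),
    linear (fun f : dg_hom X Y j => mod_act e m f);
  mod_dd : forall X i j l (e1 : i + 1 = j) (e2 : j + 1 = l) (m : mod_ob X i),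
    mod_d e2 (mod_d e1 m) = 0;
  mod_leibniz : forall X Y i j l i' j' l' (e : i + j = l) (ei : i + 1 = i')
      (ej : j + 1 = j') (el : l + 1 = l') (e1 : i' + j = l') (e2 : i + j' = l')
      (m : mod_ob Y i) (f : dg_hom X Y j),
    mod_d el (mod_act e m f) =
    mod_act e1 (mod_d ei m) f + (-1 : k) ^ i *: mod_act e2 m (dg_d ej f);
  mod_actA : forall X Y Z a b c ab bc abc (e1 : a + b = ab) (e2 : ab + c = abc)
      (e3 : b + c = bc) (e4 : a + bc = abc)
      (m : mod_ob Z a) (g : dg_hom Y Z b) (f : dg_hom X Y c),
    mod_act e2 (mod_act e1 m g) f = mod_act e4 m (dg_comp e3 g f);
  mod_act1 : forall X i (e : i + 0 = i) (m : mod_ob X i),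
    mod_act e m (dg_id X) = m }.

Arguments mod_d {k A d X i j} e m : rename.
Arguments mod_act {k A d X Y i j l} e m f : rename.

Record dgmod_hom (k : fieldType) (A : dgcat k) (M N : dgmod A) := DGModHom {
  dgm_fun :> forall X i, M X i -> N X i;
  dgm_linear : forall X i, linear (@dgm_fun X i);
  dgm_d : forall X i j (e : i + 1 = j) (m : M X i),
    dgm_fun (mod_d e m) = mod_d e (dgm_fun m);
  dgm_act : forall X Y i j l (e : i + j = l) (m : M Y i) (f : dg_hom X Y j),
    dgm_fun (mod_act e m f) = mod_act e (dgm_fun m) f }.

Section DerivedCategory.
Variables (k : fieldType) (A : dgcat k).
Implicit Types M N P : dgmod A.

Definition dgm_id M : dgmod_hom M M :=
  @DGModHom k A M M (fun X i m => m) (fun X i a u v => erefl)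
    (fun X i j e m => erefl) (fun X Y i j l e m f => erefl).

Section Comp.
Variables (M N P : dgmod A) (g : dgmod_hom N P) (f : dgmod_hom M N).
Let h X i (m : M X i) : P X i := g X i (f X i m).
Fact dgm_comp_linear X i : linear (@h X i).
Proof. by move=> a u v; rewrite /h !dgm_linear. Qed.
Fact dgm_comp_d X i j (e : i + 1 = j) (m : M X i) : h (mod_d e m) = mod_d e (h m).
Proof. by rewrite /h !dgm_d. Qed.
Fact dgm_comp_act X Y i j l (e : i + j = l) (m : M Y i) (u : dg_hom X Y j) :
  h (mod_act e m u) = mod_act e (h m) u.
Proof. by rewrite /h !dgm_act. Qed.
Definition dgm_comp : dgmod_hom M P := DGModHom dgm_comp_linear dgm_comp_d dgm_comp_act.
End Comp.

Definition dgm_eq M N (f g : dgmod_hom M N) : Prop := forall X i (m : M X i), f X i m = g X i m.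

Program Definition Cdg : category :=
  @Category (dgmod A) (@dgmod_hom k A) dgm_eq dgm_id dgm_comp _ _ _ _ _ _ _.
Next Obligation. by []. Qed.
Next Obligation. by move=> M N f g E X i m; rewrite E. Qed.
Next Obligation. by move=> M N f g h E E' X i m; rewrite E E'. Qed.
Next Obligation. by move=> M N P g g' f f' E E' X i m; rewrite /= E E'. Qed.
Next Obligation. by []. Qed.
Next Obligation. by []. Qed.
Next Obligation. by []. Qed.

Definition mod_cocycle M X i (m : M X i) : Prop :=
  forall j (e : i + 1 = j), mod_d e m = 0.
Definition mod_coboundary M X i (m : M X i) : Prop :=
  exists j (e : j + 1 = i) (m' : M X j), mod_d e m' = m.

Definition acyclic M : Prop :=
  forall X i (m : M X i), mod_cocycle m -> mod_coboundary m.

Definition quasi_iso (M N : Cdg) (f : chom M N) : Prop :=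
  forall X i,
    (forall n : N X i, mod_cocycle n ->
       exists2 m : M X i, mod_cocycle m & mod_coboundary (n - f X i m)) /\
    (forall m : M X i, mod_cocycle m -> mod_coboundary (f X i m) -> mod_coboundary m).

Definition Dcat : category := localization quasi_iso.
Definition to_Dcat : functor Cdg Dcat := to_localization quasi_iso.
End DerivedCategory.

Section Restriction.
Variables (k : fieldType) (A B : dgcat k) (F : dgfunctor A B).

Section Ob.
Variable M : dgmod B.
Program Definition res_ob : dgmod A :=
  @DGMod k A (fun X i => M (F X) i) (fun X i j e m => mod_d e m)
    (fun X Y i j l e m f => mod_act e m (dgf_hom F f)) _ _ _ _ _ _ _.
Next Obligation. by move=> *; apply: mod_d_linear. Qed.
Next Obligation. by move=> *; apply: mod_act_linear_l. Qed.
Next Obligation. by move=> X Y i j l e m a u v; rewrite /= dgf_linear mod_act_linear_r. Qed.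
Next Obligation. by move=> *; apply: mod_dd. Qed.
Next Obligation. by move=> *; rewrite /= dgf_d; apply: mod_leibniz. Qed.
Next Obligation. by move=> *; rewrite /= dgf_comp; apply: mod_actA. Qed.
Next Obligation. by move=> *; rewrite /= dgf_id mod_act1. Qed.
End Ob.

Program Definition res_mor (M N : dgmod B) (f : dgmod_hom M N) :
    dgmod_hom (res_ob M) (res_ob N) :=
  @DGModHom k A (res_ob M) (res_ob N) (fun X i m => f (F X) i m) _ _ _.
Next Obligation. by move=> M N f X i; apply: (@dgm_linear _ _ _ _ f (F X) i). Qed.
Next Obligation. by move=> *; rewrite /= dgm_d. Qed.
Next Obligation. by move=> *; rewrite /= dgm_act. Qed.

Program Definition restriction : functor (Cdg B) (Cdg A) :=
  @Functor (Cdg B) (Cdg A) res_ob res_mor _ _ _.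
Next Obligation. by move=> M N f g E X i m; apply: E. Qed.
Next Obligation. by []. Qed.
Next Obligation. by []. Qed.
End Restriction.

(* The functor D(B) -> D(A) induced by restriction along F is an equivalence. *)
Definition derived_morita (k : fieldType) (A B : DGcat k) (F : chom A B) : Prop :=
  exists R : functor (Dcat B) (Dcat A),
    naturally_isomorphic (functor_comp R (to_Dcat B))
                         (functor_comp (to_Dcat A) (restriction F)) /\
    is_equivalence R.

Definition Hmo (k : fieldType) : category := localization (@derived_morita k).
Definition to_Hmo (k : fieldType) : functor (DGcat k) (Hmo k) :=
  to_localization (@derived_morita k).

Lemma int_eq_irr (a b : int) (e e' : a = b) : e = e'.
Proof. exact: eq_irrelevance. Qed.

Lemma signD (k : fieldType) (i j : int) : (-1 : k) ^ (i + j) = (-1) ^ i * (-1) ^ j.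
Proof. by rewrite exprzDr ?unitrN1. Qed.

Lemma sign_sq (k : fieldType) (i : int) : (-1 : k) ^ i * (-1) ^ i = 1.
Proof. by rewrite -exprzMl ?unitrN1 // mulrNN mulr1 exp1rz. Qed.

(* The complex of graded morphisms of DG-modules M -> N. *)
Section HomComplex.
Variables (k : fieldType) (A : dgcat k) (M N : dgmod A).

Definition hom_fam (n : int) : lmodType k :=
  dprod (fun X : A => dprod (fun p : int => dprod (fun q : int =>
    dprod (fun e : p + n = q => dprod (fun m : M X p => N X q))))).

Definition is_graded_hom n (u : hom_fam n) : Prop :=
  (forall X p q (e : p + n = q), linear (u X p q e : M X p -> N X q)) /\
  (forall X Y p j p' q q' (e : p + n = q) (e' : p' + n = q') (a : p + j = p')
     (b : q + j = q') (m : M Y p) (f : dg_hom X Y j),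
     u X p' q' e' (mod_act a m f) = mod_act b (u Y p q e m) f).

Fact graded_hom0 n : is_graded_hom (0 : hom_fam n).
Proof.
split=> [X p q e a m m'|X Y p j p' q q' e e' a b m f].
  by rewrite /= scaler0 addr0.
by rewrite /= (lin0 (mod_act_linear_l _ _)).
Qed.

Fact graded_homZD n c (u v : hom_fam n) :
  is_graded_hom u -> is_graded_hom v -> is_graded_hom (c *: u + v).
Proof.
move=> [Lu Au] [Lv Av]; split=> [X p q e a m m'|X Y p j p' q q' e e' a b m f].
  rewrite !dprod_zd Lu Lv !scalerDr !scalerA (mulrC c) -!addrA; congr (_ + _).
  by rewrite addrCA.
rewrite !dprod_zd (Au _ _ _ _ _ q _ e _ _ b) (Av _ _ _ _ _ q _ e _ _ b).
by rewrite (mod_act_linear_l _ _).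
Qed.

Definition graded_hom_subspace n : subspace (hom_fam n) :=
  Subspace (graded_hom0 n) (@graded_homZD n).

Definition homcx (n : int) : lmodType k := subspace_type (graded_hom_subspace n).

Definition hc n (u : homcx n) X p q (e : p + n = q) (m : M X p) : N X q := sv u X p q e m.

Lemma hc_linear n (u : homcx n) X p q (e : p + n = q) : linear (@hc n u X p q e).
Proof. exact: (proj1 (svP u) X p q e). Qed.

Lemma hc_act n (u : homcx n) X Y p j p' q q' (e : p + n = q) (e' : p' + n = q')
    (a : p + j = p') (b : q + j = q') (m : M Y p) (f : dg_hom X Y j) :
  hc u e' (mod_act a m f) = mod_act b (hc u e m) f.
Proof. exact: (proj2 (svP u)). Qed.

Lemma hcP n (u v : homcx n) :
  (forall X p q (e : p + n = q) (m : M X p), hc u e m = hc v e m) -> u = v.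
Proof.
move=> E; apply: sv_inj.
do 5![apply: functional_extensionality_dep => ?]; exact: E.
Qed.

Lemma hc_zd n c (u v : homcx n) X p q (e : p + n = q) (m : M X p) :
  hc (c *: u + v) e m = c *: hc u e m + hc v e m.
Proof. by rewrite /hc sv_linear. Qed.

Section Mk.
Variables (n : int) (u : forall X p q, p + n = q -> M X p -> N X q).
Hypothesis Lu : forall X p q (e : p + n = q), linear (@u X p q e).
Hypothesis Au : forall X Y p j p' q q' (e : p + n = q) (e' : p' + n = q')
    (a : p + j = p') (b : q + j = q') (m : M Y p) (f : dg_hom X Y j),
  u e' (mod_act a m f) = mod_act b (u e m) f.
Definition mk_homcx : homcx n :=
  @mks k _ (graded_hom_subspace n) (fun X p q e m => u e m) (conj Lu Au).
Lemma hc_mk X p q (e : p + n = q) (m : M X p) : hc mk_homcx e m = u e m.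
Proof. by []. Qed.
End Mk.

Section Differential.
Variables (n n' : int) (en : n + 1 = n') (u : homcx n).

Let e1 p q : p + n' = q -> (p + n) + 1 = q. Proof. by clear u; lia. Qed.
Let e2 p q : p + n' = q -> (p + 1) + n = q. Proof. by clear u; lia. Qed.

Definition hc_d_fun X p q (e : p + n' = q) (m : M X p) : N X q :=
  mod_d (e1 e) (hc u (erefl (p + n)) m)
  - (-1 : k) ^ n *: hc u (e2 e) (mod_d (erefl (p + 1)) m).

Lemma hc_d_funE X p q r s (e : p + n' = q) (a : p + n = r) (b : r + 1 = q)
    (c : p + 1 = s) (d : s + n = q) (m : M X p) :
  hc_d_fun e m = mod_d b (hc u a m) - (-1 : k) ^ n *: hc u d (mod_d c m).
Proof.
by subst r s; rewrite /hc_d_fun (int_eq_irr (e1 e) b) (int_eq_irr (e2 e) d).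
Qed.

Fact hc_d_linear X p q (e : p + n' = q) : linear (@hc_d_fun X p q e).
Proof.
move=> a m m'; rewrite /hc_d_fun hc_linear !mod_d_linear hc_linear.
by rewrite scalerBr !scalerDr opprD !scalerA (mulrC a) addrACA.
Qed.

Fact hc_d_act X Y p j p' q q' (e : p + n' = q) (e' : p' + n' = q')
    (a : p + j = p') (b : q + j = q') (m : M Y p) (f : dg_hom X Y j) :
  hc_d_fun e' (mod_act a m f) = mod_act b (hc_d_fun e m) f.
Proof.
have a1 : p' + 1 + n = q' by clear -e' en; lia.
have a2 : p' + n + 1 = q' by clear -e' en; lia.
have a3 : p + n + 1 = q by clear -e en; lia.
have a4 : p + 1 + n = q by clear -e en; lia.
have a5 : p + n + j = p' + n by clear -a; lia.
have a6 : p + n + (j + 1) = q' by clear -a e' en; lia.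
have a7 : p + 1 + j = p' + 1 by clear -a; lia.
have a8 : p + (j + 1) = p' + 1 by clear -a; lia.
rewrite (hc_d_funE e' erefl a2 erefl a1) (hc_d_funE e erefl a3 erefl a4).
rewrite (hc_act _ erefl erefl a a5) (mod_leibniz _ a3 erefl _ b a6).
rewrite (mod_leibniz _ erefl erefl _ a7 a8) (linD (hc_linear _ _)) (linZ (hc_linear _ _)).
rewrite (hc_act _ a4 _ _ b) (hc_act _ erefl _ _ a6) (linB (mod_act_linear_l _ _)).
rewrite (linZ (mod_act_linear_l _ _)) scalerDr scalerA opprD.
rewrite signD mulrC addrACA subrr addr0 //.
Qed.

Definition hc_d : homcx n' := mk_homcx hc_d_linear hc_d_act.
End Differential.

Lemma hc_d_linear_u n n' (en : n + 1 = n') : linear (@hc_d n n' en).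
Proof.
move=> a u v; apply: hcP => X p q e m.
have a1 : p + 1 + n = q by clear -e en; lia.
have a2 : p + n + 1 = q by clear -e en; lia.
rewrite hc_zd !hc_mk !(hc_d_funE en _ e erefl a2 erefl a1) !hc_zd mod_d_linear.
by rewrite scalerBr !scalerDr opprD !scalerA (mulrC a) addrACA.
Qed.

Lemma hc_dd n n' n'' (en : n + 1 = n') (en' : n' + 1 = n'') (u : homcx n) :
  hc_d en' (hc_d en u) = 0.
Proof.
apply: hcP => X p q e m; rewrite hc_mk.
have a1 : p + 1 + n' = q by clear -e en'; lia.
have a2 : p + n' + 1 = q by clear -e en'; lia.
have a3 : p + 1 + n + 1 = q by clear -e en en'; lia.
have a4 : p + n + 1 = p + n' by clear -e en en'; lia.
have a5 : p + 1 + n = p + n' by clear -e en en'; lia.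
have a6 : p + 1 + 1 + n = q by clear -e en en'; lia.
rewrite (hc_d_funE en' _ e erefl a2 erefl a1) !hc_mk.
rewrite (hc_d_funE en u erefl erefl a4 erefl a5) (hc_d_funE en u a1 a5 a2 erefl a6).
rewrite mod_dd (lin0 (hc_linear _ _)) scaler0 subr0.
rewrite (linB (mod_d_linear _)) mod_dd sub0r (linZ (mod_d_linear _)).
have -> : (-1 : k) ^ n' = - (-1) ^ n by rewrite -en signD expr1z mulrN1.
by rewrite scaleNr opprK addNr.
Qed.
End HomComplex.
Arguments homcx {k A} M N n.

(* M is homotopically projective: Hom(M, N) is acyclic for every acyclic N. *)
Definition K_projective (k : fieldType) (A : dgcat k) (M : dgmod A) : Prop :=
  forall N : dgmod A, acyclic N ->
  forall n n' n'' (e : n + 1 = n') (e' : n' + 1 = n'') (u : homcx M N n'),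
    hc_d e' u = 0 -> exists v : homcx M N n, hc_d e v = u.

Section Opposite.
Variables (k : fieldType) (A : dgcat k).

Definition op_hom (X Y : A) (i : int) : lmodType k := dg_hom Y X i.
Let comm i j l : i + j = l -> j + i = l :> int. Proof. by rewrite addrC. Qed.
Definition op_comp (X Y Z : A) i j l (e : i + j = l) (g : op_hom Y Z i)
    (f : op_hom X Y j) : op_hom X Z l :=
  (-1 : k) ^ (i * j) *: dg_comp (comm e) f g.

Program Definition opcat : dgcat k :=
  @DGCat k A op_hom (fun X Y i j e f => dg_d e f) (fun X => dg_id X) op_comp
    _ _ _ _ _ _ _ _.
Next Obligation. by move=> X Y i j e; apply: dg_d_linear. Qed.
Next Obligation.
move=> X Y Z i j l e f a u v; rewrite /op_comp (dg_comp_linear_r _ _) scalerDr.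
by rewrite !scalerA mulrC.
Qed.
Next Obligation.
move=> X Y Z i j l e f a u v; rewrite /op_comp (dg_comp_linear_l _ _) scalerDr.
by rewrite !scalerA mulrC.
Qed.
Next Obligation. by move=> *; apply: dg_dd. Qed.
Next Obligation.
move=> X Y Z i j l i' j' l' e ei ej el e1 e2 g f; rewrite /op_comp.
rewrite (linZ (dg_d_linear _)) (dg_leibniz _ ej ei _ (comm e2) (comm e1)).
rewrite scalerDr !scalerA addrC; congr (_ *: _ + _ *: _).
  by rewrite -ei mulrDl mul1r signD.
by rewrite -ej mulrDr mulr1 signD mulrCA sign_sq mulr1.
Qed.
Next Obligation.
move=> W X Y Z a b c ab bc abc e1 e2 e3 e4 h g f; rewrite /op_comp.
rewrite (linZ (dg_comp_linear_r _ _)) (linZ (dg_comp_linear_l _ _)) !scalerA.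
rewrite (dg_compA _ _ (comm e1) (comm e2)); congr (_ *: _).
by rewrite -!signD -e1 -e3 mulrDl mulrDr addrC addrA.
Qed.
Next Obligation.
move=> X Y i e f; rewrite /op_comp mul0r expr0z scale1r.
by rewrite (int_eq_irr (comm e) (addr0 i)) dg_comp1r.
Qed.
Next Obligation.
move=> X Y i e f; rewrite /op_comp mulr0 expr0z scale1r.
by rewrite (int_eq_irr (comm e) (add0r i)) dg_comp1l.
Qed.
End Opposite.

(* The representable module A(-, y). *)
Program Definition yoneda (k : fieldType) (A : dgcat k) (Y : A) : dgmod A :=
  @DGMod k A (fun X i => dg_hom X Y i) (fun X i j e f => dg_d e f)
    (fun X Z i j l e g f => dg_comp e g f) _ _ _ _ _ _ _.
Next Obligation. by move=> *; apply: dg_d_linear. Qed.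
Next Obligation. by move=> *; apply: dg_comp_linear_l. Qed.
Next Obligation. by move=> *; apply: dg_comp_linear_r. Qed.
Next Obligation. by move=> *; apply: dg_dd. Qed.
Next Obligation. by move=> *; apply: dg_leibniz. Qed.
Next Obligation. by move=> *; apply: dg_compA. Qed.
Next Obligation. by move=> *; apply: dg_comp1r. Qed.

(* The dual Y |-> Hom(M, A(-, Y)) of a right module, as a left module, i.e. a
   right module over the opposite category. *)
Section Dual.
Variables (k : fieldType) (A : dgcat k) (M : dgmod A).

Definition dual_ob (Y : A) (n : int) : lmodType k := homcx M (yoneda Y) n.

Section Act.
Variables (X Y : A) (i j l : int) (e : i + j = l) (u : dual_ob Y i) (f : dg_hom Y X j).
Let e1 p q : p + l = q -> p + i + j = q. Proof. by clear u f; lia. Qed.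
Let e2 p q : p + l = q -> j + (p + i) = q. Proof. by clear u f; lia. Qed.

Definition dual_act_fun Z p q (ep : p + l = q) (m : M Z p) : dg_hom Z X q :=
  (-1 : k) ^ (i * j) *: dg_comp (e2 ep) f (hc u (erefl (p + i)) m).

Lemma dual_act_funE Z p q r (ep : p + l = q) (a : p + i = r) (b : j + r = q) (m : M Z p) :
  dual_act_fun ep m = (-1 : k) ^ (i * j) *: dg_comp b f (hc u a m).
Proof. by subst r; rewrite /dual_act_fun (int_eq_irr (e2 ep) b). Qed.

Fact dual_act_fun_linear Z p q (ep : p + l = q) : linear (@dual_act_fun Z p q ep).
Proof.
move=> a m m'; rewrite /dual_act_fun hc_linear (dg_comp_linear_r _ _) scalerDr.
by rewrite !scalerA mulrC.
Qed.

Fact dual_act_fun_act Z W p d p' q q' (ep : p + l = q) (ep' : p' + l = q')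
    (a : p + d = p') (b : q + d = q') (m : M W p) (g : dg_hom Z W d) :
  dual_act_fun ep' (mod_act a m g) = dg_comp b (dual_act_fun ep m) g.
Proof.
have a1 : p + i + d = p' + i by clear -a; lia.
have a2 : j + (p + i) = q by clear -ep e; lia.
have a3 : j + (p' + i) = q' by clear -ep' e; lia.
rewrite (dual_act_funE ep' erefl a3) (dual_act_funE ep erefl a2).
rewrite (hc_act _ erefl erefl a a1) /= (linZ (dg_comp_linear_l _ _)); congr (_ *: _).
by rewrite -(dg_compA a2 b a1 a3).
Qed.

Definition dual_act : dual_ob X l := mk_homcx (N := yoneda X) dual_act_fun_linear dual_act_fun_act.
End Act.

Program Definition dual : dgmod (opcat A) :=
  @DGMod k (opcat A) dual_ob (fun Y i j e u => hc_d e u) dual_act _ _ _ _ _ _ _.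
Next Obligation. by move=> Y i j e; apply: hc_d_linear_u. Qed.
Next Obligation.
move=> X Y i j l e f a u v; apply: hcP => Z p q ep m.
rewrite hc_zd !hc_mk /dual_act_fun hc_zd (dg_comp_linear_r _ _) scalerDr.
by rewrite !scalerA mulrC.
Qed.
Next Obligation.
move=> X Y i j l e u a f g; apply: hcP => Z p q ep m.
rewrite hc_zd !hc_mk /dual_act_fun (dg_comp_linear_l _ _) scalerDr.
by rewrite !scalerA mulrC.
Qed.
Next Obligation. by move=> *; apply: hc_dd. Qed.
Next Obligation.
move=> X Y i j l i' j' l' e ei ej el e1 e2 u f; apply: hcP => Z p q ep m.
have b1 : p + l + 1 = q by clear -ep el; lia.
have b2 : p + 1 + l = q by clear -ep el; lia.
have b3 : j + (p + i) = p + l by clear -e; lia.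
have b5 : j' + (p + i) = q by clear -e el ej ep; lia.
have b6 : j + (p + i') = q by clear -e el ei ep; lia.
have b7 : p + i + 1 = p + i' by clear -ei; lia.
have b8 : p + 1 + i = p + i' by clear -ei; lia.
rewrite addrC hc_zd !hc_mk addrC.
rewrite (hc_d_funE el _ ep erefl b1 erefl b2) !hc_mk.
rewrite (dual_act_funE e u f erefl erefl b3) (dual_act_funE e u f b2 b8 b6).
rewrite (dual_act_funE e1 _ f ep erefl b6) (dual_act_funE e2 u _ ep erefl b5) hc_mk.
rewrite (hc_d_funE ei u erefl erefl b7 erefl b8) /= (linZ (dg_d_linear _)).
rewrite (dg_leibniz b3 ej b7 b1 b5 b6) (linB (dg_comp_linear_r _ _)).
rewrite (linZ (dg_comp_linear_r _ _)) !scalerDr !scalerN !scalerA -addrA.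
have E1 : (-1 : k) ^ i * (-1) ^ (i * j') = (-1) ^ (i * j).
  by rewrite -ej mulrDr mulr1 signD mulrCA sign_sq mulr1.
have E2 : (-1 : k) ^ (i * j) * (-1) ^ j = (-1) ^ (i' * j).
  by rewrite -ei mulrDl mul1r signD.
rewrite E1 E2 [RHS]addrC; congr (_ + (_ - _ *: _)).
by rewrite -E2 -e signD mulrC -mulrA [_ ^ j * _]mulrC.
Qed.
Next Obligation.
move=> X Y Z a b c ab bc abc e1 e2 e3 e4 u g f; apply: hcP => W p q ep m.
have b1 : b + (p + a) = p + ab by clear -e1; lia.
have b2 : c + (p + ab) = q by clear -e2 ep; lia.
have b3 : bc + (p + a) = q by clear -e4 ep; lia.
have b4 : c + b = bc by clear -e3; lia.
rewrite !hc_mk (dual_act_funE e2 _ f ep erefl b2) hc_mk (dual_act_funE e1 u g erefl erefl b1).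
rewrite (dual_act_funE e4 u _ ep erefl b3) /= /op_comp /=.
rewrite (linZ (dg_comp_linear_r _ _)) (linZ (dg_comp_linear_l _ _)) !scalerA.
rewrite (dg_compA _ b3 b1 b2); congr (_ *: _).
by rewrite -!signD -e1 -e3 mulrDl mulrDr addrC addrA.
Qed.
Next Obligation.
move=> X i e u; apply: hcP => Z p q ep m.
have b1 : 0 + q = q by rewrite add0r.
rewrite hc_mk (dual_act_funE e u _ ep ep b1) mulr0 expr0z scale1r.
by rewrite /= dg_comp1l.
Qed.
End Dual.

Section FullSubcategory.
Variables (k : fieldType) (A : dgcat k) (P : A -> Prop).

Program Definition full_dgcat : dgcat k :=
  @DGCat k {X : A | P X} (fun X Y i => dg_hom (sval X) (sval Y) i)
    (fun X Y i j e f => dg_d e f) (fun X => dg_id (sval X))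
    (fun X Y Z i j l e g f => dg_comp e g f) _ _ _ _ _ _ _ _.
Next Obligation. by move=> *; apply: dg_d_linear. Qed.
Next Obligation. by move=> *; apply: dg_comp_linear_l. Qed.
Next Obligation. by move=> *; apply: dg_comp_linear_r. Qed.
Next Obligation. by move=> *; apply: dg_dd. Qed.
Next Obligation. by move=> *; apply: dg_leibniz. Qed.
Next Obligation. by move=> *; apply: dg_compA. Qed.
Next Obligation. by move=> *; apply: dg_comp1l. Qed.
Next Obligation. by move=> *; apply: dg_comp1r. Qed.

Definition full_inclusion : dgfunctor full_dgcat A :=
  @DGFunctor k full_dgcat A sval (fun X Y i f => f) (fun X Y i a u v => erefl)
    (fun X Y i j e f => erefl) (fun X => erefl) (fun X Y Z i j l e g f => erefl).
End FullSubcategory.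

(* DG-categories with zero differential whose morphisms are elements of an
   algebra L, composed by multiplication. *)
Section SubalgebraCategory.
Variables (k : fieldType) (L : algType k) (ob : Type) (S : ob -> ob -> int -> subspace L).
Hypothesis S1 : forall X, S X X 0 1.
Hypothesis SM : forall X Y Z i j l, i + j = l ->
  forall a b, S Y Z i a -> S X Y j b -> S X Z l (a * b).

Let hom X Y i : lmodType k := subspace_type (S X Y i).
Let one X : hom X X 0 := mks (S1 X).
Let mul X Y Z i j l (e : i + j = l) (g : hom Y Z i) (f : hom X Y j) : hom X Z l :=
  mks (SM e (svP g) (svP f)).

Program Definition subalg_dgcat : dgcat k :=
  @DGCat k ob hom (fun X Y i j e f => 0) one mul _ _ _ _ _ _ _ _.
Next Obligation. by move=> X Y i j e a u v; rewrite scaler0 addr0. Qed.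
Next Obligation.
by move=> X Y Z i j l e f a u v; apply: sv_inj; rewrite sv_linear /= mulrDl scalerAl.
Qed.
Next Obligation.
by move=> X Y Z i j l e f a u v; apply: sv_inj; rewrite sv_linear /= mulrDr scalerAr.
Qed.
Next Obligation. by []. Qed.
Next Obligation.
by move=> *; apply: sv_inj; rewrite addrC sv_linear /= mulr0 mul0r scaler0 addr0.
Qed.
Next Obligation. by move=> *; apply: sv_inj; rewrite /= mulrA. Qed.
Next Obligation. by move=> *; apply: sv_inj; rewrite /= mul1r. Qed.
Next Obligation. by move=> *; apply: sv_inj; rewrite /= mulr1. Qed.
End SubalgebraCategory.

(* The field k as a DG-category with one object. *)
Section BaseField.
Variable k : fieldType.

Program Definition unit_subspace (i : int) : subspace (k^o) :=
  @Subspace k (k^o) (fun x => i = 0 \/ x = 0) _ _.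
Next Obligation. by right. Qed.
Next Obligation.
by move=> i a u v [->|->]; [left|case=> ->; [left|right; rewrite scaler0 addr0]].
Qed.

Fact unit_subspaceM (X Y Z : unit) i j l : i + j = l -> forall a b,
  unit_subspace i a -> unit_subspace j b -> unit_subspace l (a * b).
Proof.
move=> <- a b [->|->]; last by right; rewrite mul0r.
by case=> ->; [left|right; rewrite mulr0].
Qed.

Definition base_dgcat : dgcat k :=
  subalg_dgcat (S := fun _ _ : unit => unit_subspace)
    (fun=> or_introl erefl) unit_subspaceM.
End BaseField.

(* C[t]: the same objects as C; a morphism of degree i is a polynomial in t with
   coefficients in the morphisms of degree i of C, given by its coefficients. *)
Section Polynomials.
Variables (k : fieldType) (C : dgcat k).

Definition finite_support (V : lmodType k) (u : dprod (fun _ : nat => V)) : Prop :=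
  exists N, forall n, (N <= n)%N -> u n = 0.

Fact finite_support0 V : @finite_support V 0.
Proof. by exists 0%N. Qed.
Fact finite_supportZD V a (u v : dprod (fun _ : nat => V)) :
  finite_support u -> finite_support v -> finite_support (a *: u + v).
Proof.
move=> [N Nu] [N' Nv]; exists (maxn N N') => n; rewrite geq_max => /andP[n1 n2].
by rewrite dprod_zd Nu // Nv // scaler0 addr0.
Qed.
Definition polynomial_subspace (V : lmodType k) : subspace (dprod (fun _ : nat => V)) :=
  Subspace (finite_support0 V) (@finite_supportZD V).
Definition polynomials (V : lmodType k) : lmodType k :=
  subspace_type (polynomial_subspace V).

Definition pcoef (V : lmodType k) (u : polynomials V) (n : nat) : V := sv u n.

Lemma pcoef_zd (V : lmodType k) a (u v : polynomials V) n :
  pcoef (a *: u + v) n = a *: pcoef u n + pcoef v n.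
Proof. by rewrite /pcoef sv_linear. Qed.

Lemma pcoefP (V : lmodType k) (u v : polynomials V) :
  (forall n, pcoef u n = pcoef v n) -> u = v.
Proof. by move=> E; apply: sv_inj; apply: functional_extensionality_dep. Qed.

Definition mk_poly (V : lmodType k) (u : nat -> V)
  (Hu : exists N, forall n, (N <= n)%N -> u n = 0) : polynomials V :=
  @mks k _ (polynomial_subspace V) u Hu.

Let hom (X Y : C) (i : int) : lmodType k := polynomials (dg_hom X Y i).

Fact poly_d_support X Y i j (e : i + 1 = j) (f : hom X Y i) :
  exists N, forall n, (N <= n)%N -> dg_d e (pcoef f n) = 0.
Proof.
case: (svP f) => N HN; exists N => n /HN; rewrite /pcoef => ->.
by rewrite (lin0 (dg_d_linear _)).
Qed.
Definition poly_d X Y i j (e : i + 1 = j) (f : hom X Y i) : hom X Y j :=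
  mk_poly (poly_d_support e f).

Fact poly_const_support (X Y : C) i (f : dg_hom X Y i) :
  exists N, forall n, (N <= n)%N -> (if n == 0%N then f else 0) = 0.
Proof. by exists 1%N => -[]. Qed.
Definition poly_const (X Y : C) i (f : dg_hom X Y i) : hom X Y i :=
  mk_poly (poly_const_support f).

Fact poly_comp_support X Y Z i j l (e : i + j = l) (g : hom Y Z i) (f : hom X Y j) :
  exists N, forall n, (N <= n)%N ->
    \sum_(a < n.+1) dg_comp e (pcoef g a) (pcoef f (n - a)) = 0.
Proof.
case: (svP g) (svP f) => N HN [N' HN']; exists (N + N')%N => n le_n.
apply: big1 => a _; have [/HN|lt_aN] := leqP N a.
  by rewrite /pcoef => ->; rewrite dg_comp0l.
have /HN' : (N' <= n - a)%N by lia.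
by rewrite /pcoef => ->; rewrite dg_comp0r.
Qed.
Definition poly_comp X Y Z i j l (e : i + j = l) (g : hom Y Z i) (f : hom X Y j) :
    hom X Z l :=
  mk_poly (poly_comp_support e g f).

Lemma pcoef_comp X Y Z i j l (e : i + j = l) (g : hom Y Z i) (f : hom X Y j) n :
  pcoef (poly_comp e g f) n =
  \sum_(a < n.+1) dg_comp e (pcoef g a) (pcoef f (n - a)).
Proof. by []. Qed.

Program Definition poly_dgcat : dgcat k :=
  @DGCat k C hom poly_d (fun X => poly_const (dg_id X)) poly_comp _ _ _ _ _ _ _ _.
Next Obligation.
by move=> X Y i j e a u v; apply: pcoefP => n; rewrite pcoef_zd -dg_d_linear -pcoef_zd.
Qed.
Next Obligation.
move=> X Y Z i j l e f a u v; apply: pcoefP => n; rewrite pcoef_zd !pcoef_comp.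
rewrite scaler_sumr -big_split; apply: eq_bigr => b _.
by rewrite pcoef_zd; apply: dg_comp_linear_l.
Qed.
Next Obligation.
move=> X Y Z i j l e f a u v; apply: pcoefP => n; rewrite pcoef_zd !pcoef_comp.
rewrite scaler_sumr -big_split; apply: eq_bigr => b _.
by rewrite pcoef_zd; apply: dg_comp_linear_r.
Qed.
Next Obligation. by move=> *; apply: pcoefP => n; apply: dg_dd. Qed.
Next Obligation.
move=> X Y Z i j l i' j' l' e ei ej el e1 e2 g f; apply: pcoefP => n.
rewrite addrC pcoef_zd addrC.
rewrite -[LHS]/(dg_d el (\sum_(a < n.+1) dg_comp e (pcoef g a) (pcoef f (n - a)))).
rewrite (lin_sum (dg_d_linear el)) scaler_sumr -big_split /=; apply: eq_bigr => a _.
exact: dg_leibniz.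
Qed.
Next Obligation.
move=> W X Y Z a b c ab bc abc e1 e2 e3 e4 h g f; apply: pcoefP => n.
pose t p q r := dg_comp e4 (pcoef h p) (dg_comp e3 (pcoef g q) (pcoef f r)).
transitivity (\sum_(i < n.+1) \sum_(p < n.+1 | (p <= i)%N) t p (i - p)%N (n - i)%N).
  apply: eq_bigr => i _; rewrite [X in dg_comp _ X _](_ : _ =
    \sum_(p < i.+1) dg_comp e1 (pcoef h p) (pcoef g (i - p))) //.
  rewrite (lin_sum (dg_comp_linear_l e2 _)).
  rewrite (big_ord_narrow_leq (ltn_ord i : (i <= n)%N)) /=.
  by apply: eq_bigr => p _; apply: dg_compA.
rewrite (exchange_big_dep predT) //=.
apply: eq_bigr => p _.
rewrite -[X in _ = dg_comp _ _ X]/(\sum_(q < (n - p).+1)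
   dg_comp e3 (pcoef g q) (pcoef f (n - p - q))).
rewrite (lin_sum (dg_comp_linear_r e4 _)).
rewrite -(big_mkord (fun i => (p <= i)%N) (fun i => t p (i - p)%N (n - i)%N)).
rewrite -(big_mkord predT (fun q => t p q (n - p - q)%N)).
have le_p : (p <= n.+1)%N by rewrite ltnW.
rewrite (@big_cat_nat _ _ _ p) //= big_nat_cond big_pred0; last by move=> i; lia.
rewrite add0r -{1}[p : nat]add0n big_addn subSn -1?ltnS //.
rewrite big_mkcond; apply: eq_bigr => q _; rewrite leq_addl addnK.
by rewrite addnC subnDA.
Qed.
Next Obligation.
move=> X Y i e f; apply: pcoefP => n.
rewrite -[LHS]/(\sum_(a < n.+1) dg_comp e (if a == 0%N :> nat then dg_id Y else 0)
   (pcoef f (n - a))).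
rewrite big_ord_recl big1 => [|a _]; last by rewrite /= dg_comp0l.
by rewrite addr0 subn0 dg_comp1l.
Qed.
Next Obligation.
move=> X Y i e f; apply: pcoefP => n.
rewrite -[LHS]/(\sum_(a < n.+1) dg_comp e (pcoef f a)
   (if (n - a)%N == 0%N then dg_id X else 0)).
rewrite big_ord_recr big1 => [|a _] /=; last first.
  by have /negPf-> : (n - a)%N != 0%N by [rewrite subn_eq0 -ltnNge ltn_ord]; rewrite dg_comp0r.
by rewrite add0r subnn dg_comp1r.
Qed.

Program Definition poly_inclusion : dgfunctor C poly_dgcat :=
  @DGFunctor k C poly_dgcat id (fun X Y i f => poly_const f) _ _ _ _.
Next Obligation.
move=> X Y i a u v; apply: pcoefP => n; rewrite pcoef_zd /pcoef /=.
by case: ifP => // _; rewrite scaler0 addr0.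
Qed.
Next Obligation.
move=> X Y i j e f; apply: pcoefP => n; rewrite /pcoef /=.
by case: ifP => // _; rewrite (lin0 (dg_d_linear _)).
Qed.
Next Obligation. by []. Qed.
Next Obligation.
move=> X Y Z i j l e g f; apply: pcoefP => n.
rewrite -[RHS]/(\sum_(a < n.+1) dg_comp e (if a == 0%N :> nat then g else 0)
   (if (n - a)%N == 0%N then f else 0)).
rewrite big_ord_recl big1 => [|a _]; last by rewrite /= dg_comp0l.
rewrite addr0 subn0 /pcoef /=; case: ifP => // _.
by rewrite dg_comp0r.
Qed.
End Polynomials.

Section Pretriangulated.
Variables (k : fieldType) (A : dgcat k).
Implicit Types X Y Z : A.

(* Z is the shift X[1]: the identity of X is an invertible closed morphism
   X -> X[1] of degree -1. *)
Definition dg_is_shift X Z : Prop :=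
  exists (s : dg_hom X Z (-1)) (t : dg_hom Z X 1),
  [/\ dg_closed s, dg_closed t, dg_comp (subrr 1) t s = dg_id X
    & dg_comp (addNr 1) s t = dg_id Z].

(* Z is the cone of f: as a graded object Z = Y (+) X[1], with inclusions j, q
   and projections r, p, and its differential is twisted by f. *)
Definition dg_is_cone X Y (f : dg_hom X Y 0) Z : Prop :=
  exists (j : dg_hom Y Z 0) (r : dg_hom Z Y 0)
         (q : dg_hom X Z (-1)) (p : dg_hom Z X 1),
  [/\ [/\ dg_comp (addr0 0) r j = dg_id Y, dg_comp (subrr 1) p q = dg_id X,
          dg_comp (add0r (-1)) r q = 0 & dg_comp (addr0 1) p j = 0],
      dg_comp (addr0 0) j r + dg_comp (addNr 1) q p = dg_id Z,
      dg_closed j /\ dg_closed p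
    & dg_d (addNr 1) q = dg_comp (addr0 0) j f].

Definition dg_is_zero X : Prop := dg_id X = 0.

Definition strongly_pretriangulated : Prop :=
  [/\ exists Z, dg_is_zero Z,
      forall X, exists Z, dg_is_shift X Z,
      forall X, exists Z, dg_is_shift Z X
    & forall X Y (f : dg_hom X Y 0), dg_closed f -> exists Z, dg_is_cone f Z].

Definition thick (P : A -> Prop) : Prop :=
  [/\ forall Z, dg_is_zero Z -> P Z,
      forall X Z, dg_is_shift X Z -> (P X <-> P Z),
      forall X Y (f : dg_hom X Y 0) Z, dg_closed f -> dg_is_cone f Z ->
        P X -> P Y -> P Z
    & forall (X Y : h0 A) (i : chom X Y) (r : chom Y X),
        r \oc i =c cid X -> P Y -> P X].

Definition cone_in (P : A -> Prop) (X Y : h0 A) (f : chom X Y) : Prop :=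
  exists2 Z, dg_is_cone (sval f) Z & P Z.

(* Q : A -> B exhibits H^0(B) as the Verdier quotient of H^0(A) by P; that is, B
   is the DG-quotient of A by the full DG-subcategory on P. *)
Definition dg_verdier_quotient (P : A -> Prop) (B : dgcat k) (Q : dgfunctor A B) : Prop :=
  exhibits_localization (cone_in P) (h0_functor Q).
End Pretriangulated.

(* A -> B -> C is isomorphic, up to derived Morita equivalence, to the inclusion
   of a thick subcategory followed by the Verdier quotient. *)
Definition localization_sequence (k : fieldType) (A B C : DGcat k)
    (F : chom A B) (G : chom B C) : Prop :=
  exists (B' : dgcat k) (P : B' -> Prop) (C' : dgcat k) (Q : dgfunctor B' C'),
  [/\ strongly_pretriangulated B', thick P, dg_verdier_quotient P Q
    & exists (a : @chom (Hmo k) A (full_dgcat P)) (b : @chom (Hmo k) B B')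
             (c : @chom (Hmo k) C C'),
      [/\ is_iso a, is_iso b, is_iso c,
          b \oc fmor (to_Hmo k) F =c
          fmor (to_Hmo k) (full_inclusion P : @chom (DGcat k) (full_dgcat P) B') \oc a
        & c \oc fmor (to_Hmo k) G =c fmor (to_Hmo k) (Q : @chom (DGcat k) B' C') \oc b]].

Record triangulated := Triangulated {
  tr_ob :> Type;
  tr_hom : tr_ob -> tr_ob -> zmodType;
  tr_id : forall X, tr_hom X X;
  tr_comp : forall X Y Z, tr_hom Y Z -> tr_hom X Y -> tr_hom X Z;
  tr_compA : forall W X Y Z (h : tr_hom Y Z) (g : tr_hom X Y) (f : tr_hom W X),
    tr_comp (tr_comp h g) f = tr_comp h (tr_comp g f);
  tr_comp1l : forall X Y (f : tr_hom X Y), tr_comp (tr_id Y) f = f;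
  tr_comp1r : forall X Y (f : tr_hom X Y), tr_comp f (tr_id X) = f;
  tr_compDl : forall X Y Z (g g' : tr_hom Y Z) (f : tr_hom X Y),
    tr_comp (g + g') f = tr_comp g f + tr_comp g' f;
  tr_compDr : forall X Y Z (g : tr_hom Y Z) (f f' : tr_hom X Y),
    tr_comp g (f + f') = tr_comp g f + tr_comp g f';
  tr_zero : exists Z, tr_id Z = 0;
  tr_biproduct : forall X Y, exists B
    (i : tr_hom X B) (j : tr_hom Y B) (p : tr_hom B X) (q : tr_hom B Y),
    [/\ tr_comp p i = tr_id X, tr_comp q j = tr_id Y, tr_comp p j = 0,
        tr_comp q i = 0 & tr_comp i p + tr_comp j q = tr_id B];
  tr_sh : tr_ob -> tr_ob;
  tr_shm : forall X Y, tr_hom X Y -> tr_hom (tr_sh X) (tr_sh Y);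
  tr_shm_id : forall X, tr_shm (tr_id X) = tr_id (tr_sh X);
  tr_shm_comp : forall X Y Z (g : tr_hom Y Z) (f : tr_hom X Y),
    tr_shm (tr_comp g f) = tr_comp (tr_shm g) (tr_shm f);
  tr_shmD : forall X Y (f g : tr_hom X Y), tr_shm (f + g) = tr_shm f + tr_shm g;
  tr_shm_bij : forall X Y, bijective (@tr_shm X Y);
  tr_sh_esurj : forall Y, exists X (f : tr_hom (tr_sh X) Y) (g : tr_hom Y (tr_sh X)),
    tr_comp g f = tr_id _ /\ tr_comp f g = tr_id _;
  tr_dist : forall X Y Z, tr_hom X Y -> tr_hom Y Z -> tr_hom Z (tr_sh X) -> Prop;
  tr_iso : forall X Y Z X' Y' Z'
      (f : tr_hom X Y) (g : tr_hom Y Z) (h : tr_hom Z (tr_sh X))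
      (f' : tr_hom X' Y') (g' : tr_hom Y' Z') (h' : tr_hom Z' (tr_sh X'))
      (a : tr_hom X X') (a' : tr_hom X' X) (b : tr_hom Y Y') (b' : tr_hom Y' Y)
      (c : tr_hom Z Z') (c' : tr_hom Z' Z),
    tr_comp a' a = tr_id _ -> tr_comp a a' = tr_id _ ->
    tr_comp b' b = tr_id _ -> tr_comp b b' = tr_id _ ->
    tr_comp c' c = tr_id _ -> tr_comp c c' = tr_id _ ->
    tr_comp b f = tr_comp f' a -> tr_comp c g = tr_comp g' b ->
    tr_comp (tr_shm a) h = tr_comp h' c ->
    tr_dist f g h -> tr_dist f' g' h';
  tr_trivial : forall X Z, tr_id Z = 0 -> tr_dist (tr_id X) (0 : tr_hom X Z) 0;
  tr_cone : forall X Y (f : tr_hom X Y), exists Z (g : tr_hom Y Z) h, tr_dist f g h;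
  tr_rotate : forall X Y Z (f : tr_hom X Y) (g : tr_hom Y Z) h,
    tr_dist f g h <-> tr_dist g h (- tr_shm f);
  tr_complete : forall X Y Z X' Y' Z'
      (f : tr_hom X Y) (g : tr_hom Y Z) (h : tr_hom Z (tr_sh X))
      (f' : tr_hom X' Y') (g' : tr_hom Y' Z') (h' : tr_hom Z' (tr_sh X'))
      (a : tr_hom X X') (b : tr_hom Y Y'),
    tr_dist f g h -> tr_dist f' g' h' -> tr_comp b f = tr_comp f' a ->
    exists c : tr_hom Z Z',
      tr_comp c g = tr_comp g' b /\ tr_comp (tr_shm a) h = tr_comp h' c;
  tr_octahedron : forall X Y Z X' Y' Z' (f : tr_hom X Y) (g : tr_hom Y Z)
      (u : tr_hom Y Z') (u' : tr_hom Z' (tr_sh X))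
      (v : tr_hom Z X') (v' : tr_hom X' (tr_sh Y))
      (w : tr_hom Z Y') (w' : tr_hom Y' (tr_sh X)),
    tr_dist f u u' -> tr_dist g v v' -> tr_dist (tr_comp g f) w w' ->
    exists (a : tr_hom Z' Y') (b : tr_hom Y' X'),
      [/\ tr_dist a b (tr_comp (tr_shm u) v'),
          tr_comp a u = tr_comp w g, tr_comp w' a = u',
          tr_comp b w = v & tr_comp v' b = tr_comp (tr_shm f) w'] }.

Program Definition tr_cat (T : triangulated) : category :=
  @Category T (fun X Y => tr_hom X Y) (fun X Y f g => f = g) (@tr_id T) (@tr_comp T)
    _ _ _ _ _ _ _.
Next Obligation. by []. Qed.
Next Obligation. by []. Qed.
Next Obligation. by move=> T X Y f g h -> ->. Qed.
Next Obligation. by move=> T X Y Z g g' f f' -> ->. Qed.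
Next Obligation. by move=> T *; apply: tr_compA. Qed.
Next Obligation. by move=> T *; apply: tr_comp1l. Qed.
Next Obligation. by move=> T *; apply: tr_comp1r. Qed.

Definition A1_homotopy_invariant (k : fieldType) (T : triangulated)
    (E : functor (DGcat k) (tr_cat T)) : Prop :=
  [/\ forall (A B : DGcat k) (F : chom A B), derived_morita F -> is_iso (fmor E F),
      forall (A B C : DGcat k) (F : chom A B) (G : chom B C),
        localization_sequence F G ->
        exists h : tr_hom (E C : T) (tr_sh (E A : T)),
          tr_dist (fmor E F : tr_hom (E A : T) (E B : T)) (fmor E G) h
    & forall C : DGcat k, is_iso (fmor E (poly_inclusion C : chom C (poly_dgcat C)))].

Definition is_power (T : triangulated) (n : nat) (X Y : T)
    (i : 'I_n -> tr_hom X Y) (p : 'I_n -> tr_hom Y X) : Prop :=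
  (forall a b, tr_comp (p a) (i b) = if a == b then tr_id X else 0) /\
  \sum_a tr_comp (i a) (p a) = tr_id Y.

(* The action of an integer matrix on X^(+)n, as on column vectors. *)
Definition matrix_action (T : triangulated) (n : nat) (X Y : T)
    (i : 'I_n -> tr_hom X Y) (p : 'I_n -> tr_hom Y X) (C : 'M[int]_n) : tr_hom Y Y :=
  \sum_a \sum_b tr_comp (i a) (p b) *~ C a b.

Definition is_cone (T : triangulated) (X Y : T) (f : tr_hom X Y) (Z : T) : Prop :=
  exists (g : tr_hom Y Z) (h : tr_hom Z (tr_sh X)), tr_dist f g h.

Import VectorInternalTheory.

Variant side := right_side | left_side.

(* Finite-dimensional right (resp. left) modules over L, on spaces of row
   vectors: v.a (resp. a.v) is v *m fm_act a. Every finitely generated module is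
   isomorphic to one of these. *)
Record fmod (k : fieldType) (L : falgType k) (s : side) := FMod {
  fm_dim : nat;
  fm_act : L -> 'M[k]_fm_dim;
  fm_linear : linear fm_act;
  fm_act1 : fm_act 1 = 1%:M;
  fm_actM : forall a b, fm_act (a * b) =
    match s with
    | right_side => fm_act a *m fm_act b
    | left_side => fm_act b *m fm_act a
    end }.

Section Modules.
Variables (k : fieldType) (L : falgType k) (s : side).
Implicit Types M N P : fmod L s.

Definition is_fhom M N (f : 'M[k]_(fm_dim M, fm_dim N)) : Prop :=
  forall a, fm_act M a *m f = f *m fm_act N a.

Definition fm_iso M N : Prop :=
  exists (f : 'M_(fm_dim M, fm_dim N)) (g : 'M_(fm_dim N, fm_dim M)),
    [/\ is_fhom f, is_fhom g, f *m g = 1%:M & g *m f = 1%:M].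

Definition fm_projective P : Prop :=
  forall M N (g : 'M_(fm_dim M, fm_dim N)) (h : 'M_(fm_dim P, fm_dim N)),
    is_fhom g -> row_full g -> is_fhom h ->
    exists2 h' : 'M_(fm_dim P, fm_dim M), is_fhom h' & h' *m g = h.

Definition fm_injective I : Prop :=
  forall M N (g : 'M_(fm_dim M, fm_dim N)) (h : 'M_(fm_dim M, fm_dim I)),
    is_fhom g -> row_free g -> is_fhom h ->
    exists2 h' : 'M_(fm_dim N, fm_dim I), is_fhom (M := N) (N := I) h' & g *m h' = h.

Inductive finite_injective_dim M : Prop :=
| findim0 of fm_injective M
| findimS (I C : fmod L s) (f : 'M_(fm_dim M, fm_dim I)) (g : 'M_(fm_dim I, fm_dim C)) of
    is_fhom f & row_free f & is_fhom g & row_full g & (kermx g == f)%MS &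
    fm_injective I & finite_injective_dim C.

Definition is_submodule M (U : 'M[k]_(fm_dim M)) : Prop := forall a, stablemx U (fm_act M a).

Definition fm_simple M : Prop :=
  (0 < fm_dim M)%N /\
  forall U : 'M_(fm_dim M), is_submodule U -> U = 0 \/ row_full U.

Definition fm_indecomposable M : Prop :=
  (0 < fm_dim M)%N /\
  forall U V : 'M_(fm_dim M), is_submodule U -> is_submodule V ->
    row_full (U + V)%MS -> (U :&: V)%MS = 0 -> U = 0 \/ V = 0.

Definition is_maximal_submodule M (U : 'M[k]_(fm_dim M)) : Prop :=
  [/\ is_submodule U, ~~ row_full U
    & forall V : 'M_(fm_dim M), is_submodule V -> (U <= V)%MS ->
        (V <= U)%MS \/ row_full V].

(* M / rad M is isomorphic to N, rad M being the intersection of the maximal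
   submodules of M. *)
Definition has_top M N : Prop :=
  exists f : 'M_(fm_dim M, fm_dim N), [/\ is_fhom f, row_full f
    & forall v : 'rV_(fm_dim M), v *m f = 0 <->
        (forall U : 'M_(fm_dim M), is_maximal_submodule U -> (v <= U)%MS)].

Fact fhom0 M N : is_fhom (0 : 'M_(fm_dim M, fm_dim N)).
Proof. by move=> a; rewrite mulmx0 mul0mx. Qed.
Fact fhomZD M N c (f g : 'M_(fm_dim M, fm_dim N)) :
  is_fhom f -> is_fhom g -> is_fhom (c *: f + g).
Proof.
by move=> Hf Hg a; rewrite mulmxDr mulmxDl -scalemxAr -scalemxAl Hf Hg.
Qed.
Definition fhom_subspace M N : subspace 'M[k]_(fm_dim M, fm_dim N) :=
  Subspace (@fhom0 M N) (@fhomZD M N).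
Lemma fhom1 M : is_fhom (1%:M : 'M_(fm_dim M, fm_dim M)).
Proof. by move=> a; rewrite mulmx1 mul1mx. Qed.
Lemma fhomM M N P (f : 'M_(fm_dim M, fm_dim N)) (g : 'M_(fm_dim N, fm_dim P)) :
  is_fhom f -> is_fhom g -> is_fhom (f *m g).
Proof. by move=> Hf Hg a; rewrite mulmxA Hf -mulmxA Hg mulmxA. Qed.

Definition fhom_vspace M N : {vspace 'M[k]_(fm_dim M, fm_dim N)} :=
  (\bigcap_(i < \dim {:L}) lker (linfun (fun f : 'M[k]_(fm_dim M, fm_dim N) =>
     (fm_act M (vbasis {:L})`_i *m f - f *m fm_act N (vbasis {:L})`_i)%R)))%VS.

Section Regular.
Definition reg_mul (a : L) (v : 'rV[k]_(dim L)) : 'rV[k]_(dim L) :=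
  v2r (match s with right_side => r2v v * a | left_side => a * r2v v end).
Fact reg_mul_linear a : linear (reg_mul a).
Proof.
by move=> c u v; rewrite /reg_mul; case: s;
   rewrite linearP ?mulrDl ?mulrDr -?scalerAl -?scalerAr linearP.
Qed.
HB.instance Definition _ a := GRing.isLinear.Build k _ _ _ (reg_mul a) (reg_mul_linear a).

Fact reg_act_linear : linear (fun a : L => lin1_mx (reg_mul a)).
Proof.
move=> c a b; apply/row_matrixP => i; rewrite !rowE mulmxDr -scalemxAr !mul_rV_lin1 /= /reg_mul.
by case: s; rewrite ?mulrDl ?mulrDr -?scalerAl -?scalerAr linearP.
Qed.
Fact reg_act1 : lin1_mx (reg_mul 1) = 1%:M.
Proof.
apply/row_matrixP => i; rewrite !rowE mul_rV_lin1 mulmx1 /= /reg_mul.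
by case: s => /=; rewrite ?mulr1 ?mul1r r2vK.
Qed.
Fact reg_actM a b : lin1_mx (reg_mul (a * b)) =
  match s with
  | right_side => lin1_mx (reg_mul a) *m lin1_mx (reg_mul b)
  | left_side => lin1_mx (reg_mul b) *m lin1_mx (reg_mul a)
  end.
Proof.
have mulE u : reg_mul (a * b) u = match s with
    right_side => reg_mul b (reg_mul a u) | left_side => reg_mul a (reg_mul b u) end.
  by rewrite /reg_mul; case: s => /=; rewrite v2rK mulrA.
apply/row_matrixP => i; rewrite !rowE mul_rV_lin1 /= mulE.
by case: (s); rewrite mulmxA !mul_rV_lin1.
Qed.
End Regular.

Definition regular : fmod L s := FMod reg_act_linear reg_act1 reg_actM.
End Modules.

Lemma mem_fhom_vspace (k : fieldType) (L : falgType k) s (M N : fmod L s)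
    (f : 'M_(fm_dim M, fm_dim N)) :
  f \in fhom_vspace M N <-> is_fhom f.
Proof.
have lin b : linear (fun f : 'M[k]_(fm_dim M, fm_dim N) =>
    (fm_act M b *m f - f *m fm_act N b)%R).
  move=> a u v; rewrite mulmxDr mulmxDl -scalemxAr -scalemxAl scalerBr opprD.
  by rewrite addrACA.
have E b (g : 'M[k]_(fm_dim M, fm_dim N)) : (linfun (fun f : 'M[k]_(fm_dim M, fm_dim N) =>
    (fm_act M b *m f - f *m fm_act N b)%R) g) = fm_act M b *m g - g *m fm_act N b.
  pose h := GRing.isLinear.Build k _ _ _ _ (lin b).
  pose H : {linear _ -> _} := HB.pack (fun f : 'M[k]_(fm_dim M, fm_dim N) =>
    (fm_act M b *m f - f *m fm_act N b)%R) h.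
  exact: (lfunE H g).
rewrite memvE; split=> [/subv_bigcapP Hf a|Hf].
  have Hb i : fm_act M (vbasis {:L})`_i *m f = f *m fm_act N (vbasis {:L})`_i.
    case: (ltnP i (\dim {:L})) => [lt_i|le_i]; last first.
      rewrite nth_default ?size_tuple // (lin0 (@fm_linear _ _ _ M)).
      by rewrite (lin0 (@fm_linear _ _ _ N)) mul0mx mulmx0.
    apply/eqP; rewrite -subr_eq0 -E -memv_ker memvE.
    exact: (Hf (Ordinal lt_i) isT).
  rewrite (coord_vbasis (memvf a)) (lin_sum (@fm_linear _ _ _ M)).
  rewrite (lin_sum (@fm_linear _ _ _ N)) mulmx_suml mulmx_sumr; apply: eq_bigr => i _.
  rewrite (linZ (@fm_linear _ _ _ M)) (linZ (@fm_linear _ _ _ N)).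
  by rewrite -scalemxAl -scalemxAr Hb.
by apply/subv_bigcapP => i _; rewrite -memvE memv_ker E Hf subrr.
Qed.

(* The Cartan matrix of L, for the projectives P_0, ..., P_(n-1). *)
Definition cartan_matrix (k : fieldType) (L : falgType k) (n : nat)
    (P : 'I_n -> fmod L right_side) : 'M[int]_n :=
  \matrix_(i, j) (\dim (fhom_vspace (P i) (P j)))%:Z.

(* Right bounded complexes of finitely generated projective right L-modules with
   bounded cohomology; as a DG-category they enhance D^b(mod L). *)
Record proj_complex (k : fieldType) (L : falgType k) := ProjComplex {
  pc_ob :> int -> fmod L right_side;
  pc_d : forall p q, p + 1 = q -> 'M[k]_(fm_dim (pc_ob p), fm_dim (pc_ob q));
  pc_d_hom : forall p q (e : p + 1 = q), is_fhom (pc_d e);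
  pc_dd : forall p q r (e : p + 1 = q) (e' : q + 1 = r), pc_d e *m pc_d e' = 0;
  pc_projective : forall p, fm_projective (pc_ob p);
  pc_bounded_above : exists N : int, forall p, N < p -> fm_dim (pc_ob p) = 0%N;
  pc_bounded_cohomology : exists N : int, forall p q r (e : p + 1 = q) (e' : q + 1 = r),
    q < N -> (kermx (pc_d e') <= pc_d e)%MS }.

Section DbCategory.
Variables (k : fieldType) (L : falgType k).
Implicit Types X Y Z : proj_complex L.

Definition cx_hom X Y (n : int) : lmodType k :=
  dprod (fun p : int => dprod (fun q : int => dprod (fun e : p + n = q =>
    subspace_type (fhom_subspace (X p) (Y q))))).

Definition cxh X Y n (f : cx_hom X Y n) p q (e : p + n = q) :
  'M[k]_(fm_dim (X p), fm_dim (Y q)) := sv (f p q e).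

Lemma cxh_hom X Y n (f : cx_hom X Y n) p q (e : p + n = q) : is_fhom (cxh f e).
Proof. exact: (svP (f p q e)). Qed.

Lemma cxhP X Y n (f g : cx_hom X Y n) :
  (forall p q (e : p + n = q), cxh f e = cxh g e) -> f = g.
Proof.
by move=> E; do 3![apply: functional_extensionality_dep => ?]; apply: sv_inj; apply: E.
Qed.

Lemma cxh_zd X Y n c (f g : cx_hom X Y n) p q (e : p + n = q) :
  cxh (c *: f + g) e = c *: cxh f e + cxh g e.
Proof. by []. Qed.

Definition mk_cx X Y n (f : forall p q, p + n = q -> 'M[k]_(fm_dim (X p), fm_dim (Y q)))
    (Hf : forall p q (e : p + n = q), is_fhom (f p q e)) : cx_hom X Y n :=
  fun p q e => @mks k _ (fhom_subspace (X p) (Y q)) (f p q e) (Hf p q e).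

Section Differential.
Variables (X Y : proj_complex L) (n n' : int) (en : n + 1 = n') (f : cx_hom X Y n).
Let e1 p q : p + n' = q -> p + n + 1 = q. Proof. by clear f; lia. Qed.
Let e2 p q : p + n' = q -> p + 1 + n = q. Proof. by clear f; lia. Qed.

Definition cx_d_fun p q (e : p + n' = q) : 'M[k]_(fm_dim (X p), fm_dim (Y q)) :=
  cxh f (erefl (p + n)) *m pc_d Y (e1 e)
  - (-1 : k) ^ n *: (pc_d X (erefl (p + 1)) *m cxh f (e2 e)).

Lemma cx_d_funE p q r s (e : p + n' = q) (a : p + n = r) (b : r + 1 = q)
    (c : p + 1 = s) (d : s + n = q) :
  cx_d_fun e = cxh f a *m pc_d Y b - (-1 : k) ^ n *: (pc_d X c *m cxh f d).
Proof.
by subst r s; rewrite /cx_d_fun (int_eq_irr (e1 e) b) (int_eq_irr (e2 e) d).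
Qed.

Fact cx_d_fun_hom p q (e : p + n' = q) : is_fhom (cx_d_fun e).
Proof.
rewrite /cx_d_fun addrC -scaleNr.
by apply: fhomZD; apply: fhomM; [apply: pc_d_hom|apply: cxh_hom|apply: cxh_hom|apply: pc_d_hom].
Qed.

Definition cx_d : cx_hom X Y n' := mk_cx cx_d_fun_hom.
End Differential.

Section Composition.
Variables (X Y Z : proj_complex L) (i j l : int) (e : i + j = l).
Variables (g : cx_hom Y Z i) (f : cx_hom X Y j).
Let e1 p q : p + l = q -> p + j + i = q. Proof. by clear f g; lia. Qed.

Definition cx_comp_fun p q (ep : p + l = q) : 'M[k]_(fm_dim (X p), fm_dim (Z q)) :=
  cxh f (erefl (p + j)) *m cxh g (e1 ep).

Lemma cx_comp_funE p q r (ep : p + l = q) (a : p + j = r) (b : r + i = q) :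
  cx_comp_fun ep = cxh f a *m cxh g b.
Proof. by subst r; rewrite /cx_comp_fun (int_eq_irr (e1 ep) b). Qed.

Fact cx_comp_fun_hom p q (ep : p + l = q) : is_fhom (cx_comp_fun ep).
Proof. by apply: fhomM; apply: cxh_hom. Qed.

Definition cx_comp : cx_hom X Z l := mk_cx cx_comp_fun_hom.
End Composition.

Definition cx_id_fun X p q (e : p + 0 = q) : 'M[k]_(fm_dim (X p), fm_dim (X q)) :=
  match etrans (esym (addr0 p)) e in _ = q' return 'M[k]_(fm_dim (X p), fm_dim (X q')) with
  | erefl => 1%:M
  end.
Lemma cx_id_funE X p (e : p + 0 = p) : cx_id_fun X e = 1%:M.
Proof. by rewrite /cx_id_fun (int_eq_irr (etrans _ _) erefl). Qed.
Fact cx_id_hom X p q (e : p + 0 = q) : is_fhom (cx_id_fun X e).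
Proof.
have E : p = q by rewrite -e addr0.
by case: q / E e => e; rewrite cx_id_funE; apply: fhom1.
Qed.
Definition cx_id X : cx_hom X X 0 := mk_cx (@cx_id_hom X).

Program Definition Db_dgcat : dgcat k :=
  @DGCat k (proj_complex L) cx_hom cx_d cx_id cx_comp _ _ _ _ _ _ _ _.
Next Obligation.
move=> X Y i j e a f g; apply: cxhP => p q ep; rewrite cxh_zd /cxh /= /cx_d_fun !cxh_zd.
by rewrite !mulmxDl !mulmxDr -!scalemxAl -!scalemxAr scalerBr !scalerDr opprD
   !scalerA (mulrC a) addrACA.
Qed.
Next Obligation.
move=> X Y Z i j l e f a u v; apply: cxhP => p q ep.
by rewrite cxh_zd /cxh /= /cx_comp_fun cxh_zd mulmxDr -scalemxAr.
Qed.
Next Obligation.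
move=> X Y Z i j l e f a u v; apply: cxhP => p q ep.
by rewrite cxh_zd /cxh /= /cx_comp_fun cxh_zd mulmxDl -scalemxAl.
Qed.
Next Obligation.
move=> X Y i j l e1 e2 f; apply: cxhP => p q ep.
have a1 : p + j + 1 = q by clear -ep e2; lia.
have a2 : p + 1 + j = q by clear -ep e2; lia.
have a3 : p + i + 1 = p + j by clear -e1; lia.
have a4 : p + 1 + i = p + j by clear -e1; lia.
have a5 : p + 1 + 1 + i = q by clear -e1 ep e2; lia.
rewrite [LHS](cx_d_funE e2 _ ep erefl a1 erefl a2).
rewrite [cxh _ erefl](cx_d_funE e1 f erefl erefl a3 erefl a4).
rewrite [cxh _ a2](cx_d_funE e1 f a2 a4 a1 erefl a5).
rewrite mulmxBl mulmxBr -mulmxA pc_dd mulmx0 sub0r -!scalemxAl -!scalemxAr.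
rewrite [pc_d X _ *m (pc_d X _ *m _)]mulmxA pc_dd mul0mx scaler0 subr0 mulmxA.
have -> : (-1 : k) ^ j = - (-1) ^ i by rewrite -e1 signD expr1z mulrN1.
by rewrite scaleNr opprK addNr.
Qed.
Next Obligation.
move=> X Y Z i j l i' j' l' e ei ej el e1 e2 g f; apply: cxhP => p q ep.
have a1 : p + l + 1 = q by clear -ep el; lia.
have a2 : p + 1 + l = q by clear -ep el; lia.
have a3 : p + j + i = p + l by clear -e; lia.
have a4 : p + 1 + j = p + j' by clear -ej; lia.
have a5 : p + j' + i = q by clear -ep ej e el; lia.
have a6 : p + j + i' = q by clear -ep ei e el; lia.
have a7 : p + j + 1 = p + j' by clear -ej; lia.
rewrite addrC cxh_zd addrC.
rewrite [LHS](cx_d_funE el _ ep erefl a1 erefl a2).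
rewrite [cxh (cx_comp e g f) erefl](cx_comp_funE e g f erefl erefl a3).
rewrite [cxh (cx_comp e g f) a2](cx_comp_funE e g f a2 a4 a5).
rewrite [cxh (cx_comp e1 _ _) ep](cx_comp_funE e1 _ f ep erefl a6).
rewrite [cxh (cx_comp e2 _ _) ep](cx_comp_funE e2 g _ ep erefl a5).
rewrite [cxh (cx_d ei g) a6](cx_d_funE ei g a6 a3 a1 a7 a5).
rewrite [cxh (cx_d ej f) _](cx_d_funE ej f erefl erefl a7 erefl a4).
rewrite mulmxBr mulmxBl !scalerBr -!scalemxAr -!scalemxAl scalerA -signD e !mulmxA.
by rewrite addrA subrK.
Qed.
Next Obligation.
move=> W X Y Z a b c ab bc abc e1 e2 e3 e4 h g f; apply: cxhP => p q ep.
have a1 : p + c + ab = q by clear -ep e2; lia.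
have a2 : p + c + b = p + bc by clear -e3; lia.
have a3 : p + bc + a = q by clear -ep e4; lia.
rewrite [LHS](cx_comp_funE e2 _ f ep erefl a1) [RHS](cx_comp_funE e4 h _ ep erefl a3).
rewrite [cxh (cx_comp e1 _ _) _](cx_comp_funE e1 h g a1 a2 a3).
by rewrite [cxh (cx_comp e3 _ _) _](cx_comp_funE e3 g f erefl erefl a2) mulmxA.
Qed.
Next Obligation.
move=> X Y i e f; apply: cxhP => p q ep; have a : q + 0 = q by rewrite addr0.
rewrite [LHS](cx_comp_funE e _ f ep ep a).
by rewrite [cxh (cx_id Y) a]cx_id_funE mulmx1.
Qed.
Next Obligation.
move=> X Y i e f; apply: cxhP => p q ep; have a : p + 0 = p by rewrite addr0.
rewrite [LHS](cx_comp_funE e f _ ep a ep).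
by rewrite [cxh (cx_id X) a]cx_id_funE mul1mx.
Qed.

Definition pc_bounded X : Prop :=
  exists N : int, forall p, p < N -> fm_dim (X p) = 0%N.

(* Homotopy equivalent to a bounded complex of finitely generated projectives. *)
Definition perfect (X : Db_dgcat) : Prop :=
  exists2 Y : Db_dgcat, pc_bounded Y & @isomorphic (h0 Db_dgcat) X Y.
End DbCategory.

Definition basic (k : fieldType) (L : falgType k) : Prop :=
  exists (m : nat) (P : 'I_m -> fmod L right_side)
    (f : forall i, 'M_(fm_dim (P i), fm_dim (regular L right_side)))
    (g : forall i, 'M_(fm_dim (regular L right_side), fm_dim (P i))),
  [/\ forall i, is_fhom (f i) /\ is_fhom (g i),
      forall i, f i *m g i = 1%:M,
      forall i j, i != j -> f i *m g j = 0,
      \sum_i g i *m f i = 1%:M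
    & (forall i, fm_indecomposable (P i)) /\
      (forall i j, fm_iso (P i) (P j) -> i = j)].

Section Radical.
Variables (k : fieldType) (L : falgType k).
Definition right_ideal (I : {vspace L}) : Prop := forall x a, x \in I -> x * a \in I.
Definition maximal_right_ideal (I : {vspace L}) : Prop :=
  [/\ right_ideal I, I != fullv
    & forall J, right_ideal J -> (I <= J)%VS -> J = I \/ J = fullv].
Definition jacobson_radical (x : L) : Prop :=
  forall I, maximal_right_ideal I -> x \in I.
End Radical.

Record nonneg_grading (k : fieldType) (L : falgType k) := NonnegGrading {
  gr_part :> int -> {vspace L};
  gr_neg : forall i, i < 0 -> gr_part i = 0%VS;
  gr_one : 1 \in gr_part 0;
  gr_mul : forall i j x y, x \in gr_part i -> y \in gr_part j -> x * y \in gr_part (i + j);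
  gr_direct : exists N : nat,
    [/\ directv (\sum_(i < N) gr_part i%:Z)%VS, (\sum_(i < N) gr_part i%:Z = fullv)%VS
      & forall i : int, N%:Z <= i -> gr_part i = 0%VS] }.

(* The composite L_0 -> L -> L / rad L is bijective. *)
Definition degree0_is_top (k : fieldType) (L : falgType k) (G : nonneg_grading L) : Prop :=
  forall x : L, exists! y, y \in G 0 /\ jacobson_radical (x - y).

(* Graded L-modules as modules over a category with set of objects Z and
   Hom(x, y) = L_(x-y). A right DG-module M over it is a complex of graded right
   L-modules, M x being the part of internal degree x; a right DG-module N over
   the opposite category is a complex of graded left L-modules, N y being the
   part of internal degree -y. The representable module at y is L(-y), so that
   [dual M] is the complex of graded left modules Hom(M, L), with the graded Hom. *)
Section GradedModules.
Variables (k : fieldType) (L : falgType k) (G : nonneg_grading L).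

Program Definition gr_subspace (x y i : int) : subspace L :=
  @Subspace k L (fun a => a \in G (x - y) /\ (i = 0 \/ a = 0)) _ _.
Next Obligation. by move=> x y i; split; [apply: mem0v|right]. Qed.
Next Obligation.
move=> x y i a u v [Gu Hu] [Gv Hv]; split; first by rewrite memvD ?memvZ.
case: Hu => [->|->]; first by left.
by case: Hv => ->; [left|right; rewrite scaler0 addr0].
Qed.

Fact gr_subspace1 x : gr_subspace x x 0 1.
Proof. by split; [rewrite subrr; apply: gr_one|left]. Qed.
Fact gr_subspaceM x y z i j l : i + j = l ->
  forall a b, gr_subspace y z i a -> gr_subspace x y j b -> gr_subspace x z l (a * b).
Proof.
move=> <- a b [Ga Ha] [Gb Hb]; split.
  by rewrite (_ : x - z = (y - z) + (x - y)); [apply: gr_mul|lia].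
case: Ha => [->|->]; last by right; rewrite mul0r.
by case: Hb => ->; [left|right; rewrite mulr0].
Qed.
Definition gr_dgcat : dgcat k := subalg_dgcat gr_subspace1 gr_subspaceM.

Program Definition top_subspace (c s x i : int) : subspace L :=
  @Subspace k L (fun a => a \in G 0 /\ ((x = c /\ i = s) \/ a = 0)) _ _.
Next Obligation. by move=> c s x i; split; [apply: mem0v|right]. Qed.
Next Obligation.
move=> c s x i a u v [Gu Hu] [Gv Hv]; split; first by rewrite memvD ?memvZ.
case: Hu => [?|->]; first by left.
by case: Hv => [?|->]; [left|right; rewrite scaler0 addr0].
Qed.

Fact top_actP c s x y i j l (left : bool) : i + j = l -> forall m f,
  top_subspace c s y i m -> gr_subspace (if left then y else x) (if left then x else y) j f ->
  top_subspace c s x l (if x == c then if left then f * m else m * f else 0).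
Proof.
move=> <- m f [Gm Hm] [Gf Hf]; case: eqP => [->|_] in Gf *; last first.
  by split; [apply: mem0v|right].
case: Hm Gm => [[-> ->]|->] Gm in Gf *; last first.
  by split; [|right]; case: left {Gf}; rewrite ?mulr0 ?mul0r // mem0v.
have G0f : f \in G 0 by case: left Gf; rewrite subrr.
split; last by case: Hf => ->; [left; rewrite addr0|right; case: left {Gf}; rewrite ?mulr0 ?mul0r].
by rewrite -(addr0 0); case: left {Gf}; apply: gr_mul.
Qed.

Let top_hom c s x i : lmodType k := subspace_type (top_subspace c s x i).

Let top_act_r c s x y i j l (e : i + j = l) (m : top_hom c s y i)
    (f : subspace_type (gr_subspace x y j)) : top_hom c s x l :=
  mks (@top_actP c s x y i j l false e _ _ (svP m) (svP f)).

Let top_act_l c s x y i j l (e : i + j = l) (m : top_hom c s y i)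
    (f : subspace_type (gr_subspace y x j)) : top_hom c s x l :=
  mks (@top_actP c s x y i j l true e _ _ (svP m) (svP f)).

(* L_0 = L / L_(>0) as a graded right module, in cohomological degree 0. *)
Program Definition top_right : dgmod gr_dgcat :=
  @DGMod k gr_dgcat (top_hom 0 0) (fun x i j e m => 0) (@top_act_r 0 0)
    _ _ _ _ _ _ _.
Next Obligation. by move=> x i j e a u v; rewrite scaler0 addr0. Qed.
Next Obligation.
move=> x y i j l e f a u v; apply: sv_inj; rewrite sv_linear /=; case: eqP => _.
  by rewrite mulrDl scalerAl.
by rewrite scaler0 addr0.
Qed.
Next Obligation.
move=> x y i j l e m a u v; apply: sv_inj; rewrite sv_linear /=; case: eqP => _.
  by rewrite mulrDr scalerAr.
by rewrite scaler0 addr0.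
Qed.
Next Obligation. by []. Qed.
Next Obligation.
move=> *; apply: sv_inj; rewrite addrC sv_linear /= mulr0 mul0r.
by case: eqP; rewrite scaler0 addr0.
Qed.
Next Obligation.
move=> x y z a b c ab bc abc e1 e2 e3 e4 m g f; apply: sv_inj => /=.
case: eqP => // x0; case: eqP => [_|/eqP y_neq0]; first by rewrite mulrA.
rewrite mul0r; have [_ [[z0 _]|->]] := svP m; last by rewrite mul0r.
have [Gg _] := svP g; have [Gf _] := svP f.
have [y_lt0|y_gt0|y0] := ltgtP y 0; last 1 first.
- by rewrite y0 eqxx in y_neq0.
- by move: (sv g) (sv m) Gg => v w; rewrite z0 subr0 gr_neg // memv0 => /eqP->; rewrite mul0r mulr0.
by move: (sv f) Gf => v; rewrite x0 sub0r gr_neg ?oppr_lt0 // memv0 => /eqP->; rewrite !mulr0.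
Qed.
Next Obligation.
move=> x i e m; apply: sv_inj => /=; case: eqP => [_|x_neq]; first by rewrite mulr1.
by have [_ [[//]|->]] := svP m.
Qed.

(* The complex of graded left modules Sigma^d L_0(a): it is L_0 in cohomological
   degree -d and internal degree -a. *)
Program Definition top_left (d a : int) : dgmod (opcat gr_dgcat) :=
  @DGMod k (opcat gr_dgcat) (top_hom a (- d)) (fun y i j e m => 0) (@top_act_l a (- d))
    _ _ _ _ _ _ _.
Next Obligation. by move=> d a x i j e c u v; rewrite scaler0 addr0. Qed.
Next Obligation.
move=> d a x y i j l e f c u v; apply: sv_inj; rewrite sv_linear /=; case: eqP => _.
  by rewrite mulrDr scalerAr.
by rewrite scaler0 addr0.
Qed.
Next Obligation.
move=> d a x y i j l e m c u v; apply: sv_inj; rewrite sv_linear /=; case: eqP => _.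
  by rewrite mulrDl scalerAl.
by rewrite scaler0 addr0.
Qed.
Next Obligation. by []. Qed.
Next Obligation.
move=> *; apply: sv_inj; rewrite addrC sv_linear /= mulr0 mul0r.
by case: eqP; rewrite scaler0 addr0.
Qed.
Next Obligation.
move=> d t x y z a b c ab bc abc e1 e2 e3 e4 m g f; apply: sv_inj => /=.
have [Gg Hg] := svP g; have [Gf _] := svP f.
have E : sv (@op_comp k gr_dgcat x y z b c bc e3 g f) = sv f * sv g.
  rewrite -[LHS]/((-1 : k) ^ (b * c) *: (sv f * sv g)).
  case: Hg => [b0|->]; first by move: (sv g) => v; rewrite b0 mul0r expr0z scale1r.
  by rewrite mulr0 scaler0.
transitivity (if x == t then sv f * sv g * sv m else 0); last first.
  by case: eqP => // _; exact: (congr1 (fun v => v * sv m) (esym E)).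
case: eqP => // x0 /=; case: eqP => [_|/eqP y_neq]; first by rewrite mulrA.
rewrite mulr0; have [_ [[z0 _]|->]] := svP m; last by rewrite mulr0.
have [y_lt|y_gt|y0] := ltgtP y t; last 1 first.
- by rewrite y0 eqxx in y_neq.
- by move: (sv f) Gf => v; rewrite x0 gr_neg ?subr_lt0 // memv0 => /eqP->; rewrite !mul0r.
by move: (sv g) (sv m) Gg => v w; rewrite z0 gr_neg ?subr_lt0 // memv0 => /eqP->; rewrite mulr0 mul0r.
Qed.
Next Obligation.
move=> d a x i e m; apply: sv_inj => /=; case: eqP => [_|x_neq]; first by rewrite mul1r.
by have [_ [[//]|->]] := svP m.
Qed.
End GradedModules.

(* RHom(L_0, L) is computed from a homotopically projective resolution of L_0. *)
Definition AS_Gorenstein (k : fieldType) (L : falgType k) (G : nonneg_grading L) : Prop :=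
  [/\ finite_injective_dim (regular L right_side),
      finite_injective_dim (regular L left_side)
    & exists (d a : int) (P : dgmod (gr_dgcat G)) (f : dgmod_hom P (top_right G)),
        [/\ K_projective P, quasi_iso f
          & @isomorphic (Dcat (opcat (gr_dgcat G))) (dual P) (top_left G d a)]].

(* Main.v *)
Require Import Defs.
From Stdlib Require Import Setoid Morphisms.
From HB Require Import structures.
From mathcomp Require Import all_boot all_order all_algebra all_field.
From mathcomp Require Import boolp zify.
Import Defs.

Set Implicit Arguments.
Unset Strict Implicit.
Unset Printing Implicit Defensive.
#[local] Obligation Tactic := idtac.
Import Order.TTheory GRing.Theory Num.Theory.
Local Open Scope ring_scope.

(** The relative bar resolutions of the simple modules over the idempotents
    generate the bounded derived category. Their DG-category is quasi-isomorphic
    to the DG-category of endomorphisms of the augmented bar complexes which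
    commute with the contraction: the Koszul dual. The grading of the algebra
    makes it weighted with weights of one sign, and f |-> sum_w f_w t^w shows
    that an A^1-homotopy invariant does not distinguish such a DG-category from
    its part of weight zero, which is discrete. Hence E of the derived category
    is E(k)^n on the classes of the simple modules. The same argument for their
    projective covers, which generate the perfect complexes, gives E(k)^n on the
    classes of the projectives. The functors V |-> V e_i to complexes of vector
    spaces identify the inclusion with the Cartan matrix, and the localization
    sequence finishes the proof. *)

(** * Categories *)


(** The endomorphisms of the resolutions themselves may have weights of both signs, and infinitely
    many at once, so the polynomial in t makes no sense for them. A morphism that commutes with the
    contraction is determined by its component into the one-dimensional module in degree 1. This
    component has a finite dimensional source in weights >= 0 and a target in weight 0, whence
    finitely many weights of one sign. In weight 0 only scalars survive, because each bar stage
    discards the image of the contraction, which contains the whole weight 0 part.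

    Morita equivalences are obtained without derived tensor products: a strict deformation
    retraction of Hom complexes, linear on one side, makes coinduction, a plain Hom functor,
    preserve quasi-isomorphisms. Quasi-isomorphisms, contractibility and perfectness are all reduced
    to generators by one principle: the objects at which a DG-module is acyclic modulo a submodule
    form a thick class.

    The coordinates on E(k)^n come from indicator functors on a discrete category; the functors V
    |-> V e_i show that they are independent. *)

Inductive zterm := ZVar of nat | ZZero | ZAdd of zterm & zterm | ZOpp of zterm.

Section AbelianReflection.
Variable V : zmodType.
Implicit Types (env : seq V) (t : zterm).

Fixpoint zeval env t : V :=
  match t with
  | ZVar i => env`_i
  | ZZero => 0
  | ZAdd a b => zeval env a + zeval env b
  | ZOpp a => - zeval env a
  end.

(** The flag is the sign under inspection, and each negation flips it: [false] counts the positive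
    occurrences of a variable, [true] the negative ones. *)
Fixpoint zcount (s : bool) (i : nat) t : nat :=
  match t with
  | ZVar j => if s then 0 else (i == j)%N
  | ZZero => 0
  | ZAdd a b => (zcount s i a + zcount s i b)%N
  | ZOpp a => zcount (~~ s) i a
  end.

Lemma zevalE env t : zeval env t =
  \sum_(i < size env) (env`_i *+ zcount false i t - env`_i *+ zcount true i t).
Proof.
elim: t => [j||a IHa b IHb|a IHa] /=.
- under eq_bigr do rewrite mulr0n subr0.
  have [lt_j|le_j] := ltnP j (size env).
    rewrite (bigD1 (Ordinal lt_j)) //= eqxx mulr1n big1 ?addr0 // => i /negPf.
    by rewrite -val_eqE /= => ->.
  rewrite nth_default // big1 // => i _; case: eqP => // ij.
  by have := ltn_ord i; rewrite ij ltnNge le_j.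
- by rewrite big1 // => i _; rewrite subrr.
- by rewrite IHa IHb -big_split; apply: eq_bigr => i _; rewrite !mulrnDr opprD addrACA.
- by rewrite IHa -sumrN; apply: eq_bigr => i _; rewrite opprB.
Qed.

(** Multiplicities are compared crosswise so that the test stays in [nat] and is decided by
    computation. *)
Lemma zeval_eq env s t :
  all (fun i => zcount false i s + zcount true i t == zcount false i t + zcount true i s)%N
    (iota 0 (size env)) ->
  zeval env s = zeval env t.
Proof.
move=> /allP st; rewrite !zevalE; apply: eq_bigr => i _.
have /st/eqP E : (i : nat) \in iota 0 (size env) by rewrite mem_iota /=.
by apply/eqP; rewrite subr_eq addrAC eq_sym subr_eq -!mulrnDr E.
Qed.
End AbelianReflection.

Ltac zindex same x env :=
  match env with
  | cons ?y _ => let u := match goal with _ => same x y end in constr:(O)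
  | cons _ ?r => let n := zindex same x r in constr:(S n)
  end.
Ltac zinsert same x env :=
  match env with
  | _ => let n := zindex same x env in env
  | _ => constr:(cons x env)
  end.
Ltac zatoms same t env :=
  match t with
  | @GRing.add _ ?a ?b => let e := zatoms same a env in zatoms same b e
  | @GRing.opp _ ?a => zatoms same a env
  | @GRing.zero _ => env
  | _ => zinsert same t env
  end.
Ltac zreify same t env :=
  match t with
  | @GRing.add _ ?a ?b =>
    let a' := zreify same a env in let b' := zreify same b env in constr:(ZAdd a' b')
  | @GRing.opp _ ?a => let a' := zreify same a env in constr:(ZOpp a')
  | @GRing.zero _ => constr:(ZZero)
  | _ => let n := zindex same t env in constr:(ZVar n)
  end.
Ltac abel_with same :=
  match goal with
  | |- @eq ?V ?a ?b =>
    let e0 := constr:(@nil V) in let e1 := zatoms same a e0 in let e2 := zatoms same b e1 in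
    let a' := zreify same a e2 in let b' := zreify same b e2 in
    apply: (@zeval_eq _ e2 a' b'); vm_compute; reflexivity
  end.
Ltac same_syntax x y := constr_eq x y.
Ltac same_convertible x y := unify x y.
(* Equations in abelian groups, up to syntactic equality of the atoms if that
   suffices and up to conversion otherwise. *)
Ltac abel := first [abel_with same_syntax | abel_with same_convertible].

(** * Isomorphisms, equivalences and localizations of categories *)

#[export] Instance ceq_equivalence (C : category) (X Y : C) : Equivalence (@ceq C X Y).
Proof. by split; [exact: ceq_refl|exact: ceq_sym|exact: ceq_trans]. Qed.
#[export] Hint Resolve ceq_refl : core.
#[export] Instance ccomp_proper (C : category) (X Y Z : C) :
  Proper (@ceq C Y Z ==> @ceq C X Y ==> @ceq C X Z) (@ccomp C X Y Z).
Proof. by move=> g g' gg f f' ff; apply: ccomp_ceq. Qed.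
#[export] Instance fmor_proper (C D : category) (F : functor C D) (X Y : C) :
  Proper (@ceq C X Y ==> @ceq D (F X) (F Y)) (@fmor C D F X Y).
Proof. by move=> f g fg; apply: fmor_ceq. Qed.

Section Isomorphisms.
Variables (C : category).
Implicit Types X Y Z : C.

Lemma is_iso_id X : is_iso (cid X).
Proof. by exists (cid X); split; apply: ccomp1l. Qed.

Lemma is_iso_comp X Y Z (g : chom Y Z) (f : chom X Y) :
  is_iso g -> is_iso f -> is_iso (g \oc f).
Proof.
move=> [g' [g'g gg']] [f' [f'f ff']]; exists (f' \oc g'); split.
  by rewrite -> ccompA, <- (ccompA g'), g'g, ccomp1l.
by rewrite -> ccompA, <- (ccompA f), ff', ccomp1l.
Qed.

Lemma is_iso_inj X Y Z (f : chom Y Z) (g h : chom X Y) :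
  is_iso f -> f \oc g =c f \oc h -> g =c h.
Proof.
move=> [f' [f'f _]] fgh.
by rewrite <- (ccomp1l g), <- (ccomp1l h), <- f'f, !ccompA, fgh.
Qed.

Lemma is_iso_surj X Y Z (f : chom X Y) (g h : chom Y Z) :
  is_iso f -> g \oc f =c h \oc f -> g =c h.
Proof.
move=> [f' [_ ff']] gh.
by rewrite <- (ccomp1r g), <- (ccomp1r h), <- ff', <- !ccompA, gh.
Qed.
End Isomorphisms.

Lemma fmor_iso (C D : category) (F : functor C D) (X Y : C) (f : chom X Y) :
  is_iso f -> is_iso (fmor F f).
Proof. by move=> [g [gf fg]]; exists (fmor F g); split; rewrite <- fmor_comp, <- fmor_id; apply: fmor_ceq. Qed.

Definition idfunctor (C : category) : functor C C :=
  @Functor C C id (fun X Y f => f) (fun X Y f g fg => fg)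
    (fun X => ceq_refl (cid X)) (fun X Y Z g f => ceq_refl (g \oc f)).

Lemma naturally_isomorphic_sym (C D : category) (F G : functor C D) :
  naturally_isomorphic F G -> naturally_isomorphic G F.
Proof.
move=> [eta [iso nat]].
have inv X : {g : chom (G X) (F X) | inverse_morphisms (eta X) g}.
  exact: (boolp.cid (iso X)).
exists (fun X => sval (inv X)); split=> [X|X Y f].
  by case: (inv X) => g [gf fg]; exists (eta X).
case: (inv X) => g [gf fg]; case: (inv Y) => g' [gf' fg'] /=.
apply: (is_iso_inj (iso Y)); rewrite <- ccompA, fg', ccomp1l, <- ccompA, nat, ccompA, fg.
by rewrite -> ccomp1r.
Qed.

Lemma quasi_inverse_equivalence (C D : category) (R : functor C D) (S : functor D C) :
  naturally_isomorphic (functor_comp S R) (idfunctor C) ->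
  naturally_isomorphic (functor_comp R S) (idfunctor D) ->
  is_equivalence R.
Proof.
move=> [eta [iso_eta nat_eta]] [mu [iso_mu nat_mu]].
split=> [X Y f g RfRg|X Y h|Y].
- apply: (is_iso_surj (iso_eta X)); have := nat_eta _ _ f; have := nat_eta _ _ g.
  by rewrite /= => <- <-; rewrite -> RfRg.
- have [eta' [l r]] := iso_eta X; exists (eta Y \oc fmor S h \oc eta').
  have S_inj U V (f g : @chom D U V) : fmor S f =c fmor S g -> f =c g.
    move=> fg; apply: (is_iso_surj (iso_mu U)); have := nat_mu _ _ f; have := nat_mu _ _ g.
    by rewrite /= => <- <-; rewrite -> fg.
  apply: S_inj; apply: (is_iso_inj (iso_eta Y)).
  have := nat_eta _ _ (eta Y \oc fmor S h \oc eta'); rewrite /= => ->.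
  by rewrite -> ccompA, l, ccomp1r.
- by exists (S Y), (mu Y); apply: iso_mu.
Qed.

Section LocalizationLift.
Variables (C D : category) (W : forall X Y : C, chom X Y -> Prop) (F : functor C D).
Hypothesis F_inverts : forall X Y (f : chom X Y), W f -> is_iso (fmor F f).

Definition loc_lift_inv X Y (f : chom X Y) (w : W f) := boolp.cid (F_inverts w).

Fixpoint loc_lift_mor X Y (u : loc_hom W X Y) : chom (F X) (F Y) :=
  match u in loc_hom _ X Y return chom (F X) (F Y) with
  | loc_in X Y f => fmor F f
  | loc_inv X Y f w => sval (loc_lift_inv w)
  | loc_comp X Y Z v u => loc_lift_mor v \oc loc_lift_mor u
  end.

Lemma loc_lift_ceq X Y (u v : loc_hom W X Y) : loc_eq u v -> loc_lift_mor u =c loc_lift_mor v.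
Proof.
elim=> {X Y u v} /=.
- by move=> X Y u; apply: ceq_refl.
- by move=> X Y u v _; apply: ceq_sym.
- by move=> X Y u v w _ uv _; apply: ceq_trans.
- by move=> X Y Z g g' f f' _ gg _ ff; apply: ccomp_ceq.
- by move=> *; apply: ccompA.
- by move=> *; rewrite -> fmor_id, ccomp1l.
- by move=> *; rewrite -> fmor_id, ccomp1r.
- by move=> *; apply: fmor_ceq.
- by move=> *; apply: fmor_comp.
- by move=> X Y f w; case: loc_lift_inv => g [/= gf fg]; rewrite -> gf, fmor_id.
- by move=> X Y f w; case: loc_lift_inv => g [/= gf fg]; rewrite -> fg, fmor_id.
Qed.

Definition loc_lift : functor (localization W) D :=
  @Functor (localization W) D F loc_lift_mor loc_lift_ceq (fun X => fmor_id F X)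
    (fun X Y Z g f => ceq_refl _).
End LocalizationLift.

Lemma loc_in_iso (C : category) (W : forall X Y : C, chom X Y -> Prop) (X Y : C) (f : chom X Y) :
  W X Y f -> is_iso (fmor (to_localization W) f).
Proof. by move=> w; exists (loc_inv w); split; [apply: loc_inv_l|apply: loc_inv_r]. Qed.

(** Formal inverses need no check: naturality at f, composed with the inverses of the two images of
    f, is naturality at the inverse of f. *)
Lemma localization_natural (C D : category) (W : forall X Y : C, chom X Y -> Prop)
    (P Q : functor (localization W) D) (eta : forall X : C, chom (P X) (Q X)) :
  (forall X Y (f : chom X Y), eta Y \oc fmor P (loc_in W f) =c fmor Q (loc_in W f) \oc eta X) ->
  forall (X Y : localization W) (u : chom X Y), eta Y \oc fmor P u =c fmor Q u \oc eta X.
Proof.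
move=> nat X Y; elim=> {X Y} [//|X Y f w|X Y Z v IHv u IHu].
- have P_iso : is_iso (fmor P (loc_in W f)) by apply/fmor_iso/loc_in_iso.
  apply: (is_iso_surj P_iso).
  have {1}-> : eta X \oc fmor P (loc_inv w) \oc fmor P (loc_in W f) =c eta X.
    rewrite -> ccompA, <- (fmor_comp P (loc_inv w : @chom (localization W) _ _)).
    have -> : ((loc_inv w : @chom (localization W) _ _) \oc loc_in W f) =c cid (X : localization W).
      exact: loc_inv_l.
    by rewrite -> fmor_id, ccomp1r.
  rewrite -> ccompA, nat, <- ccompA.
  rewrite <- (fmor_comp Q (loc_inv w : @chom (localization W) _ _)).
  have -> : ((loc_inv w : @chom (localization W) _ _) \oc loc_in W f) =c cid (X : localization W).
    exact: loc_inv_l.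
  by rewrite -> fmor_id, ccomp1l.
- rewrite -> (fmor_comp P (v : @chom (localization W) _ _) u).
  rewrite -> (fmor_comp Q (v : @chom (localization W) _ _) u).
  by rewrite <- ccompA, IHv, ccompA, IHu, ccompA.
Qed.

(** * Triangulated categories *)

Section Triangulated.
Variable T : triangulated.
Implicit Types X Y Z : T.
Local Notation "g \ot f" := (tr_comp g f) (at level 40, left associativity).

Lemma tr_comp0l X Y Z (f : tr_hom X Y) : (0 : tr_hom Y Z) \ot f = 0.
Proof. by apply: (addrI (0 \ot f)); rewrite -tr_compDl !addr0. Qed.
Lemma tr_comp0r X Y Z (g : tr_hom Y Z) : g \ot (0 : tr_hom X Y) = 0.
Proof. by apply: (addrI (g \ot 0)); rewrite -tr_compDr !addr0. Qed.
Lemma tr_compNl X Y Z (g : tr_hom Y Z) (f : tr_hom X Y) : (- g) \ot f = - (g \ot f).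
Proof. by apply/eqP; rewrite -subr_eq0 opprK -tr_compDl addNr tr_comp0l. Qed.
Lemma tr_compNr X Y Z (g : tr_hom Y Z) (f : tr_hom X Y) : g \ot (- f) = - (g \ot f).
Proof. by apply/eqP; rewrite -subr_eq0 opprK -tr_compDr addNr tr_comp0r. Qed.
Lemma tr_compBl X Y Z (g g' : tr_hom Y Z) (f : tr_hom X Y) : (g - g') \ot f = g \ot f - g' \ot f.
Proof. by rewrite tr_compDl tr_compNl. Qed.
Lemma tr_compBr X Y Z (g : tr_hom Y Z) (f f' : tr_hom X Y) : g \ot (f - f') = g \ot f - g \ot f'.
Proof. by rewrite tr_compDr tr_compNr. Qed.
Lemma tr_comp_suml X Y Z I (r : seq I) (g : I -> tr_hom Y Z) (f : tr_hom X Y) :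
  (\sum_(i <- r) g i) \ot f = \sum_(i <- r) g i \ot f.
Proof. by apply: (big_morph (fun g => g \ot f)) => [u v|]; [exact: tr_compDl|exact: tr_comp0l]. Qed.
Lemma tr_comp_sumr X Y Z I (r : seq I) (g : tr_hom Y Z) (f : I -> tr_hom X Y) :
  g \ot (\sum_(i <- r) f i) = \sum_(i <- r) g \ot f i.
Proof. by apply: (big_morph (fun f => g \ot f)) => [u v|]; [exact: tr_compDr|exact: tr_comp0r]. Qed.
Lemma tr_compMzl X Y Z (g : tr_hom Y Z) (f : tr_hom X Y) (m : int) : (g *~ m) \ot f = (g \ot f) *~ m.
Proof.
have nat (n : nat) : (g *+ n) \ot f = (g \ot f) *+ n.
  by elim: n => [|n IH]; rewrite ?mulr0n ?tr_comp0l // !mulrS tr_compDl IH.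
by case: m => n; rewrite ?NegzE ?mulrNz -?pmulrn ?tr_compNl nat.
Qed.
Lemma tr_compMzr X Y Z (g : tr_hom Y Z) (f : tr_hom X Y) (m : int) : g \ot (f *~ m) = (g \ot f) *~ m.
Proof.
have nat (n : nat) : g \ot (f *+ n) = (g \ot f) *+ n.
  by elim: n => [|n IH]; rewrite ?mulr0n ?tr_comp0r // !mulrS tr_compDr IH.
by case: m => n; rewrite ?NegzE ?mulrNz -?pmulrn ?tr_compNr nat.
Qed.

Lemma tr_shm0 X Y : tr_shm (0 : tr_hom X Y) = 0.
Proof. by apply: (addrI (tr_shm 0)); rewrite -tr_shmD !addr0. Qed.

Lemma tr_zero_l X Y (f : tr_hom X Y) : tr_id X = 0 -> f = 0.
Proof. by move=> X0; rewrite -(tr_comp1r f) X0 tr_comp0r. Qed.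
(** The trivial triangle on X maps to the given one by the identity and f; the completing map shows
    that g f factors through a zero object. *)
Lemma dist_comp0 X Y Z (f : tr_hom X Y) (g : tr_hom Y Z) h : tr_dist f g h -> g \ot f = 0.
Proof.
have [O O0] := tr_zero T; move=> D.
have [c [cE _]] := tr_complete (a := tr_id X) (b := f) (tr_trivial X O0) D erefl.
by rewrite -cE (tr_zero_l c O0) tr_comp0l.
Qed.

(** Exactness of Hom(W, -) at Y. Completing a map from the rotated trivial triangle on W gives a
    morphism between shifts, which comes from W -> X because the shift is bijective on morphisms. *)
Lemma dist_weak_kernel W X Y Z (f : tr_hom X Y) (g : tr_hom Y Z) h (e : tr_hom W Y) :
  tr_dist f g h -> g \ot e = 0 -> exists e', e = f \ot e'.
Proof.
have [O O0] := tr_zero T; move=> D ge.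
have tri : tr_dist (0 : tr_hom W O) (0 : tr_hom O (tr_sh W)) (- tr_shm (tr_id W)).
  by rewrite -tr_rotate; apply: tr_trivial.
have/(tr_rotate _ _ _) D' := D.
have [|c [cE1 cE2]] := tr_complete (a := e) (b := 0 : tr_hom O Z) tri D'.
  by rewrite tr_comp0l ge.
have [s sK Ks] := tr_shm_bij W X.
exists (s c); rewrite -[LHS]/(id e).
have [s' s'K _] := tr_shm_bij W Y.
rewrite -(s'K e) -(s'K (f \ot s c)); congr s'.
rewrite tr_shm_comp Ks; apply: oppr_inj.
by rewrite -tr_compNl -cE2 tr_shm_id tr_compNr tr_comp1r.
Qed.

Lemma dist_weak_cokernel W X Y Z (f : tr_hom X Y) (g : tr_hom Y Z) h (e : tr_hom Z W) :
  tr_dist f g h -> e \ot g = 0 -> exists e', e = e' \ot h.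
Proof.
have [O O0] := tr_zero T; move=> /(tr_rotate _ _ _) D eg.
have O0' : tr_id (tr_sh O) = 0 by rewrite -tr_shm_id O0 tr_shm0.
have tri : tr_dist (0 : tr_hom O W) (tr_id W) (0 : tr_hom W (tr_sh O)).
  by rewrite tr_rotate tr_shm0 oppr0; apply: tr_trivial.
have [|c [cE _]] := tr_complete (a := 0 : tr_hom Y O) (b := e) D tri.
  by rewrite tr_comp0r eg.
by exists c; rewrite cE tr_comp1l.
Qed.

(** The error c - id factors through h and is killed by h, so it squares to zero and id - (c - id)
    inverts c. This stands in for the five lemma. *)
Lemma dist_endo_iso X Y Z (f : tr_hom X Y) (g : tr_hom Y Z) h (c : tr_hom Z Z) :
  tr_dist f g h -> c \ot g = g -> h \ot c = h -> exists c', c' \ot c = tr_id Z /\ c \ot c' = tr_id Z.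
Proof.
move=> D cg hc; pose e := c - tr_id Z.
have eg : e \ot g = 0 by rewrite tr_compBl cg tr_comp1l subrr.
have he : h \ot e = 0 by rewrite tr_compBr hc tr_comp1r subrr.
have [e' eE] := dist_weak_cokernel D eg.
have ee : e \ot e = 0 by rewrite {1}eE tr_compA he tr_comp0r.
have -> : c = tr_id Z + e by rewrite addrC subrK.
exists (tr_id Z - e).
by split; rewrite !(tr_compBl, tr_compBr, tr_compDl, tr_compDr, tr_comp1l, tr_comp1r, ee); abel.
Qed.

(** The completions c and c' need not be inverse to each other, but by [dist_endo_iso] both
    composites are invertible, which gives c a left and a right inverse. *)
Lemma cone_isomorphic X Y Z X' Y' Z' (f : tr_hom X Y) (g : tr_hom Y Z) h
    (f' : tr_hom X' Y') (g' : tr_hom Y' Z') h' (a : tr_hom X X') (b : tr_hom Y Y') :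
  tr_dist f g h -> tr_dist f' g' h' -> @is_iso (tr_cat T) _ _ a -> @is_iso (tr_cat T) _ _ b ->
  b \ot f = f' \ot a -> @isomorphic (tr_cat T) Z Z'.
Proof.
move=> D D' [a' [/= aa' a'a]] [b' [/= bb' b'b]] E.
have E' : b' \ot f' = f \ot a'.
  rewrite -[f']tr_comp1r -a'a -(tr_compA f') -E !tr_compA -tr_compA bb' tr_comp1l //.
have [c [c1 c2]] := tr_complete D D' E; have [c' [c1' c2']] := tr_complete D' D E'.
have [u [u1 u2]] : exists u, u \ot (c' \ot c) = tr_id Z /\ (c' \ot c) \ot u = tr_id Z.
  apply: (dist_endo_iso D); first by rewrite tr_compA c1 -tr_compA c1' tr_compA bb' tr_comp1r.
  by rewrite -tr_compA -c2' tr_compA -c2 -tr_compA -tr_shm_comp aa' tr_shm_id tr_comp1l.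
have [v [v1 v2]] : exists v, v \ot (c \ot c') = tr_id Z' /\ (c \ot c') \ot v = tr_id Z'.
  apply: (dist_endo_iso D'); first by rewrite tr_compA c1' -tr_compA c1 tr_compA b'b tr_comp1r.
  by rewrite -tr_compA -c2 tr_compA -c2' -tr_compA -tr_shm_comp a'a tr_shm_id tr_comp1l.
exists c, (u \ot c'); split; first by rewrite /= tr_compA.
have E1 : u \ot c' = c' \ot v.
  rewrite -[LHS]tr_comp1r -v2 -!tr_compA (tr_compA u c' c) u1 tr_comp1l //.
by rewrite /= E1 -tr_compA.
Qed.
End Triangulated.

(** * Thick subcategories and derived Morita equivalences *)

Section Subspaces.
Variables (k : fieldType) (V : lmodType k) (S : subspace V).
Lemma subspaceD u v : S u -> S v -> S (u + v).
Proof. by move=> Su Sv; rewrite -[u]scale1r; apply: subspaceZD. Qed.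
Lemma subspaceZ a u : S u -> S (a *: u).
Proof. by move=> Su; rewrite -[_ *: u]addr0; apply: subspaceZD => //; apply: subspace0. Qed.
Lemma subspaceN u : S u -> S (- u).
Proof. by move=> Su; rewrite -scaleN1r; apply: subspaceZ. Qed.
Lemma subspaceB u v : S u -> S v -> S (u - v).
Proof. by move=> Su Sv; apply: subspaceD => //; apply: subspaceN. Qed.
End Subspaces.

Definition zero_subspace (k : fieldType) (V : lmodType k) : subspace V.
Proof.
exists (fun v => v = 0) => // a u v -> ->; by rewrite scaler0 addr0.
Defined.

Lemma mod_d_act_closed (k : fieldType) (A : dgcat k) (N : dgmod A) X Y i j l i' l'
    (e : i + j = l) (ei : i + 1 = i') (el : l + 1 = l') (e1 : i' + j = l')
    (m : N Y i) (f : dg_hom X Y j) :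
  dg_closed f -> mod_d el (mod_act e m f) = mod_act e1 (mod_d ei m) f.
Proof.
move=> cf; have e2 : i + (j + 1) = l' by clear -e el; lia.
by rewrite (mod_leibniz e ei erefl el e1 e2) cf (lin0 (mod_act_linear_r _ _)) scaler0 addr0.
Qed.

Section DGModuleMorphisms.
Variables (k : fieldType) (A : dgcat k) (M N : dgmod A) (f : dgmod_hom M N).
Lemma dgm0 X i : f X i 0 = 0. Proof. exact: (lin0 (@dgm_linear _ _ _ _ f X i)). Qed.
Lemma dgmB X i u v : f X i (u - v) = f X i u - f X i v.
Proof. exact: (linB (@dgm_linear _ _ _ _ f X i)). Qed.
Lemma dgm_cocycle X i (m : M X i) : mod_cocycle m -> mod_cocycle (f X i m).
Proof. by move=> cm j e; rewrite -dgm_d cm dgm0. Qed.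
Lemma mod_cocycleB X i (m n : M X i) : mod_cocycle m -> mod_cocycle n -> mod_cocycle (m - n).
Proof. by move=> cm cn j e; rewrite (linB (mod_d_linear _)) cm cn subrr. Qed.
Lemma mod_coboundary0 X i : mod_coboundary (0 : M X i).
Proof. by exists (i - 1), (subrK 1 i), 0; rewrite (lin0 (mod_d_linear _)). Qed.
End DGModuleMorphisms.

(** * Objects at which a DG-module is acyclic *)

Section AcyclicThick.
Variables (k : fieldType) (A : dgcat k) (N : dgmod A) (I : forall X i, subspace (N X i)).
Hypothesis Iact : forall X Y i j l (e : i + j = l) (m : N Y i) (f : dg_hom X Y j),
  I Y i m -> I X l (mod_act e m f).

(** Acyclicity at X of the quotient of N by I, for I a subcomplex, written without forming the
    quotient. With I = 0 it tests contractibility and quasi-isomorphisms; with I the maps vanishing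
    in low degrees it tests perfectness. *)
Definition acyclic_mod X : Prop := forall h i j (e' : h + 1 = i) (e : i + 1 = j) (m : N X i),
  I X j (mod_d e m) -> exists y : N X h, I X i (m - mod_d e' y).

(** The degrees a and b are left free so that the lemma covers both shifts (g = 0) and homotopy
    retracts (a = b = 0). *)
Lemma acyclic_mod_retract X Z a b (eab : a + b = 0) (s : dg_hom X Z a) (t : dg_hom Z X b)
    (g : dg_hom Z Z (-1)) :
  dg_closed s -> dg_closed t -> dg_comp eab s t - dg_id Z = dg_d (addNr 1) g ->
  acyclic_mod X -> acyclic_mod Z.
Proof.
move=> cs ct E HX h i j e' e m Im.
have e1 : i + a + 1 = j + a by clear -e; lia.
have e2 : h + a + 1 = i + a by clear -e'; lia.
have [|y Hy] := HX _ _ _ e2 e1 (mod_act erefl m s).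
  by rewrite (mod_d_act_closed erefl e e1 erefl) //; apply: Iact.
have e3 : h + a + b = h by clear -eab; lia.
have e4 : i + a + b = i by clear -eab; lia.
have e5 : i + -1 = h by clear -e'; lia.
have e6 : j + -1 = i by clear -e; lia.
have mE : mod_act e4 (mod_act erefl m s) t = m + mod_act (addr0 i) m (dg_d (addNr 1) g).
  rewrite (mod_actA _ _ eab (addr0 i)) -E (linB (mod_act_linear_r _ _)) mod_act1.
  by rewrite addrC subrK.
(* A primitive of m s over X is carried back along t; the second term corrects for s t being the
   identity only up to the homotopy g. *)
exists (mod_act e3 y t - (-1) ^ i *: mod_act e5 m g).
rewrite (linB (mod_d_linear _)) (linZ (mod_d_linear _)).
rewrite (mod_d_act_closed e3 e2 e' e4) // (mod_leibniz e5 e (addNr 1) e' e6 (addr0 i)).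
rewrite scalerDr scalerA sign_sq scale1r.
have -> : m - (mod_act e4 (mod_d e2 y) t - ((-1) ^ i *: mod_act e6 (mod_d e m) g +
    mod_act (addr0 i) m (dg_d (addNr 1) g))) =
  mod_act e4 (mod_act erefl m s - mod_d e2 y) t + (-1) ^ i *: mod_act e6 (mod_d e m) g.
  by rewrite (linB (mod_act_linear_l _ _)) mE; abel.
by apply: subspaceD; [apply: Iact|apply: subspaceZ; apply: Iact].
Qed.

Lemma thick_acyclic_mod : thick acyclic_mod.
Proof.
split.
- move=> Z Z0 h i j e' e m _; exists 0.
  rewrite (lin0 (mod_d_linear _)) subr0 -(mod_act1 (addr0 i) m) Z0.
  by rewrite (lin0 (mod_act_linear_r _ _)); apply: subspace0.
- move=> X Z [s [t [cs ct ts st]]]; split.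
    apply: (acyclic_mod_retract (eab := addNr 1) (s := s) (t := t) (g := 0)) => //.
    by rewrite st subrr (lin0 (dg_d_linear _)).
  apply: (acyclic_mod_retract (eab := subrr 1) (s := t) (t := s) (g := 0)) => //.
  by rewrite ts subrr (lin0 (dg_d_linear _)).
- move=> X Y f Z cf [j [r [q [p [[rj pq rq pj] jrqp [cj cp] dq]]]]] HX HY a i b e' e m Im.
  have [|y Hy] := HY _ _ _ e' e (mod_act (addr0 i) m j).
    by rewrite (mod_d_act_closed (addr0 i) e e (addr0 b)) //; apply: Iact.
  (* Subtracting this boundary puts the component of m along Y into I. The remaining component,
     along q, is then a cocycle modulo I over X. *)
  pose m' := m - mod_d e' (mod_act (addr0 a) y r).
  have dm' : mod_d e m' = mod_d e m by rewrite (linB (mod_d_linear _)) mod_dd subr0.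
  have m'j : I Y i (mod_act (addr0 i) m' j).
    rewrite (linB (mod_act_linear_l _ _)).
    rewrite -(mod_d_act_closed (addr0 a) e' e' (addr0 i)) //.
    by rewrite (mod_actA _ _ (addr0 0) (addr0 a)) rj mod_act1.
  have e1 : i + -1 = a by clear -e'; lia.
  have e2 : b + -1 = i by clear -e; lia.
  have e3 : a - 1 + 1 = a by rewrite subrK.
  have [|x Hx] := HX _ _ _ e3 e' (mod_act e1 m' q).
    rewrite (mod_leibniz e1 e (addNr 1) e' e2 (addr0 i)) dm' dq.
    apply: subspaceD; first exact: Iact.
    rewrite -(mod_actA (addr0 i) (addr0 i)); by apply/subspaceZ/Iact.
  exists (mod_act (addr0 a) y r + mod_act e3 x p).
  rewrite (linD (mod_d_linear _)) opprD addrA -/m' (mod_d_act_closed e3 e3 e' e') //.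
  rewrite -{1}(mod_act1 (addr0 i) m') -jrqp (linD (mod_act_linear_r _ _)).
  rewrite -(mod_actA (addr0 i) (addr0 i)) -(mod_actA e1 e').
  rewrite -addrA -(linB (mod_act_linear_l _ _)).
  by apply: subspaceD; apply: Iact.
- move=> X Y [i ci] [r cr] [g /= E]; apply: (acyclic_mod_retract (eab := addr0 0) cr ci E).
Qed.
End AcyclicThick.

(** * Mapping cones of morphisms of DG-modules *)

Section MappingCone.
Variables (k : fieldType) (A : dgcat k) (N N' : dgmod A) (g : dgmod_hom N N').

Definition mcone_ob X (i : int) : lmodType k := (N X (i + 1)%R * N' X i)%type.
Let e1 i j : i + 1 = j -> i + 1 + 1 = j + 1 :> int. Proof. by move=> ->. Qed.
Let e2 i j : i + 1 = j -> i + 1 + 0 = j :> int. Proof. by rewrite addr0. Qed.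
Let e3 i j l : i + j = l -> i + 1 + j = l + 1 :> int. Proof. by move=> <-; lia. Qed.
(** Acting by the identity of X, of degree 0, moves g m from degree i + 1 to the propositionally
    equal degree j without a transport. *)
Definition mcone_d X i j (e : i + 1 = j) (m : mcone_ob X i) : mcone_ob X j :=
  (- mod_d (e1 e) m.1, mod_d e m.2 + mod_act (e2 e) (g _ _ m.1) (dg_id X)).
Definition mcone_act X Y i j l (e : i + j = l) (m : mcone_ob Y i) (f : dg_hom X Y j) :
    mcone_ob X l :=
  (mod_act (e3 e) m.1 f, mod_act e m.2 f).

Lemma mod_castA (M : dgmod A) X Y i i' j l (a : i + 0 = i') (b : i' + j = l) (c : i + j = l)
    (m : M Y i) (f : dg_hom X Y j) :
  mod_act b (mod_act a m (dg_id Y)) f = mod_act c m f.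
Proof. by rewrite (mod_actA a b (add0r j) c) dg_comp1l. Qed.

Program Definition mcone : dgmod A :=
  @DGMod k A mcone_ob mcone_d mcone_act _ _ _ _ _ _ _.
Next Obligation.
move=> X i j e a [m1 m2] [n1 n2]; rewrite /mcone_d /=; congr pair => /=.
  by rewrite mod_d_linear scalerN opprD.
by rewrite !(mod_d_linear, dgm_linear, mod_act_linear_l _ _) scalerDr addrACA.
Qed.
Next Obligation.
move=> X Y i j l e f a [m1 m2] [n1 n2]; rewrite /mcone_act /=; congr pair;
by rewrite /= (mod_act_linear_l _ _).
Qed.
Next Obligation.
by move=> X Y i j l e [m1 m2] a u v; rewrite /mcone_act; congr pair;
   rewrite /= (mod_act_linear_r _ _).
Qed.
Next Obligation.
move=> X i j l a b [m1 m2]; rewrite /mcone_d /=; congr pair => /=.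
  by rewrite (linN (mod_d_linear _)) mod_dd opprK.
rewrite (linD (mod_d_linear _)) mod_dd add0r (linN (@dgm_linear _ _ _ _ g _ _)) dgm_d.
rewrite (linN (mod_act_linear_l _ _)) (mod_d_act_closed (e2 a) (e1 a) b (e2 b)).
  by rewrite subrr.
exact: dg_id_closed.
Qed.
Next Obligation.
move=> X Y i j l i' j' l' e ei ej el a b [m1 m2] f; rewrite /mcone_d /mcone_act /=; congr pair => /=.
  rewrite (mod_leibniz (e3 e) (e1 ei) ej (e1 el) (e3 a) (e3 b)) opprD.
  rewrite (linN (mod_act_linear_l _ _)) signD expr1z mulrN1 scaleNr opprK.
  by congr (_ + _).
rewrite (mod_leibniz e ei ej el a b) (linD (mod_act_linear_l _ _)) dgm_act.
rewrite (mod_castA (e2 ei) a (etrans (e3 e) el)).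
rewrite (mod_actA (e3 e) (e2 el) (addr0 j) (etrans (e3 e) el)) dg_comp1r.
by rewrite addrAC.
Qed.
Next Obligation.
by move=> X Y Z a b c ab bc abc f1 f2 f3 f4 [m1 m2] u f; rewrite /mcone_act; congr pair;
   apply: mod_actA.
Qed.
Next Obligation. by move=> X i e [m1 m2]; rewrite /mcone_act /=; congr pair; apply: mod_act1. Qed.

Definition quasi_iso_at X : Prop := forall i,
  (forall n : N' X i, mod_cocycle n ->
     exists2 m : N X i, mod_cocycle m & mod_coboundary (n - g X i m)) /\
  (forall m : N X i, mod_cocycle m -> mod_coboundary (g X i m) -> mod_coboundary m).

Definition acyclic_at (M : dgmod A) X : Prop := acyclic_mod (fun Y i => zero_subspace (M Y i)) X.

(** Turns a statement about a map into the acyclicity of one module, so that [thick_acyclic_mod]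
    applies to quasi-isomorphisms. *)
Lemma mcone_acyclic X : quasi_iso_at X <-> acyclic_at mcone X.
Proof.
split=> [H|H].
- move=> h i j e' e [n n'] /= [] /eqP; rewrite oppr_eq0 => /eqP dn E.
  subst j; move/eqP: E; rewrite mod_act1 addr_eq0 => /eqP E.
  have cn : mod_cocycle n.
    move=> j' ej; subst j'; exact: etrans (congr1 (fun e => mod_d e n) (int_eq_irr _ _)) dn.
  have [] := proj2 (H (i + 1)) n cn.
    by exists i, erefl, (- n'); rewrite (linN (mod_d_linear _)) E opprK.
  move=> i' [ei [a aE]]; have ? : i' = i by clear -ei; lia.
  subst i'; have := proj1 (H i) (n' + g X i a).
  case=> [j' ej|m cm [h' [eh [b bE]]]].
    by subst j'; rewrite (linD (mod_d_linear _)) -dgm_d E (int_eq_irr erefl ei) aE addNr.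
  have ? : h' = h by clear -e' eh; lia.
  subst h' i; exists (m - a, b); apply/eqP; rewrite subr_eq0; apply/eqP.
  rewrite /mcone_d /=; congr pair => /=.
    rewrite (int_eq_irr (e1 erefl) ei) (linB (mod_d_linear _)) (cm _ ei) aE.
    by rewrite sub0r opprK.
  rewrite mod_act1 (int_eq_irr erefl eh) bE (linB (@dgm_linear _ _ _ _ g _ _)).
  by abel.
- move=> i; have eh : i - 1 + 1 = i by rewrite subrK.
  split=> [n' cn|m cm [i' [ei [m' mE]]]].
    have [|[y y'] /eqP] := H _ _ _ eh erefl (0, n').
      rewrite /= /mcone_d /= (lin0 (mod_d_linear _)) oppr0 cn add0r.
      by rewrite (lin0 (@dgm_linear _ _ _ _ g _ _)) (lin0 (mod_act_linear_l _ _)).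
    rewrite subr_eq0 /mcone_d /= => /eqP [] /esym /eqP; rewrite oppr_eq0 => /eqP dy yE.
    exists (mod_act (e2 eh) y (dg_id X)).
      move=> j ej; rewrite (mod_d_act_closed (e2 eh) (e1 eh) ej (etrans (addr0 _) ej)).
        by rewrite dy (lin0 (mod_act_linear_l _ _)).
      exact: dg_id_closed.
    by exists (i - 1), eh, y'; rewrite yE dgm_act addrK.
  have ? : i' = i - 1 by clear -ei; lia.
  subst i'; have eh' : i - 1 - 1 + 1 = i - 1 by rewrite subrK.
  have ei' : i + 0 = i - 1 + 1 by clear; lia.
  have [|[y y'] /eqP] := H _ _ _ eh' eh (mod_act ei' m (dg_id X), - m').
    rewrite /= /mcone_d /=; congr pair => /=.
      rewrite (mod_d_act_closed ei' erefl (e1 eh) (etrans (addr0 _) erefl)); last exact: dg_id_closed.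
      by rewrite cm (lin0 (mod_act_linear_l _ _)) oppr0.
    rewrite dgm_act (mod_castA ei' (e2 eh) (addr0 i)) mod_act1 (linN (mod_d_linear _)).
    by rewrite (int_eq_irr eh ei) mE addNr.
  rewrite subr_eq0 /mcone_d /= => /eqP [] E _.
  exists (i - 1 - 1 + 1), (etrans (congr1 (+%R^~ 1) eh') eh), (- y).
  rewrite (linN (mod_d_linear _)) -[m](mod_act1 (addr0 i)) -(mod_castA ei' (e2 eh)) E.
  have e4 : i - 1 + 1 + 0 = i by clear; lia.
  rewrite (linN (mod_act_linear_l _ _)); congr (- _).
  move: (e1 eh') (e2 eh) => a b; move: (etrans _ _) => c.
  by rewrite -(mod_d_act_closed (addr0 _) a c b) ?mod_act1 //; exact: dg_id_closed.
Qed.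

(** This is how a map of modules over B is shown to be a quasi-isomorphism by looking only at
    generators of B. *)
Lemma thick_quasi_iso_at : thick quasi_iso_at.
Proof.
rewrite (_ : quasi_iso_at = acyclic_at mcone).
  apply: thick_acyclic_mod => X Y i j l e m f ->.
  exact: (lin0 (mod_act_linear_l _ _)).
by apply: funext => X; apply/propext/mcone_acyclic.
Qed.
End MappingCone.

Lemma add_swap (i p q : int) : p + i = q -> i + p = q.
Proof. by rewrite addrC. Qed.

(** * Coinduction, the right adjoint of restriction *)

Section Coinduction.
Variables (k : fieldType) (A B : dgcat k) (F : dgfunctor A B).

Section Ob.
Variable M : dgmod A.
(** The complex Hom_A(B(F-, Y), M). The underived right adjoint is chosen because it is a plain
    complex of graded maps and needs no tensor product over A. *)
Definition coind_ob (Y : B) (n : int) : lmodType k := homcx (res_ob F (yoneda Y)) M n.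

Section Act.
Variables (X Y : B) (i j l : int) (e : i + j = l) (u : coind_ob Y i) (f : dg_hom X Y j).
Let e1 p q : p + l = q -> j + p + i = q. Proof. by clear u f; lia. Qed.
Definition coind_act_fun Z p q (ep : p + l = q) (m : res_ob F (yoneda X) Z p) : M Z q :=
  hc u (e1 ep) (dg_comp erefl f (m : dg_hom (F Z) X p) : res_ob F (yoneda Y) Z (j + p)).
Lemma coind_act_funE Z p q r (ep : p + l = q) (a : j + p = r) (b : r + i = q)
    (m : dg_hom (F Z) X p) :
  coind_act_fun ep m = hc u b (dg_comp a f m : res_ob F (yoneda Y) Z r).
Proof. by subst r; rewrite /coind_act_fun (int_eq_irr (e1 ep) b). Qed.
Fact coind_act_linear Z p q (ep : p + l = q) : linear (@coind_act_fun Z p q ep).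
Proof. by move=> a m m'; rewrite /coind_act_fun (dg_comp_linear_r _ _) hc_linear. Qed.
Fact coind_act_act Z W p d p' q q' (ep : p + l = q) (ep' : p' + l = q')
    (a : p + d = p') (b : q + d = q') (m : res_ob F (yoneda X) W p) (g : dg_hom Z W d) :
  coind_act_fun ep' (mod_act a m g) = mod_act b (coind_act_fun ep m) g.
Proof.
have a1 : j + p + d = j + p' by clear -a; lia.
rewrite /coind_act_fun /= -(dg_compA erefl a1 a erefl).
exact: (hc_act u (e1 ep) (e1 ep') a1 b).
Qed.
Definition coind_act : coind_ob X l := mk_homcx coind_act_linear coind_act_act.
End Act.

Program Definition coind : dgmod B :=
  @DGMod k B coind_ob (fun Y i j e u => hc_d e u) coind_act _ _ _ _ _ _ _.
Next Obligation. by move=> Y i j e; apply: hc_d_linear_u. Qed.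
Next Obligation.
by move=> X Y i j l e f a u v; apply: hcP => Z p q ep m; rewrite hc_zd !hc_mk /coind_act_fun hc_zd.
Qed.
Next Obligation.
move=> X Y i j l e u a f g; apply: hcP => Z p q ep m.
by rewrite hc_zd !hc_mk /coind_act_fun (dg_comp_linear_l _ _) hc_linear.
Qed.
Next Obligation. by move=> *; apply: hc_dd. Qed.
Next Obligation.
move=> X Y i j l i' j' l' e ei ej el e1 e2 u f; apply: hcP => Z p q ep m.
have b1 : p + l + 1 = q by clear -ep el; lia.
have b2 : p + 1 + l = q by clear -ep el; lia.
have b3 : j + p + i = p + l by clear -e; lia.
have b4 : j + (p + 1) + i = q by clear -e el ep; lia.
have b5 : j + p + i' = q by clear -e el ei ep; lia.
have b6 : j' + p + i = q by clear -e el ej ep; lia.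
have b7 : j + p + 1 = j + (p + 1) by clear; lia.
have b8 : j' + p = j + (p + 1) by clear -ej; lia.
rewrite addrC hc_zd !hc_mk addrC.
rewrite (hc_d_funE el _ ep erefl b1 erefl b2) !hc_mk.
rewrite (coind_act_funE e u f erefl erefl b3) (coind_act_funE e u f b2 erefl b4).
rewrite (coind_act_funE e1 _ f ep erefl b5) (coind_act_funE e2 u _ ep erefl b6) hc_mk.
rewrite (hc_d_funE ei u b5 b3 b1 b7 b4) /=.
rewrite (dg_leibniz erefl ej erefl b7 b8 erefl) (linD (hc_linear _ _)) (linZ (hc_linear _ _)).
rewrite scalerDr scalerA -signD e opprD.
have -> : hc u b4 (dg_comp b8 (dg_d ej f) m : res_ob F (yoneda Y) Z _) =
          hc u b6 (dg_comp erefl (dg_d ej f) m : res_ob F (yoneda Y) Z _).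
  suff E r (a : j' + p = r) (c : r + i = q) :
      hc u c (dg_comp a (dg_d ej f) m : res_ob F (yoneda Y) Z _) =
      hc u b6 (dg_comp erefl (dg_d ej f) m : res_ob F (yoneda Y) Z _) by apply: E.
  by subst r; rewrite (int_eq_irr c b6).
by abel.
Qed.
Next Obligation.
move=> X Y Z a b c ab bc abc e1 e2 e3 e4 u g f; apply: hcP => W p q ep m.
have b1 : c + p + ab = q by clear -e2 ep; lia.
have b2 : b + (c + p) + a = q by clear -e1 e2 ep; lia.
have b3 : bc + p = b + (c + p) by clear -e3; lia.
rewrite !hc_mk (coind_act_funE e2 _ f ep erefl b1) hc_mk (coind_act_funE e1 u g b1 erefl b2).
by rewrite (coind_act_funE e4 u _ ep b3 b2) (dg_compA e3 b3 erefl erefl).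
Qed.
Next Obligation.
move=> X i e u; apply: hcP => Z p q ep m.
by rewrite hc_mk (coind_act_funE e u _ ep (add0r p) ep) dg_comp1l.
Qed.

Definition counit_fun X i (u : res_ob F coind X i) : M X i :=
  hc (u : coind_ob (F X) i) (add0r i) (dg_id (F X) : res_ob F (yoneda (F X)) X 0).

Program Definition counit : dgmod_hom (res_ob F coind) M :=
  @DGModHom k A (res_ob F coind) M counit_fun _ _ _.
Next Obligation. by move=> X i a u v; rewrite /counit_fun hc_zd. Qed.
Next Obligation.
move=> X i j e u; rewrite -[LHS]/(hc_d_fun e (u : coind_ob (F X) i) (add0r j)
  (dg_id (F X) : res_ob F (yoneda (F X)) X 0)).
have a : 1 + i = j by clear -e; lia.
rewrite (hc_d_funE e u (add0r j) (add0r i) e (add0r 1) a) /=.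
by rewrite (dg_id_closed (F X)) (lin0 (hc_linear _ _)) scaler0 subr0.
Qed.
Next Obligation.
move=> X Y i j l e u f; rewrite -[LHS]/(coind_act_fun e (u : coind_ob (F Y) i) (dgf_hom F f)
  (add0r l) (dg_id (F X) : dg_hom (F X) (F X) 0)).
have a : j + i = l by clear -e; lia.
rewrite (coind_act_funE e _ _ _ (addr0 j) a) dg_comp1r.
rewrite -(hc_act u (add0r i) a (add0r j) e) /=; congr hc.
by rewrite dg_comp1l.
Qed.
End Ob.

Program Definition coind_mor (M N : dgmod A) (g : dgmod_hom M N) :
    dgmod_hom (coind M) (coind N) :=
  @DGModHom k B (coind M) (coind N) (fun X i u =>
    @mk_homcx k A _ N i (fun Z p q e m => g Z q (hc (u : coind_ob M X i) e m)) _ _) _ _ _.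
Next Obligation. by move=> M N g X i u Z p q e a m m' /=; rewrite hc_linear dgm_linear. Qed.
Next Obligation.
by move=> M N g X i u Z W p j p' q q' e e' a b m f /=; rewrite (hc_act _ e e' a b) dgm_act.
Qed.
Next Obligation.
by move=> M N g X i a u v; apply: hcP => Z p q e m; rewrite hc_zd !hc_mk hc_zd dgm_linear.
Qed.
Next Obligation.
move=> M N g X i j e u; apply: hcP => Z p q ep m; rewrite [LHS]hc_mk.
rewrite -[LHS]/(g Z q (hc_d_fun e (u : coind_ob M X i) ep m)) [RHS]hc_mk /hc_d_fun !hc_mk.
by rewrite (linB (@dgm_linear _ _ _ _ g _ _)) dgm_d (linZ (@dgm_linear _ _ _ _ g _ _)).
Qed.
Next Obligation. by move=> M N g X Y i j l e u f; apply: hcP. Qed.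

Program Definition coinduction : functor (Cdg A) (Cdg B) :=
  @Functor (Cdg A) (Cdg B) coind coind_mor _ _ _.
Next Obligation. by move=> M N f g E X i u; apply: hcP => Z p q e m; rewrite !hc_mk E. Qed.
Next Obligation. by move=> M X i u; apply: hcP. Qed.
Next Obligation. by move=> M N P g f X i u; apply: hcP. Qed.

Section Unit.
Variable N : dgmod B.
Local Notation e1 := add_swap.
Definition unit_mor : dgmod_hom N (coind (res_ob F N)).
Proof.
unshelve refine (@DGModHom k B N (coind (res_ob F N)) (fun X i n =>
    @mk_homcx k A (res_ob F (yoneda X)) (res_ob F N) i (fun Z p q e m =>
       mod_act (d := N) (X := F Z) (e1 e) n (m : dg_hom (F Z) X p)) _ _) _ _ _).
- by move=> Z p q e a m m'; apply: (@mod_act_linear_r k B N).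
- move=> Z W p j p' q q' e e' a b m f /=; symmetry; exact: mod_actA.
- move=> X i a u v; apply: hcP => Z p q e m; rewrite hc_zd !hc_mk; exact: (@mod_act_linear_l k B N (F Z) X i p q (e1 e) m a u v).
- move=> X i j e n; apply: hcP => Z p q ep m; rewrite [RHS]hc_mk [LHS]hc_mk /hc_d_fun !hc_mk /=.
  have a1 : i + p + 1 = q by clear -e ep; lia.
  have a2 : i + (p + 1) = q by clear -e ep; lia.
  have E r (c : i + p = r) (c' : r + 1 = q) :
    mod_d (d := N) c' (mod_act c n (m : dg_hom (F Z) X p)) =
    mod_act (e1 ep) (mod_d e n) (m : dg_hom (F Z) X p) +
      (-1) ^ i *: mod_act a2 n (dg_d erefl (m : dg_hom (F Z) X p)).
    exact: mod_leibniz.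
  by rewrite E (int_eq_irr (e1 _) a2) addrK.
- move=> X Y i j l e n f; apply: hcP => Z p q ep m; exact: (@mod_actA k B N).
Defined.
End Unit.

Lemma counit_unit (N : dgmod B) X i (n : N (F X) i) :
  counit_fun (unit_mor N _ _ n : res_ob F (coind (res_ob F N)) X i) = n.
Proof. by rewrite -[LHS]/(mod_act (d := N) (add_swap (add0r i)) n (dg_id (F X))) mod_act1. Qed.
End Coinduction.

(** * A criterion for derived Morita equivalences *)

Section DerivedMorita.
Variables (k : fieldType) (A B : dgcat k) (F : dgfunctor A B).

(** Generation is phrased as an induction principle; it is applied to classes of objects at which
    some map of modules is a quasi-isomorphism. *)
Definition thick_generated : Prop :=
  forall Q : B -> Prop, thick Q -> (forall X, Q (F X)) -> forall Y, Q Y.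

(* A-linear deformation retraction of B(F-, F X) onto A(-, X). *)
Record hom_retraction (X : A) := HomRetraction {
  hr_retract : forall X' i, dg_hom (F X') (F X) i -> dg_hom X' X i;
  hr_homotopy : forall X' i j, j + 1 = i -> dg_hom (F X') (F X) i -> dg_hom (F X') (F X) j;
  hr_retract_linear : forall X' i, linear (@hr_retract X' i);
  hr_homotopy_linear : forall X' i j (e : j + 1 = i), linear (@hr_homotopy X' i j e);
  hr_retract_d : forall X' i j (e : i + 1 = j) (b : dg_hom (F X') (F X) i),
    hr_retract (dg_d e b) = dg_d e (hr_retract b);
  hr_retract_comp : forall X' X'' i j l (e : i + j = l) (b : dg_hom (F X') (F X) i)
      (a : dg_hom X'' X' j),
    hr_retract (dg_comp e b (dgf_hom F a)) = dg_comp e (hr_retract b) a;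
  hr_homotopy_comp : forall X' X'' i i' j l l' (e : i + j = l) (ei : i' + 1 = i)
      (el : l' + 1 = l) (e' : i' + j = l') (b : dg_hom (F X') (F X) i) (a : dg_hom X'' X' j),
    hr_homotopy el (dg_comp e b (dgf_hom F a)) = dg_comp e' (hr_homotopy ei b) (dgf_hom F a);
  hr_retract_id : hr_retract (dg_id (F X)) = dg_id X;
  hr_homotopyE : forall X' h i j (eh : h + 1 = i) (e : i + 1 = j) (b : dg_hom (F X') (F X) i),
    b - dgf_hom F (hr_retract b) = dg_d eh (hr_homotopy eh b) + hr_homotopy e (dg_d e b) }.

Hypothesis F_retraction : forall X, hom_retraction X.
Hypothesis F_generated : thick_generated.

Section Counit.
Variables (M : dgmod A) (X : A).
Let r := hr_retract (F_retraction X).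
Let Hh := hr_homotopy (F_retraction X).
Let Y := F X.

Local Notation e1 := add_swap.

(** The map m |-> (b |-> m r(b)). Since r commutes with d this is a chain map, and since r preserves
    the identity it is a section of the counit, which is evaluation at the identity. *)
Definition counit_section n (m : M X n) : coind_ob F M Y n.
Proof.
unshelve refine (@mk_homcx k A (res_ob F (yoneda Y)) M n
  (fun Z p q e (b : res_ob F (yoneda Y) Z p) => mod_act (d := M) (e1 e) m (@r Z p b)) _ _).
- move=> Z p q e a u v; rewrite -[X in r X]/(a *: (u : dg_hom (F Z) Y p) + v) /r.
  by rewrite hr_retract_linear (mod_act_linear_r _ _).
- move=> Z W p j p' q q' e e' a b u f; rewrite -[X in r X]/(dg_comp a (u : dg_hom _ _ _) (dgf_hom F f)).
  by rewrite /r hr_retract_comp -(mod_actA (e1 e) b).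
Defined.

Lemma hc_counit_section n (m : M X n) Z p q (e : p + n = q) (b : res_ob F (yoneda Y) Z p) :
  hc (counit_section m) e b = mod_act (d := M) (e1 e) m (@r Z p b).
Proof. by []. Qed.

Lemma counit_sectionE n (m : M X n) : counit_fun (counit_section m : res_ob F (coind F M) X n) = m.
Proof.
rewrite -[LHS]/(mod_act (d := M) (e1 (add0r n)) m (r (dg_id (F X)))) /r hr_retract_id.
by rewrite mod_act1.
Qed.

Lemma counit_section_d n n' (e : n + 1 = n') (m : M X n) :
  mod_d (d := coind F M) e (counit_section m) = counit_section (mod_d e m).
Proof.
apply: hcP => Z p q ep b;
rewrite -[LHS]/(hc_d_fun e (counit_section m) ep b) /hc_d_fun !hc_counit_section.
rewrite -[X in _ - _ *: mod_act _ _ X]/(r (dg_d erefl (b : dg_hom _ _ _))) /r hr_retract_d -/r.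
have e2 : n + (p + 1) = q by clear -e ep; lia.
rewrite [X in _ - _ *: X](_ : _ = mod_act e2 m (dg_d erefl (r b))); last first.
  by congr mod_act; apply: int_eq_irr.
rewrite (mod_leibniz _ e erefl _ (e1 ep) e2) addrK //.
Qed.

(** Surjectivity on cocycles comes from the section. For injectivity the homotopy of the retraction
    shows that a cocycle u is determined, up to a boundary, by its value at the identity. *)
Lemma counit_quasi_iso n :
  (forall m : M X n, mod_cocycle m -> exists2 u : coind F M Y n, mod_cocycle u &
     counit_fun (u : res_ob F (coind F M) X n) = m) /\
  (forall u : coind F M Y n, mod_cocycle u ->
     mod_coboundary (counit_fun (u : res_ob F (coind F M) X n)) -> mod_coboundary u).
Proof.
split=> [m cm|u cu [h [e [m mE]]]].
  exists (counit_section m); last exact: counit_sectionE.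
  move=> j ej; rewrite counit_section_d cm; apply: hcP => Z p q ep b.
  exact: (lin0 (@mod_act_linear_l k A M Z X j p q (e1 ep) (r b))).
have eH p q s : p + h = q -> s + 1 = p -> s + n = q by clear -e; lia.
have v_lin : forall Z p q (ep : p + h = q), linear (fun b : res_ob F (yoneda Y) Z p =>
    hc u (eH _ _ _ ep (subrK 1 p)) (Hh (subrK 1 p) b : res_ob F (yoneda Y) Z (p - 1))).
  by move=> Z p q ep a b c; rewrite -[X in Hh _ X]/(a *: (b : dg_hom (F Z) Y p) + c)
    /Hh hr_homotopy_linear hc_linear.
have v_act : forall Z W p j p' q q' (ep : p + h = q) (ep' : p' + h = q')
    (a : p + j = p') (b : q + j = q') (x : res_ob F (yoneda Y) W p) (f : dg_hom Z W j),
    hc u (eH _ _ _ ep' (subrK 1 p')) (Hh (subrK 1 p') (mod_act a x f)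
       : res_ob F (yoneda Y) Z (p' - 1)) =
    mod_act b (hc u (eH _ _ _ ep (subrK 1 p)) (Hh (subrK 1 p) x
       : res_ob F (yoneda Y) W (p - 1))) f.
  move=> Z W p j p' q q' ep ep' a b x f.
  have a1 : p - 1 + j = p' - 1 by clear -a; lia.
  rewrite -[X in Hh _ X]/(dg_comp a (x : dg_hom _ _ _) (dgf_hom F f)) /Hh.
  rewrite (hr_homotopy_comp _ a (subrK 1 p) (subrK 1 p') a1).
  exact: (hc_act u (eH _ _ _ ep (subrK 1 p)) (eH _ _ _ ep' (subrK 1 p')) a1 b).
pose v : coind_ob F M Y h := mk_homcx v_lin v_act.
have cocE Z p q q' s (a : p + n = q) (b : q + 1 = q') (c : p + 1 = s) (d : s + n = q')
    (x : res_ob F (yoneda Y) Z p) : mod_d b (hc u a x) = (-1) ^ n *: hc u d (mod_d c x).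
  apply/eqP; rewrite -subr_eq0; apply/eqP.
  have ed : p + (n + 1) = q' by clear -a b; lia.
  rewrite -(hc_d_funE erefl u ed) -[LHS]/(hc (hc_d erefl u) ed x).
  by have -> : hc_d erefl u = 0 := cu _ erefl.
(* Write b as F(r b) + d H b + H d b. On the first term u is u(1) r(b), bounded by the section of m;
   on the others u is bounded by v, which is u composed with H. *)
exists h, e, (counit_section m + (-1) ^ n *: v).
apply: hcP => Z p q ep b.
rewrite -[mod_d e _]/(hc_d e (counit_section m + (-1) ^ n *: v)).
rewrite (linD (hc_d_linear_u e)) (linZ (hc_d_linear_u e)) addrC hc_zd addrC.
rewrite [X in hc X _ _ + _]counit_section_d mE.
have a1 : p + h + 1 = q by clear -e ep; lia.
have a2 : p + 1 + h = q by clear -e ep; lia.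
have a3 : p + 1 - 1 = p by rewrite addrK.
have -> : hc (counit_section (counit_fun (u : res_ob F (coind F M) X n))) ep b =
    hc u ep (dgf_hom F (r b) : res_ob F (yoneda Y) Z p).
  rewrite -[LHS]/(mod_act (d := M) (e1 ep) (hc u (add0r n) (dg_id (F X) : res_ob F (yoneda Y) X 0)) (r b)).
  rewrite -(hc_act u (add0r n) ep (add0r p) (e1 ep)); congr hc.
  exact: dg_comp1l.
rewrite -[X in _ *: X]/(hc_d_fun e v ep b) (hc_d_funE e v ep erefl a1 erefl a2) !hc_mk.
have a4 : p - 1 + 1 = p by rewrite subrK.
rewrite (cocE _ _ _ _ _ _ _ a4 ep).
have -> : hc u (eH (p + 1) q (p + 1 - 1) a2 (subrK 1 (p + 1)))
     (Hh (subrK 1 (p + 1)) (mod_d erefl b) : res_ob F (yoneda Y) Z _) =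
  hc u ep (Hh (erefl (p + 1)) (dg_d erefl (b : dg_hom (F Z) Y p)) : res_ob F (yoneda Y) Z _).
  suff E s (c : s + n = q) (c' : s + 1 = p + 1) :
      hc u c (Hh c' (dg_d erefl (b : dg_hom (F Z) Y p)) : res_ob F (yoneda Y) Z s) =
      hc u ep (Hh erefl (dg_d erefl (b : dg_hom (F Z) Y p)) : res_ob F (yoneda Y) Z p) by apply: E.
  have ? : s = p by clear -c'; lia.
  by subst s; rewrite (int_eq_irr c ep) (int_eq_irr c' erefl).
have -> : (-1 : k) ^ h = - (-1) ^ n by rewrite -e signD expr1z mulrN1 opprK.
rewrite scaleNr opprK scalerDr !scalerA sign_sq !scale1r -(linD (hc_linear _ _)).
rewrite -[X in _ + hc _ _ X]/(dg_d a4 (Hh (subrK 1 p) (b : dg_hom (F Z) Y p)) +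
  Hh (erefl (p + 1)) (dg_d erefl (b : dg_hom (F Z) Y p))).
rewrite (int_eq_irr a4 (subrK 1 p)) /Hh -hr_homotopyE -/r.
by rewrite -(linD (hc_linear _ _)) [X in hc _ _ X](_ : _ = b) //; rewrite addrC; apply: subrK.
Qed.
End Counit.

(** At an object F X the unit is a section of the counit, so the claim follows from
    [counit_quasi_iso]; generation extends it to all objects. *)
Lemma unit_quasi_iso (N : dgmod B) : quasi_iso (unit_mor F N).
Proof.
apply: (F_generated (thick_quasi_iso_at (unit_mor F N))) => X i; set M := res_ob F N.
have [srj inj] := @counit_quasi_iso M X i; split.
- move=> u cu; pose n : N (F X) i := counit_fun (u : res_ob F (coind F M) X i).
  have cn : mod_cocycle n := @dgm_cocycle _ _ _ _ (counit F M) X i u cu.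
  exists n => //; apply: inj; first exact: mod_cocycleB cu (dgm_cocycle _ cn).
  have -> : counit_fun (u - unit_mor F N (F X) i n : res_ob F (coind F M) X i) = 0.
    apply: (etrans (dgmB (counit F M) (u : res_ob F (coind F M) X i) _)).
    by apply/eqP; rewrite subr_eq0; apply/eqP; symmetry; exact: (@counit_unit k A B F N X i n).
  exact: mod_coboundary0.
- move=> n cn [h [e [w wE]]]; exists h, e, (counit_fun (w : res_ob F (coind F M) X h)).
  rewrite -[n](@counit_unit k A B F N X) -wE; symmetry; exact: (dgm_d (counit F M) e).
Qed.

Lemma counit_quasi_iso_hom (M : dgmod A) : quasi_iso (counit F M).
Proof.
move=> X i; have [srj inj] := @counit_quasi_iso M X i; split=> [n cn|m cm]; last exact: inj.
have [u cu uE] := srj _ cn; exists u => //.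
by rewrite -[counit F M X i u]/(counit_fun u) uE subrr; apply: mod_coboundary0.
Qed.

(** At F X the counit compares the coinduced map with f at X, and such objects generate. This is
    where the retraction replaces resolutions of modules. *)
Lemma coind_mor_quasi_iso (M M' : dgmod A) (f : dgmod_hom M M') :
  quasi_iso f -> quasi_iso (coind_mor F f).
Proof.
move=> qf; apply: (F_generated (thick_quasi_iso_at (coind_mor F f))) => X i.
have [srj inj] := @counit_quasi_iso M X i; have [srj' inj'] := @counit_quasi_iso M' X i.
have counit_d (K : dgmod A) a b (e : a + 1 = b) (u : res_ob F (coind F K) X a) :
  counit_fun (mod_d e u) = mod_d e (counit_fun u) by exact: (dgm_d (counit F K)).
have nat a (u : res_ob F (coind F M) X a) :
  counit_fun (coind_mor F f _ _ u : res_ob F (coind F M') X a) = f X a (counit_fun u) by [].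
split=> [u cu|u cu [h [e [v vE]]]].
- have cc : mod_cocycle (counit_fun (u : res_ob F (coind F M') X i)).
    exact: (@dgm_cocycle _ _ _ _ (counit F M') X i u cu).
  have [m cm mE] := proj1 (qf X i) _ cc; have [w cw wE] := srj _ cm.
  exists w => //; apply: inj'; first exact: mod_cocycleB cu (dgm_cocycle _ cw).
  have -> : counit_fun (u - coind_mor F f (F X) i w : res_ob F (coind F M') X i) =
      counit_fun (u : res_ob F (coind F M') X i) - f X i m by rewrite -wE; exact: (dgmB (counit F M')).
  by [].
- apply: inj => //; apply: (proj2 (qf X i)).
    exact: (@dgm_cocycle _ _ _ _ (counit F M) X i u cu).
  by rewrite -nat -vE; exists h, e, (counit_fun (v : res_ob F (coind F M') X h)); rewrite -counit_d.
Qed.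

Lemma res_mor_quasi_iso (N N' : dgmod B) (f : dgmod_hom N N') :
  quasi_iso f -> quasi_iso (res_mor F f).
Proof. by move=> qf X i; apply: (qf (F X) i). Qed.

(** Restriction and coinduction both preserve quasi-isomorphisms, so they descend to the derived
    categories as they are; unit and counit are quasi-isomorphisms and become natural isomorphisms
    there. *)
Theorem derived_morita_criterion : derived_morita (F : @chom (DGcat k) A B).
Proof.
have invR (N N' : Cdg B) (f : chom N N') : quasi_iso f ->
    is_iso (fmor (functor_comp (to_Dcat A) (restriction F)) f).
  by move=> qf; apply/loc_in_iso/res_mor_quasi_iso.
have invS (M M' : Cdg A) (f : chom M M') : quasi_iso f ->
    is_iso (fmor (functor_comp (to_Dcat B) (coinduction F)) f).
  by move=> qf; apply/loc_in_iso/coind_mor_quasi_iso.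
exists (loc_lift invR); split.
  exists (fun X => cid _); split=> [X|X Y f]; first exact: is_iso_id.
  by rewrite -> ccomp1l, ccomp1r.
apply: (@quasi_inverse_equivalence _ _ _ (loc_lift invS)).
  apply: naturally_isomorphic_sym; exists (fun N => fmor (to_Dcat B) (unit_mor F N : chom (N : Cdg B) _)).
  split=> [N|]; first exact/loc_in_iso/unit_quasi_iso.
  apply: localization_natural => N N' f.
  rewrite -[fmor (functor_comp _ _) _]/(fmor (to_Dcat B) (coind_mor F (res_mor F f) : @chom (Cdg B) _ _)).
  rewrite -[fmor (idfunctor _) _]/(fmor (to_Dcat B) f).
  apply: ceq_trans (ceq_sym (fmor_comp (to_Dcat B) _ _)) _.
  apply: ceq_trans _ (fmor_comp (to_Dcat B) _ _); apply: fmor_ceq => X i n.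
  by apply: hcP => Z p q e m; rewrite -[LHS]/(mod_act (add_swap e) (f X i n) m) -dgm_act.
exists (fun M => fmor (to_Dcat A) (counit F M : @chom (Cdg A) _ M)).
split=> [M|]; first exact/loc_in_iso/counit_quasi_iso_hom.
apply: localization_natural => M M' f.
rewrite -[fmor (functor_comp _ _) _]/(fmor (to_Dcat A) (res_mor F (coind_mor F f) : @chom (Cdg A) _ _)).
rewrite -[fmor (idfunctor _) _]/(fmor (to_Dcat A) f).
apply: ceq_trans (ceq_sym (fmor_comp (to_Dcat A) _ _)) _.
by apply: ceq_trans _ (fmor_comp (to_Dcat A) _ _); apply: fmor_ceq.
Qed.
End DerivedMorita.

(** * Constructions of DG-categories *)

Section SubDG.
Variables (k : fieldType) (A : dgcat k) (ob : Type) (o : ob -> A)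
  (S : forall X Y i, subspace (dg_hom (o X) (o Y) i)).
Hypothesis Sd : forall X Y i j (e : i + 1 = j) f, S X Y i f -> S X Y j (dg_d e f).
Hypothesis S1 : forall X, S X X 0 (dg_id (o X)).
Hypothesis SM : forall X Y Z i j l (e : i + j = l) g f,
  S Y Z i g -> S X Y j f -> S X Z l (dg_comp e g f).

Definition sub_hom X Y i : lmodType k := subspace_type (S X Y i).

Program Definition sub_dgcat : dgcat k :=
  @DGCat k ob sub_hom (fun X Y i j e f => mks (Sd e (svP f))) (fun X => mks (S1 X))
    (fun X Y Z i j l e g f => mks (SM e (svP g) (svP f))) _ _ _ _ _ _ _ _.
Next Obligation. by move=> X Y i j e a u v; apply: sv_inj; apply: dg_d_linear. Qed.
Next Obligation.
by move=> X Y Z i j l e f a u v; apply: sv_inj; apply: (dg_comp_linear_l e (sv f)).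
Qed.
Next Obligation.
by move=> X Y Z i j l e f a u v; apply: sv_inj; apply: (dg_comp_linear_r e (sv f)).
Qed.
Next Obligation. by move=> *; apply: sv_inj; apply: dg_dd. Qed.
Next Obligation.
by move=> *; apply: sv_inj; rewrite addrC sv_linear addrC /=; apply: dg_leibniz.
Qed.
Next Obligation. by move=> *; apply: sv_inj; apply: dg_compA. Qed.
Next Obligation. by move=> *; apply: sv_inj; apply: dg_comp1l. Qed.
Next Obligation. by move=> *; apply: sv_inj; apply: dg_comp1r. Qed.
End SubDG.

Section FullLift.
Variables (k : fieldType) (A B : dgcat k) (P : B -> Prop) (F : dgfunctor A B).
Hypothesis FP : forall X, P (F X).
Definition full_lift : dgfunctor A (full_dgcat P) :=
  @DGFunctor k A (full_dgcat P) (fun X => exist _ (F X) (FP X)) (fun X Y i f => dgf_hom F f)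
    (@dgf_linear _ _ _ F) (@dgf_d _ _ _ F) (@dgf_id _ _ _ F) (@dgf_comp _ _ _ F).
End FullLift.

Section ProductDG.
Variables (k : fieldType) (A B : dgcat k).
Definition prod_hom (X Y : A * B) i : lmodType k := (dg_hom X.1 Y.1 i * dg_hom X.2 Y.2 i)%type.

Program Definition prod_dgcat : dgcat k :=
  @DGCat k (A * B)%type prod_hom (fun X Y i j e f => (dg_d e f.1, dg_d e f.2))
    (fun X => (dg_id X.1, dg_id X.2))
    (fun X Y Z i j l e g f => (dg_comp e g.1 f.1, dg_comp e g.2 f.2)) _ _ _ _ _ _ _ _.
Next Obligation. by move=> X Y i j e a u v; congr pair; rewrite /= dg_d_linear. Qed.
Next Obligation.
by move=> X Y Z i j l e f a u v; congr pair; rewrite /= (dg_comp_linear_l _ _).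
Qed.
Next Obligation.
by move=> X Y Z i j l e f a u v; congr pair; rewrite /= (dg_comp_linear_r _ _).
Qed.
Next Obligation. by move=> *; congr pair; apply: dg_dd. Qed.
Next Obligation. by move=> *; congr pair; apply: dg_leibniz. Qed.
Next Obligation. by move=> *; congr pair; apply: dg_compA. Qed.
Next Obligation. by move=> X Y i e [f g]; congr pair; apply: dg_comp1l. Qed.
Next Obligation. by move=> X Y i e [f g]; congr pair; apply: dg_comp1r. Qed.

Definition prod_fst : dgfunctor prod_dgcat A :=
  @DGFunctor k prod_dgcat A fst (fun X Y i f => f.1) (fun X Y i a u v => erefl)
    (fun X Y i j e f => erefl) (fun X => erefl) (fun X Y Z i j l e g f => erefl).
Definition prod_snd : dgfunctor prod_dgcat B :=
  @DGFunctor k prod_dgcat B snd (fun X Y i f => f.2) (fun X Y i a u v => erefl)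
    (fun X Y i j e f => erefl) (fun X => erefl) (fun X Y Z i j l e g f => erefl).

Lemma prod_closed X Y i (f : @dg_hom k prod_dgcat X Y i) :
  dg_closed f <-> dg_closed f.1 /\ dg_closed f.2.
Proof.
split=> [cf|[c1 c2] j e]; last by congr pair; [apply: c1|apply: c2].
by split=> j e; [exact: (congr1 (fun z : dg_hom X.1 Y.1 j * dg_hom X.2 Y.2 j => z.1) (cf j e))
               |exact: (congr1 (fun z : dg_hom X.1 Y.1 j * dg_hom X.2 Y.2 j => z.2) (cf j e))].
Qed.

Variables (C : dgcat k) (F : dgfunctor C A) (G : dgfunctor C B).
Program Definition pair_functor : dgfunctor C prod_dgcat :=
  @DGFunctor k C prod_dgcat (fun X => (F X, G X)) (fun X Y i f => (dgf_hom F f, dgf_hom G f)) _ _ _ _.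
Next Obligation. by move=> X Y i a u v; congr pair; apply: dgf_linear. Qed.
Next Obligation. by move=> *; congr pair; apply: dgf_d. Qed.
Next Obligation. by move=> *; congr pair; apply: dgf_id. Qed.
Next Obligation. by move=> *; congr pair; apply: dgf_comp. Qed.
End ProductDG.

Section ZeroObjects.
Variables (k : fieldType) (A : dgcat k).
Implicit Types X Y Z : A.
Lemma zero_hom_l Z Y i (f : dg_hom Z Y i) : dg_is_zero Z -> f = 0.
Proof. by move=> Z0; rewrite -(dg_comp1r (addr0 i) f) Z0 dg_comp0r. Qed.
Lemma zero_hom_r X Z i (f : dg_hom X Z i) : dg_is_zero Z -> f = 0.
Proof. by move=> Z0; rewrite -(dg_comp1l (add0r i) f) Z0 dg_comp0l. Qed.
End ZeroObjects.

Section ConstantZero.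
Variables (k : fieldType) (A B : dgcat k) (O : B).
Hypothesis O0 : dg_is_zero O.
Program Definition zero_functor : dgfunctor A B :=
  @DGFunctor k A B (fun=> O) (fun X Y i f => 0) _ _ _ _.
Next Obligation. by move=> X Y i a u v; rewrite scaler0 addr0. Qed.
Next Obligation. by move=> *; rewrite (lin0 (dg_d_linear _)). Qed.
Next Obligation. by move=> *; rewrite O0. Qed.
Next Obligation. by move=> *; rewrite dg_comp0l. Qed.
End ConstantZero.

(** * Contractible objects and cones *)

Section Contractible.
Variables (k : fieldType) (A : dgcat k).
Implicit Types X Y Z : A.

Definition contractible X := exists h : dg_hom X X (-1), dg_d (addNr 1) h = dg_id X.

Lemma zero_contractible Z : dg_is_zero Z -> contractible Z.
Proof. by move=> Z0; exists 0; rewrite Z0 (lin0 (dg_d_linear _)). Qed.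

(** A contraction is a primitive of the identity in the module represented by X itself; quantifying
    over all representables brings contractibility under [thick_acyclic_mod]. *)
Lemma contractibleP X : contractible X <-> forall W, acyclic_at (yoneda W) X.
Proof.
split=> [[h hE] W a i j e' e m dm|H].
  have e1 : i + -1 = a by clear -e'; lia.
  have e2 : j + -1 = i by clear -e; lia.
  exists ((-1) ^ i *: dg_comp e1 m h); rewrite (linZ (mod_d_linear _)) /=.
  rewrite (dg_leibniz e1 e (addNr 1) e' e2 (addr0 i)) [dg_d e m]dm hE dg_comp0l add0r.
  by rewrite scalerA sign_sq scale1r dg_comp1r subrr.
have [|h /eqP] := H X (-1) 0 1 (addNr 1) (add0r 1) (dg_id X); first exact: dg_id_closed.
by rewrite subr_eq0 => /eqP E; exists h.
Qed.

Lemma thick_forall (I : Type) (P : I -> A -> Prop) :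
  (forall i, thick (P i)) -> thick (fun X => forall i, P i X).
Proof.
move=> th; split=> [Z Z0 i|X Z s|X Y f Z cf co HX HY i|X Y i r ri HY j].
- by have [+ _ _ _] := th i; apply.
- by split=> H i; have [_ + _ _] := th i; move=> /(_ X Z s) => -[]; auto.
- by have [_ _ + _] := th i; apply; eauto.
- by have [_ _ _ +] := th j; apply; eauto.
Qed.

Lemma thick_contractible : thick contractible.
Proof.
rewrite (_ : contractible = fun X => forall W, acyclic_at (yoneda W) X).
  apply: thick_forall => W; apply: thick_acyclic_mod => X Y i j l e m f ->.
  exact: (lin0 (mod_act_linear_l _ _)).
by apply: funext => X; apply/propext/contractibleP.
Qed.

(** The cone data prescribe only d q. The value of d r is forced: differentiate r j = 1 and r q = 0
    and recombine with j r + q p = 1. *)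
Lemma cone_d_retraction X Y Z (f : dg_hom X Y 0) (j : dg_hom Y Z 0) (r : dg_hom Z Y 0)
    (q : dg_hom X Z (-1)) (p : dg_hom Z X 1) :
  dg_comp (addr0 0) r j = dg_id Y -> dg_comp (add0r (-1)) r q = 0 ->
  dg_comp (addr0 0) j r + dg_comp (addNr 1) q p = dg_id Z -> dg_closed j ->
  dg_d (addNr 1) q = dg_comp (addr0 0) j f ->
  dg_d (add0r 1) r = - dg_comp (add0r 1) f p.
Proof.
move=> rj rq E cj dq.
rewrite -[LHS](dg_comp1r (addr0 1)) -E (linD (dg_comp_linear_r _ _)).
rewrite -(dg_compA (addr0 1) (addr0 1)) -(dg_compA (subrr 1 : 1 + -1 = 0) (add0r 1)).
have := dg_leibniz (addr0 0) (add0r 1) (add0r 1) (add0r 1) (addr0 1) (add0r 1) r j.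
rewrite rj cj dg_comp0r scaler0 addr0 dg_id_closed => <-; rewrite dg_comp0l add0r.
have := dg_leibniz (add0r (-1)) (add0r 1) (addNr 1) (addNr 1) (subrr 1) (addr0 0) r q.
rewrite rq (lin0 (dg_d_linear _)) dq expr0z scale1r -(dg_compA (addr0 0) (addr0 0)) rj dg_comp1l.
by move=> /eqP; rewrite eq_sym addr_eq0 => /eqP->; rewrite (linN (dg_comp_linear_l _ _)).
Qed.

(** The contraction is q r, with differential j r + q p. *)
Lemma cone_id_contractible X Z : dg_is_cone (dg_id X) Z -> contractible Z.
Proof.
move=> [j [r [q [p [[rj pq rq pj] E [cj cp] dq]]]]]; exists (dg_comp (addr0 (-1)) q r).
have dr := cone_d_retraction rj rq E cj dq.
rewrite (dg_leibniz (addr0 (-1)) (addNr 1) (add0r 1) (addNr 1) (addr0 0) (addNr 1)).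
rewrite dq dr dg_comp1r dg_comp1l (linN (dg_comp_linear_r _ _)) exprN1 invrN1 scaleN1r.
by rewrite opprK E.
Qed.

(** The component p s j of a contraction s of the cone inverts f up to homotopy; its components p s
    q and r s j, up to sign, are the two homotopies. *)
Lemma cone_contractible_iso (X Y : h0 A) (f : chom X Y) Z :
  dg_is_cone (sval f) Z -> contractible Z -> is_iso f.
Proof.
case: f => f cf [/= j [r [q [p [[rj pq rq pj] E [cj cp] dq]]]]] [s sE].
have dr := cone_d_retraction rj rq E cj dq.
pose sj := dg_comp (addr0 (-1)) s j.
have dsj : dg_d (addNr 1) sj = j.
  rewrite (dg_leibniz (addr0 (-1)) (addNr 1) (add0r 1) (addNr 1) (addr0 0) (addNr 1)).
  by rewrite sE cj dg_comp0r scaler0 addr0 dg_comp1l.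
pose g := dg_comp (subrr 1) p sj.
have cg : dg_closed g.
  apply: (dg_closedP (e := add0r 1)).
  have e2 : 1 + 1 - 1 = 1 :> int by [].
  rewrite (dg_leibniz (subrr 1) erefl (addNr 1) (add0r 1) e2 (addr0 1)) cp dg_comp0l add0r.
  by rewrite dsj pj scaler0.
exists (exist _ g cg); split.
  exists (dg_comp (add0r (-1)) (dg_comp (subrr 1) p s) q); rewrite /= -/g.
  have cps : dg_d (add0r 1) (dg_comp (subrr 1) p s) = - p.
    have e2 : 1 + 1 - 1 = 1 :> int by [].
    rewrite (dg_leibniz (subrr 1) erefl (addNr 1) (add0r 1) e2 (addr0 1)) cp dg_comp0l add0r.
    by rewrite sE dg_comp1r expr1z scaleN1r.
  rewrite (dg_leibniz (add0r (-1)) (add0r 1) (addNr 1) (addNr 1) (subrr 1) (addr0 0)).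
  rewrite cps (linN (dg_comp_linear_l _ _)) pq dq expr0z scale1r.
  rewrite addrC; congr (_ + _); rewrite /g /sj -(dg_compA (addr0 0) (addr0 0)); congr (dg_comp _ _ f).
  by rewrite (dg_compA (subrr 1) (addr0 0) (addr0 (-1)) (subrr 1)).
exists (- dg_comp (add0r (-1)) r sj); rewrite /=.
rewrite (linN (dg_d_linear _)).
rewrite (dg_leibniz (add0r (-1)) (add0r 1) (addNr 1) (addNr 1) (subrr 1) (addr0 0)).
rewrite dr dsj (linN (dg_comp_linear_l _ _)) rj expr0z scale1r.
by rewrite (dg_compA (add0r 1) (subrr 1) (subrr 1) (addr0 0)) opprD opprK.
Qed.
End Contractible.

Section ThickPreimage.
Variables (k : fieldType) (A B : dgcat k) (F : dgfunctor A B).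

Lemma dgf_comp' X Y Z i j l (e : i + j = l) (g : dg_hom Y Z i) (f : dg_hom X Y j) :
  dg_comp e (dgf_hom F g) (dgf_hom F f) = dgf_hom F (dg_comp e g f).
Proof. by rewrite dgf_comp. Qed.
Lemma dgf0 X Y i : dgf_hom F (0 : dg_hom X Y i) = 0.
Proof. exact: (lin0 (@dgf_linear _ _ _ _ _ _ _)). Qed.

Lemma dgf_is_zero X : dg_is_zero X -> dg_is_zero (F X).
Proof. by move=> X0; rewrite /dg_is_zero -dgf_id X0 dgf0. Qed.
Lemma dgf_is_shift X Z : dg_is_shift X Z -> dg_is_shift (F X) (F Z).
Proof.
move=> [s [t [cs ct ts st]]]; exists (dgf_hom F s), (dgf_hom F t).
by split; rewrite ?dgf_comp' ?ts ?st ?dgf_id //; apply: dgf_closed.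
Qed.
Lemma dgf_is_cone X Y (f : dg_hom X Y 0) Z : dg_is_cone f Z -> dg_is_cone (dgf_hom F f) (F Z).
Proof.
move=> [j [r [q [p [[rj pq rq pj] E [cj cp] dq]]]]].
exists (dgf_hom F j), (dgf_hom F r), (dgf_hom F q), (dgf_hom F p); split.
- by rewrite !dgf_comp' rj pq rq pj !dgf_id !dgf0.
- by rewrite !dgf_comp' -(linD (@dgf_linear _ _ _ _ _ _ _)) E dgf_id.
- by split; apply: dgf_closed.
- by rewrite dgf_comp' -dgf_d dq.
Qed.
Lemma thick_preimage (Q : B -> Prop) : thick Q -> thick (fun X => Q (F X)).
Proof.
move=> [Q1 Q2 Q3 Q4]; split=> [Z /dgf_is_zero/Q1//|X Z /dgf_is_shift/Q2//|X Y f Z cf|X Y i r ri].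
  by move=> /dgf_is_cone; apply: Q3; apply: dgf_closed.
apply: (Q4 (F X) (F Y) (fmor (h0_functor F) i) (fmor (h0_functor F) r)).
apply: ceq_trans (ceq_sym (fmor_comp (h0_functor F) r i)) _.
apply: ceq_trans (fmor_id (h0_functor F) X); exact: fmor_ceq.
Qed.
End ThickPreimage.

Section ProductPretriangulated.
Variables (k : fieldType) (A B : dgcat k).
Implicit Types X Y Z : prod_dgcat A B.

Lemma prod_is_zero X : dg_is_zero X.1 -> dg_is_zero X.2 -> dg_is_zero X.
Proof. by move=> X1 X2; congr pair. Qed.
Lemma prod_is_shift X Z : dg_is_shift X.1 Z.1 -> dg_is_shift X.2 Z.2 -> dg_is_shift X Z.
Proof.
move=> [s [t [cs ct ts st]]] [s' [t' [cs' ct' ts' st']]]; exists (s, s'), (t, t').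
by split; [apply/prod_closed|apply/prod_closed|congr pair|congr pair].
Qed.
Lemma prod_is_cone X Y (f : dg_hom X Y 0) Z :
  dg_is_cone f.1 Z.1 -> dg_is_cone f.2 Z.2 -> dg_is_cone f Z.
Proof.
move=> [j [r [q [p [[? ? ? ?] ? [? ?] ?]]]]] [j' [r' [q' [p' [[? ? ? ?] ? [? ?] ?]]]]].
exists (j, j'), (r, r'), (q, q'), (p, p'); split; try by congr pair.
  by split; congr pair.
by split; apply/prod_closed.
Qed.
Lemma prod_strongly_pretriangulated :
  strongly_pretriangulated A -> strongly_pretriangulated B ->
  strongly_pretriangulated (prod_dgcat A B).
Proof.
move=> [[O O0] A1 A2 A3] [[O' O0'] B1 B2 B3]; split.
- by exists (O, O'); apply: prod_is_zero.
- by move=> [X X']; have [Z ?] := A1 X; have [Z' ?] := B1 X'; exists (Z, Z'); apply: prod_is_shift.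
- by move=> [X X']; have [Z ?] := A2 X; have [Z' ?] := B2 X'; exists (Z, Z'); apply: prod_is_shift.
- move=> X Y f /prod_closed[c1 c2]; have [Z ?] := A3 _ _ _ c1; have [Z' ?] := B3 _ _ _ c2.
  by exists (Z, Z'); apply: prod_is_cone.
Qed.
End ProductPretriangulated.

Lemma dg_comp_mid (k : fieldType) (A : dgcat k) (W X Y Z : A) i j j' l u v w
    (e1 : i + j = u) (e2 : j' + l = v) (e3 : u + v = w) (e4 : i + l = w) (e : j + j' = 0)
    (a : dg_hom Y Z i) (b : dg_hom X Y j) (c : dg_hom Y X j') (d : dg_hom W Y l) :
  dg_comp e b c = dg_id Y ->
  dg_comp e3 (dg_comp e1 a b) (dg_comp e2 c d) = dg_comp e4 a d.
Proof.
move=> bc; have e5 : j + v = l by clear -e2 e; lia.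
by rewrite (dg_compA e1 e3 e5 e4) -(dg_compA e (add0r l)) bc dg_comp1l.
Qed.

Lemma dg_comp_mid0 (k : fieldType) (A : dgcat k) (W X Y Z : A) i l w (e1 : i + 0 = i)
    (e2 : 0 + l = l) (e3 : i + l = w) (V : A) (a : dg_hom Y Z i) (b : dg_hom X Y 0)
    (c : dg_hom V X 0) (d : dg_hom W V l) :
  dg_comp (addr0 0) b c = 0 -> dg_comp e3 (dg_comp e1 a b) (dg_comp e2 c d) = 0.
Proof.
move=> bc; rewrite (dg_compA e1 e3 (add0r l) e3) -(dg_compA (addr0 0) (add0r l)) bc.
by rewrite dg_comp0l dg_comp0r.
Qed.

Section Biproducts.
Variables (k : fieldType) (A : dgcat k).
Implicit Types X Y Z : A.

Record biproduct X Y Z := Biproduct {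
  bi1 : dg_hom X Z 0; bi2 : dg_hom Y Z 0; bp1 : dg_hom Z X 0; bp2 : dg_hom Z Y 0;
  bi1_closed : dg_closed bi1; bi2_closed : dg_closed bi2;
  bp1_closed : dg_closed bp1; bp2_closed : dg_closed bp2;
  bp1i1 : dg_comp (addr0 0) bp1 bi1 = dg_id X; bp2i2 : dg_comp (addr0 0) bp2 bi2 = dg_id Y;
  bp1i2 : dg_comp (addr0 0) bp1 bi2 = 0; bp2i1 : dg_comp (addr0 0) bp2 bi1 = 0;
  bipE : dg_comp (addr0 0) bi1 bp1 + dg_comp (addr0 0) bi2 bp2 = dg_id Z }.

Lemma biproduct_exists : strongly_pretriangulated A ->
  forall X Y, exists Z, inhabited (biproduct X Y Z).
Proof.
move=> [_ _ shA coneA] X Y; have [W [s [t [cs ct ts st]]]] := shA X.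
(* Here W is X[-1], and the cone of the zero map from X[-1] to Y is the sum of X and Y. *)
have c0 : dg_closed (0 : dg_hom W Y 0) by move=> j e; rewrite (lin0 (dg_d_linear _)).
have [Z [j [r [q [p [[rj pq rq pj] E [cj cp] dq]]]]]] := coneA _ _ _ c0.
have dr := cone_d_retraction rj rq E cj dq.
rewrite dg_comp0r in dq; rewrite dg_comp0l oppr0 in dr.
have cq := dg_closedP dq; have cr := dg_closedP dr.
exists Z; split; exists (dg_comp (addNr 1) q t) j (dg_comp (addNr 1) s p) r => //.
- exact: dg_comp_closed.
- exact: dg_comp_closed.
- by rewrite (dg_comp_mid _ _ _ (addNr 1) _ _ pq).
- by rewrite (dg_compA _ _ (addr0 1) (addNr 1)) pj dg_comp0r.
- by rewrite -(dg_compA (add0r (-1)) (addNr 1)) rq dg_comp0l.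
- by rewrite (dg_comp_mid _ _ _ (addNr 1) _ _ ts) addrC E.
Qed.

Lemma biproduct_thick (Q : A -> Prop) X Y Z : strongly_pretriangulated A -> thick Q ->
  biproduct X Y Z -> Q X -> Q Y -> Q Z.
Proof.
move=> [_ _ shA _] [_ Q2 Q3 _] [i1 i2 p1 p2 ci1 ci2 cp1 cp2 p1i1 p2i2 p1i2 p2i1 E] QX QY.
have [W [s [t [cs ct ts st]]]] := shA X.
have QW : Q W by apply/(Q2 W X) => //; exists s, t.
have c0 : dg_closed (0 : dg_hom W Y 0) by move=> j e; rewrite (lin0 (dg_d_linear _)).
apply: (Q3 W Y 0 Z c0) => //.
exists i2, p2, (dg_comp (add0r (-1)) i1 s), (dg_comp (addr0 1) t p1); split.
- split=> //.
  + by rewrite (dg_comp_mid _ _ _ (subrr 1) _ _ p1i1).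
  + by rewrite -(dg_compA (addr0 0) (add0r (-1))) p2i1 dg_comp0l.
  + by rewrite (dg_compA _ _ (addr0 0) (addr0 1)) p1i2 dg_comp0r.
- by rewrite (dg_comp_mid _ _ _ (addr0 0) _ _ st) addrC.
- by split=> //; apply: dg_comp_closed.
- by rewrite dg_comp0r; apply: dg_comp_closed.
Qed.

(** X is a retract of the sum of the Y t. The sum is assembled one index at a time, remembering only
    maps u and v with v u equal to the partial sum. *)
Lemma thick_sum (Q : A -> Prop) (T : finType) (X : A) (Y : T -> A) (P : pred T)
    (f : forall t, dg_hom X (Y t) 0) (g : forall t, dg_hom (Y t) X 0) :
  strongly_pretriangulated A -> thick Q ->
  (forall t, [/\ Q (Y t), dg_closed (f t) & dg_closed (g t)]) ->
  \sum_(t | P t) dg_comp (addr0 0) (g t) (f t) = dg_id X -> Q X.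
Proof.
move=> prA thQ HY E.
suff [Z [u [v [QZ cu cv vuE]]]] : exists Z (u : dg_hom X Z 0) (v : dg_hom Z X 0),
    [/\ Q Z, dg_closed u, dg_closed v &
      dg_comp (addr0 0) v u = \sum_(t | P t) dg_comp (addr0 0) (g t) (f t)].
  have [_ _ _ Q4] := thQ; apply: (Q4 (X : h0 A) (Z : h0 A) (exist _ u cu) (exist _ v cv)) => //.
  by exists 0; rewrite /= vuE E subrr (lin0 (dg_d_linear _)).
have [[O O0] _ _ _] := prA; have [Q1 _ _ _] := thQ.
apply: (big_rec (fun s => exists Z (u : dg_hom X Z 0) (v : dg_hom Z X 0),
    [/\ Q Z, dg_closed u, dg_closed v & dg_comp (addr0 0) v u = s])).
  exists O, 0, 0; split=> [|j e|j e|]; first exact: Q1.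
  - exact: (lin0 (dg_d_linear _)).
  - exact: (lin0 (dg_d_linear _)).
  - exact: dg_comp0l.
move=> t s _ [Z [u [v [QZ cu cv vuE]]]]; have [QY cf cg] := HY t.
have [W [bi]] := biproduct_exists prA (Y t) Z; have QW := biproduct_thick prA thQ bi QY QZ.
case: bi => i1 i2 p1 p2 ci1 ci2 cp1 cp2 p1i1 p2i2 p1i2 p2i1 bE.
exists W, (dg_comp (addr0 0) i1 (f t) + dg_comp (addr0 0) i2 u),
  (dg_comp (addr0 0) (g t) p1 + dg_comp (addr0 0) v p2).
have closedD Y1 Y2 (a b : dg_hom Y1 Y2 0) : dg_closed a -> dg_closed b -> dg_closed (a + b).
  by move=> ca cb j e; rewrite (linD (dg_d_linear _)) ca cb addr0.
split=> //; try by apply: closedD; apply: dg_comp_closed.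
rewrite (linD (dg_comp_linear_l _ _)) !(linD (dg_comp_linear_r _ _)).
rewrite (dg_comp_mid _ _ _ (addr0 0) _ _ p1i1) (dg_comp_mid _ _ _ (addr0 0) _ _ p2i2) vuE.
by rewrite !dg_comp_mid0 // add0r addr0.
Qed.
End Biproducts.

Section SumFunctor.
Variables (k : fieldType) (A : dgcat k).
Variables (Z : A * A -> A) (b : forall X, biproduct X.1 X.2 (Z X)).

Definition sum_hom (X Y : prod_dgcat A A) i (f : dg_hom X Y i) : dg_hom (Z X) (Z Y) i :=
  dg_comp (add0r i) (bi1 (b Y)) (dg_comp (addr0 i) f.1 (bp1 (b X))) +
  dg_comp (add0r i) (bi2 (b Y)) (dg_comp (addr0 i) f.2 (bp2 (b X))).

Program Definition sum_functor : dgfunctor (prod_dgcat A A) A :=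
  @DGFunctor k _ A Z sum_hom _ _ _ _.
Next Obligation.
move=> X Y i a u v; rewrite /sum_hom /= !(dg_comp_linear_l _ _) !(dg_comp_linear_r _ _).
by rewrite scalerDr addrACA.
Qed.
Next Obligation.
move=> X Y i j e f; rewrite /sum_hom (linD (dg_d_linear _)).
have E (U V W T : A) (x : dg_hom V W 0) (y : dg_hom U V i) (z : dg_hom T U 0) :
    dg_closed x -> dg_closed z ->
    dg_d e (dg_comp (add0r i) x (dg_comp (addr0 i) y z)) =
    dg_comp (add0r j) x (dg_comp (addr0 j) (dg_d e y) z).
  move=> cx cz; rewrite (dg_leibniz _ (add0r 1) e e (etrans (addrC 1 i) e) (add0r j)) cx.
  rewrite dg_comp0l add0r expr0z scale1r (dg_leibniz _ e (add0r 1) e (addr0 j) e) cz.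
  by rewrite dg_comp0r scaler0 addr0.
by rewrite !E //; do ?[exact: bi1_closed|exact: bi2_closed|exact: bp1_closed|exact: bp2_closed].
Qed.
Next Obligation. by move=> X; rewrite /sum_hom /= !dg_comp1l (int_eq_irr (add0r 0) (addr0 0)) bipE. Qed.
Next Obligation.
move=> X Y V i j l e g f; rewrite /sum_hom /=.
rewrite (linD (dg_comp_linear_l _ _)) !(linD (dg_comp_linear_r _ _)).
have cross (U1 U2 U3 : A) (x : dg_hom U3 (Z V) 0) (y : dg_hom U1 U3 i) (z : dg_hom (Z Y) U1 0)
     (x' : dg_hom U2 (Z Y) 0) (y' : dg_hom (Z X) U2 j) :
   dg_comp e (dg_comp (add0r i) x (dg_comp (addr0 i) y z)) (dg_comp (add0r j) x' y') =
   dg_comp (add0r l) x (dg_comp e y (dg_comp (add0r j) (dg_comp (addr0 0) z x') y')).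
  rewrite (dg_compA _ _ e (add0r l)); congr (dg_comp _ _ _).
  by rewrite (dg_compA _ _ (add0r j) e) (dg_compA (addr0 0) (add0r j) (add0r j) (add0r j)).
rewrite !cross bp1i1 bp2i2 bp1i2 bp2i1 !dg_comp0l !dg_comp0r !dg_comp1l addr0 add0r.
by rewrite !(dg_compA e _ (addr0 j) e).
Qed.
End SumFunctor.

(** Its purpose is to turn a mere map on objects into a DG-functor, which sends f to its scalar
    times an identity. *)
Record kscalar (k : fieldType) (A : dgcat k) := KScalar {
  ks_coef : forall X Y i, @dg_hom k A X Y i -> k;
  ks_linear : forall X Y i, linear (@ks_coef X Y i : _ -> k^o);
  ks_d : forall X Y i j (e : i + 1 = j) (f : dg_hom X Y i), ks_coef (dg_d e f) = 0;
  ks_comp : forall X Y Z i j l (e : i + j = l) (g : dg_hom Y Z i) (f : dg_hom X Y j),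
    ks_coef (dg_comp e g f) = ks_coef g * ks_coef f;
  ks_supp : forall X Y i (f : dg_hom X Y i), ks_coef f != 0 -> X = Y /\ i = 0 }.

Section ScalarFunctor.
Variables (k : fieldType) (A B : dgcat k) (s : kscalar A) (X : A -> B).
(** Weaker than asking for coefficient 1: an object of coefficient 0 may be sent to a zero object,
    as happens for the pointed category below. *)
Hypothesis X1 : forall a, ks_coef s (dg_id a) *: dg_id (X a) = dg_id (X a).

Definition scalar_mor a b i (c : k) : dg_hom (X a) (X b) i :=
  match pselect (a = b), i =P 0 with
  | left e, ReflectT ei =>
    c *: ecast i (dg_hom (X a) (X b) i) (esym ei) (ecast b (dg_hom (X a) (X b) 0) e (dg_id (X a)))
  | _, _ => 0
  end.

Lemma scalar_mor_id a c : scalar_mor a a 0 c = c *: dg_id (X a).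
Proof.
rewrite /scalar_mor; case: pselect => // e; case: eqP => // ei.
by rewrite (Prop_irrelevance e erefl) (int_eq_irr ei erefl).
Qed.

Lemma scalar_mor_linear a b i : linear (scalar_mor a b i : k^o -> _).
Proof.
move=> x u v; rewrite /scalar_mor; case: pselect => [e|_]; last by rewrite scaler0 addr0.
by case: eqP => [ei|_]; rewrite ?scalerDl ?scalerA // scaler0 addr0.
Qed.

Lemma scalar_mor0 a b i : scalar_mor a b i 0 = 0.
Proof. exact: (lin0 (@scalar_mor_linear a b i)). Qed.

Program Definition scalar_functor : dgfunctor A B :=
  @DGFunctor k A B X (fun a b i f => scalar_mor a b i (ks_coef s f)) _ _ _ _.
Next Obligation. by move=> a b i x u v; rewrite ks_linear scalar_mor_linear. Qed.
Next Obligation.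
move=> a b i j e f; rewrite /= ks_d scalar_mor0.
have [->|/ks_supp[? ?]] := eqVneq (ks_coef s f) 0.
  by rewrite scalar_mor0 (lin0 (dg_d_linear _)).
by subst b i; rewrite scalar_mor_id (linZ (dg_d_linear _)) dg_id_closed scaler0.
Qed.
Next Obligation. by move=> a; rewrite /= scalar_mor_id X1. Qed.
Next Obligation.
move=> a b c i j l e g f; rewrite /= ks_comp.
have [->|/ks_supp[? ?]] := eqVneq (ks_coef s g) 0.
  by rewrite mul0r !scalar_mor0 dg_comp0l.
have [->|/ks_supp[? ?]] := eqVneq (ks_coef s f) 0.
  by rewrite mulr0 !scalar_mor0 dg_comp0r.
subst c b i j l; rewrite !scalar_mor_id (linZ (dg_comp_linear_l _ _)) (linZ (dg_comp_linear_r _ _)).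
by rewrite dg_comp1l scalerA.
Qed.
End ScalarFunctor.

Lemma scalar_functor_comp (k : fieldType) (A B C : dgcat k) (s : kscalar A) (X : A -> B)
    (X1 : forall a, ks_coef s (dg_id a) *: dg_id (X a) = dg_id (X a)) (F : dgfunctor B C)
    (Y : A -> C) (Y1 : forall a, ks_coef s (dg_id a) *: dg_id (Y a) = dg_id (Y a)) :
  (forall a, F (X a) = Y a) -> dgf_iso (dgf_compf F (scalar_functor X1)) (scalar_functor Y1).
Proof.
move=> FXY; have {FXY}YE : Y = (fun a => F (X a)) by apply: funext => a; rewrite FXY.
subst Y.
exists (fun a => dg_id _), (fun a => dg_id _); split=> [a|a|a|a b i f].
- by split; apply: dg_id_closed.
- by rewrite dg_comp1l.
- by rewrite dg_comp1l.
rewrite dg_comp1l dg_comp1r /=.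
have [->|/ks_supp[? ?]] := eqVneq (ks_coef s f) 0.
  by rewrite !scalar_mor0 dgf0.
by subst b i; rewrite !scalar_mor_id (linZ (@dgf_linear _ _ _ _ _ _ _)) dgf_id.
Qed.

(** * Homotopy invariants of DG-categories *)

Lemma thin_row (k : fieldType) (u v : 'rV[k]_0) : u = v.
Proof. by rewrite [u]thinmx0 [v]thinmx0. Qed.

Definition zero_dgcat (k : fieldType) : dgcat k.
Proof.
unshelve refine (@DGCat k unit (fun _ _ _ => 'rV[k]_0 : lmodType k) (fun _ _ _ _ _ _ => 0)
  (fun _ => 0) (fun _ _ _ _ _ _ _ _ _ => 0) _ _ _ _ _ _ _ _); repeat intro; exact: thin_row.
Defined.

Lemma zero_dgcat_eq (k : fieldType) (X Y : zero_dgcat k) i (f g : dg_hom X Y i) : f = g.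
Proof. exact: thin_row. Qed.

Lemma exhibits_localization_isos (C : category) (W : forall X Y : C, chom X Y -> Prop) :
  (forall X Y (f : chom X Y), W X Y f -> is_iso f) ->
  forall F : functor C C, (forall X, F X = X) ->
  naturally_isomorphic F (idfunctor C) -> exhibits_localization W F.
Proof.
move=> iW F _ FE; have inv X Y (f : chom X Y) : W X Y f -> is_iso (fmor (idfunctor C) f) by apply: iW.
exists (loc_lift inv); split; last first.
  apply: naturally_isomorphic_sym; case: FE => eta [ie nat].
  by exists eta; split.
apply: (@quasi_inverse_equivalence _ _ _ (to_localization W)).
  exists (fun X => cid (X : localization W)); split=> [X|]; first exact: is_iso_id.
  apply: localization_natural => X Y f.
  apply: ceq_trans (ccomp1l _) _; exact: ceq_sym (ccomp1r _).
exists (fun X => cid X); split=> [X|X Y f]; first exact: is_iso_id.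
apply: ceq_trans (ccomp1l _) _; exact: ceq_sym (ccomp1r _).
Qed.

Section Invariant.
Variables (k : fieldType) (T : triangulated) (E : functor (DGcat k) (tr_cat T)).
Hypothesis E_A1 : A1_homotopy_invariant E.
Local Notation "g \ot f" := (tr_comp g f) (at level 40, left associativity).

Definition Em (A B : dgcat k) (F : dgfunctor A B) : tr_hom (E A : T) (E B : T) :=
  fmor E (F : @chom (DGcat k) A B).

Lemma Em_iso (A B : dgcat k) (F G : dgfunctor A B) : dgf_iso F G -> Em F = Em G.
Proof. by move=> FG; apply: (fmor_ceq E (FG : @ceq (DGcat k) A B F G)). Qed.
Lemma Em_comp (A B C : dgcat k) (G : dgfunctor B C) (F : dgfunctor A B) :
  Em (dgf_compf G F) = Em G \ot Em F.
Proof. exact: (fmor_comp E (G : @chom (DGcat k) B C) (F : @chom (DGcat k) A B)). Qed.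
Lemma Em_id (A : dgcat k) : Em (dgf_idf A) = tr_id (E A : T).
Proof. exact: (fmor_id E A). Qed.
Lemma Em_morita (A B : dgcat k) (F : dgfunctor A B) :
  derived_morita (F : @chom (DGcat k) A B) -> @is_iso (tr_cat T) _ _ (Em F).
Proof. by have [H _ _] := E_A1; apply: H. Qed.

Lemma Em_verdier (A B C : dgcat k) (P : B -> Prop) (F : dgfunctor A (full_dgcat P))
    (Q : dgfunctor B C) :
  strongly_pretriangulated B -> thick P -> dg_verdier_quotient P Q ->
  is_iso (fmor (to_Hmo k) (F : @chom (DGcat k) A (full_dgcat P))) ->
  exists h, tr_dist (Em (dgf_compf (full_inclusion P) F)) (Em Q) h.
Proof.
have [_ loc _] := E_A1; move=> prB thP QQ iF; apply: loc.
exists B, P, C, Q; split=> //.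
exists (fmor (to_Hmo k) (F : @chom (DGcat k) A (full_dgcat P))), (cid _), (cid _).
split=> //; [exact: is_iso_id|exact: is_iso_id| |].
  apply: ceq_trans (ccomp1l _) _; exact: (fmor_comp (to_Hmo k)).
apply: ceq_trans (ccomp1l _) _; exact: ceq_sym (ccomp1r _).
Qed.

(** The zero category is a thick subcategory of itself with quotient itself, so two isomorphisms are
    consecutive maps of a triangle and their composite vanishes. *)
Lemma Em_zero_dgcat : tr_id (E (zero_dgcat k) : T) = 0.
Proof.
pose Z := zero_dgcat k; pose P := fun _ : Z => True.
have prZ : strongly_pretriangulated Z.
  split.
  - by exists tt; apply: zero_dgcat_eq.
  - by move=> X; exists tt, 0, 0; split=> *; repeat intro; apply: zero_dgcat_eq.
  - by move=> X; exists tt, 0, 0; split=> *; repeat intro; apply: zero_dgcat_eq.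
  - move=> X Y f _; exists tt, 0, 0, 0, 0; split; do ?[split]; repeat intro; exact: zero_dgcat_eq.
have thP : thick P by split.
have [h D] : exists h, tr_dist (Em (dgf_compf (full_inclusion P) (full_lift (F := dgf_idf Z) (fun=> I))))
   (Em (dgf_idf Z)) h.
  apply: Em_verdier => //.
    apply: exhibits_localization_isos => [X Y f _|//|].
      exists (exist _ 0 (fun _ _ => zero_dgcat_eq _ _)).
      by split; exists 0; apply: zero_dgcat_eq.
    exists (fun X => cid (X : h0 Z)); split=> [X|X Y f]; first exact: is_iso_id.
    by exists 0; apply: zero_dgcat_eq.
  apply: fmor_iso; exists (full_inclusion P : @chom (DGcat k) _ Z); split.
    exact: dgf_comp1l.
  exists (fun X => dg_id (sval X)), (fun X => dg_id (sval X)).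
  by split=> *; do ?[split]; repeat intro; apply: zero_dgcat_eq.
have := dist_comp0 D; rewrite Em_comp Em_id tr_comp1l => E0.
have iF : @is_iso (tr_cat T) _ _ (Em (dgf_compf (full_inclusion P)
    (full_lift (F := dgf_idf Z) (P := P) (fun=> I)))).
  rewrite (Em_iso (G := dgf_idf Z)) ?Em_id; first exact: (@is_iso_id (tr_cat T)).
  exact: dgf_comp1l.
rewrite Em_comp E0 in iF; case: iF => g [_ /=]; rewrite tr_comp0l => <- //.
Qed.

Section ZeroFunctors.
Variables (A D : dgcat k) (O : D) (O0 : dg_is_zero O).

(** A contractible object is a homotopy retract of a zero object, so the inclusion of the zero
    category is a derived Morita equivalence. *)
Lemma E_contractible : tr_id (E (full_dgcat (@contractible k D)) : T) = 0.
Proof.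
pose O' : full_dgcat (@contractible k D) := exist _ O (zero_contractible O0).
have O'0 : dg_is_zero O' by exact: O0.
pose F := zero_functor (zero_dgcat k) O'0.
have [|G [_ FG]] := @Em_morita _ _ F; last first.
  by rewrite /= in FG; rewrite -FG -[G]tr_comp1l Em_zero_dgcat tr_comp0l tr_comp0r.
apply: derived_morita_criterion => [X|Q [Q1 _ _ Q4] QF Y].
  exists (fun _ _ _ => 0) (fun _ _ _ _ _ => 0); try by (repeat intro; apply: zero_dgcat_eq).
  - by move=> X' i j e a u v; rewrite scaler0 addr0.
  - by move=> *; rewrite dg_comp0l.
  - by move=> X' h i j eh e b; rewrite (lin0 (dg_d_linear _)) addr0 subr0; apply: (zero_hom_l _ O'0).
have c0 U V : dg_closed (0 : @dg_hom k (full_dgcat (@contractible k D)) U V 0).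
  by move=> j e; apply: (lin0 (dg_d_linear _)).
apply: (Q4 (Y : h0 _) (O' : h0 _) (exist _ 0 (c0 _ _)) (exist _ 0 (c0 _ _))); last exact: (QF tt).
case: Y => Y [h hE]; exists (- h); rewrite /= dg_comp0l sub0r.
by rewrite (linN (dg_d_linear _)) hE.
Qed.

Lemma Em_contractible (F : dgfunctor A D) : (forall X, contractible (F X)) -> Em F = 0.
Proof.
move=> cF; rewrite -(Em_iso (F := dgf_compf (full_inclusion (@contractible k D)) (full_lift cF))).
  by rewrite Em_comp -[Em (full_lift _)]tr_comp1l E_contractible tr_comp0l tr_comp0r.
by case: F cF => *; apply: dgf_iso_refl.
Qed.
End ZeroFunctors.

(** * Additivity on direct sums of DG-functors *)

Section Additivity.
Variable D : dgcat k.
Hypothesis prD : strongly_pretriangulated D.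
Variables (O : D) (O0 : dg_is_zero O).
Let DD := prod_dgcat D D.
Let in1 : dgfunctor D DD := pair_functor (dgf_idf D) (zero_functor D O0).
Let in2 : dgfunctor D DD := pair_functor (zero_functor D O0) (dgf_idf D).
Let P : DD -> Prop := fun X => contractible X.2.

Let thP : thick P. Proof. exact: (thick_preimage (prod_snd D D) (@thick_contractible k D)). Qed.

Let in1P X : P (in1 X). Proof. exact: zero_contractible. Qed.

(** The inverse equivalence is X |-> (O, X). The comparison (X1, X2) -> (O, X2) is inverted because
    the second component of its cone is the cone of an identity. *)
Lemma prod_snd_quotient : dg_verdier_quotient P (prod_snd D D).
Proof.
have inv (X Y : h0 DD) (f : chom X Y) : cone_in P f -> is_iso (fmor (h0_functor (prod_snd D D)) f).
  move=> [Z Zc PZ]; apply: cone_contractible_iso PZ.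
  exact: (dgf_is_cone (prod_snd D D) Zc).
exists (loc_lift inv); split; last first.
  exists (fun X => cid _); split=> [X|X Y f]; first exact: is_iso_id.
  apply: ceq_trans (ccomp1l _) _; exact: ceq_sym (ccomp1r _).
have eta_closed (X : DD) : dg_closed ((0, dg_id X.2) : @dg_hom k DD X (in2 X.2) 0).
  by apply/prod_closed; split; [move=> j e; apply: (lin0 (dg_d_linear _))|apply: dg_id_closed].
pose eta (X : h0 DD) : @chom (h0 DD) X (in2 X.2) := exist _ _ (eta_closed X).
have eta_in X : cone_in P (eta X).
  have [_ _ _ cD] := prD.
  have [|Z1 c1] := cD X.1 O 0; first by move=> j e; apply: (lin0 (dg_d_linear _)).
  have [|Z2 c2] := cD X.2 X.2 (dg_id X.2); first exact: dg_id_closed.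
  by exists (Z1, Z2); [apply: prod_is_cone|apply: cone_id_contractible c2].
pose S := functor_comp (to_localization (cone_in P)) (h0_functor in2).
apply: (@quasi_inverse_equivalence _ _ _ S).
  apply: naturally_isomorphic_sym; exists (fun X => loc_in (cone_in P) (eta X)); split=> [X|].
    exact: (@loc_in_iso _ (cone_in P)).
  apply: localization_natural => X Y f.
  rewrite -[fmor (idfunctor _) _]/(fmor (to_localization (cone_in P)) f).
  rewrite -[fmor (functor_comp S _) _]/(fmor (to_localization (cone_in P))
    (fmor (h0_functor in2) (fmor (h0_functor (prod_snd D D)) f))).
  rewrite -![loc_in _ (eta _)]/(fmor (to_localization (cone_in P)) (eta _)).
  apply: ceq_trans (ceq_sym (fmor_comp (to_localization (cone_in P)) _ _)) _.
  apply: ceq_trans _ (fmor_comp (to_localization (cone_in P)) _ _); apply: fmor_ceq.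
  exists 0; rewrite (lin0 (dg_d_linear _)); apply/eqP; rewrite subr_eq0; apply/eqP.
  by congr pair; rewrite /= ?dg_comp0l ?dg_comp1l ?dg_comp1r.
exists (fun X => cid X); split=> [X|X Y f]; first exact: is_iso_id.
apply: ceq_trans (ccomp1l _) _; apply: ceq_trans _ (ceq_sym (ccomp1r _)).
exact: dg_homotopic_refl.
Qed.

(** A pair (X, Y) with Y contractible is a homotopy retract of (X, O), so the fully faithful functor
    X |-> (X, O) generates. *)
Lemma prod_fst_morita : derived_morita (full_lift in1P : @chom (DGcat k) D (full_dgcat P)).
Proof.
have O_eq i (u v : dg_hom O O i) : u = v by rewrite (zero_hom_l u O0) (zero_hom_l v O0).
apply: derived_morita_criterion => [X|Q [_ _ _ Q4] QF [[X Y] cY]].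
  unshelve refine (@HomRetraction k D (full_dgcat P) (full_lift in1P) X
    (fun X' i (b : @dg_hom k DD (in1 X') (in1 X) i) => b.1) (fun _ _ _ _ _ => 0) _ _ _ _ _ _ _) => //.
  - by move=> X' i j e a u v; rewrite scaler0 addr0.
  - by move=> *; rewrite dg_comp0l.
  - move=> X' h i j eh e b; rewrite (lin0 (dg_d_linear _)) addr0; apply/eqP; rewrite subr_eq0.
    by case: b => b1 b2; apply/eqP; congr pair; apply: O_eq.
have cf (U V : DD) (a : dg_hom U.1 V.1 0) : dg_closed a -> dg_closed ((a, 0) : @dg_hom k DD U V 0).
  by move=> ca; apply/prod_closed; split=> // j e; apply: (lin0 (dg_d_linear _)).
pose W : full_dgcat P := exist _ (X, Y) cY.
pose i : @chom (h0 (full_dgcat P)) W (full_lift in1P X) :=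
  exist _ _ (cf (X, Y) (X, O) (dg_id X) (@dg_id_closed _ _ X)).
pose r : @chom (h0 (full_dgcat P)) (full_lift in1P X) W :=
  exist _ _ (cf (X, O) (X, Y) (dg_id X) (@dg_id_closed _ _ X)).
apply: (Q4 W (full_lift in1P X) i r); last exact: QF.
case: (cY) => h hE; exists (0, - h); rewrite /=; congr pair => /=.
  by rewrite dg_comp1l subrr (lin0 (dg_d_linear _)).
by rewrite dg_comp0l (linN (dg_d_linear _)) hE add0r.
Qed.

(** The triangle of D -> D x D -> D splits. The error e is killed by the second projection, hence
    factors through [in1], and the first projection shows that the factor is zero. *)
Lemma Em_prod_id : tr_id (E DD : T) =
  Em in1 \ot Em (prod_fst D D) + Em in2 \ot Em (prod_snd D D).
Proof.
have iso_in1 := loc_in_iso (W := @derived_morita k) prod_fst_morita.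
have [h] := Em_verdier (prod_strongly_pretriangulated prD prD) thP prod_snd_quotient iso_in1.
have -> : Em (dgf_compf (full_inclusion P) (full_lift in1P)) = Em in1.
  apply: Em_iso.
  exists (fun X => dg_id _), (fun X => dg_id _); split=> [X|X|X|X Y i f].
  - by split; apply: dg_id_closed.
  - by rewrite dg_comp1l.
  - by rewrite dg_comp1l.
  - by rewrite dg_comp1l dg_comp1r.
move=> dist.
have s1 : Em (prod_snd D D) \ot Em in1 = 0 by apply: dist_comp0 dist.
have f2 : Em (prod_fst D D) \ot Em in2 = 0.
  by rewrite -Em_comp; apply: (Em_contractible O0) => X; apply: zero_contractible.
have f1 : Em (prod_fst D D) \ot Em in1 = tr_id _.
  by rewrite -Em_comp -Em_id; apply: Em_iso; apply: dgf_iso_refl.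
have s2 : Em (prod_snd D D) \ot Em in2 = tr_id _.
  by rewrite -Em_comp -Em_id; apply: Em_iso; apply: dgf_iso_refl.
pose e := tr_id (E DD : T) - Em in1 \ot Em (prod_fst D D) - Em in2 \ot Em (prod_snd D D).
have se : Em (prod_snd D D) \ot e = 0.
  rewrite !tr_compBr -!tr_compA s1 s2 tr_comp0l tr_comp1r tr_comp1l subr0 subrr //.
have fe : Em (prod_fst D D) \ot e = 0.
  rewrite !tr_compBr -!tr_compA f1 f2 tr_comp0l tr_comp1r tr_comp1l subrr subr0 //.
have [x eE] := dist_weak_kernel dist se.
have x0 : x = 0 by rewrite -[x]tr_comp1l -f1 tr_compA -eE fe.
apply/eqP; rewrite -subr_eq0 opprD addrA -/e eE x0 tr_comp0r //.
Qed.

Record functor_biproduct (A : dgcat k) (J F G : dgfunctor A D) := FunctorBiproduct {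
  fb :> forall X, biproduct (F X) (G X) (J X);
  fb_i1 : forall X Y i (f : dg_hom X Y i),
    dg_comp (addr0 i) (dgf_hom J f) (bi1 (fb X)) = dg_comp (add0r i) (bi1 (fb Y)) (dgf_hom F f);
  fb_i2 : forall X Y i (f : dg_hom X Y i),
    dg_comp (addr0 i) (dgf_hom J f) (bi2 (fb X)) = dg_comp (add0r i) (bi2 (fb Y)) (dgf_hom G f) }.

(** J is isomorphic to the pairing of F and G followed by the sum functor, whose restriction to
    either factor is the identity up to isomorphism; [Em_prod_id] splits the pairing. *)
Lemma Em_biproduct (A : dgcat k) (J F G : dgfunctor A D) :
  functor_biproduct J F G -> Em J = Em F + Em G.
Proof.
move=> [b n1 n2].
have choice X : {Z : D & biproduct X.1 X.2 Z}.
  have /boolp.cid[Z H] := biproduct_exists prD X.1 X.2.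
  have /boolp.cid[c _] : exists c : biproduct X.1 X.2 Z, True by case: H => c; exists c.
  by exists Z.
pose S := sum_functor (fun X => projT2 (choice X)).
(* The chosen sums are only isomorphic to the values of J; the comparison is the canonical map
   between two sums of the same objects. *)
have -> : Em J = Em (dgf_compf S (pair_functor F G)).
  apply: Em_iso; pose c X := projT2 (choice (F X, G X)).
  exists (fun X => dg_comp (addr0 0) (bi1 (c X)) (bp1 (b X)) + dg_comp (addr0 0) (bi2 (c X)) (bp2 (b X))).
  exists (fun X => dg_comp (addr0 0) (bi1 (b X)) (bp1 (c X)) + dg_comp (addr0 0) (bi2 (b X)) (bp2 (c X))).
  have closedD Y1 Y2 (u v : @dg_hom k D Y1 Y2 0) : dg_closed u -> dg_closed v -> dg_closed (u + v).
    by move=> cu cv j e; rewrite (linD (dg_d_linear _)) cu cv addr0.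
  have compE Y1 Y2 Z1 Z2 Z3 (u : @biproduct k D Y1 Y2 Z1) (v : @biproduct k D Y1 Y2 Z2)
      (w : @biproduct k D Y1 Y2 Z3) :
    dg_comp (addr0 0) (dg_comp (addr0 0) (bi1 u) (bp1 v) + dg_comp (addr0 0) (bi2 u) (bp2 v))
      (dg_comp (addr0 0) (bi1 v) (bp1 w) + dg_comp (addr0 0) (bi2 v) (bp2 w)) =
    dg_comp (addr0 0) (bi1 u) (bp1 w) + dg_comp (addr0 0) (bi2 u) (bp2 w).
    rewrite (linD (dg_comp_linear_l _ _)) !(linD (dg_comp_linear_r _ _)).
    rewrite (dg_comp_mid _ _ _ (addr0 0) _ _ (bp1i1 v)) (dg_comp_mid _ _ _ (addr0 0) _ _ (bp2i2 v)).
    by rewrite !dg_comp_mid0 ?addr0 ?add0r //; [apply: bp2i1|apply: bp1i2].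
  split=> [X|X|X|X Y i f].
  - split; apply: closedD; apply: dg_comp_closed;
    by do ?[exact: bi1_closed|exact: bi2_closed|exact: bp1_closed|exact: bp2_closed].
  - by rewrite compE bipE.
  - by rewrite compE bipE.
  have J1 : dg_comp (add0r i) (bp1 (b Y)) (dgf_hom J f) = dg_comp (addr0 i) (dgf_hom F f) (bp1 (b X)).
    rewrite -[dgf_hom J f](dg_comp1r (addr0 i)) -(bipE (b X)) !(linD (dg_comp_linear_r _ _)).
    rewrite -!(dg_compA (addr0 i) (addr0 i)) n1 n2 -!(dg_compA (add0r i) (addr0 i)).
    rewrite -!(dg_compA (addr0 0) (add0r i)) bp1i1 bp1i2 dg_comp1l !dg_comp0l addr0 //.
  have J2 : dg_comp (add0r i) (bp2 (b Y)) (dgf_hom J f) = dg_comp (addr0 i) (dgf_hom G f) (bp2 (b X)).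
    rewrite -[dgf_hom J f](dg_comp1r (addr0 i)) -(bipE (b X)) !(linD (dg_comp_linear_r _ _)).
    rewrite -!(dg_compA (addr0 i) (addr0 i)) n1 n2 -!(dg_compA (add0r i) (addr0 i)).
    rewrite -!(dg_compA (addr0 0) (add0r i)) bp2i2 bp2i1 dg_comp1l !dg_comp0l add0r //.
  rewrite (linD (dg_comp_linear_l _ _)) (linD (dg_comp_linear_r _ _)) /= /sum_hom /=.
  rewrite !(dg_compA (addr0 0) (add0r i) (add0r i) (add0r i)) J1 J2.
  rewrite !(linD (dg_comp_linear_l _ _)) -/(c X) -/(c Y).
  have cross (U1 U2 U3 U4 U5 : D) (x : dg_hom U2 U1 0) (y : dg_hom U3 U2 i) (z : dg_hom U4 U3 0)
      (z' : dg_hom U5 U4 0) (w : dg_hom (J X) U5 0) :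
    dg_comp (addr0 i) (dg_comp (add0r i) x (dg_comp (addr0 i) y z)) (dg_comp (addr0 0) z' w) =
    dg_comp (add0r i) x (dg_comp (addr0 i) y (dg_comp (addr0 0) (dg_comp (addr0 0) z z') w)).
    rewrite (dg_compA _ _ (addr0 i) (add0r i)) (dg_compA _ _ (addr0 0) (addr0 i)).
    by rewrite (dg_compA _ _ (addr0 0) (addr0 0)).
  rewrite !cross bp1i1 bp2i2 bp1i2 bp2i1.
  by rewrite !dg_comp1l !dg_comp0l !dg_comp0r addr0 add0r.
rewrite Em_comp -[Em (pair_functor F G)]tr_comp1l Em_prod_id.
have S1 : Em (dgf_compf S in1) = tr_id _.
  rewrite -Em_id; apply: Em_iso; pose c X := projT2 (choice (X, O)).
  exists (fun X => bp1 (c X)), (fun X => bi1 (c X)); split=> [X|X|X|X Y i f].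
  - by split; [apply: bp1_closed|apply: bi1_closed].
  - rewrite -(bipE (c X)) (zero_hom_r (bp2 (c X)) O0) dg_comp0r addr0 //.
  - exact: bp1i1.
  rewrite /= /sum_hom /= dg_comp0l dg_comp0r addr0 -/(c X) -/(c Y).
  by rewrite -(dg_compA (addr0 0) (add0r i)) bp1i1 dg_comp1l.
have S2 : Em (dgf_compf S in2) = tr_id _.
  rewrite -Em_id; apply: Em_iso; pose c X := projT2 (choice (O, X)).
  exists (fun X => bp2 (c X)), (fun X => bi2 (c X)); split=> [X|X|X|X Y i f].
  - by split; [apply: bp2_closed|apply: bi2_closed].
  - rewrite -(bipE (c X)) (zero_hom_r (bp1 (c X)) O0) dg_comp0r add0r //.
  - exact: bp2i2.
  rewrite /= /sum_hom /= dg_comp0l dg_comp0r add0r -/(c X) -/(c Y).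
  by rewrite -(dg_compA (addr0 0) (add0r i)) bp2i2 dg_comp1l.
rewrite tr_compDl tr_compDr -!tr_compA -!(Em_comp S) S1 S2 !tr_comp1l -!Em_comp.
have proj_iso (H H' : dgfunctor A D) :
    dgf_iso (dgf_compf (prod_fst D D) (pair_functor H H')) H /\
    dgf_iso (dgf_compf (prod_snd D D) (pair_functor H H')) H'.
  by split; [case: H|case: H'] => *; apply: dgf_iso_refl.
by congr (_ + _); apply: Em_iso; have [] := proj_iso F G.
Qed.
End Additivity.

(** * Weighted DG-categories and homotopy invariance *)

Section Weights.
Variables (A : dgcat k) (w : nat -> forall X Y : A, forall i, dg_hom X Y i -> dg_hom X Y i).
Hypothesis w_linear : forall N X Y i, linear (@w N X Y i).
Hypothesis w_d : forall N X Y i j (e : i + 1 = j) (f : dg_hom X Y i), w N (dg_d e f) = dg_d e (w N f).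
Hypothesis w_id : forall X, w 0 (dg_id X) = dg_id X.
Hypothesis w_idem : forall N M X Y i (f : dg_hom X Y i), w N (w M f) = if N == M then w M f else 0.
Hypothesis w_fin : forall X Y i (f : dg_hom X Y i), exists K, forall N, (K <= N)%N -> w N f = 0.
Hypothesis w_sum : forall X Y i (f : dg_hom X Y i) K,
  (forall N, (K <= N)%N -> w N f = 0) -> \sum_(N < K) w N f = f.
Hypothesis w_comp : forall N X Y Z i j l (e : i + j = l) (g : dg_hom Y Z i) (f : dg_hom X Y j),
  w N (dg_comp e g f) = \sum_(a < N.+1) dg_comp e (w a g) (w (N - a) f).

Definition weight0_subspace (X Y : A) i : subspace (dg_hom X Y i).
Proof.
exists (fun f => w 0 f = f); first exact: (lin0 (@w_linear _ _ _ _)).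
by move=> a u v wu wv; rewrite w_linear wu wv.
Defined.

Lemma w0_comp X Y Z i j l (e : i + j = l) (g : dg_hom Y Z i) (f : dg_hom X Y j) :
  w 0 (dg_comp e g f) = dg_comp e (w 0 g) (w 0 f).
Proof. by rewrite w_comp big_ord1. Qed.

Definition weight0_dgcat : dgcat k.
Proof.
apply: (@sub_dgcat k A A id weight0_subspace) => /=.
- by move=> X Y i j e f wf; rewrite w_d wf.
- exact: w_id.
- by move=> X Y Z i j l e g f wg wf; rewrite w0_comp wg wf.
Defined.

Definition weight0_inclusion : dgfunctor weight0_dgcat A :=
  @DGFunctor k weight0_dgcat A id (fun X Y i f => sv f) (fun X Y i a u v => erefl)
    (fun X Y i j e f => erefl) (fun X => erefl) (fun X Y Z i j l e g f => erefl).

Lemma w0_in X Y i (f : dg_hom X Y i) : weight0_subspace X Y i (w 0 f).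
Proof. exact: w_idem. Qed.

Program Definition weight0_projection : dgfunctor A weight0_dgcat :=
  @DGFunctor k A weight0_dgcat id (fun X Y i f => mks (w0_in f)) _ _ _ _.
Next Obligation. by move=> X Y i a u v; apply: sv_inj; apply: w_linear. Qed.
Next Obligation. by move=> *; apply: sv_inj; apply: w_d. Qed.
Next Obligation. by move=> *; apply: sv_inj; apply: w_id. Qed.
Next Obligation. by move=> *; apply: sv_inj; apply: w0_comp. Qed.

(** The coaction of the multiplicative monoid of the affine line given by the weights: [w_fin] makes
    its values polynomial, [w_comp] makes it multiplicative. *)
Program Definition weight_functor : dgfunctor A (poly_dgcat A) :=
  @DGFunctor k A (poly_dgcat A) id (fun X Y i f => mk_poly (w_fin f)) _ _ _ _.
Next Obligation.
by move=> X Y i a u v; apply: pcoefP => n; rewrite pcoef_zd; apply: w_linear.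
Qed.
Next Obligation. by move=> *; apply: pcoefP => n; apply: w_d. Qed.
Next Obligation.
move=> X; apply: pcoefP => -[|n]; first exact: w_id.
by rewrite -[LHS]/(w n.+1 (dg_id X)) -[in LHS]w_id w_idem.
Qed.
Next Obligation. by move=> *; apply: pcoefP => n; rewrite pcoef_comp; apply: w_comp. Qed.

Program Definition eval0 : dgfunctor (poly_dgcat A) A :=
  @DGFunctor k (poly_dgcat A) A id (fun X Y i f => pcoef f 0) _ _ _ _.
Next Obligation. by move=> X Y i a u v; apply: pcoef_zd. Qed.
Next Obligation. by []. Qed.
Next Obligation. by []. Qed.
Next Obligation.
move=> X Y Z i j l e g f.
by rewrite -[LHS]/(\sum_(a < 1) dg_comp e (pcoef g a) (pcoef f (0 - a))) big_ord1.
Qed.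

(** The sum stops at some bound of the support obtained by choice; [eval1E] makes the choice
    immaterial. *)
Definition eval1_fun (V : lmodType k) (f : polynomials V) : V :=
  \sum_(n < sval (boolp.cid (svP f))) pcoef f n.

Lemma eval1E (V : lmodType k) (f : polynomials V) K :
  (forall n, (K <= n)%N -> pcoef f n = 0) -> eval1_fun f = \sum_(n < K) pcoef f n.
Proof.
have widen M M' : (forall n, (M <= n)%N -> pcoef f n = 0) -> (M <= M')%N ->
    \sum_(n < M') pcoef f n = \sum_(n < M) pcoef f n.
  move=> fM leM; rewrite -!(big_mkord predT (pcoef f)) (@big_cat_nat _ _ _ M) //= addrC.
  by rewrite big_nat big1 ?add0r // => n /andP[/fM].
rewrite /eval1_fun; case: (boolp.cid _) => M /= fM fK; have [le|/ltnW le] := leqP M K.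
  exact/esym/widen.
exact: widen.
Qed.

Lemma eval1_bound (V : lmodType k) (f : polynomials V) :
  exists K, forall n, (K <= n)%N -> pcoef f n = 0.
Proof. exact: (svP f). Qed.

Program Definition eval1 : dgfunctor (poly_dgcat A) A :=
  @DGFunctor k (poly_dgcat A) A id (fun X Y i f => eval1_fun f) _ _ _ _.
Next Obligation.
move=> X Y i a u v; have [K uK] := eval1_bound u; have [K' vK] := eval1_bound v.
pose M := maxn K K'.
rewrite !(@eval1E _ _ M) => [|n|n|n]; rewrite ?geq_max ?pcoef_zd; try by move=> /andP[/uK ? /vK].
  by rewrite scaler_sumr -big_split; apply: eq_bigr => n _; rewrite pcoef_zd.
by move=> /andP[/uK-> /vK->]; rewrite scaler0 addr0.
Qed.
Next Obligation.
move=> X Y i j e u; have [K uK] := eval1_bound u.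
rewrite (@eval1E _ u K) // (@eval1E _ _ K) => [|n /uK un]; first by rewrite (lin_sum (dg_d_linear _)).
by rewrite -[LHS]/(dg_d e (pcoef u n)) un (lin0 (dg_d_linear _)).
Qed.
Next Obligation. by move=> X; rewrite -[LHS]/(eval1_fun (poly_const (dg_id (X : A)))) (@eval1E _ _ 1) ?big_ord1 // => -[]. Qed.
Next Obligation.
move=> X Y Z i j l e g f; have [K gK] := eval1_bound g; have [K' fK] := eval1_bound f.
rewrite (@eval1E _ g K) // (@eval1E _ f K') //.
rewrite (@eval1E _ _ (K + K').+1%N) => [|n le_n]; last first.
  rewrite pcoef_comp big1 // => a _; have [/gK->|lt_a] := leqP K a; first exact: dg_comp0l.
  by rewrite fK ?dg_comp0r //; lia.
pose t a b := dg_comp e (pcoef g a) (pcoef f b).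
transitivity (\sum_(n < (K + K').+1) \sum_(a < (K + K').+1 | (a <= n)%N) t a (n - a)%N).
  apply: eq_bigr => n _.
  by rewrite (big_ord_narrow_leq (ltn_ord n : (n <= K + K')%N)) /= -[LHS]pcoef_comp.
rewrite (exchange_big_dep predT) //=.
have tK a b : (K <= a)%N -> t a b = 0 by move=> /gK a0; rewrite /t a0 dg_comp0l.
have tK' a b : (K' <= b)%N -> t a b = 0 by move=> /fK b0; rewrite /t b0 dg_comp0r.
have inner a : (a <= K)%N -> \sum_(n < (K + K').+1 | (a <= n)%N) t a (n - a)%N = \sum_(b < K') t a b.
  move=> le_a; rewrite -(big_mkord (fun n => (a <= n)%N) (fun n => t a (n - a)%N)).
  rewrite (@big_cat_nat _ _ _ a) //=; last by lia.
  rewrite big_nat_cond big_pred0 ?add0r; last by move=> n; lia.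
  rewrite -{1}[a]add0n big_addn -(big_mkord predT (t a)).
  rewrite (@big_cat_nat _ _ _ K' 0 ((K + K').+1 - a)) //=; last by lia.
  rewrite [X in _ = X]big_mkcond [X in X + _]big_mkcond.
  rewrite [X in _ + X]big_nat_cond [X in _ + X]big1 ?addr0; last first.
    by move=> n /andP[/andP[le_n _] _]; rewrite addnK tK' //; case: ifP.
  by apply: eq_big_nat => n _; rewrite leq_addl addnK.
rewrite (lin_sum (dg_comp_linear_l e _)) -(big_mkord predT (fun a => dg_comp e (pcoef g a) _)).
rewrite -(big_mkord predT (fun a => \sum_(n < (K + K').+1 | (a <= n)%N) t a (n - a)%N)).
rewrite (@big_cat_nat _ _ _ K) //=; last by lia.
rewrite addrC big_nat big1 ?add0r => [|a /andP[le_a _]]; last by apply: big1 => n _; apply: tK.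
apply: eq_big_nat => a /andP[_ /ltnW lt_a]; rewrite inner //.
by rewrite (lin_sum (dg_comp_linear_r e _)).
Qed.

(** Evaluations at 0 and at 1 are both left inverse to A -> A[t], which E inverts, so E identifies
    them. After the weight functor they become the projection to weight 0 and the identity. *)
Theorem Em_weight0 : @is_iso (tr_cat T) _ _ (Em weight0_inclusion).
Proof.
have [_ _ polyE] := E_A1; have ipoly := polyE A.
have ev_eq : Em eval0 = Em eval1.
  apply: (is_iso_surj ipoly).
  suff : Em eval0 \ot Em (poly_inclusion A) = Em eval1 \ot Em (poly_inclusion A) by [].
  rewrite -!Em_comp; apply: Em_iso.
  exists (fun X => dg_id _), (fun X => dg_id _); split=> [X|X|X|X Y i f].
  - by split; apply: dg_id_closed.
  - by rewrite dg_comp1l.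
  - by rewrite dg_comp1l.
  - rewrite dg_comp1l dg_comp1r /=; symmetry.
    by rewrite (@eval1E _ _ 1) ?big_ord1 // => -[].
exists (Em weight0_projection); split.
  rewrite /= -Em_comp.
  rewrite (Em_iso (G := dgf_idf _)) ?Em_id //.
  exists (fun X => dg_id _), (fun X => dg_id _); split=> [X|X|X|X Y i f].
  - by split; apply: dg_id_closed.
  - by rewrite dg_comp1l.
  - by rewrite dg_comp1l.
  - by rewrite dg_comp1l dg_comp1r; apply: sv_inj => /=; exact: (svP f).
rewrite /= -Em_comp.
have -> : Em (dgf_compf weight0_inclusion weight0_projection) = Em (dgf_compf eval0 weight_functor).
  apply: Em_iso; exists (fun X => dg_id _), (fun X => dg_id _); split=> [X|X|X|X Y i f].
  - by split; apply: dg_id_closed.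
  - by rewrite dg_comp1l.
  - by rewrite dg_comp1l.
  - by rewrite dg_comp1l dg_comp1r.
rewrite Em_comp ev_eq -Em_comp (Em_iso (G := dgf_idf _)) ?Em_id //.
exists (fun X => dg_id _), (fun X => dg_id _); split=> [X|X|X|X Y i f].
- by split; apply: dg_id_closed.
- by rewrite dg_comp1l.
- by rewrite dg_comp1l.
- rewrite dg_comp1l dg_comp1r /=; have [K wK] := w_fin f.
  by rewrite (@eval1E _ (mk_poly (w_fin f)) K wK); apply: w_sum.
Qed.
End Weights.
End Invariant.

(** * Finite-dimensional modules *)

Section FiniteModules.
Variables (k : fieldType) (L : falgType k).
Local Notation fmodR := (fmod L right_side).
Implicit Types M N P : fmodR.

Lemma fhomD M N (f g : 'M_(fm_dim M, fm_dim N)) : is_fhom f -> is_fhom g -> is_fhom (f + g).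
Proof. by move=> Hf Hg; rewrite -[f]scale1r; apply: fhomZD. Qed.
Lemma fhomZ M N c (f : 'M_(fm_dim M, fm_dim N)) : is_fhom f -> is_fhom (c *: f).
Proof. by move=> Hf; rewrite -[_ *: f]addr0; apply: fhomZD => //; apply: fhom0. Qed.
Lemma fhomN M N (f : 'M_(fm_dim M, fm_dim N)) : is_fhom f -> is_fhom (- f).
Proof. by move=> Hf; rewrite -scaleN1r; apply: fhomZ. Qed.
Lemma fhomB M N (f g : 'M_(fm_dim M, fm_dim N)) : is_fhom f -> is_fhom g -> is_fhom (f - g).
Proof. by move=> Hf Hg; apply: fhomD => //; apply: fhomN. Qed.

Lemma fm_act_sum M (I : Type) (r : seq I) (c : I -> k) (a : I -> L) :
  fm_act M (\sum_(i <- r) c i *: a i) = \sum_(i <- r) c i *: fm_act M (a i).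
Proof.
rewrite (lin_sum (@fm_linear _ _ _ M)); apply: eq_bigr => i _; exact: (linZ (@fm_linear _ _ _ M)).
Qed.

Program Definition zero_fmod : fmodR := @FMod k L right_side 0 (fun=> 0) _ _ _.
Next Obligation. by move=> a x y; rewrite scaler0 addr0. Qed.
Next Obligation. by apply/matrixP => -[]. Qed.
Next Obligation. by move=> a b; rewrite mulmx0. Qed.

Lemma fm_projective_dim0 M : fm_dim M = 0%N -> fm_projective M.
Proof.
move=> M0 A B g h _ _ _; exists 0; first exact: fhom0.
by rewrite mul0mx; apply/matrixP => i; have := ltn_ord i; rewrite {2}M0.
Qed.

Section DirectSum.
Variables M N : fmodR.
Program Definition dsum : fmodR :=
  @FMod k L right_side (fm_dim M + fm_dim N)
    (fun a => block_mx (fm_act M a) 0 0 (fm_act N a)) _ _ _.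
Next Obligation.
move=> a x y; rewrite scale_block_mx add_block_mx !scaler0 !addr0.
by rewrite (@fm_linear _ _ _ M) (@fm_linear _ _ _ N).
Qed.
Next Obligation. by rewrite /= !fm_act1 -scalar_mx_block. Qed.
Next Obligation. by move=> a b; rewrite /= !fm_actM mulmx_block !mul0mx !mulmx0 !addr0 !add0r. Qed.

Lemma fhom_row_mx A (f : 'M_(fm_dim A, fm_dim M)) (g : 'M_(fm_dim A, fm_dim N)) :
  is_fhom f -> is_fhom g -> is_fhom (N := dsum) (row_mx f g).
Proof.
by move=> Hf Hg a; rewrite mul_mx_row mul_row_block !mulmx0 addr0 add0r Hf Hg.
Qed.
Lemma fhom_col_mx A (f : 'M_(fm_dim M, fm_dim A)) (g : 'M_(fm_dim N, fm_dim A)) :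
  is_fhom f -> is_fhom g -> is_fhom (M := dsum) (col_mx f g).
Proof.
move=> Hf Hg a; rewrite -[fm_act dsum a]/(block_mx (fm_act M a) 0 0 (fm_act N a)).
by rewrite mul_block_col mul_col_mx !mul0mx addr0 add0r Hf Hg.
Qed.
Lemma dsum_projective : fm_projective M -> fm_projective N -> fm_projective dsum.
Proof.
move=> pM pN A B g h Hg fg Hh.
have Hi1 : is_fhom (M := M) (N := dsum) (row_mx 1%:M 0).
  by apply: fhom_row_mx; [apply: fhom1|apply: fhom0].
have Hi2 : is_fhom (M := N) (N := dsum) (row_mx 0 1%:M).
  by apply: fhom_row_mx; [apply: fhom0|apply: fhom1].
have [u Hu uE] := pM _ _ _ _ Hg fg (fhomM (N := dsum) Hi1 Hh).
have [v Hv vE] := pN _ _ _ _ Hg fg (fhomM (N := dsum) Hi2 Hh).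
exists (col_mx u v); first exact: fhom_col_mx.
by rewrite mul_col_mx uE vE -mul_col_mx -block_mxEv -scalar_mx_block mul1mx.
Qed.
End DirectSum.

Lemma row_factor (m n : nat) (U : 'M[k]_(m, n)) :
  {r : 'M[k]_(\rank U, n) | row_free r & (r :=: U)%MS}.
Proof. exists (row_base U); [exact: row_base_free|exact: eq_row_base]. Qed.

Section Submodule.
Variables (N : fmodR) (m : nat) (U : 'M[k]_(m, fm_dim N)).
Hypothesis U_stable : forall a, (U *m fm_act N a <= U)%MS.

Definition submod_incl := s2val (row_factor U).
Local Notation r := submod_incl.
Lemma submod_incl_free : row_free r. Proof. exact: (s2valP (row_factor U)). Qed.
Lemma submod_inclE : (r :=: U)%MS. Proof. exact: (s2valP' (row_factor U)). Qed.

Lemma submod_incl_stable a : r *m fm_act N a *m pinvmx r *m r = r *m fm_act N a.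
Proof. by rewrite mulmxKpV // (eqmxMr _ submod_inclE) submod_inclE U_stable. Qed.

Program Definition submod : fmodR :=
  @FMod k L right_side (\rank U) (fun a => r *m fm_act N a *m pinvmx r) _ _ _.
Next Obligation.
by move=> c a b; rewrite (@fm_linear _ _ _ N) mulmxDr mulmxDl -scalemxAr -scalemxAl.
Qed.
Next Obligation. by rewrite /= fm_act1 mulmx1 mulmxVp // submod_incl_free. Qed.
Next Obligation. by move=> a b; rewrite /= fm_actM; move: (submod_incl_stable a); move: (pinvmx r) => p E; rewrite !mulmxA E. Qed.

Lemma submod_incl_hom : is_fhom (M := submod) (N := N) r.
Proof. by move=> a; rewrite -[LHS]/(r *m fm_act N a *m pinvmx r *m r) submod_incl_stable. Qed.
Lemma submod_corestr M (g : 'M_(fm_dim M, fm_dim N)) : is_fhom g -> (g <= U)%MS ->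
  is_fhom (M := M) (N := submod) (g *m pinvmx r) /\ g *m pinvmx r *m r = g.
Proof.
move=> Hg gU; have E : g *m pinvmx r *m r = g by rewrite mulmxKpV // submod_inclE.
split=> // a; rewrite -[fm_act submod a]/(r *m fm_act N a *m pinvmx r).
by move: (pinvmx r) E => p E; rewrite !mulmxA E Hg.
Qed.
End Submodule.

(** Projectivity is stated for surjections, so d is first corestricted to its image, where g takes
    its values. *)
Lemma proj_lift P M N (d : 'M_(fm_dim M, fm_dim N)) (g : 'M_(fm_dim P, fm_dim N)) :
  fm_projective P -> is_fhom d -> is_fhom g -> (g <= d)%MS ->
  exists2 h : 'M_(fm_dim P, fm_dim M), is_fhom h & h *m d = g.
Proof.
move=> pP Hd Hg gd.
have st a : (d *m fm_act N a <= d)%MS by rewrite -Hd submxMl.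
have [H1 E1] := submod_corestr st Hd (submx_refl d).
have [H2 E2] := submod_corestr st Hg gd.
have [|h Hh hE] := pP _ _ _ _ H1 _ H2.
  by rewrite /row_full eqn_leq rank_leq_col /= -{1}E1 mxrankM_maxl.
by exists h => //; rewrite -E1 mulmxA hE.
Qed.

(** The rank factorization splits the idempotent: e e = e, with one factor cancelled on each side,
    gives the identity in the middle. *)
Lemma idem_factor (m : nat) (e : 'M[k]_m) : e *m e = e ->
  {rs : 'M[k]_(\rank e, m) * 'M[k]_(m, \rank e) | rs.1 *m rs.2 = 1%:M & rs.2 *m rs.1 = e}.
Proof.
have cancel p (r : 'M[k]_(p, m)) (s : 'M_(m, p)) (t : 'M_(p, m)) :
    e *m e = e -> row_free r -> t *m s = 1%:M -> s *m r = e -> r *m s = 1%:M.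
  move=> ee fr ts sr; apply: (row_free_inj fr); rewrite mul1mx -[LHS]mul1mx -[RHS]mul1mx -ts -!mulmxA.
  by congr (t *m _); rewrite !mulmxA sr -mulmxA sr ee.
move=> ee; exists (row_base e, col_base e) => /=; last exact: mulmx_base.
exact: cancel ee (row_base_free e) (mulVpmx (col_base_full e)) (mulmx_base e).
Qed.

Section IdempotentImage.
Variables (M : fmodR) (e : 'M[k]_(fm_dim M)).
Hypotheses (He : is_fhom (M := M) (N := M) e) (ee : e *m e = e).

Definition im_in := (s2val (idem_factor ee)).1.
Definition im_out := (s2val (idem_factor ee)).2.
Lemma im_inK : im_in *m im_out = 1%:M. Proof. exact: (s2valP (idem_factor ee)). Qed.
Lemma im_outK : im_out *m im_in = e. Proof. exact: (s2valP' (idem_factor ee)). Qed.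
Lemma im_in_idem : im_in *m e = im_in. Proof. by rewrite -[X in _ *m X]im_outK mulmxA im_inK mul1mx. Qed.
Lemma im_out_idem : e *m im_out = im_out. Proof. by rewrite -[X in X *m _]im_outK -mulmxA im_inK mulmx1. Qed.

Program Definition im_mod : fmodR :=
  @FMod k L right_side (\rank e) (fun a => im_in *m fm_act M a *m im_out) _ _ _.
Next Obligation.
by move=> c a b; rewrite (@fm_linear _ _ _ M) mulmxDr mulmxDl -scalemxAr -scalemxAl.
Qed.
Next Obligation. by rewrite /= fm_act1 mulmx1 im_inK. Qed.
Next Obligation.
move=> a b; rewrite /= fm_actM -!mulmxA (mulmxA im_out) im_outK.
by rewrite (mulmxA e) -He -(mulmxA _ e) im_out_idem.
Qed.

Lemma im_in_hom : is_fhom (M := im_mod) (N := M) im_in.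
Proof.
move=> a; rewrite -[fm_act im_mod a]/(im_in *m fm_act M a *m im_out) -!mulmxA im_outK.
by rewrite He mulmxA im_in_idem.
Qed.
Lemma im_out_hom : is_fhom (M := M) (N := im_mod) im_out.
Proof.
move=> a; rewrite -[fm_act im_mod a]/(im_in *m fm_act M a *m im_out) !mulmxA im_outK.
by rewrite -He -mulmxA im_out_idem.
Qed.

Lemma im_projective : fm_projective M -> fm_projective im_mod.
Proof.
move=> pM A B g h Hg fg Hh; have [u Hu uE] := pM _ _ _ _ Hg fg (fhomM im_out_hom Hh).
exists (im_in *m u); first exact: (fhomM im_in_hom Hu).
by rewrite -mulmxA uE mulmxA im_inK mul1mx.
Qed.
End IdempotentImage.

End FiniteModules.

(** * Complexes of projective modules *)

Section Complexes.
Variables (k : fieldType) (L : falgType k).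
Local Notation Db := (Db_dgcat L).
Implicit Types X Y Z : proj_complex L.

(** Transport along an equation of degrees as an isomorphism matrix, so that it can be multiplied
    and absorbed into differentials and components. *)
Definition pcast (X : int -> fmod L right_side) p q (e : p = q) : 'M[k]_(fm_dim (X p), fm_dim (X q)) :=
  match e in _ = q return 'M[k]_(fm_dim (X p), fm_dim (X q)) with erefl => 1%:M end.

Section Pcast.
Variable X : int -> fmod L right_side.
Lemma pcast1 p (e : p = p) : pcast X e = 1%:M. Proof. by rewrite (int_eq_irr e erefl). Qed.
Lemma pcastM p q r (e : p = q) (e' : q = r) : pcast X e *m pcast X e' = pcast X (etrans e e').
Proof. by subst; rewrite !pcast1 mulmx1. Qed.
Lemma pcastK p q (e : p = q) (e' : q = p) : pcast X e *m pcast X e' = 1%:M.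
Proof. by rewrite pcastM pcast1. Qed.
Lemma pcast_hom p q (e : p = q) : is_fhom (pcast X e).
Proof. by subst; rewrite pcast1; apply: fhom1. Qed.
End Pcast.

Lemma pcast_dr X p q r (a : p + 1 = q) (e : q = r) (b : p + 1 = r) :
  pc_d X a *m pcast X e = pc_d X b.
Proof. by subst r; rewrite pcast1 mulmx1 (int_eq_irr a b). Qed.
Lemma pcast_dl X p q r (a : q + 1 = r) (e : p = q) (b : p + 1 = r) :
  pcast X e *m pc_d X a = pc_d X b.
Proof. by subst q; rewrite pcast1 mul1mx (int_eq_irr a b). Qed.
Arguments pcast_dr {X p q r} a e b.
Arguments pcast_dl {X p q r} a e b.

Lemma pcast_cxr X Y n (f : cx_hom X Y n) p q r (a : p + n = q) (e : q = r) (b : p + n = r) :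
  cxh f a *m pcast Y e = cxh f b.
Proof. by subst r; rewrite pcast1 mulmx1 (int_eq_irr a b). Qed.
Lemma pcast_cxl X Y n (f : cx_hom X Y n) p q r (a : q + n = r) (e : p = q) (b : p + n = r) :
  pcast X e *m cxh f a = cxh f b.
Proof. by subst q; rewrite pcast1 mul1mx (int_eq_irr a b). Qed.

Lemma cxh0 X Y n p q (e : p + n = q) : cxh (0 : cx_hom X Y n) e = 0. Proof. by []. Qed.
Lemma cxhD X Y n (f g : cx_hom X Y n) p q (e : p + n = q) : cxh (f + g) e = cxh f e + cxh g e.
Proof. by []. Qed.
Lemma cxhB X Y n (f g : cx_hom X Y n) p q (e : p + n = q) : cxh (f - g) e = cxh f e - cxh g e.
Proof. by []. Qed.
Lemma cxhZ X Y n c (f : cx_hom X Y n) p q (e : p + n = q) : cxh (c *: f) e = c *: cxh f e.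
Proof. by []. Qed.
Lemma cxh_comp X Y Z i j l (e : i + j = l) (g : @dg_hom k Db Y Z i) (f : @dg_hom k Db X Y j)
    p q r (ep : p + l = q) (a : p + j = r) (b : r + i = q) :
  cxh (dg_comp e g f : cx_hom X Z l) ep = cxh f a *m cxh g b.
Proof. exact: cx_comp_funE. Qed.
Lemma cxh_d X Y n n' (en : n + 1 = n') (f : @dg_hom k Db X Y n) p q r s (e : p + n' = q)
    (a : p + n = r) (b : r + 1 = q) (c : p + 1 = s) (d : s + n = q) :
  cxh (dg_d en f : cx_hom X Y n') e = cxh f a *m pc_d Y b - (-1 : k) ^ n *: (pc_d X c *m cxh f d).
Proof. exact: cx_d_funE. Qed.
Lemma cxh_id X p q (e : p + 0 = q) (e' : p = q) : cxh (dg_id (X : Db) : cx_hom X X 0) e = pcast X e'.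
Proof. by case: q / e' e => e; rewrite -[LHS]/(cx_id_fun X e) cx_id_funE. Qed.

Arguments cxh_id {X p q} e e'.

Lemma cx_closedP X Y n (f : @dg_hom k Db X Y n) :
  dg_closed f <-> forall p q r s (a : p + n = r) (b : r + 1 = q) (c : p + 1 = s) (d : s + n = q),
    cxh f a *m pc_d Y b = (-1 : k) ^ n *: (pc_d X c *m cxh f d).
Proof.
split=> [cf p q r s a b c d|H].
  apply/eqP; rewrite -subr_eq0; apply/eqP.
  have e : p + (n + 1) = q by clear -a b; lia.
  by rewrite -(cxh_d erefl f e) cf.
apply: (dg_closedP (e := erefl)); apply: cxhP => p q e.
have b : p + n + 1 = q by clear -e; lia.
have d : p + 1 + n = q by clear -e; lia.
by rewrite (cxh_d erefl f e erefl b erefl d) (H _ _ _ _ erefl b erefl d) subrr.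
Qed.

Lemma cx_closed0 X Y (f : @dg_hom k Db X Y 0) : dg_closed f -> forall p q r s
  (a : p + 0 = r) (b : r + 1 = q) (c : p + 1 = s) (d : s + 0 = q),
  cxh f a *m pc_d Y b = pc_d X c *m cxh f d.
Proof. by move=> /cx_closedP cf p q r s a b c d; rewrite (cf _ _ _ _ a b c d) scale1r. Qed.

Definition exact_at X q := forall p r (e : p + 1 = q) (e' : q + 1 = r) (v : 'rV_(fm_dim (X q))),
  v *m pc_d X e' = 0 -> exists w, v = w *m pc_d X e.

Lemma exact_atP X p q r (e : p + 1 = q) (e' : q + 1 = r) :
  (kermx (pc_d X e') <= pc_d X e)%MS <-> exact_at X q.
Proof.
split=> [/rV_subP H p' r' ep er v v0|H].
  have ? : p' = p by clear -e ep; lia.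
  have E : r' = r by rewrite -er -e'.
  subst p'; move: er v0; rewrite E => er v0; have /submxP[w wE] : (v <= pc_d X e)%MS.
    by apply/H/sub_kermxP; rewrite (int_eq_irr e' er).
  by exists w; rewrite (int_eq_irr ep e).
by apply/rV_subP => v /sub_kermxP /H -/(_ _ e)[w ->]; apply: submxMl.
Qed.

Lemma pc_exact_low X : exists N : int, forall q, q < N -> exact_at X q.
Proof.
have [N HN] := pc_bounded_cohomology X; exists N => q lt_q.
have e : q - 1 + 1 = q by rewrite subrK.
by apply/(@exact_atP X _ _ _ e (erefl (q + 1))); apply: HN.
Qed.

Lemma pc_bounded_cohomology_of (M : int -> fmod L right_side)
    (d : forall p q, p + 1 = q -> 'M[k]_(fm_dim (M p), fm_dim (M q))) :
  (exists N : int, forall p q r (e : p + 1 = q) (e' : q + 1 = r) (v : 'rV_(fm_dim (M q))),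
    q < N -> v *m d _ _ e' = 0 -> exists w, v = w *m d _ _ e) ->
  exists N : int, forall p q r (e : p + 1 = q) (e' : q + 1 = r),
    q < N -> (kermx (d _ _ e') <= d _ _ e)%MS.
Proof.
move=> [N H]; exists N => p q r e e' lt_q; apply/rV_subP => v /sub_kermxP v0.
by have [w ->] := H _ _ _ e e' v lt_q v0; apply: submxMl.
Qed.

Definition zero_complex : proj_complex L.
Proof.
exists (fun=> zero_fmod L) (fun _ _ _ => 0).
- by move=> *; apply: fhom0.
- by move=> *; rewrite mul0mx.
- by move=> p; apply: fm_projective_dim0.
- by exists 0.
- by exists 0 => p q r e e' _; rewrite [kermx _](_ : _ = 0) ?sub0mx //; apply/matrixP => -[].
Defined.

Lemma dim0_mx m n (f g : 'M[k]_(m, n)) : m = 0%N -> f = g.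
Proof. by move=> m0; apply/matrixP => i; have := ltn_ord i; rewrite {2}m0. Qed.
Lemma dim0_mxr m n (f g : 'M[k]_(m, n)) : n = 0%N -> f = g.
Proof. by move=> n0; apply/matrixP => i j; have := ltn_ord j; rewrite {2}n0. Qed.

Lemma zero_complex_zero : @dg_is_zero k Db zero_complex.
Proof. by apply: cxhP => p q e; apply: dim0_mx. Qed.

Section Shift.
Variables (X : proj_complex L) (n : int).
Let e1 p q : p + 1 = q -> p + n + 1 = q + n :> int. Proof. by clear X; lia. Qed.
Definition shift_complex : proj_complex L.
Proof.
exists (fun p => X (p + n)) (fun p q e => (-1) ^ n *: pc_d X (e1 e)).
- by move=> p q e; apply: fhomZ; apply: pc_d_hom.
- by move=> p q r e e'; rewrite -scalemxAl -scalemxAr pc_dd !scaler0.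
- by move=> p; apply: pc_projective.
- by have [N HN] := pc_bounded_above X; exists (N - n) => p lt_p; apply: HN; clear -lt_p; lia.
- apply: pc_bounded_cohomology_of; have [N HN] := pc_exact_low X.
  exists (N - n) => p q r e e' v lt_q v0; have lt_q' : q + n < N by clear -lt_q; lia.
  have [|w ->] := HN _ lt_q' _ _ (e1 e) (e1 e') v.
    by rewrite -[_ *m _]scale1r -(sign_sq k n) -scalerA scalemxAr v0 scaler0.
  by exists ((-1) ^ n *: w); rewrite -scalemxAl -scalemxAr scalerA sign_sq scale1r.
Defined.
Lemma shift_dE p q (e : p + 1 = q) (a : p + n + 1 = q + n) :
  pc_d shift_complex e = (-1) ^ n *: pc_d X a.
Proof. by rewrite /= (int_eq_irr (e1 e) a). Qed.
End Shift.

Section ShiftMap.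
Variables (X : proj_complex L) (n m d : int) (ed : m + d = n).
Let e1 p q : p + d = q -> p + n = q + m :> int. Proof. by clear X; lia. Qed.
(** The identity of X, viewed as a morphism X[n] -> X[m] of degree n - m; consecutive shifts are
    compared by those of degree 1 and -1. *)
Definition shift_map : @dg_hom k Db (shift_complex X n) (shift_complex X m) d :=
  @mk_cx k L (shift_complex X n) (shift_complex X m) d (fun p q e => pcast X (e1 e))
    (fun p q e => pcast_hom X (e1 e)).
Lemma shift_mapE p q (e : p + d = q) (a : p + n = q + m) :
  cxh (shift_map : cx_hom (shift_complex X n) (shift_complex X m) d) e = pcast X a.
Proof. by rewrite -[LHS]/(pcast X (e1 e)) (int_eq_irr (e1 e) a). Qed.
Lemma shift_map_closed : dg_closed shift_map.
Proof.
apply/cx_closedP => p q r s a b c e.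
have a1 : p + n + 1 = q + m by clear -a b ed; lia.
have a2 : p + n + 1 = s + n by clear -c; lia.
have a3 : r + m + 1 = q + m by clear -b; lia.
rewrite (shift_mapE a (e1 a)) (shift_mapE e (e1 e)) (shift_dE _ b a3) (shift_dE _ c a2).
rewrite -scalemxAr (pcast_dl a3 _ a1) -scalemxAl (pcast_dr a2 _ a1) scalerA -signD.
by have -> : (-1 : k) ^ (d + n) = (-1) ^ m by rewrite -ed addrCA !signD sign_sq mulr1.
Qed.
End ShiftMap.

Arguments shift_mapE {X n m d} ed {p q} e a.

Lemma shift_map_comp X n m l d d' d'' (e : m + d = n) (e' : l + d' = m) (e'' : l + d'' = n)
    (ed : d' + d = d'') :
  dg_comp ed (shift_map X e') (shift_map X e) = shift_map X e''.
Proof.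
apply: cxhP => p q ep; have a : p + d + d' = q by clear -ed ep; lia.
have a1 : p + n = p + d + m by clear -e; lia.
have a2 : p + d + m = q + l by clear -e' a; lia.
rewrite (cxh_comp ed _ _ ep erefl a) (shift_mapE _ _ a1) (shift_mapE _ _ a2).
rewrite (shift_mapE _ _ (etrans a1 a2)); exact: (pcastM X a1 a2).
Qed.
Lemma shift_map_id X n (e : n + 0 = n) :
  shift_map X e = dg_id (shift_complex X n : Db).
Proof.
apply: cxhP => p q ep; have a : p = q by rewrite -ep addr0.
by case: q / a ep => ep; rewrite (shift_mapE _ _ erefl) (cxh_id _ erefl).
Qed.

Lemma shift_is_shift X n m : n + 1 = m -> @dg_is_shift k Db (shift_complex X n) (shift_complex X m).
Proof.
move=> e; have a : m + -1 = n by clear -e; lia.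
exists (shift_map X a), (shift_map X e); split; try exact: shift_map_closed.
- by rewrite (shift_map_comp X _ _ (addr0 n)) shift_map_id.
- by rewrite (shift_map_comp X _ _ (addr0 m)) shift_map_id.
Qed.

Section Unshift.
Variables (X : proj_complex L).
Let e1 p q : p + 0 = q -> p = q + 0 :> int. Proof. by clear X; lia. Qed.
Let e2 p q : p + 0 = q -> p + 0 = q :> int. Proof. by []. Qed.
(** X[0] has the terms X (p + 0), which are not convertible to X p, so even this comparison needs an
    explicit isomorphism. *)
Definition to_shift0 : @dg_hom k Db X (shift_complex X 0) 0 :=
  @mk_cx k L X (shift_complex X 0) 0 (fun p q e => pcast X (e1 e)) (fun p q e => pcast_hom X (e1 e)).
Definition of_shift0 : @dg_hom k Db (shift_complex X 0) X 0 :=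
  @mk_cx k L (shift_complex X 0) X 0 (fun p q e => pcast X e) (fun p q e => pcast_hom X e).
Lemma to_shift0_closed : dg_closed to_shift0.
Proof.
apply/cx_closedP => p q r s a b c d; rewrite scale1r.
have a1 : r + 0 + 1 = q + 0 by clear -b; lia.
have a2 : p + 1 = q + 0 by clear -a b; lia.
rewrite (shift_dE _ b a1) scale1r -[cxh _ a]/(pcast X (e1 a)) -[cxh _ d]/(pcast X (e1 d)).
by rewrite (pcast_dl a1 _ a2) (pcast_dr c _ a2).
Qed.
Lemma of_shift0_closed : dg_closed of_shift0.
Proof.
apply/cx_closedP => p q r s a b c d; rewrite scale1r.
have a1 : p + 0 + 1 = s + 0 by clear -c; lia.
have a2 : p + 0 + 1 = q by clear -a b; lia.
rewrite (shift_dE _ c a1) scale1r -[cxh _ a]/(pcast X a) -[cxh _ d]/(pcast X d).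
by rewrite (pcast_dl b _ a2) (pcast_dr a1 _ a2).
Qed.
Lemma of_to_shift0 : dg_comp (addr0 0) of_shift0 to_shift0 = dg_id (X : Db).
Proof.
apply: cxhP => p q e; have a : p + 0 + 0 = q by rewrite addr0.
rewrite (cxh_comp _ _ _ e erefl a) -[cxh _ a]/(pcast X a) -[cxh _ erefl]/(pcast X (e1 erefl)).
rewrite pcastM (cxh_id _ (etrans (esym (addr0 p)) e)); congr pcast; exact: int_eq_irr.
Qed.
Lemma to_of_shift0 : dg_comp (addr0 0) to_shift0 of_shift0 = dg_id (shift_complex X 0 : Db).
Proof.
apply: cxhP => p q e; have a : p + 0 + 0 = q by rewrite addr0.
rewrite (cxh_comp _ _ _ e erefl a) -[cxh _ a]/(pcast X (e1 a)) -[cxh _ erefl]/(pcast X erefl).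
have E : p = q by rewrite -e addr0.
by case: q / E e a => e a; rewrite (cxh_id _ erefl); exact: (etrans (pcastM X (erefl _) (e1 a)) (pcast1 X _)).
Qed.
End Unshift.

Section Cone.
Variables (X Y : proj_complex L) (f : @dg_hom k Db X Y 0).
Hypothesis cf : dg_closed f.
Let e1 p q : p + 1 = q -> p + 1 + 1 = q + 1 :> int. Proof. by move=> ->. Qed.
Let e2 p q : p + 1 = q -> p + 1 + 0 = q :> int. Proof. by move=> ->; rewrite addr0. Qed.

Definition cone_d p q (e : p + 1 = q) :
    'M[k]_(fm_dim (dsum (X (p + 1)) (Y p)), fm_dim (dsum (X (q + 1)) (Y q))) :=
  block_mx (- pc_d X (e1 e)) (cxh f (e2 e)) 0 (pc_d Y e).

Lemma cone_d_hom p q (e : p + 1 = q) : is_fhom (cone_d e).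
Proof.
rewrite /cone_d block_mxEv; apply: fhom_col_mx; apply: fhom_row_mx.
- by apply: fhomN; apply: pc_d_hom.
- exact: cxh_hom.
- exact: fhom0.
- exact: pc_d_hom.
Qed.

Lemma cone_f_d p q r (e : p + 1 = q) (e' : q + 1 = r) :
  cxh f (e2 e) *m pc_d Y e' = pc_d X (e1 e) *m cxh f (e2 e').
Proof. exact: (cx_closed0 cf). Qed.

Definition cone_complex : proj_complex L.
Proof.
exists (fun p => dsum (X (p + 1)) (Y p)) cone_d.
- exact: cone_d_hom.
- move=> p q r e e'; rewrite /cone_d mulmx_block !mul0mx !mulmx0 !addr0 mulNmx mulmxN opprK pc_dd.
  by rewrite mulNmx cone_f_d addNr add0r pc_dd block_mx0.
- by move=> p; apply: dsum_projective; apply: pc_projective.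
- have [N HN] := pc_bounded_above X; have [N' HN'] := pc_bounded_above Y.
  exists (Num.max N N') => p; rewrite gt_max => /andP[lt1 lt2] /=.
  by rewrite HN' // HN //; clear -lt1; lia.
- apply: pc_bounded_cohomology_of.
  have [N HN] := pc_exact_low X; have [N' HN'] := pc_exact_low Y.
  exists (Num.min (N - 1) N') => p q r e e' v; rewrite lt_min => /andP[lt1 lt2].
  have lt1' : q + 1 < N by clear -lt1; lia.
  rewrite -[v](@hsubmxK _ 1 (fm_dim (X (q + 1))) (fm_dim (Y q))).
  move: (lsubmx _) (rsubmx _) => x y; rewrite /cone_d mul_row_block mulmx0 addr0 mulmxN.
  rewrite -[X in _ = X](@row_mx0 _ 1) => /eq_row_mx[/eqP + xy]; rewrite oppr_eq0 => /eqP xd.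
  have [x' x'E] := HN _ lt1' _ _ (e1 e) (e1 e') _ xd.
  have [|y' y'E] := HN' _ lt2 _ _ e e' (x' *m cxh f (e2 e) + y).
    by rewrite mulmxDl -mulmxA cone_f_d mulmxA -x'E xy.
  exists (row_mx (- x') y'); rewrite mul_row_block mulmx0 addr0 mulNmx mulmxN opprK -x'E.
  by rewrite -y'E mulNmx addKr.
Defined.

Lemma cone_dE p q (e : p + 1 = q) (a : p + 1 + 1 = q + 1) (b : p + 1 + 0 = q) :
  pc_d cone_complex e = block_mx (- pc_d X a) (cxh f b) 0 (pc_d Y e).
Proof. by rewrite -[LHS]/(cone_d e) /cone_d (int_eq_irr (e1 e) a) (int_eq_irr (e2 e) b). Qed.

Let e3 p q : p + 0 = q -> p = q :> int. Proof. by rewrite addr0. Qed.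
Let e4 p q : p + -1 = q -> p = q + 1 :> int. Proof. by move=> <-; rewrite subrK. Qed.

Definition cone_j : @dg_hom k Db Y cone_complex 0 :=
  @mk_cx k L Y cone_complex 0 (fun p q e => row_mx 0 (pcast Y (e3 e)))
    (fun p q e => fhom_row_mx (@fhom0 _ _ _ _ _) (pcast_hom Y (e3 e))).
Definition cone_r : @dg_hom k Db cone_complex Y 0 :=
  @mk_cx k L cone_complex Y 0 (fun p q e => col_mx 0 (pcast Y (e3 e)))
    (fun p q e => fhom_col_mx (@fhom0 _ _ _ _ _) (pcast_hom Y (e3 e))).
Definition cone_q : @dg_hom k Db X cone_complex (-1) :=
  @mk_cx k L X cone_complex (-1) (fun p q e => row_mx (pcast X (e4 e)) 0)
    (fun p q e => fhom_row_mx (pcast_hom X (e4 e)) (@fhom0 _ _ _ _ _)).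
Definition cone_p : @dg_hom k Db cone_complex X 1 :=
  @mk_cx k L cone_complex X 1 (fun p q e => col_mx (pcast X e) 0)
    (fun p q e => fhom_col_mx (pcast_hom X e) (@fhom0 _ _ _ _ _)).

Lemma cone_is_cone : @dg_is_cone k Db X Y f cone_complex.
Proof.
have jE p q (e : p + 0 = q) (a : p = q) : cxh (cone_j : cx_hom _ _ 0) e = row_mx 0 (pcast Y a).
  by rewrite (int_eq_irr a (e3 e)).
have rE p q (e : p + 0 = q) (a : p = q) : cxh (cone_r : cx_hom _ _ 0) e = col_mx 0 (pcast Y a).
  by rewrite (int_eq_irr a (e3 e)).
have qE p q (e : p + -1 = q) (a : p = q + 1) : cxh (cone_q : cx_hom _ _ (-1)) e = row_mx (pcast X a) 0.
  by rewrite (int_eq_irr a (e4 e)).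
have pE p q (e : p + 1 = q) : cxh (cone_p : cx_hom _ _ 1) e = col_mx (pcast X e) 0 by [].
exists cone_j, cone_r, cone_q, cone_p; split; [split| |split|].
- apply: cxhP => p q e; have a : p + 0 + 0 = q by clear -e; lia.
  rewrite (cxh_comp _ _ _ e erefl a) (jE _ _ _ (e3 erefl)) (rE _ _ _ (e3 a)).
  by rewrite mul_row_col mul0mx add0r pcastM (cxh_id _ (etrans (e3 erefl) (e3 a))).
- apply: cxhP => p q e; have a : p + -1 + 1 = q by clear -e; lia.
  rewrite (cxh_comp _ _ _ e erefl a) (qE _ _ _ (e4 erefl)) pE.
  by rewrite mul_row_col mul0mx addr0 pcastM (cxh_id _ (etrans (e4 erefl) a)).
- apply: cxhP => p q e; have a : p + -1 + 0 = q by clear -e; lia.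
  rewrite (cxh_comp _ _ _ e erefl a) (qE _ _ _ (e4 erefl)) (rE _ _ _ (e3 a)).
  by rewrite mul_row_col mulmx0 mul0mx addr0.
- apply: cxhP => p q e; have a : p + 0 + 1 = q by clear -e; lia.
  rewrite (cxh_comp _ _ _ e erefl a) (jE _ _ _ (e3 erefl)) pE.
  by rewrite mul_row_col mulmx0 mul0mx addr0.
- apply: cxhP => p q e; have a : p + 0 + 0 = q by clear -e; lia.
  have b : p + 1 + -1 = q by clear -e; lia.
  rewrite cxhD (cxh_comp _ _ _ e erefl a) (cxh_comp _ _ _ e erefl b).
  rewrite (jE _ _ _ (e3 a)) (rE _ _ _ (e3 erefl)) (qE _ _ _ (e4 b)) pE.
  have c : p = q by clear -e; lia.
  rewrite (cxh_id _ c) !mul_col_row !mul0mx !mulmx0 add_block_mx !pcastM.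
  by rewrite !addr0 !add0r; case: q / c e a b => e a b; rewrite !pcast1 -scalar_mx_block.
- apply/cx_closedP => p q r s a b c d; rewrite scale1r.
  have b1 : r + 1 + 1 = q + 1 by clear -b; lia.
  have b2 : r + 1 + 0 = q by clear -b; lia.
  have b3 : p + 1 = q by clear -a b; lia.
  rewrite (jE _ _ _ (e3 a)) (jE _ _ _ (e3 d)) (cone_dE b b1 b2) mul_row_block !mul0mx !add0r.
  by rewrite mulmx0 mul_mx_row mulmx0 (pcast_dl b _ b3) (pcast_dr c _ b3).
- apply/cx_closedP => p q r s a b c d; rewrite expr1z scaleN1r.
  have b1 : p + 1 + 1 = s + 1 by clear -c; lia.
  have b2 : p + 1 + 0 = s by clear -c; lia.
  have b3 : p + 1 + 1 = q by clear -a b; lia.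
  rewrite !pE (cone_dE c b1 b2) mul_block_col mul_col_mx !mulmx0 !mul0mx !addr0 mulNmx.
  by rewrite (pcast_dl b _ b3) (pcast_dr b1 _ b3) opp_col_mx opprK oppr0.
- apply: cxhP => p q e; have a1 : p - 1 + 1 = q by clear -e; lia.
  have a2 : p + 1 - 1 = q by clear -e; lia.
  rewrite (cxh_d (addNr 1) cone_q e erefl a1 erefl a2) exprN1 invrN1 scaleN1r opprK.
  have b1 : p - 1 + 1 + 1 = q + 1 by clear -a1; lia.
  have b2 : p - 1 + 1 + 0 = q by clear -a1; lia.
  rewrite (qE _ _ _ (e4 erefl)) (qE _ _ _ (e4 a2)) (cone_dE a1 b1 b2) mul_row_block !mul0mx !addr0.
  rewrite mul_mx_row mulmx0 add_row_mx addr0 mulmxN.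
  have b3 : p + 1 = q + 1 by clear -e; lia.
  have b4 : p + 0 + 0 = q by clear -e; lia.
  rewrite (pcast_dl b1 _ b3) (pcast_dr erefl _ b3) addNr (pcast_cxl f b2 _ e).
  rewrite (cxh_comp _ _ _ e erefl b4) (jE _ _ _ (e3 b4)) mul_mx_row mulmx0.
  by rewrite (pcast_cxr f erefl _ e).
Qed.
End Cone.

Theorem Db_strongly_pretriangulated : strongly_pretriangulated Db.
Proof.
have sh (X X' Z : Db) (u : dg_hom X X' 0) (v : dg_hom X' X 0) : dg_closed u -> dg_closed v ->
    dg_comp (addr0 0) v u = dg_id X -> dg_comp (addr0 0) u v = dg_id X' ->
    (dg_is_shift X' Z -> dg_is_shift X Z) /\ (dg_is_shift Z X' -> dg_is_shift Z X).
  move=> cu cv vu uv; split=> -[s [t [cs ct ts st]]].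
    exists (dg_comp (addr0 (-1)) s u), (dg_comp (add0r 1) v t); split; try exact: dg_comp_closed.
      by rewrite (dg_comp_mid _ _ _ (addr0 0) _ _ ts).
    by rewrite (dg_comp_mid _ _ _ (addNr 1) _ _ uv).
  exists (dg_comp (add0r (-1)) v s), (dg_comp (addr0 1) t u); split; try exact: dg_comp_closed.
    by rewrite (dg_comp_mid _ _ _ (subrr 1) _ _ uv).
  by rewrite (dg_comp_mid _ _ _ (addr0 0) _ _ st).
have sh0 X := sh X _ _ _ _ (to_shift0_closed X) (of_shift0_closed X) (of_to_shift0 X) (to_of_shift0 X).
split.
- by exists zero_complex; apply: zero_complex_zero.
- by move=> X; exists (shift_complex X 1); apply: (proj1 (sh0 _ X)); apply: shift_is_shift.
- by move=> X; exists (shift_complex X (-1)); apply: (proj2 (sh0 _ X)); apply: shift_is_shift.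
- by move=> X Y f cf; exists (cone_complex cf); apply: cone_is_cone.
Qed.

Lemma thick_shift (Q : Db -> Prop) X n : thick Q -> Q X -> Q (shift_complex X n).
Proof.
move=> thQ QX; have [_ Q2 _ Q4] := thQ.
have Q0 : Q (shift_complex X 0).
  apply: (Q4 (shift_complex X 0 : h0 Db) (X : h0 Db) (exist _ _ (of_shift0_closed X))
    (exist _ _ (to_shift0_closed X))) => //.
  exists 0; rewrite (lin0 (dg_d_linear _)); apply/eqP; rewrite subr_eq0; apply/eqP.
  exact: to_of_shift0.
have step a b : a + 1 = b -> Q (shift_complex X a) <-> Q (shift_complex X b).
  by move=> e; apply: Q2; apply: shift_is_shift.
case: n => m; elim: m => [|m IH] //.
- by apply/(step m%:Z) => //; lia.
- by apply/(step (Negz 0) 0).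
- by apply/(step (Negz m.+1) (Negz m)) => //; rewrite !NegzE; lia.
Qed.

Section SplitIdempotent.
Variables (X : proj_complex L) (e : @dg_hom k Db X X 0).
Hypotheses (ce : dg_closed e) (ee : dg_comp (addr0 0) e e = e).
Let ep p := cxh (e : cx_hom X X 0) (addr0 p).
Let ep_hom p : is_fhom (ep p). Proof. exact: cxh_hom. Qed.
Let epp p : ep p *m ep p = ep p.
Proof.
have := congr1 (fun u : @dg_hom k Db X X 0 => cxh (u : cx_hom X X 0) (addr0 p)) ee.
by rewrite /= (cxh_comp _ _ _ (addr0 p) (addr0 p) (addr0 p)). Qed.
Let epd p q (c : p + 1 = q) : ep p *m pc_d X c = pc_d X c *m ep q.
Proof. exact: (cx_closed0 ce). Qed.
Let r p := im_in (epp p).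
Let s p := im_out (epp p).

Definition im_complex : proj_complex L.
Proof.
exists (fun p => im_mod (ep_hom p) (epp p)) (fun p q c => r p *m pc_d X c *m s q).
- move=> p q c; apply: (fhomM (N := X q)); last exact: im_out_hom.
  by apply: (fhomM (N := X p)); [apply: im_in_hom|apply: pc_d_hom].
- move=> p q t c c'; rewrite -!mulmxA (mulmxA (s q)) im_outK (mulmxA (ep q)) epd.
  by rewrite !mulmxA -(mulmxA (r p)) pc_dd mulmx0 !mul0mx.
- by move=> p; apply: im_projective; apply: pc_projective.
- have [N HN] := pc_bounded_above X; exists N => p /HN X0 /=.
  by apply/eqP; rewrite -leqn0 -X0 rank_leq_row.
- apply: pc_bounded_cohomology_of; have [N HN] := pc_exact_low X.
  exists N => p q t c c' v lt_q v0.
  have [|w wE] := HN _ lt_q _ _ c c' (v *m r q).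
    have -> : v *m r q *m pc_d X c' = v *m (r q *m pc_d X c' *m s t) *m r t.
      by rewrite -!mulmxA im_outK -epd (mulmxA (r q)) im_in_idem.
    by rewrite v0 mul0mx.
  exists (w *m s p); rewrite -!mulmxA (mulmxA (s p)) im_outK (mulmxA (ep p)) epd.
  by rewrite -mulmxA im_out_idem mulmxA -wE -mulmxA im_inK mulmx1.
Defined.

Let i1 p q : p + 0 = q -> p = q :> int. Proof. by rewrite addr0. Qed.
Definition im_complex_in : @dg_hom k Db im_complex X 0 :=
  @mk_cx k L im_complex X 0 (fun p q c => r p *m pcast X (i1 c))
    (fun p q c => fhomM (im_in_hom _ _) (pcast_hom X (i1 c))).
Definition im_complex_out : @dg_hom k Db X im_complex 0 :=
  @mk_cx k L X im_complex 0 (fun p q c => pcast X (i1 c) *m s q)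
    (fun p q c => fhomM (pcast_hom X (i1 c)) (im_out_hom _ _)).

Lemma im_complexP : [/\ dg_closed im_complex_in, dg_closed im_complex_out,
  dg_comp (addr0 0) im_complex_out im_complex_in = dg_id (im_complex : Db) &
  dg_comp (addr0 0) im_complex_in im_complex_out = e].
Proof.
have iE p q (c : p + 0 = q) (a : p = q) : cxh (im_complex_in : cx_hom _ _ 0) c = r p *m pcast X a.
  by rewrite (int_eq_irr a (i1 c)).
have oE p q (c : p + 0 = q) (a : p = q) : cxh (im_complex_out : cx_hom _ _ 0) c = pcast X a *m s q.
  by rewrite (int_eq_irr a (i1 c)).
have dE p q (c : p + 1 = q) : pc_d im_complex c = r p *m pc_d X c *m s q by [].
split.
- apply/cx_closedP => p q u v a b c d; have Eu : u = p by rewrite -a addr0.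
  have Ev : v = q by rewrite -d addr0.
  move: a b c d; rewrite Eu Ev {u v Eu Ev} => a b c d; rewrite scale1r (iE _ _ _ erefl) (iE _ _ _ erefl) dE !pcast1 !mulmx1 (int_eq_irr b c).
  rewrite -!mulmxA im_outK -epd; transitivity (r p *m ep p *m pc_d X c); last by rewrite mulmxA.
  by rewrite im_in_idem.
- apply/cx_closedP => p q u v a b c d; have Eu : u = p by rewrite -a addr0.
  have Ev : v = q by rewrite -d addr0.
  move: a b c d; rewrite Eu Ev {u v Eu Ev} => a b c d; rewrite scale1r (oE _ _ _ erefl) (oE _ _ _ erefl) dE !pcast1 !mul1mx (int_eq_irr b c).
  rewrite !mulmxA im_outK epd; transitivity (pc_d X c *m (ep q *m s q)); first by rewrite mulmxA.
  by rewrite im_out_idem.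
- apply: cxhP => p q c; have a : p + 0 + 0 = q by clear -c; lia.
  rewrite (cxh_comp _ _ _ c (addr0 p) c) (iE _ _ _ erefl) (oE _ _ _ (i1 c)) pcast1 mulmx1.
  move: (i1 c) => E; case: q / E c {a} => c; rewrite (cxh_id _ erefl) pcast1 mul1mx.
  exact: im_inK.
- apply: cxhP => p q c; rewrite (cxh_comp _ _ _ c (addr0 p) c) (oE _ _ _ erefl) (iE _ _ _ (i1 c)).
  rewrite pcast1 mul1mx mulmxA im_outK (pcast_cxr e (addr0 p) (i1 c) c) //.
Qed.
End SplitIdempotent.
End Complexes.

Arguments pcast_dr {k L X p q r} a e b.
Arguments pcast_dl {k L X p q r} a e b.
Arguments cxh_id {k L X p q} e e'.

(** * Contractible and perfect complexes *)

Section Descend.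
Variables (T : int -> Type) (good : forall p, T p -> Prop) (R : forall p, T p -> T (p + 1) -> Prop).
Arguments good {p}.
Arguments R {p}.

(** Dependent choice for downward recursion over the integers. It builds the contractions, the chain
    maps and the Koszul morphisms, all of which are prescribed in high degrees and solved
    downwards. *)
Lemma descend (N : int) (base : forall p, T p) :
  (forall p, N <= p -> good (base p) /\ R (base p) (base (p + 1))) ->
  (forall p (x : T (p + 1)), p < N -> good x -> exists2 y, good y & R y x) ->
  exists f : forall p, T p, [/\ forall p, good (f p), forall p, R (f p) (f (p + 1))
    & forall p, N <= p -> f p = base p].
Proof.
move=> Hbase Hstep.
(* The step is made total, with the junk value [base p] outside its hypotheses, so that one choice
   function serves for all p. *)
have Hs p (x : T (p + 1)) : exists y, p < N -> good x -> good y /\ R y x.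
  case: (boolP (p < N)) => [lt_p|_]; last by exists (base p).
  case: (pselect (good x)) => [gx|ngx]; last by exists (base p).
  by have [y gy Ry] := Hstep _ _ lt_p gx; exists y.
pose s p x := sval (boolp.cid (Hs p x)).
have sP p x : p < N -> good x -> good (s p x) /\ R (s p x) x by exact: (svalP (boolp.cid (Hs p x))).
pose F := fix F n p : T p := if n is n'.+1 then s p (F n' (p + 1)) else base p.
(* The number of steps from N down to p, and 0 at or above N. *)
pose m p := if N - p is Posz n then n else 0%N.
have mS p : p < N -> m p = (m (p + 1)).+1.
  rewrite /m => lt_p; case E : (N - p) => [a|a]; case E' : (N - (p + 1)) => [b|b]; move: E E' => /=; lia.
have m0 p : N <= p -> m p = 0%N.
  by rewrite /m => le_p; case E : (N - p) => [a|a] //; lia.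
have gF p : good (F (m p) p).
  move E : (m p) => n; elim: n p E => [|n IH] p E.
    by apply: (proj1 (Hbase _ _)); case: (leP N p) => // /mS; rewrite E.
  have lt_p : p < N by case: (leP N p) => // /m0; rewrite E.
  by apply: (proj1 (sP _ _ _ _)) => //; apply: IH; move: (mS _ lt_p); rewrite E => -[].
exists (fun p => F (m p) p); split=> // [p|p le_p]; last by rewrite m0.
case: (leP N p) => [le_p|lt_p].
  by rewrite !m0 //; [exact: (proj2 (Hbase _ le_p))|lia].
by rewrite (mS p) //; apply: (proj2 (sP _ _ _ _)).
Qed.
End Descend.

Section DiagonalMaps.
Variables (k : fieldType) (L : falgType k).
Local Notation Db := (Db_dgcat L).
Implicit Types X Y : proj_complex L.

Section Diag.
Variables (X Y : proj_complex L) (E : forall p, 'M[k]_(fm_dim (X p), fm_dim (Y p))).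
Hypothesis E_hom : forall p, is_fhom (M := X p) (N := Y p) (E p).
Let a0 p q : p + 0 = q -> p = q :> int. Proof. by rewrite addr0. Qed.
Definition diag_cx : @dg_hom k Db X Y 0 :=
  @mk_cx k L X Y 0 (fun p q e => pcast X (a0 e) *m E q)
    (fun p q e => fhomM (pcast_hom X (a0 e)) (E_hom q)).
Lemma diag_cxE p (e : p + 0 = p) : cxh (diag_cx : cx_hom X Y 0) e = E p.
Proof. by rewrite -[LHS]/(pcast X (a0 e) *m E p) pcast1 mul1mx. Qed.
Lemma diag_cx_closed :
  (forall p q (e : p + 1 = q), E p *m pc_d Y e = pc_d X e *m E q) -> dg_closed diag_cx.
Proof.
move=> H; apply/cx_closedP => p q r s a b c d; rewrite scale1r.
have Er : r = p by rewrite -a addr0.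
have Es : s = q by rewrite -d addr0.
move: a b c d; rewrite Er Es => a b c d; rewrite !diag_cxE (int_eq_irr b c); exact: H.
Qed.
End Diag.

Lemma cx_deg0P X Y (f g : @dg_hom k Db X Y 0) :
  (forall p, cxh (f : cx_hom X Y 0) (addr0 p) = cxh (g : cx_hom X Y 0) (addr0 p)) -> f = g.
Proof.
move=> E; apply: cxhP => p q e; have Eq : q = p by rewrite -e addr0.
by move: e; rewrite Eq => e; rewrite (int_eq_irr e (addr0 p)).
Qed.
Lemma cxh_id0 X p (e : p + 0 = p) : cxh (dg_id (X : Db) : cx_hom X X 0) e = 1%:M.
Proof. by rewrite (cxh_id e erefl). Qed.
Lemma cxh_comp0 X Y Z (g : @dg_hom k Db Y Z 0) (f : @dg_hom k Db X Y 0) p (e : p + 0 = p) :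
  cxh (dg_comp (addr0 0) g f : cx_hom X Z 0) e = cxh (f : cx_hom X Y 0) e *m cxh (g : cx_hom Y Z 0) e.
Proof. exact: cxh_comp. Qed.
End DiagonalMaps.

Section Contraction.
Variables (k : fieldType) (L : falgType k).
Local Notation Db := (Db_dgcat L).

Lemma cx_contractibleP (X : proj_complex L) (h : forall p, 'M[k]_(fm_dim (X (p + 1)), fm_dim (X p))) :
  (forall p, is_fhom (M := X (p + 1)) (N := X p) (h p)) ->
  (forall p, h p *m pc_d X (erefl (p + 1)) + pc_d X (erefl (p + 1 + 1)) *m h (p + 1) = 1%:M) ->
  @contractible k Db X.
Proof.
move=> Hh hE; have a1 p q : p + -1 = q -> p = q + 1 :> int by move=> <-; rewrite subrK.
pose H : @dg_hom k Db X X (-1) := @mk_cx k L X X (-1) (fun p q e => pcast X (a1 p q e) *m h q)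
  (fun p q e => fhomM (pcast_hom X (a1 p q e)) (Hh q)).
have HE p q (e : p + -1 = q) (a : p = q + 1) : cxh (H : cx_hom X X (-1)) e = pcast X a *m h q.
  by rewrite (int_eq_irr a (a1 _ _ e)).
exists H; apply: cx_deg0P => q; rewrite cxh_id0; have [p pE] : exists p, p + 1 = q by exists (q - 1); rewrite subrK.
subst q; have b1 : p + 1 + -1 = p by rewrite addrK.
have b2 : p + 1 + 1 + -1 = p + 1 by rewrite addrK.
rewrite (cxh_d _ _ _ b1 erefl erefl b2) exprN1 invrN1 scaleN1r opprK (HE _ _ _ erefl) (HE _ _ _ erefl).
by rewrite !pcast1 !mul1mx hE.
Qed.

(** The usual construction of a contraction of an exact right bounded complex of projectives, from
    the top downwards. *)
Lemma exact_contractible (X : proj_complex L) : (forall q, exact_at X q) -> @contractible k Db X.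
Proof.
move=> exX; have [N HN] := pc_bounded_above X.
pose d p := pc_d X (erefl (p + 1)).
pose T p := 'M[k]_(fm_dim (X (p + 1)), fm_dim (X p)).
(* The condition d h d = d is what the next step needs: it places 1 - d h in the kernel of d, hence
   by exactness in the image of the preceding differential. *)
pose good p (h : T p) := is_fhom (M := X (p + 1)) (N := X p) h /\ d p *m h *m d p = d p.
pose R p (h : T p) (h' : T (p + 1)) := h *m d p + d (p + 1) *m h' = 1%:M.
have dd p : d p *m d (p + 1) = 0 by exact: pc_dd.
have [||h [gh Rh _]] := @descend T good R N (fun p => 0).
- move=> p le_p; have X1 : fm_dim (X (p + 1)) = 0%N by apply: HN; lia.
  by split; [split; [exact: fhom0|apply: (dim0_mxr _ _ X1)]|apply: (dim0_mxr _ _ X1)].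
- move=> p h lt_p [Hh hE]; pose g := 1%:M - d (p + 1) *m h.
  have Hg : is_fhom (M := X (p + 1)) (N := X (p + 1)) g.
    by apply: fhomB; [exact: fhom1|apply: fhomM Hh; exact: pc_d_hom].
  have gd : (g <= d p)%MS.
    have K : (kermx (d (p + 1)%R) <= d p)%MS by apply/(exact_atP X _ _); apply: exX.
    apply: submx_trans K.
    by apply/sub_kermxP; rewrite mulmxBl mul1mx hE subrr.
  have [y Hy yE] := proj_lift (@pc_projective _ _ X (p + 1)) (@pc_d_hom _ _ X _ _ (erefl (p + 1))) Hg gd.
  exists y; last by rewrite /R yE subrK.
  by split=> //; rewrite -mulmxA yE mulmxBr mulmx1 mulmxA dd mul0mx subr0.
by apply: (cx_contractibleP (h := h)) => p; [have [] := gh p|exact: Rh].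
Qed.
End Contraction.

Section Perfect.
Variables (k : fieldType) (L : falgType k).
Local Notation Db := (Db_dgcat L).

(* A complex is perfect if and only if its identity is homotopic to such a morphism. *)
Definition low_subspace (W : Db) (Z : Db) i : subspace (@mod_ob k Db (yoneda W) Z i).
Proof.
exists (fun f => exists N : int, forall p q (e : p + i = q), p < N -> cxh (f : cx_hom Z W i) e = 0).
  by exists 0.
move=> a u v [N uN] [N' vN]; exists (Num.min N N') => p q e; rewrite lt_min => /andP[lt1 lt2].
by rewrite cxh_zd uN // vN // scaler0 addr0.
Defined.

Lemma low_subspace_act (W X Y : Db) i j l (e : i + j = l) (m : @mod_ob k Db (yoneda W) Y i)
    (f : dg_hom X Y j) :
  low_subspace W Y i m -> low_subspace W X l (mod_act e m f).
Proof.
move=> [N HN]; exists (N - j) => p q ep lt_p; have b : p + j + i = q by clear -e ep; lia.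
by rewrite (cxh_comp e m f ep erefl b) HN ?mulmx0 //; clear -lt_p; lia.
Qed.

Section Truncation.
Variables (X : proj_complex L) (h : @dg_hom k Db X X (-1)) (p0 : int).
Hypothesis hE : forall p q r (a : p + 1 = q) (b : q + 1 = r) (c : q + -1 = p) (d : r + -1 = q),
  p <= p0 -> cxh (h : cx_hom X X (-1)) c *m pc_d X a + pc_d X b *m cxh (h : cx_hom X X (-1)) d = 1%:M.
Let b1 q : q + 1 + -1 = q :> int. Proof. by clear; lia. Qed.

(** X is contracted by h up to degree p0 + 1. In degree p0 the map d h is idempotent and projects
    along the kernel of d; with 1 above and 0 below it gives a chain idempotent homotopic to the
    identity, whose image is bounded. *)
Definition trunc_idem q : 'M[k]_(fm_dim (X q)) :=
  if p0 < q then 1%:M else if q == p0 then pc_d X (erefl (q + 1)) *m cxh (h : cx_hom X X (-1)) (b1 q) else 0.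
Lemma trunc_idem_hom q : is_fhom (M := X q) (N := X q) (trunc_idem q).
Proof.
rewrite /trunc_idem; case: ifP => _; first exact: fhom1; case: ifP => _; last exact: fhom0.
by apply: fhomM; [apply: pc_d_hom|apply: cxh_hom].
Qed.
Let dhd q r (b : q + 1 = r) (d : r + -1 = q) : q <= p0 ->
  pc_d X b *m cxh (h : cx_hom X X (-1)) d *m pc_d X b = pc_d X b.
Proof.
move=> le_q; have a : r + 1 + -1 = r by rewrite addrK.
have := hE b erefl d a le_q; move/(congr1 (fun m => pc_d X b *m m)).
by rewrite mulmxDr !mulmxA pc_dd mul0mx addr0 mulmx1.
Qed.

Lemma trunc_idem_d p q (e : p + 1 = q) : trunc_idem p *m pc_d X e = pc_d X e *m trunc_idem q.
Proof.
rewrite /trunc_idem; case: (ltgtP p0 p) => [lt_p|lt_p|Ep].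
- by rewrite (_ : p0 < q) ?mul1mx ?mulmx1 //; clear -lt_p e; lia.
- rewrite (_ : p0 < q = false); last by clear -lt_p e; lia.
  by rewrite mul0mx; case: ifP => _; rewrite ?mulmx0 // mulmxA pc_dd mul0mx.
- rewrite (_ : p0 < q) ?mulmx1; last by clear -Ep e; lia.
  by subst q; rewrite dhd // Ep.
Qed.
Lemma trunc_idem_idem q : trunc_idem q *m trunc_idem q = trunc_idem q.
Proof.
rewrite /trunc_idem; case: (ltgtP p0 q) => [_|_|Eq]; rewrite ?mul1mx ?mulmx0 //.
by rewrite mulmxA dhd // Eq.
Qed.
Definition trunc_cx : @dg_hom k Db X X 0 := diag_cx trunc_idem_hom.
Lemma trunc_cx_closed : dg_closed trunc_cx.
Proof. by apply: diag_cx_closed => p q e; apply: trunc_idem_d. Qed.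
Lemma trunc_cx_idem : dg_comp (addr0 0) trunc_cx trunc_cx = trunc_cx.
Proof. by apply: cx_deg0P => p; rewrite cxh_comp0 diag_cxE trunc_idem_idem. Qed.
Lemma trunc_cx_homotopic : dg_homotopic (dg_id (X : Db)) trunc_cx.
Proof.
have Hh p q (e : p + -1 = q) : is_fhom (M := X p) (N := X q)
    (if p <= p0 then cxh (h : cx_hom X X (-1)) e else 0).
  by case: ifP => _; [exact: cxh_hom|exact: fhom0].
exists (@mk_cx k L X X (-1) _ Hh); apply: cx_deg0P => q.
have a : q - 1 + 1 = q by rewrite subrK.
rewrite cxhB cxh_id0 diag_cxE (cxh_d _ _ _ erefl a erefl (b1 q)) exprN1 invrN1 scaleN1r opprK.
rewrite -[cxh (mk_cx _) erefl]/(if q <= p0 then cxh (h : cx_hom X X (-1)) (erefl (q + -1)) else 0).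
rewrite -[cxh (mk_cx _) (b1 q)]/(if q + 1 <= p0 then cxh (h : cx_hom X X (-1)) (b1 q) else 0).
rewrite /trunc_idem; case: (ltgtP p0 q) => [lt_q|lt_q|Eq].
- by rewrite subrr mul0mx add0r (_ : (q + 1 <= p0) = false) ?mulmx0 //; clear -lt_q; lia.
- rewrite subr0 (_ : (q + 1 <= p0)) ?hE //; clear -lt_q; lia.
- have le_q : q - 1 <= p0 by rewrite Eq; lia.
  have := hE a erefl erefl (b1 q) le_q; move=> <-.
  by rewrite addrK (_ : (q + 1 <= p0) = false) ?mulmx0 ?addr0 //; clear -Eq; lia.
Qed.
End Truncation.

(** Bounded complexes satisfy the condition trivially and homotopy retracts inherit it. Conversely,
    applied to the identity of X it gives a homotopy contracting X in low degrees, and [trunc_cx]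
    cuts off that part. *)
Lemma perfectP (X : Db) : perfect X <-> forall W, acyclic_mod (low_subspace W) X.
Proof.
split=> [[Y [N HN] [s [t [ts st]]]] W|H].
  have [g gE] := ts.
  apply: (acyclic_mod_retract (@low_subspace_act W) (eab := addr0 0) (svalP t) (svalP s) gE).
  move=> h i j e' e m _; exists 0; exists N => p q ep lt_p; apply: dim0_mx; exact: HN.
have := H X (-1) 0 1 (addNr 1) (add0r 1) (dg_id X).
case=> [|h]; first by exists 0 => p q e _; rewrite -[mod_d _ _]/(dg_d (add0r 1) (dg_id X)) dg_id_closed.
(* Degrees q < N are contracted, and [hE] concerns q = p + 1 for p <= p0. *)
move=> [N hN]; pose p0 := N - 2.
have hE p q r (a : p + 1 = q) (b : q + 1 = r) (c : q + -1 = p) (d : r + -1 = q) : p <= p0 ->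
    cxh (h : cx_hom X X (-1)) c *m pc_d X a + pc_d X b *m cxh (h : cx_hom X X (-1)) d = 1%:M.
  move=> le_p; have lt_q : q < N by move: le_p; rewrite /p0; clear -a; lia.
  have := hN q q (addr0 q) lt_q; rewrite cxhB cxh_id0 (cxh_d _ _ _ c a b d).
  by rewrite exprN1 invrN1 scaleN1r opprK => /eqP; rewrite subr_eq0 => /eqP.
have ci := trunc_cx_closed hE; have ii := trunc_cx_idem hE.
exists (im_complex ci ii).
  exists p0 => p lt_p; apply/eqP; rewrite -[fm_dim _]/(\rank _) mxrank_eq0 diag_cxE /trunc_idem.
  by case: ltgtP lt_p.
have [cin cout oi io] := im_complexP ci ii.
exists (exist _ _ cout), (exist _ _ cin); split.
  rewrite -[_ =c _]/(dg_homotopic (dg_comp (addr0 0) _ _) (dg_id (X : Db))) io.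
  by apply: dg_homotopic_sym; apply: trunc_cx_homotopic hE.
rewrite -[_ =c _]/(dg_homotopic (dg_comp (addr0 0) _ _) (dg_id (im_complex ci ii : Db))) oi.
exact: dg_homotopic_refl.
Qed.

Theorem thick_perfect : thick (@perfect k L).
Proof.
rewrite (_ : @perfect k L = fun X => forall W, acyclic_mod (low_subspace W) X).
  by apply: thick_forall => W; apply: thick_acyclic_mod; apply: low_subspace_act.
by apply: funext => X; apply: propext; apply: perfectP.
Qed.

Lemma perfect_of_bounded (X : Db) : pc_bounded X -> perfect X.
Proof.
by move=> bX; exists X => //; exists (cid (X : h0 Db)); apply: is_iso_id.
Qed.
End Perfect.

(** * Generating the derived category *)

Section ConeTarget.
Variables (k : fieldType) (A : dgcat k).
Implicit Types X Y Z : A.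

Lemma dg_d_comp_closed X Y Z i j l i' l' (e : i + j = l) (ei : i + 1 = i') (el : l + 1 = l')
    (e1 : i' + j = l') (g : dg_hom Y Z i) (f : dg_hom X Y j) :
  dg_closed f -> dg_d el (dg_comp e g f) = dg_comp e1 (dg_d ei g) f.
Proof. exact: (@mod_d_act_closed k A (yoneda Z)). Qed.

Lemma dg_closed0 X Y i : dg_closed (0 : dg_hom X Y i).
Proof. by move=> j e; rewrite (lin0 (dg_d_linear _)). Qed.

Variable Q : A -> Prop.
Hypotheses (prA : strongly_pretriangulated A) (thQ : thick Q).

Lemma thick_strict_retract X Y (i : dg_hom X Y 0) (r : dg_hom Y X 0) :
  dg_closed i -> dg_closed r -> dg_comp (addr0 0) r i = dg_id X -> Q Y -> Q X.
Proof.
move=> ci cr ri QY; have [_ _ _ Q4] := thQ.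
apply: (Q4 (X : h0 A) (Y : h0 A) (exist _ i ci) (exist _ r cr)) => //.
by rewrite /= /ceq /= /h0_eq /= ri; apply: dg_homotopic_refl.
Qed.

Lemma thick_contractible_mem X : contractible X -> Q X.
Proof.
move=> [h hE]; have [[O O0] _ _ _] := prA; have [Q1 _ _ Q4] := thQ.
apply: (Q4 (X : h0 A) (O : h0 A) (exist _ 0 (@dg_closed0 X O 0)) (exist _ 0 (@dg_closed0 O X 0))).
  by exists (- h); rewrite /= dg_comp0l sub0r (linN (dg_d_linear _)) hE.
exact: Q1.
Qed.

(* Y is a retract of the cone of Z[-1] -> X. *)
Lemma thick_cone_target X Y Z (f : dg_hom X Y 0) :
  dg_closed f -> dg_is_cone f Z -> Q X -> Q Z -> Q Y.
Proof.
move=> cf [j [r [q [p [[rj pq rq pj] E [cj cp] dq]]]]] QX QZ.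
have [_ _ shA coneA] := prA; have [_ Q2 Q3 _] := thQ.
have [W0 sh] := shA Z; have QW0 : Q W0 by apply/(Q2 _ _ sh).
have [s [t [cs ct ts st]]] := sh.
pose g : dg_hom W0 X 0 := dg_comp (subrr 1) p s.
have cg : dg_closed g by apply: dg_comp_closed.
have [W co] := coneA _ _ g cg; have QW := Q3 _ _ _ _ cg co QW0 QX.
case: co => j' [r' [q' [p' [[rj' pq' rq' pj'] E' [cj' cp'] dq']]]].
have dr := cone_d_retraction rj rq E cj dq; have dr' := cone_d_retraction rj' rq' E' cj' dq'.
pose u : dg_hom Y W 0 := dg_comp (addr0 0) (dg_comp (addNr 1) q' t) j.
pose v : dg_hom W Y 0 := dg_comp (addr0 0) r (dg_comp (addNr 1) s p') - dg_comp (addr0 0) f r'.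
apply: (thick_strict_retract (i := u) (r := v)) QW.
- apply: (@dg_closedP _ _ _ _ _ _ (add0r 1)).
  rewrite (dg_d_comp_closed _ (add0r 1) _ (addr0 1)) // (dg_d_comp_closed _ (addNr 1) _ (add0r 1)) //.
  rewrite dq' (dg_compA (addr0 0) (add0r 1) (add0r 1) (add0r 1)).
  rewrite (dg_compA (subrr 1) (add0r 1) (addNr 1) (addr0 1)) st dg_comp1r.
  by rewrite (dg_compA (add0r 1) (addr0 1) (addr0 1) (add0r 1)) pj dg_comp0r.
- apply: (@dg_closedP _ _ _ _ _ _ (add0r 1)).
  have csp : dg_closed (dg_comp (addNr 1) s p') by apply: dg_comp_closed.
  rewrite (linB (dg_d_linear _)) (dg_d_comp_closed _ (add0r 1) _ (addr0 1)) // dr.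
  rewrite (dg_leibniz _ (add0r 1) (add0r 1) _ (addr0 1) (add0r 1)) cf dg_comp0l add0r expr0z scale1r.
  rewrite dr' (linN (dg_comp_linear_r _ _)) (linN (dg_comp_linear_l _ _)) opprK.
  rewrite (dg_compA (add0r 1) (addr0 1) (addr0 1) (add0r 1)).
  by rewrite (dg_compA (subrr 1) (add0r 1) (addNr 1) (addr0 1)) addNr.
rewrite (linB (dg_comp_linear_l _ _)).
rewrite (dg_compA (addr0 0) (addr0 0) (addr0 0) (addr0 0) f).
rewrite -(dg_compA (addr0 0) (addr0 0) (addr0 0) (addr0 0) r').
rewrite -(dg_compA (add0r (-1)) (addNr 1) (addNr 1) (addr0 0) r') rq'.
rewrite !dg_comp0l dg_comp0r subr0 (dg_compA (addr0 0) (addr0 0) (addr0 0) (addr0 0) r).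
rewrite -(dg_compA (addr0 0) (addr0 0) (addr0 0) (addr0 0) (dg_comp _ s p')).
have -> : dg_comp (addr0 0) (dg_comp (addNr 1) s p') (dg_comp (addNr 1) q' t) = dg_id Z.
  by rewrite (dg_comp_mid _ _ _ (addNr 1) _ _ pq').
by rewrite dg_comp1l rj.
Qed.
End ConeTarget.

(** Lets the generation results, which are stated for all complexes, be used inside the full
    subcategory of perfect ones. *)
Lemma thick_full_extend (k : fieldType) (A : dgcat k) (P : A -> Prop) (Q : full_dgcat P -> Prop) :
  thick P -> thick Q -> thick (fun X => exists PX : P X, Q (exist _ X PX)).
Proof.
move=> [P1 P2 P3 P4] [Q1 Q2 Q3 Q4]; split=> [Z Z0|X Z s|X Y f Z cf co [PX QX] [PY QY]|X Y i r ri [PY QY]].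
- by exists (P1 _ Z0); apply: Q1.
- split=> -[PX QX].
    have PZ : P Z by apply/(P2 _ _ s).
    by exists PZ; apply/(Q2 (exist _ X PX) (exist _ Z PZ)).
  have PX' : P X by apply/(P2 _ _ s).
  by exists PX'; apply/(Q2 (exist _ X PX') (exist _ Z PX)).
- have PZ := P3 _ _ _ _ cf co PX PY; exists PZ.
  exact: (Q3 (exist _ X PX) (exist _ Y PY) f (exist _ Z PZ)).
- have PX := P4 _ _ _ _ ri PY; exists PX.
  exact: (Q4 (exist _ X PX : h0 (full_dgcat P)) (exist _ Y PY : h0 (full_dgcat P)) i r).
Qed.

Section Generation.
Variables (k : fieldType) (L : falgType k).
Local Notation Db := (Db_dgcat L).

(* The cone of f kills a cohomology class in the lowest degree and creates none. *)
Lemma generation_step (X Y : proj_complex L) a (f : @dg_hom k Db X Y 0) (cf : dg_closed f)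
    p (e : p + 1 = a) (x : 'rV_(fm_dim (X a))) :
  (forall q, a < q -> fm_dim (X q) = 0%N) -> (forall q, q < a -> exact_at X q) ->
  (forall q, q < a -> exact_at Y q) ->
  ~~ (x *m cxh (f : cx_hom X Y 0) (addr0 a) <= pc_d Y e)%MS ->
  (forall x' : 'rV_(fm_dim (X a)), (x' *m cxh (f : cx_hom X Y 0) (addr0 a) <= pc_d Y e)%MS ->
    (x' <= pc_d X e)%MS) ->
  let Z := cone_complex cf in
  [/\ forall q, q < a -> exact_at Z q, fm_dim (Z a) = fm_dim (Y a),
      (\rank (pc_d Y e) < \rank (pc_d Z e))%N & forall q, a < q -> fm_dim (Z q) = fm_dim (Y q)].
Proof.
move=> X0 exX exY xf inj Z.
have X0' q : a <= q -> fm_dim (X (q + 1)) = 0%N by move=> le_q; apply: X0; lia.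
have ZY q : a <= q -> fm_dim (Z q) = fm_dim (Y q) by move=> le_q; rewrite /= X0'.
split=> [q lt_q|||q lt_q]; first 1 last.
- exact: ZY.
- move: x xf inj X0' ZY {X0 exX exY}; rewrite /Z {Z}; case: a / e => x xf inj X0' ZY.
  have b1 : p + 1 + 1 = p + 1 + 1 by [].
  rewrite (cone_dE cf erefl b1 (addr0 _)).
  have Yf : (pc_d Y (erefl (p + 1)%R) < col_mx (cxh (f : cx_hom X Y 0) (addr0 (p + 1)%R)) (pc_d Y (erefl (p + 1)%R)))%MS.
    rewrite ltmxE -addsmxE addsmxSr /=; apply: contra xf; rewrite col_mx_sub => /andP[le_f _].
    exact: submx_trans (submxMl _ _) le_f.
  apply: leq_trans (rank_ltmx Yf) _; rewrite block_mxEv.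
  set D := col_mx (row_mx _ _) _; suff <- : D *m col_mx 0 1%:M = col_mx (cxh (f : cx_hom X Y 0) (addr0 (p + 1))) (pc_d Y (erefl (p + 1))).
    exact: mxrankM_maxl.
  by rewrite /D mul_col_mx !mul_row_col !mulmx0 !mulmx1 !add0r.
- by apply: ZY; apply: ltW.
move=> t r et er v; have lt_q' : q + 1 <= a by clear -lt_q; lia.
have b1 : t + 1 + 1 = q + 1 by rewrite et.
have b2 : t + 1 + 0 = q by rewrite et addr0.
have b3 : q + 1 + 1 = r + 1 by rewrite er.
have b4 : q + 1 + 0 = r by rewrite er addr0.
rewrite (cone_dE cf er b3 b4) (cone_dE cf et b1 b2).
rewrite -[v](@hsubmxK _ 1 (fm_dim (X (q + 1))) (fm_dim (Y q))).
move: (lsubmx _) (rsubmx _) => {v} u y; rewrite mul_row_block mulmx0 addr0 mulmxN.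
rewrite -[X in _ = X](@row_mx0 _ 1) => /eq_row_mx[/eqP + uy]; rewrite oppr_eq0 => /eqP ud.
have [u' u'E] : exists w, u = w *m pc_d X b1.
  case: (ltgtP (q + 1) a) lt_q' => // [lt_q1|q1a] _; first exact: (exX _ lt_q1 _ _ b1 b3 _ ud).
  have Ep : p = q by clear -e q1a; lia.
  move: x xf inj {exX exY X0 X0' ZY Z lt_q}; move: e; rewrite Ep; case: a / q1a => e x _ inj.
  have /submxP[w wE] : (u <= pc_d X e)%MS.
    apply: inj; apply/submxP; exists (- y); rewrite mulNmx; apply/eqP; rewrite -addr_eq0; apply/eqP.
    have Er := er; move: er b4 uy; rewrite -Er => er b4; by rewrite (int_eq_irr b4 (addr0 _)) (int_eq_irr er e).
  by exists (w *m pcast X (esym et)); rewrite -mulmxA (pcast_dl b1 _ e).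
have [|y' y'E] := exY _ lt_q _ _ et er (u' *m cxh (f : cx_hom X Y 0) b2 + y).
  by rewrite mulmxDl -mulmxA (cx_closed0 cf b2 er b1 b4) mulmxA -u'E uy.
exists (row_mx (- u') y'); rewrite mul_row_block mulmx0 addr0 mulNmx mulmxN opprK -u'E.
by rewrite -y'E mulNmx addKr.
Qed.

(** Two nested inductions: on the number of degrees that may carry cohomology, and on the corank of
    the differential into the lowest of them. Each cone raises that rank without changing the
    dimensions in this degree and above. *)
Theorem generation (Q : Db -> Prop) : thick Q ->
  (forall (Y : proj_complex L) p a (e : p + 1 = a) (v : 'rV_(fm_dim (Y a))),
    (forall q, q < a -> exact_at Y q) ->
    (forall r (e' : a + 1 = r), v *m pc_d Y e' = 0) -> ~~ (v <= pc_d Y e)%MS ->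
    exists (X : proj_complex L) (f : @dg_hom k Db X Y 0) (x : 'rV_(fm_dim (X a))),
    [/\ dg_closed f, Q X,
      (forall q, a < q -> fm_dim (X q) = 0%N) /\ (forall q, q < a -> exact_at X q),
      ~~ (x *m cxh (f : cx_hom X Y 0) (addr0 a) <= pc_d Y e)%MS &
      forall x' : 'rV_(fm_dim (X a)), (x' *m cxh (f : cx_hom X Y 0) (addr0 a) <= pc_d Y e)%MS ->
        (x' <= pc_d X e)%MS]) ->
  forall Y, Q Y.
Proof.
move=> thQ gen Y; have prD := @Db_strongly_pretriangulated k L.
have [N HN] := pc_bounded_above Y; have [M HM] := pc_exact_low Y.
suff [n nE] : exists n : nat, N - n%:Z + 1 <= M.
  suff H m : forall (Z : proj_complex L), (forall q, N < q -> fm_dim (Z q) = 0%N) ->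
      (forall q, q < N - m%:Z + 1 -> exact_at Z q) -> Q Z.
    by apply: (H n) => // q lt_q; apply: HM; apply: lt_le_trans nE.
  elim: m => [|m IH] Z HZ exZ.
    apply: (@thick_contractible_mem k Db Q prD thQ); apply: exact_contractible => q p r e e' v v0.
    have [le_q|lt_q] := leP q N; first by apply: (exZ q _ p r e e' v v0); clear -le_q; lia.
    by exists 0; apply: dim0_mxr; apply: HZ.
  pose p := N - m%:Z - 1; pose a := N - m%:Z; have e : p + 1 = a by rewrite subrK.
  have {}exZ q : q < a -> exact_at Z q by rewrite /a => lt_q; apply: exZ; clear -lt_q; lia.
  (* The measure of the inner induction; [generation_step] makes it drop. *)
  move Ec : (fm_dim (Z a) - \rank (pc_d Z e))%N => c.
  elim/ltn_ind: c Z HZ exZ Ec => c IHc Z HZ exZ Ec.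
  have [exa|nex] := pselect (exact_at Z a).
    apply: IH => // q lt_q; have [lt_qa|le_aq] := ltP q a; first exact: exZ.
    by have -> : q = a by clear -lt_q le_aq; rewrite /a in le_aq *; lia.
  have [v [v0 nv]] : exists v : 'rV_(fm_dim (Z a)),
      (forall r (e' : a + 1 = r), v *m pc_d Z e' = 0) /\ ~~ (v <= pc_d Z e)%MS.
    apply: contrapT => nv; apply: nex => p' r e1 e2 v v0.
    have Ep : p' = p by clear -e e1; lia.
    subst p'; suff /submxP[w ->] : (v <= pc_d Z e1)%MS by exists w.
    rewrite (int_eq_irr e1 e); apply: contrapT => /negP nve; apply: nv; exists v; split=> // r' e3.
    have Er : r = r' by [rewrite -e2]; move: e3; rewrite -Er => e3; by rewrite (int_eq_irr e3 e2).
  have [X [f [x [cf QX [X0 exX] xf inj]]]] := gen Z p a e v exZ v0 nv.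
  have [ex1 d1 d2 d3] := generation_step cf X0 exX exZ xf inj.
  apply: (thick_cone_target prD thQ cf (cone_is_cone cf) QX).
  apply: (IHc _ _ _ _ _ erefl) => //.
    by move: (rank_leq_col (pc_d (cone_complex cf) e)) d1 d2 Ec; clear; lia.
  move=> q lt_q; rewrite d3 ?HZ //; apply: le_lt_trans lt_q; rewrite /a; clear; lia.
case: (leP N M) => le_NM; first by exists 1%N; lia.
exists (absz (N - M + 1)); lia.
Qed.
End Generation.


(** * Bounded complexes *)

Section Bounded.
Variables (k : fieldType) (L : falgType k).
Local Notation Db := (Db_dgcat L).
Local Notation fmodR := (fmod L right_side).

Section Mask.
Variables (c : bool) (M : fmodR).
(** M or zero, uniformly in the condition: brutal truncations and stalk complexes are then given by
    one formula in all degrees. *)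
Definition mask_mod : fmodR := if c then M else zero_fmod L.
Definition mask_in : 'M[k]_(fm_dim mask_mod, fm_dim M) :=
  if c as c return 'M[k]_(fm_dim (if c then M else zero_fmod L), fm_dim M) then 1%:M else 0.
Definition mask_out : 'M[k]_(fm_dim M, fm_dim mask_mod) :=
  if c as c return 'M[k]_(fm_dim M, fm_dim (if c then M else zero_fmod L)) then 1%:M else 0.
Lemma mask_in_hom : is_fhom mask_in.
Proof. by rewrite /mask_in /mask_mod; case: c; [exact: fhom1|exact: fhom0]. Qed.
Lemma mask_out_hom : is_fhom mask_out.
Proof. by rewrite /mask_out /mask_mod; case: c; [exact: fhom1|exact: fhom0]. Qed.
Lemma mask_inK : mask_in *m mask_out = 1%:M.
Proof. by rewrite /mask_in /mask_out /mask_mod; case: c; [exact: mulmx1|exact: dim0_mx]. Qed.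
Lemma mask_outK : mask_out *m mask_in = if c then 1%:M else 0.
Proof. by rewrite /mask_in /mask_out /mask_mod; case: c; [exact: mulmx1|exact: mulmx0]. Qed.
Lemma mask_in0 : ~~ c -> mask_in = 0.
Proof. by rewrite /mask_in /mask_mod; case: c. Qed.
Lemma mask_out0 : ~~ c -> mask_out = 0.
Proof. by rewrite /mask_out /mask_mod; case: c. Qed.
Lemma mask_projective : fm_projective M -> fm_projective mask_mod.
Proof. by rewrite /mask_mod; case: c => // _; apply: fm_projective_dim0. Qed.
Lemma mask_dim0 : ~~ c \/ fm_dim M = 0%N -> fm_dim mask_mod = 0%N.
Proof. by rewrite /mask_mod; case: c => // -[]. Qed.
End Mask.
Arguments mask_in {c M}.
Arguments mask_out {c M}.

Section Band.
Variables (Y : proj_complex L) (bY : pc_bounded Y) (c : pred int).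
Definition band_d p q (e : p + 1 = q) : 'M[k]_(fm_dim (mask_mod (c p) (Y p)), fm_dim (mask_mod (c q) (Y q))) :=
  mask_in *m pc_d Y e *m mask_out.
Definition band : proj_complex L.
Proof.
exists (fun p => mask_mod (c p) (Y p)) band_d.
- move=> p q e; apply: (fhomM (N := Y q)); last exact: mask_out_hom.
  by apply: (fhomM (N := Y p)); [exact: mask_in_hom|exact: pc_d_hom].
- move=> p q r e e'; rewrite /band_d -!mulmxA (mulmxA mask_out) mask_outK.
  by case: (c q); rewrite ?mul0mx ?mulmx0 // mul1mx (mulmxA (pc_d Y e)) pc_dd mul0mx mulmx0.
- by move=> p; apply: mask_projective; apply: pc_projective.
- have [N HN] := pc_bounded_above Y; exists N => p /HN Y0.
  by apply: mask_dim0; right.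
- have [N HN] := bY; exists N => p q r e e' lt_q.
  move: (kermx _) => K; rewrite (_ : K = 0) ?sub0mx //; apply: dim0_mx.
  by apply: mask_dim0; right; apply: HN.
Defined.
End Band.

Section BandCone.
Variables (Y : proj_complex L) (bY : pc_bounded Y) (b : int).
Hypothesis Yb : forall p, p < b -> fm_dim (Y p) = 0%N.
Let R := band bY (fun p => p == b).
Let Y' := band bY (fun p => b < p).
Let SR := shift_complex R (-1).

Let a1 p : p - 1 + 1 = p :> int. Proof. by rewrite subrK. Qed.
Let F p : 'M[k]_(fm_dim (SR p), fm_dim (Y' p)) := mask_in *m pc_d Y (a1 p) *m mask_out.
Let F_hom p : is_fhom (M := SR p) (N := Y' p) (F p).
Proof.
apply: (fhomM (N := Y p)); last exact: mask_out_hom.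
by apply: (fhomM (N := Y (p - 1))); [exact: mask_in_hom|exact: pc_d_hom].
Qed.
Definition band_map : @dg_hom k Db SR Y' 0 := diag_cx F_hom.

Let SR_d p q (e : p + 1 = q) : pc_d SR e = 0.
Proof.
have e' : p - 1 + 1 = q - 1 by clear -e; lia.
rewrite (shift_dE _ e e') -[pc_d R e']/(mask_in *m pc_d Y e' *m mask_out).
case: (pselect (p - 1 == b)) => [/eqP E1|/negP H]; last by rewrite (mask_in0 _ H) !mul0mx scaler0.
have H : ~~ (q - 1 == b) by clear -E1 e; lia.
by rewrite (mask_out0 _ H) mulmx0 scaler0.
Qed.
Let Y'_d p q (e : p + 1 = q) : pc_d Y' e = mask_in *m pc_d Y e *m mask_out. Proof. by []. Qed.

Lemma band_map_closed : dg_closed band_map.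
Proof.
apply: diag_cx_closed => p q e; rewrite SR_d mul0mx Y'_d /F -!mulmxA (mulmxA mask_out) mask_outK.
case: ifP => _; rewrite ?mul0mx ?mulmx0 // mul1mx (mulmxA (pc_d Y _)) pc_dd mul0mx mulmx0 //.
Qed.

Let j : @dg_hom k Db Y' Y 0 := diag_cx (X := Y') (Y := Y) (fun p => mask_in_hom (b < p) (Y p)).
Let r : @dg_hom k Db Y Y' 0 := diag_cx (X := Y) (Y := Y') (fun p => mask_out_hom (b < p) (Y p)).
Let a2 p q : p + -1 = q -> p - 1 = q :> int. Proof. by []. Qed.
Let a3 p q : p + 1 = q -> p = q - 1 :> int. Proof. by clear; lia. Qed.
Let qm p q' (e : p + -1 = q') : 'M[k]_(fm_dim (SR p), fm_dim (Y q')) := mask_in *m pcast Y (a2 e).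
Let pm p q' (e : p + 1 = q') : 'M[k]_(fm_dim (Y p), fm_dim (SR q')) := pcast Y (a3 e) *m mask_out.
Let q : @dg_hom k Db SR Y (-1) := @mk_cx k L SR Y (-1) qm
  (fun p q' e => fhomM (mask_in_hom _ _) (pcast_hom Y (a2 e))).
Let pp : @dg_hom k Db Y SR 1 := @mk_cx k L Y SR 1 pm
  (fun p q' e => fhomM (pcast_hom Y (a3 e)) (mask_out_hom _ _)).
Let qE p q' (e : p + -1 = q') : cxh (q : cx_hom SR Y (-1)) e = qm e. Proof. by []. Qed.
Let pE p q' (e : p + 1 = q') : cxh (pp : cx_hom Y SR 1) e = pm e. Proof. by []. Qed.

(** A complex starting in degree b is the cone of its first differential, viewed as a map from the
    first term, shifted by -1, to the part above b. *)
Lemma band_cone : @dg_is_cone k Db SR Y' band_map Y.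
Proof.
exists j, r, q, pp; split; [split| |split|].
- by apply: cx_deg0P => p; rewrite cxh_comp0 !diag_cxE mask_inK cxh_id0.
- apply: cx_deg0P => p; rewrite (cxh_comp _ _ _ (addr0 p) erefl (a1 p)) cxh_id0 qE pE /qm /pm.
  by rewrite !pcast1 mulmx1 mul1mx mask_inK.
- apply: cxhP => p q' e; have e' : q' + 0 = q' by rewrite addr0.
  rewrite (cxh_comp _ r q e e e') diag_cxE qE /qm; case: (pselect (p - 1 == b)) => [/eqP E1|/negP H].
    by rewrite (mask_out0 _ (_ : ~~ (b < q'))) ?mulmx0 //; clear -E1 e; lia.
  by rewrite (mask_in0 _ H) !mul0mx.
- apply: cxhP => p q' e; rewrite (cxh_comp _ pp j e (addr0 p) e) diag_cxE pE /pm.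
  case: (pselect (b < p)) => [lt_p|/negP H]; last by rewrite (mask_in0 _ H) !mul0mx.
  by rewrite (mask_out0 _ (_ : ~~ (q' - 1 == b))) ?mulmx0 //; clear -lt_p e; lia.
- apply: cx_deg0P => p; rewrite cxhD cxh_comp0 !diag_cxE mask_outK cxh_id0.
  rewrite (cxh_comp _ q pp (addr0 p) erefl (addrK 1 p)) qE pE /qm /pm -mulmxA (mulmxA mask_out) mask_outK.
  have -> : (p + 1 - 1 == b) = (p == b) by rewrite addrK.
  case: (ltgtP b p) => [lt_p|lt_p|Ep]; rewrite ?mul0mx ?mulmx0 ?addr0 ?add0r //.
    by apply: dim0_mx; apply: Yb.
  by rewrite mul1mx pcastK.
- apply: diag_cx_closed => p q' e; rewrite Y'_d -!mulmxA mask_outK.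
  case: (pselect (b < p)) => [lt_p|/negP H]; last by rewrite (mask_in0 _ H) !mul0mx.
  by rewrite (_ : b < q') ?mulmx1 //; clear -lt_p e; lia.
- apply/cx_closedP => p q' s t c d e f; rewrite SR_d mulmx0 pE /pm.
  case: (pselect (q' - 1 == b)) => [/eqP E1|/negP H]; last by rewrite (mask_out0 _ H) !mulmx0 scaler0.
  by apply: dim0_mx; apply: Yb; clear -E1 c d; lia.
- apply: cx_deg0P => p; rewrite cxh_comp0 !diag_cxE.
  rewrite (cxh_d _ _ _ erefl (a1 p) erefl (addrK 1 p)) SR_d mul0mx scaler0 subr0 qE /qm pcast1 mulmx1.
  transitivity ((mask_in : 'M[k]_(fm_dim (SR p), _)) *m pc_d Y (a1 p) *m (if b < p then 1%:M else 0)).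
    case: (pselect (p - 1 == b)) => [/eqP E1|/negP H]; last by rewrite (mask_in0 _ H) !mul0mx.
    by rewrite (_ : b < p) ?mulmx1 //; clear -E1; lia.
  by rewrite /F -mask_outK !mulmxA.
Qed.
End BandCone.

(** Induction on the length, removing the lowest term by [band_cone]. *)
Theorem bounded_generation (Q : Db -> Prop) : thick Q ->
  (forall (X : proj_complex L) b, (forall p, p != b -> fm_dim (X p) = 0%N) -> Q X) ->
  forall X, pc_bounded X -> Q X.
Proof.
move=> thQ Q1 X bX; have [N HN] := pc_bounded_above X; have [M HM] := bX.
suff H m : forall Y : proj_complex L, pc_bounded Y -> (forall p, N < p -> fm_dim (Y p) = 0%N) ->
    (forall p, p + m%:Z <= N -> fm_dim (Y p) = 0%N) -> Q Y.
  apply: (H (absz (N - M + 1))) => // p le_p; case: (ltP p M) => [/HM//|le_Mp].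
  by apply: HN; move: le_p le_Mp; clear; lia.
elim: m => [|m IH] Y bY YN Ym.
  have [[O _] _ _ _] := @Db_strongly_pretriangulated k L.
  apply: (@thick_contractible_mem k Db Q (@Db_strongly_pretriangulated k L) thQ).
  exists 0; rewrite (lin0 (dg_d_linear _)); apply: cx_deg0P => p; apply: dim0_mx.
  by case: (ltP N p) => [/YN//|le_p]; apply: Ym; move: le_p; clear; lia.
pose b := N - m%:Z.
have Yb p : p < b -> fm_dim (Y p) = 0%N by move=> lt_p; apply: Ym; move: lt_p; rewrite /b; clear; lia.
have [_ _ Q3 _] := thQ; apply: (@Q3 _ _ (band_map bY b) Y (band_map_closed bY b) (band_cone bY Yb)).
  apply: thick_shift => //; apply: (Q1 _ b) => p ne_p; apply: mask_dim0; by left.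
apply: IH.
- have [K HK] := bY; exists K => p lt_p; apply: mask_dim0; right; exact: HK.
- by move=> p lt_p; apply: mask_dim0; right; apply: YN.
- by move=> p le_p; apply: mask_dim0; left; move: le_p; rewrite /b; clear; lia.
Qed.
End Bounded.

Arguments mask_in {k L c M}.
Arguments mask_out {k L c M}.

Section Stalks.
Variables (k : fieldType) (L : falgType k).
Local Notation Db := (Db_dgcat L).

Definition stalk (M : fmod L right_side) (pM : fm_projective M) : proj_complex L.
Proof.
exists (fun p => mask_mod (p == 0) M) (fun p q e => 0).
- by move=> *; apply: fhom0.
- by move=> *; rewrite mul0mx.
- by move=> p; apply: mask_projective.
- by exists 0 => p lt_p; apply: mask_dim0; left; rewrite gt_eqF.
- exists 0 => p q r e e' lt_q; move: (kermx _) => K.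
  by rewrite (_ : K = 0) ?sub0mx //; apply: dim0_mx; apply: mask_dim0; left; rewrite lt_eqF.
Defined.

Lemma stalk_bounded M (pM : fm_projective M) : pc_bounded (stalk pM).
Proof. by exists 0 => p lt_p; apply: mask_dim0; left; rewrite lt_eqF. Qed.

Section AtDegree.
Variable b : int.
Definition concentrated (X : proj_complex L) := forall p, p != b -> fm_dim (X p) = 0%N.

Section Map.
Variables (X Y : proj_complex L) (g : 'M[k]_(fm_dim (X b), fm_dim (Y b))).
Hypothesis Hg : is_fhom (M := X b) (N := Y b) g.
Definition at_mx p : 'M[k]_(fm_dim (X p), fm_dim (Y p)) :=
  match p =P b with ReflectT e => pcast X e *m g *m pcast Y (esym e) | _ => 0 end.
Lemma at_mx_hom p : is_fhom (M := X p) (N := Y p) (at_mx p).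
Proof.
rewrite /at_mx; case: eqP => [e|_]; last exact: fhom0.
apply: (fhomM (N := Y b)); last exact: pcast_hom.
by apply: (fhomM (N := X b)) => //; exact: pcast_hom.
Qed.
Lemma at_mxE : at_mx b = g.
Proof. by rewrite /at_mx; case: eqP => // e; rewrite !pcast1 mul1mx mulmx1. Qed.
Definition at_hom : @dg_hom k Db X Y 0 := diag_cx at_mx_hom.
Lemma at_hom_closed : concentrated X -> concentrated Y -> dg_closed at_hom.
Proof.
move=> cX cY; apply: diag_cx_closed => p q e.
have [Ep|/cX X0] := eqVneq p b; last exact: dim0_mx.
by apply: dim0_mxr; apply: cY; rewrite -e Ep; apply/eqP; clear; lia.
Qed.
End Map.

Lemma at_homP (X Y : proj_complex L) (f g : @dg_hom k Db X Y 0) : concentrated X ->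
  cxh (f : cx_hom X Y 0) (addr0 b) = cxh (g : cx_hom X Y 0) (addr0 b) -> f = g.
Proof.
move=> cX E; apply: cx_deg0P => p; have [->//|/cX X0] := eqVneq p b; exact: dim0_mx.
Qed.
End AtDegree.

(** A dual basis of the only nonzero term exhibits X as a summand of shifted stalks. *)
Lemma thick_concentrated (Q : Db -> Prop) (b : int) (X : proj_complex L) (T : finType)
    (P : T -> fmod L right_side) (pP : forall t, fm_projective (P t))
    (f : forall t, 'M[k]_(fm_dim (X b), fm_dim (P t)))
    (g : forall t, 'M[k]_(fm_dim (P t), fm_dim (X b))) :
  thick Q -> (forall t, Q (stalk (pP t))) -> concentrated b X ->
  (forall t, is_fhom (M := X b) (N := P t) (f t)) ->
  (forall t, is_fhom (M := P t) (N := X b) (g t)) ->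
  \sum_t f t *m g t = 1%:M -> Q X.
Proof.
move=> thQ QP cX Hf Hg fg; pose S t := shift_complex (stalk (pP t)) (- b).
have cS t : concentrated b (S t) by move=> p ne; apply: mask_dim0; left; rewrite subr_eq0.
have Hf' t : is_fhom (M := X b) (N := S t b) (f t *m mask_out).
  by apply: (fhomM (N := P t)) => //; exact: mask_out_hom.
have Hg' t : is_fhom (M := S t b) (N := X b) (mask_in *m g t).
  by apply: (fhomM (N := P t)) => //; exact: mask_in_hom.
apply: (@thick_sum k Db Q T X S predT (fun t => at_hom (Hf' t)) (fun t => at_hom (Hg' t))) => //.
- exact: Db_strongly_pretriangulated.
- by move=> t; split; [exact: thick_shift|exact: at_hom_closed|exact: at_hom_closed].
apply: (at_homP cX); rewrite cxh_id0 -fg.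
transitivity (\sum_t cxh (dg_comp (addr0 0) (at_hom (Hg' t)) (at_hom (Hf' t)) : cx_hom X X 0) (addr0 b)).
  by apply: (big_morph (fun h : cx_hom X X 0 => cxh h (addr0 b))).
apply: eq_bigr => t _; rewrite cxh_comp0 !diag_cxE !at_mxE -mulmxA (mulmxA mask_out) mask_outK.
by rewrite subrr eqxx mul1mx.
Qed.
End Stalks.

(** * Simple modules and idempotents *)

Import VectorInternalTheory.

Section Quotient.
Variables (k : fieldType) (L : falgType k) (M : fmod L right_side) (m : nat) (B : 'M[k]_(m, fm_dim M)).
Hypothesis B_stable : forall a, (B *m fm_act M a <= B)%MS.

Definition quot_proj := col_base (cokermx B).
Local Notation c := quot_proj.
Lemma quot_proj0 p (v : 'M_(p, fm_dim M)) : (v <= B)%MS = (v *m c == 0).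
Proof.
rewrite submxE -{1}(mulmx_base (cokermx B)) mulmxA; apply/eqP/eqP => [E|->]; last exact: mul0mx.
by apply: (row_free_inj (row_base_free (cokermx B))); rewrite mul0mx.
Qed.
Let cK : pinvmx c *m c = 1%:M. Proof. by apply: mulVpmx; apply: col_base_full. Qed.
Let c_act a : c *m (pinvmx c *m fm_act M a *m c) = fm_act M a *m c.
Proof.
have E : ((c *m pinvmx c - 1%:M) *m fm_act M a <= B)%MS.
  apply: submx_trans (B_stable a); apply: submxMr; rewrite quot_proj0 mulmxBl -mulmxA cK.
  by rewrite mulmx1 mul1mx subrr.
by move: E; rewrite quot_proj0 !mulmxBl mul1mx subr_eq0 => /eqP <-; rewrite !mulmxA.
Qed.
Program Definition quot_mod : fmod L right_side :=
  @FMod k L right_side _ (fun a => pinvmx c *m fm_act M a *m c) _ _ _.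
Next Obligation.
by move=> x a b; rewrite (@fm_linear _ _ _ M) mulmxDr mulmxDl -scalemxAr -scalemxAl.
Qed.
Next Obligation. by rewrite /= fm_act1 mulmx1 cK. Qed.
Next Obligation. by move=> a b; rewrite /= -[RHS]mulmxA -[RHS]mulmxA c_act fm_actM !mulmxA. Qed.
Lemma quot_proj_hom : is_fhom (M := M) (N := quot_mod) c.
Proof. by move=> a; rewrite -[LHS]c_act. Qed.
End Quotient.

Section Characters.
Variables (k : fieldType) (L : falgType k) (n : nat) (S : 'I_n -> fmod L right_side).
Hypotheses (S_distinct : forall i j, fm_iso (S i) (S j) -> i = j)
  (S_complete : forall M : fmod L right_side, fm_simple M -> exists i, fm_iso M (S i))
  (S_dim1 : forall i, fm_dim (S i) = 1%N).

(** The trace reads off the scalar by which L acts on a one-dimensional module, without a cast along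
    the dimension. *)
Definition chr i (a : L) : k := \tr (fm_act (S i) a).

Lemma dim1_scalar d (A : 'M[k]_d) : d = 1%N -> A = (\tr A)%:M.
Proof. by move=> d1; subst d; rewrite [A]mx11_scalar mxtrace_scalar. Qed.
Lemma chrE i a : fm_act (S i) a = (chr i a)%:M. Proof. exact: dim1_scalar. Qed.
Lemma chr_linear i : linear (chr i : L -> k^o).
Proof. by move=> x a b; rewrite /chr (@fm_linear _ _ _ (S i)) linearP. Qed.
Lemma chr1 i : chr i 1 = 1.
Proof. by rewrite /chr fm_act1 mxtrace1 S_dim1. Qed.
Lemma chrM i a b : chr i (a * b) = chr i a * chr i b.
Proof. by rewrite {1}/chr fm_actM !chrE -scalar_mxM mxtrace_scalar S_dim1. Qed.
Lemma chrB i a b : chr i (a - b) = chr i a - chr i b. Proof. exact: (linB (@chr_linear i)). Qed.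
Lemma chrZ i c a : chr i (c *: a) = c * chr i a. Proof. exact: (linZ (@chr_linear i)). Qed.
Lemma chr_sum i (I : Type) (r : seq I) (P : pred I) (F : I -> L) :
  chr i (\sum_(t <- r | P t) F t) = \sum_(t <- r | P t) chr i (F t).
Proof. exact: (lin_sum (@chr_linear i)). Qed.
Lemma chrX i a m : chr i (a ^+ m) = chr i a ^+ m.
Proof. by elim: m => [|m IH]; rewrite ?expr0 ?chr1 // !exprS chrM IH. Qed.

(** By induction on the dimension M contains a simple submodule, and L acts on it through a
    character. *)
Lemma fm_eigenvector (M : fmod L right_side) : (0 < fm_dim M)%N ->
  exists i (v : 'rV_(fm_dim M)), v != 0 /\ forall a, v *m fm_act M a = chr i a *: v.
Proof.
have [d] := ubnP (fm_dim M); elim: d M => // d IH M; rewrite ltnS => le_d M_gt0.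
have [sM|nsM] := pselect (fm_simple M).
  have [i [f [g [Hf Hg fg gf]]]] := S_complete sM; exists i.
  have Si_gt0 : (0 < fm_dim (S i))%N by rewrite S_dim1.
  pose u : 'rV[k]_(fm_dim (S i)) := const_mx 1; exists (u *m g); split.
    apply/eqP => ug; have : u *m g *m f = 0 by rewrite ug mul0mx.
    by rewrite -mulmxA gf mulmx1 => /rowP/(_ (Ordinal Si_gt0)); rewrite !mxE => /eqP; rewrite oner_eq0.
  by move=> a; rewrite -mulmxA -Hg chrE mul_scalar_mx scalemxAr.
have [U [U_sub U0 Uf]] : exists U : 'M_(fm_dim M), [/\ is_submodule U, U <> 0 & ~ row_full U].
  apply: contrapT => H; apply: nsM; split=> // U U_sub; apply: contrapT => nU; apply: H; exists U.
  by split=> // h; apply: nU; [left|right].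
have stU a : (U *m fm_act M a <= U)%MS by exact: U_sub.
have lt_U : (\rank U < d)%N.
  by apply: leq_trans le_d; rewrite ltn_neqAle rank_leq_col andbT; apply/negP => rU; apply: Uf.
have U_gt0 : (0 < \rank U)%N by rewrite lt0n mxrank_eq0; apply/eqP.
have [i [v [v0 vE]]] := IH (submod stU) lt_U U_gt0.
exists i, (v *m submod_incl U); split.
  by apply/eqP => E; move/eqP: v0; apply; apply: (row_free_inj (submod_incl_free U)); rewrite mul0mx.
by move=> a; rewrite -mulmxA -(submod_incl_hom stU) mulmxA vE scalemxAl.
Qed.

(** An eigenvector in the image of K in M/B, lifted to K. With K the cocycles and B the boundaries
    it finds a simple submodule in cohomology. *)
Lemma fm_eigenvector_mod (M : fmod L right_side) m p (B : 'M_(m, fm_dim M)) (K : 'M_(p, fm_dim M)) :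
  (forall a, (B *m fm_act M a <= B)%MS) -> (forall a, (K *m fm_act M a <= K)%MS) -> ~~ (K <= B)%MS ->
  exists i (v : 'rV_(fm_dim M)), [/\ (v <= K)%MS, ~~ (v <= B)%MS
    & forall a, (v *m fm_act M a - chr i a *: v <= B)%MS].
Proof.
move=> stB stK KB; pose Q := quot_mod stB; pose c := quot_proj B.
have cH : is_fhom (M := M) (N := Q) c := quot_proj_hom stB.
have stU a : (K *m c *m fm_act Q a <= K *m c)%MS.
  by rewrite -mulmxA -cH mulmxA; apply: submxMr; apply: stK.
have U_gt0 : (0 < fm_dim (submod stU))%N by rewrite /= lt0n mxrank_eq0 -quot_proj0.
have [i [w [w0 wE]]] := fm_eigenvector U_gt0.
have /submxP[x xE] : (w *m submod_incl (N := Q) (K *m c) <= K *m c)%MS.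
  by rewrite (submx_trans (submxMl _ _)) // submod_inclE.
exists i, (x *m K); split; first exact: submxMl.
  rewrite quot_proj0 -mulmxA -xE; apply/eqP => E; move/eqP: w0; apply.
  by apply: (row_free_inj (submod_incl_free (N := Q) (K *m c))); rewrite mul0mx.
move=> a; have xKc : x *m K *m c = w *m submod_incl (N := Q) (K *m c) by rewrite -mulmxA.
rewrite quot_proj0 mulmxBl -scalemxAl xKc -(mulmxA (x *m K)) cH mulmxA xKc -mulmxA.
by rewrite -(submod_incl_hom stU) mulmxA wE scalemxAl subrr.
Qed.

(** The kernel of a character is a maximal right ideal. *)
Lemma chr_radical i x : jacobson_radical x -> chr i x = 0.
Proof.
pose h := GRing.isLinear.Build k L k^o _ (chr i) (@chr_linear i).
pose f : {linear L -> k^o} := HB.pack (chr i : L -> k^o) h.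
have kerE a : (a \in lker (linfun f)) = (chr i a == 0) by rewrite memv_ker lfunE.
move=> rx; apply/eqP; rewrite -kerE; apply: rx; split.
- by move=> a b; rewrite !kerE chrM => /eqP->; rewrite mul0r.
- by apply/eqP => E; have := memvf (1 : L); rewrite -E kerE chr1 oner_eq0.
- move=> J _ IJ; have [[y yJ cy]|H] := pselect (exists2 y, y \in J & chr i y != 0).
    right; apply/eqP; rewrite eqEsubv subvf /=; apply/subvP => z _.
    rewrite -(subrK (chr i z / chr i y *: y) z); apply: memvD; last exact: memvZ.
    by apply: (subvP IJ); rewrite kerE chrB chrZ divfK ?subrr.
  left; apply/eqP; rewrite eqEsubv IJ andbT; apply/subvP => y yJ; rewrite kerE.
  by apply: contrapT => cy; apply: H; exists y => //; apply/negP.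
Qed.

(* L/I has an eigenvector, which generates it. *)
Lemma radical_chr x : (forall i, chr i x = 0) -> jacobson_radical x.
Proof.
move=> x0 I [rI Inf Imax]; pose M := regular L right_side.
have memE a : (a \in I) = (v2r a <= vs2mx I)%MS by rewrite -genmxE.
have actE (v : 'rV_(dim L)) a : v *m fm_act M a = v2r (r2v v * a) by rewrite /= mul_rV_lin1.
have stI a : (vs2mx I *m fm_act M a <= vs2mx I)%MS.
  apply/row_subP => j; rewrite row_mul actE -memE rI //.
  by rewrite memE r2vK row_sub.
have stK a : ((1%:M : 'M_(fm_dim M)) *m fm_act M a <= (1%:M : 'M_(fm_dim M)))%MS by rewrite submx1.
have nK : ~~ ((1%:M : 'M_(fm_dim M)) <= vs2mx I)%MS.
  apply: contra Inf => H; rewrite eqEsubv subvf /=; apply/subvP => z _.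
  by rewrite memE (submx_trans _ H) // submx1.
have [i [v [_ vI vE]]] := fm_eigenvector_mod stI stK nK.
pose u := @r2v k L v.
have {}vI : u \notin I by rewrite memE /u r2vK.
have {}vE a : u * a - chr i a *: u \in I.
  by rewrite memE linearB linearZ /= {2}/u r2vK -actE; apply: vE.
have rJ : right_ideal (I + <[u]>)%VS.
  move=> y a /memv_addP[z zI [w /vlineP[c ->] ->]]; rewrite mulrDl -scalerAl.
  rewrite -(subrK (chr i a *: u) (u * a)) scalerDr addrA; apply: memv_add.
    by rewrite memvD ?memvZ ?rI.
  by rewrite !memvZ // memv_line.
have [E|E] := Imax _ rJ (addvSl _ _).
  by case/negP: vI; rewrite -E (subvP (addvSr _ _)) // memv_line.
have : (1 : L) \in (I + <[u]>)%VS by rewrite E memvf.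
case/memv_addP => z zI [w /vlineP[c ->] E1]; rewrite -[x]mul1r E1 mulrDl -scalerAl.
by rewrite memvD ?rI // memvZ //; have := vE x; rewrite x0 scale0r subr0.
Qed.

Variable G : nonneg_grading L.
Hypothesis L0_top : degree0_is_top G.

Lemma grade0_inj a : a \in G 0 -> (forall i, chr i a = 0) -> a = 0.
Proof.
move=> Ga ca; have [y [_ yU]] := L0_top a.
rewrite -(yU 0); last by split; [exact: mem0v|rewrite subr0; exact: radical_chr].
symmetry; apply: yU; split=> //; rewrite subrr; apply: radical_chr => i.
by have := chrB i a a; rewrite !subrr.
Qed.

Lemma chr_separated i j : i != j -> exists a, chr i a = 1 /\ chr j a = 0.
Proof.
move=> ij; have [a ca] : exists a, chr i a != chr j a.
  apply: contrapT => H; move/eqP: ij; apply; apply: S_distinct.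
  have E a : chr i a = chr j a by apply/eqP; apply: contrapT => /negP ca; apply: H; exists a.
  have Ed : fm_dim (S i) = fm_dim (S j) by rewrite !S_dim1.
  exists (castmx (erefl, Ed) 1%:M), (castmx (erefl, esym Ed) 1%:M).
  have cH (A B : fmod L right_side) (e : fm_dim A = fm_dim B) : (forall a, \tr (fm_act A a) = \tr (fm_act B a)) ->
      fm_dim A = 1%N -> is_fhom (M := A) (N := B) (castmx (erefl, e) 1%:M).
    move=> tE A1 a; rewrite (dim1_scalar (fm_act A a) A1) (dim1_scalar (fm_act B a)); last by rewrite -e.
    by rewrite tE scalar_mxC.
  have cK d d' (e : d = d') (e' : d' = d) :
      castmx (erefl, e) (1%:M : 'M[k]_d) *m castmx (erefl, e') 1%:M = 1%:M.
    by subst d'; rewrite (eq_irrelevance e' erefl) !castmx_id mulmx1.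
  by split; [apply: cH|apply: cH => // a; rewrite -[LHS]E|exact: cK|exact: cK].
pose t := chr i a - chr j a; have t0 : t != 0 by rewrite subr_eq0.
exists (t^-1 *: (a - chr j a *: 1)); rewrite !chrZ !chrB !chrZ !chr1 !mulr1 subrr mulr0.
by rewrite mulVf.
Qed.

(** Products of elements separating two characters interpolate, as in the Chinese remainder theorem;
    the representative in degree 0 has the same characters because the radical is killed by all of
    them. *)
Lemma grade0_lift (c : 'I_n -> k) : exists2 a, a \in G 0 & forall i, chr i a = c i.
Proof.
have sep i : exists f, forall j, chr j f = (j == i)%:R.
  have H j : exists a, chr i a = 1 /\ (j != i -> chr j a = 0).
    have [->|ji] := eqVneq j i; first by exists 1; rewrite chr1.
    by have [a [a1 a0]] := chr_separated (negbT (introF eqP (fun E => negP ji (introT eqP (esym E))))); exists a.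
  pose a j := sval (boolp.cid (H j)); have aP j : chr i (a j) = 1 /\ (j != i -> chr j (a j) = 0) by exact: svalP (boolp.cid (H j)).
  have pE (s : seq 'I_n) j : chr j (\prod_(t <- s) a t) = \prod_(t <- s) chr j (a t).
    by apply: (big_morph (chr j) (chrM j) (chr1 j)).
  exists (\prod_(j <- enum 'I_n) a j) => j; rewrite pE.
  have [->|ji] := eqVneq j i; first by rewrite big1 // => t _; have [] := aP t.
  have : j \in enum 'I_n by rewrite mem_enum.
  by case/splitPr => s1 s2; rewrite big_cat big_cons /= (proj2 (aP j) ji) mul0r mulr0.
pose f i := sval (boolp.cid (sep i)); have fP i j : chr j (f i) = (j == i)%:R by exact: svalP (boolp.cid (sep i)) j.
have [a [[Ga ra] _]] := L0_top (\sum_i c i *: f i).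
exists a => // i; have := chr_radical i ra; rewrite chrB => /eqP; rewrite subr_eq0 => /eqP <-.
rewrite chr_sum (bigD1 i) //= chrZ fP eqxx mulr1 big1 ?addr0 // => j ji.
by rewrite chrZ fP eq_sym (negbTE ji) mulr0.
Qed.

(** The characters identify degree 0 with k^n; these are its standard idempotents, and their
    relations follow from [grade0_inj]. *)
Definition idem i : L := s2val (cid2 (grade0_lift (fun j => (j == i)%:R))).
Lemma idem_grade i : idem i \in G 0. Proof. exact: (s2valP (cid2 (grade0_lift _))). Qed.
Lemma chr_idem i j : chr j (idem i) = (j == i)%:R.
Proof. exact: (s2valP' (cid2 (grade0_lift (fun j => (j == i)%:R)))). Qed.
Lemma grade0M a b : a \in G 0 -> b \in G 0 -> a * b \in G 0.
Proof. by move=> Ga Gb; rewrite -(addr0 0); apply: gr_mul. Qed.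
Lemma grade0E a : a \in G 0 -> a = \sum_i chr i a *: idem i.
Proof.
move=> Ga; apply/eqP; rewrite -subr_eq0; apply/eqP; apply: grade0_inj.
  by rewrite memvB // memv_suml // => i _; rewrite memvZ // idem_grade.
move=> j; rewrite chrB chr_sum (bigD1 j) //= chrZ chr_idem eqxx mulr1 big1 ?addr0 ?subrr // => i ij.
by rewrite chrZ chr_idem eq_sym (negbTE ij) mulr0.
Qed.
Lemma idemM i j : idem i * idem j = if i == j then idem i else 0.
Proof.
apply/eqP; rewrite -subr_eq0; apply/eqP; apply: grade0_inj => [|t].
  by rewrite memvB ?grade0M ?idem_grade //; case: ifP => _; rewrite ?idem_grade ?mem0v.
have chr0 : chr t 0 = 0 by exact: (lin0 (@chr_linear t)).
rewrite chrB chrM !chr_idem; case: (eqVneq i j) => [->|ij].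
  by rewrite chr_idem; case: eqP => _; rewrite ?mulr1 ?mulr0 subrr.
by rewrite chr0 subr0; case: (eqVneq t i) => [->|_]; rewrite ?(negbTE ij) ?mulr0 ?mul0r.
Qed.
Lemma idem_sum : \sum_i idem i = 1.
Proof. by rewrite (grade0E (gr_one G)); apply: eq_bigr => i _; rewrite chr1 scale1r. Qed.

(** The grading is bounded, so an element of positive degree is nilpotent. *)
Lemma chr_pos i c a : 0 < c -> a \in G c -> chr i a = 0.
Proof.
move=> c_gt0 Ga; have [N [_ _ GN]] := gr_direct G.
have Gp m : a ^+ m \in G (c * m%:Z).
  elim: m => [|m IH]; first by rewrite expr0 mulr0 gr_one.
  by rewrite exprS (_ : c * m.+1%:Z = c + c * m%:Z) ?gr_mul //; lia.
have : a ^+ N = 0.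
  apply/eqP; rewrite -memv0 -(GN (c * N%:Z)) //; move: c_gt0; clear; nia.
move/(congr1 (chr i)); rewrite chrX; have -> : chr i 0 = 0 by exact: (lin0 (@chr_linear i)).
by move/eqP; rewrite expf_eq0 => /andP[_ /eqP].
Qed.
End Characters.

(** What the constructions below retain about the simple modules: orthogonal idempotents spanning
    degree 0, the characters, and eigenvectors in subquotients. *)
Record top_data (k : fieldType) (L : falgType k) (G : nonneg_grading L) (n : nat) := TopData {
  td_S : 'I_n -> fmod L right_side;
  td_e : 'I_n -> L;
  td_dim : forall i, fm_dim (td_S i) = 1%N;
  td_grade : forall i, td_e i \in G 0;
  td_eM : forall i j, td_e i * td_e j = if i == j then td_e i else 0;
  td_sum : \sum_i td_e i = 1;
  td_chr_e : forall i j, chr td_S j (td_e i) = (j == i)%:R;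
  td_chr_pos : forall i c a, 0 < c -> a \in G c -> chr td_S i a = 0;
  td_grade0 : forall a, a \in G 0 -> a = \sum_i chr td_S i a *: td_e i;
  td_eigen : forall (M : fmod L right_side) m p (B : 'M_(m, fm_dim M)) (K : 'M_(p, fm_dim M)),
    (forall a, (B *m fm_act M a <= B)%MS) -> (forall a, (K *m fm_act M a <= K)%MS) -> ~~ (K <= B)%MS ->
    exists i (v : 'rV_(fm_dim M)), [/\ (v <= K)%MS, ~~ (v <= B)%MS
      & forall a, (v *m fm_act M a - chr td_S i a *: v <= B)%MS] }.

Lemma top_data_exists (k : fieldType) (L : falgType k) (G : nonneg_grading L)
  (L0_top : degree0_is_top G) (n : nat) (S : 'I_n -> fmod L right_side)
  (S_distinct : forall i j, fm_iso (S i) (S j) -> i = j)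
  (S_complete : forall M : fmod L right_side, fm_simple M -> exists i, fm_iso M (S i))
  (S_dim1 : forall i, fm_dim (S i) = 1%N) : exists t : top_data G n, td_S t = S.
Proof.
unshelve refine (ex_intro _ (@TopData k L G n S (idem S_distinct S_dim1 L0_top) S_dim1 _ _ _ _ _ _ _) erefl).
- exact: idem_grade.
- exact: idemM.
- exact: idem_sum.
- exact: chr_idem.
- exact: chr_pos.
- by move=> a; apply: grade0E.
- by move=> M m p B K; apply: fm_eigenvector_mod.
Qed.

(** * Relatively free modules *)

Import VectorInternalTheory.

Lemma lin1_mxE (k : fieldType) m p (f : 'rV[k]_m -> 'rV[k]_p) : linear f -> forall u, u *m lin1_mx f = f u.
Proof.
move=> lf u; pose h := GRing.isLinear.Build k 'rV[k]_m 'rV[k]_p _ f lf.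
pose g : {linear 'rV[k]_m -> 'rV[k]_p} := HB.pack f h; exact: (mul_rV_lin1 g).
Qed.

Lemma row_ext (k : fieldType) m p (f g : 'M[k]_(m, p)) : (forall u : 'rV_m, u *m f = u *m g) -> f = g.
Proof. by move=> E; apply/row_matrixP => i; rewrite !rowE E. Qed.

Section Grading.
Variables (k : fieldType) (L : falgType k) (G : nonneg_grading L).

Definition gr_bound := sval (boolp.cid (gr_direct G)).
Let grP := svalP (boolp.cid (gr_direct G)).
Let gr_full : (\sum_(i < gr_bound) G i%:Z = fullv)%VS. Proof. by have [] := grP. Qed.

Lemma gr_high i : gr_bound%:Z <= i -> G i = 0%VS. Proof. by have [_ _ H] := grP; apply: H. Qed.

Definition gr_comp (c : int) (a : L) : L :=
  if c is Posz m then
    (if insub m is Some i then sumv_pi_for (esym gr_full) (i : 'I_gr_bound) a else 0)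
  else 0.

Lemma gr_comp_linear c : linear (gr_comp c).
Proof.
move=> x u v; rewrite /gr_comp; case: c => m; last by rewrite scaler0 addr0.
by case: insub => [i|]; rewrite ?linearP // scaler0 addr0.
Qed.
Lemma gr_comp_mem c a : gr_comp c a \in G c.
Proof.
rewrite /gr_comp; case: c => m; last exact: mem0v.
by case: insubP => [i _ <-|_]; [apply: memv_sum_pi|apply: mem0v].
Qed.
Lemma gr_comp_sum a : \sum_(i < gr_bound) gr_comp i%:Z a = a.
Proof.
rewrite -[RHS](sumv_pi_sum (esym gr_full) (memvf a)); apply: eq_bigr => i _.
by rewrite /gr_comp; case: insubP => [j _ /ord_inj->|]; rewrite ?ltn_ord.
Qed.
Lemma gr_supp c a : a \in G c -> a = 0 \/ exists2 i : 'I_gr_bound, c = i%:Z & a \in G i%:Z.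
Proof.
move=> Ga; have [c_lt0|c_ge0] := ltP c 0.
  by left; apply/eqP; rewrite -memv0 -(gr_neg G c_lt0).
have [c_hi|c_lo] := leP gr_bound%:Z c; first by left; apply/eqP; rewrite -memv0 -(gr_high c_hi).
case: c Ga c_ge0 c_lo => // m Ga _ lt_m; right; by exists (Ordinal (lt_m : (m < gr_bound)%N)).
Qed.
Lemma gr_compE c c' a : a \in G c -> gr_comp c' a = if c' == c then a else 0.
Proof.
have g0 t : gr_comp t 0 = 0 by exact: (lin0 (@gr_comp_linear t)).
case/gr_supp => [->|[i -> Ga]]; first by rewrite g0; case: ifP.
have dx : directv (\sum_(i < gr_bound) G i%:Z)%VS by have [] := grP.
have /directv_sum_unique/(_ (fun j => gr_comp j%:Z a) (fun j => if j == i then a else 0)) := dx.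
rewrite gr_comp_sum -big_mkcond big_pred1_eq eqxx => /(_ _ _)/esym/forallP H.
have {}H (j : 'I_gr_bound) : gr_comp j%:Z a = if j == i then a else 0.
  apply/eqP; apply: (implyP (H _ _ j)) => // t _; first exact: gr_comp_mem.
  by case: eqP => [->|_]; rewrite ?mem0v.
case: c' => [m|m]; last by rewrite /gr_comp; case: eqP.
have [lt_m|le_m] := ltnP m gr_bound; first by rewrite (H (Ordinal lt_m)).
rewrite /gr_comp insubF; last by rewrite ltnNge le_m.
by case: eqP => // -[E]; move: (ltn_ord i); rewrite -E ltnNge le_m.
Qed.
End Grading.

Section Tensor.
Variables (k : fieldType) (L : falgType k).
Local Notation d := (dim L).
(** The pure tensor v (x) a in the space k^m (x) L, encoded as the vectorized outer product. *)
Definition tens m (v : 'rV[k]_m) (a : L) : 'rV[k]_(m * d) := mxvec (v^T *m v2r a).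
Lemma tens_linear_l m a : linear (fun v => @tens m v a).
Proof. by move=> x u v; rewrite /tens linearP /= mulmxDl -scalemxAl linearP. Qed.
Lemma tens_linear_r m v : linear (@tens m v).
Proof. by move=> x a b; rewrite /tens linearP /= mulmxDr -scalemxAr linearP. Qed.
Lemma tens_ext m p (f g : 'M_(m * d, p)) : (forall v a, tens v a *m f = tens v a *m g) -> f = g.
Proof.
move=> E; apply/row_matrixP => s; case/mxvec_indexP: s => i j.
rewrite !rowE -mxvec_delta -(mul_delta_mx (0 : 'I_1)).
have := E (delta_mx 0 i) (r2v (delta_mx 0 j)); rewrite /tens r2vK trmx_delta //.
Qed.
Lemma tens_homogeneous_ext (G : nonneg_grading L) m p (f g : 'M_(m * d, p)) :
  (forall v a c, a \in G c -> tens v a *m f = tens v a *m g) -> f = g.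
Proof.
move=> E; apply: tens_ext => v a; rewrite -(gr_comp_sum G a) (lin_sum (@tens_linear_r m v)).
by rewrite !mulmx_suml; apply: eq_bigr => i _; apply: E (gr_comp_mem G _ _).
Qed.

Definition kron m p (X : 'M[k]_(m, p)) (f : L -> L) : 'M[k]_(m * d, p * d) :=
  lin1_mx (fun u => mxvec (X^T *m vec_mx u *m lin1_mx (fun y : 'rV[k]_d => v2r (f (r2v y))))).
Lemma tens_kron m p (X : 'M[k]_(m, p)) (f : L -> L) v a : linear f ->
  tens v a *m kron X f = tens (v *m X) (f a).
Proof.
move=> lf; rewrite /kron lin1_mxE; last first.
  by move=> x u w; rewrite linearP /= mulmxDr mulmxDl -scalemxAr -scalemxAl linearP.
rewrite /tens mxvecK; congr mxvec; rewrite trmx_mul -!mulmxA lin1_mxE ?v2rK //.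
by move=> x u w; rewrite linearP lf linearP.
Qed.

Section Free.
Variable m : nat.
Program Definition free_mod : fmod L right_side :=
  @FMod k L right_side (m * d) (fun b => kron 1%:M (fun a => a * b)) _ _ _.
Next Obligation.
move=> x a b; apply: tens_ext => v u.
rewrite mulmxDr -scalemxAr !tens_kron ?mulmx1 => [|? ? ?|? ? ?|? ? ?]; rewrite ?mulrDl ?scalerAl //.
by rewrite mulrDr -scalerAr (@tens_linear_r m v).
Qed.
Next Obligation.
apply: tens_ext => v u; rewrite tens_kron ?mulmx1 ?mulr1 // => ? ? ?.
by rewrite mulrDl scalerAl.
Qed.
Next Obligation.
move=> a b; apply: tens_ext => v u; have lin c : linear (fun a : L => a * c).
  by move=> ? ? ?; rewrite mulrDl scalerAl.
by rewrite mulmxA !tens_kron // !mulmx1 mulrA.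
Qed.
Lemma tens_act (v : 'rV_m) a b : tens v a *m fm_act free_mod b = tens v (a * b).
Proof. by rewrite tens_kron ?mulmx1 // => ? ? ?; rewrite mulrDl scalerAl. Qed.

Definition free_unit : 'M[k]_(m, fm_dim free_mod) := lin1_mx (fun v => tens v 1).
Lemma mul_free_unit v : v *m free_unit = tens v 1.
Proof. by apply: lin1_mxE; apply: tens_linear_l. Qed.
Lemma tensE (v : 'rV_m) a : tens v a = v *m free_unit *m fm_act free_mod a.
Proof. by rewrite mul_free_unit tens_act mul1r. Qed.

Variables (N : fmod L right_side).
Section Ext.
Variable g : 'M[k]_(m, fm_dim N).
Definition free_ext : 'M[k]_(fm_dim free_mod, fm_dim N) :=
  lin1_mx (fun u : 'rV_(m * d) => \sum_j (col j (vec_mx u))^T *m g *m fm_act N (r2v (delta_mx 0 j))).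
Lemma tens_ext_map v a : tens v a *m free_ext = v *m g *m fm_act N a.
Proof.
rewrite lin1_mxE; last first.
  move=> x u w; rewrite scaler_sumr -big_split; apply: eq_bigr => j _.
  by rewrite !linearP /= !mulmxDl -!scalemxAl.
have aE : a = \sum_j v2r a 0 j *: r2v (delta_mx 0 j).
  rewrite -[LHS]v2rK {1}[v2r a]row_sum_delta linear_sum; apply: eq_bigr => j _; exact: linearZ.
rewrite /tens mxvecK [in RHS]aE fm_act_sum mulmx_sumr; apply: eq_bigr => j _.
rewrite -scalemxAr !scalemxAl; congr (_ *m _ *m _).
by apply/rowP => i; rewrite !mxE big_ord1 !mxE mulrC.
Qed.
Lemma free_ext_hom : is_fhom (M := free_mod) (N := N) free_ext.
Proof.
move=> b; apply: tens_ext => v a.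
by rewrite !mulmxA tens_act !tens_ext_map -!mulmxA fm_actM.
Qed.
Lemma free_unit_ext : free_unit *m free_ext = g.
Proof. by apply: row_ext => v; rewrite mulmxA mul_free_unit tens_ext_map fm_act1 mulmx1. Qed.
End Ext.

Lemma free_hom_ext (f g : 'M[k]_(fm_dim free_mod, fm_dim N)) :
  is_fhom (M := free_mod) (N := N) f -> is_fhom (M := free_mod) (N := N) g ->
  free_unit *m f = free_unit *m g -> f = g.
Proof.
move=> Hf Hg E; apply: tens_ext => v a.
by rewrite tensE -!mulmxA Hf Hg !(mulmxA free_unit) E.
Qed.
End Free.

Arguments free_ext {m} N g.

Lemma free_projective m : fm_projective (free_mod m).
Proof.
move=> A B g h Hg fg Hh; exists (free_ext A (free_unit m *m h *m pinvmx g)).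
  exact: free_ext_hom.
apply: (free_hom_ext (fhomM (@free_ext_hom _ _ _) Hg) Hh).
by rewrite mulmxA free_unit_ext -mulmxA mulVpmx ?mulmx1.
Qed.
End Tensor.
Arguments free_ext {k L m} N g.

(** * Modules free relative to the idempotents, and their weights *)

Section RelativelyFree.
Variables (k : fieldType) (L : falgType k) (G : nonneg_grading L) (n : nat) (t : top_data G n).
Local Notation e := (td_e t).
Local Notation fmodR := (fmod L right_side).

(** A grading of M by projections, supported in 0 <= i < [wt_bound], such that elements of L of
    degree c raise weights by c. The sum is required for every window containing the support, which
    spares reindexing later. *)
Record weights (M : fmodR) := Weights {
  wt : int -> 'M[k]_(fm_dim M);
  wt_bound : nat;
  wt_orth : forall i j, wt i *m wt j = if i == j then wt i else 0;
  wt_act : forall i c a, a \in G c -> fm_act M a *m wt i = wt (i - c) *m fm_act M a;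
  wt0 : forall i, i < 0 \/ wt_bound%:Z <= i -> wt i = 0;
  wt_sum : forall m N, (wt_bound + m <= N)%N -> \sum_(s < N) wt (s%:Z - m%:Z) = 1%:M }.

Section FreeWeights.
Variables (M : fmodR) (W : weights M).
Let F := free_mod L (fm_dim M).
(** The tensor product grading: v (x) a has the weight of v plus the degree of a. *)
Definition free_wt i : 'M[k]_(fm_dim F) := \sum_(c < gr_bound G) kron (wt W (i - c%:Z)) (gr_comp G c%:Z).
Lemma tens_wt i v a c : a \in G c -> tens v a *m free_wt i = tens (v *m wt W (i - c)) a.
Proof.
move=> Ga; have tens0 (w : 'rV_(fm_dim M)) : tens w (0 : L) = 0 by exact: (lin0 (@tens_linear_r _ L _ w)).
rewrite mulmx_sumr; case/gr_supp: (Ga) => [->|[j cE _]].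
  by rewrite tens0 big1 // => s _; rewrite mul0mx.
rewrite (bigD1 j) //= tens_kron ?(gr_compE _ Ga) ?cE ?eqxx ?big1 ?addr0 //; last exact: gr_comp_linear.
move=> s sj; rewrite tens_kron ?(gr_compE _ Ga) ?cE; last exact: gr_comp_linear.
by rewrite eqz_nat (_ : (s == j :> nat) = false) ?tens0 //; apply: negbTE.
Qed.
Program Definition free_weights : weights F := @Weights F free_wt (wt_bound W + gr_bound G) _ _ _ _.
Next Obligation.
move=> i j; apply: (tens_homogeneous_ext (G := G)) => v a c Ga.
rewrite mulmxA (tens_wt _ _ Ga) (tens_wt _ _ Ga) -mulmxA wt_orth.
have -> : (i - c == j - c) = (i == j) by apply/eqP/eqP => [|->//]; clear; lia.
case: eqP => _; first by rewrite (tens_wt _ _ Ga).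
by rewrite !mulmx0; exact: (lin0 (@tens_linear_l _ L _ a)).
Qed.
Next Obligation.
move=> i c b Gb; apply: (tens_homogeneous_ext (G := G)) => v a c' Ga.
rewrite !mulmxA tens_act (tens_wt _ _ Ga) tens_act (tens_wt _ _ (gr_mul Ga Gb)).
by congr (tens (v *m wt W _) _); clear; lia.
Qed.
Next Obligation.
move=> i Hi; apply: (tens_homogeneous_ext (G := G)) => v a c Ga; rewrite (tens_wt _ _ Ga) mulmx0.
case/gr_supp: (Ga) => [->|[j cE _]]; first exact: (lin0 (@tens_linear_r _ L _ _)).
rewrite wt0 ?mulmx0; first exact: (lin0 (@tens_linear_l _ L _ a)).
by have := ltn_ord j; move: cE Hi; clear; lia.
Qed.
Next Obligation.
move=> m N le_N; apply: (tens_homogeneous_ext (G := G)) => v a c Ga; rewrite mulmx1 mulmx_sumr.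
case/gr_supp: (Ga) => [->|[j cE _]].
  rewrite (lin0 (@tens_linear_r _ L _ v)) big1 // => s _; exact: mul0mx.
have lt_j := ltn_ord j; transitivity (tens (v *m \sum_(s < N) wt W (s%:Z - (m + j)%:Z)) a).
  rewrite mulmx_sumr (lin_sum (@tens_linear_l _ L _ a)); apply: eq_bigr => s _.
  by rewrite (tens_wt _ _ Ga) cE; congr (tens (v *m wt W _) _); clear; lia.
by rewrite wt_sum ?mulmx1 //; move: le_N lt_j; clear; lia.
Qed.

Lemma free_unit_wt i : wt W i *m free_unit L (fm_dim M) = free_unit L (fm_dim M) *m wt free_weights i.
Proof.
by apply: row_ext => v; rewrite !mulmxA !mul_free_unit (tens_wt _ _ (gr_one G)) subr0.
Qed.
Lemma free_ext_wt (N : fmodR) (V : weights N) (h : 'M[k]_(fm_dim M, fm_dim N)) :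
  (forall i, wt W i *m h = h *m wt V i) ->
  forall i, wt free_weights i *m free_ext N h = free_ext N h *m wt V i.
Proof.
move=> hw i; apply: (tens_homogeneous_ext (G := G)) => v a c Ga.
rewrite !mulmxA (tens_wt _ _ Ga) !tens_ext_map -(mulmxA v) hw mulmxA.
by rewrite -(mulmxA (v *m h)) -(wt_act V _ Ga) mulmxA.
Qed.
End FreeWeights.

Section ImageWeights.
Variables (M : fmodR) (W : weights M) (p : 'M[k]_(fm_dim M)) (Hp : is_fhom (M := M) (N := M) p)
  (pp : p *m p = p) (pw : forall i, wt W i *m p = p *m wt W i).
Let r := im_in pp. Let o := im_out pp.
Let o_r : o *m r = p. Proof. exact: im_outK. Qed.
Let rp : r *m p = r. Proof. exact: im_in_idem. Qed.
Let ro : r *m o = 1%:M. Proof. exact: im_inK. Qed.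
Program Definition im_weights : weights (im_mod Hp pp) :=
  @Weights (im_mod Hp pp) (fun i => r *m wt W i *m o) (wt_bound W) _ _ _ _.
Next Obligation.
move=> i j; rewrite -[LHS]/(r *m wt W i *m o *m (r *m wt W j *m o)) !mulmxA -(mulmxA _ o) o_r.
rewrite -(mulmxA r) pw mulmxA rp -(mulmxA r (wt W i) (wt W j)) wt_orth; case: eqP => // _.
by rewrite mulmx0 mul0mx.
Qed.
Next Obligation.
move=> i c a Ga.
transitivity (r *m fm_act M a *m o *m (r *m wt W i *m o)); first by [].
transitivity (r *m wt W (i - c) *m o *m (r *m fm_act M a *m o)); last by [].
rewrite !mulmxA -!(mulmxA _ o) o_r -(mulmxA r (fm_act M a)) Hp mulmxA rp.
by rewrite -(mulmxA r (wt W (i - c)) p) pw mulmxA rp -(mulmxA r) (wt_act W _ Ga) mulmxA.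
Qed.
Next Obligation. by move=> i Hi; rewrite -[LHS]/(r *m wt W i *m o) wt0 // mulmx0 mul0mx. Qed.
Next Obligation. by move=> m N le_N; rewrite -mulmx_suml -mulmx_sumr wt_sum // mulmx1 ro. Qed.
End ImageWeights.

(* T together with the idempotent projecting it onto a complement of the image
   of the contracting homotopy. *)
Record bar_stage := BarStage {
  bs :> fmodR;
  bs_pi : 'M[k]_(fm_dim bs);
  bs_wt : weights bs;
  bs_pp : bs_pi *m bs_pi = bs_pi;
  bs_pe : forall i, fm_act bs (e i) *m bs_pi = bs_pi *m fm_act bs (e i);
  bs_pw : forall i, wt bs_wt i *m bs_pi = bs_pi *m wt bs_wt i }.

Section Next.
Variable s : bar_stage.
Local Notation M := (bs s).
Local Notation pi := (bs_pi s).
Local Notation act := (fm_act M).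
Let F := free_mod L (fm_dim M).
Let u : 'M[k]_(fm_dim M, fm_dim F) := free_unit L (fm_dim M).
(** The extension [phi] of [g] sends v (x) a to the sum of v pi e_i (x) e_i a. It is idempotent with
    image im(pi) (x) L, the tensor product over the span of the idempotents, thus realized as a
    summand of a free module. *)
Let g : 'M[k]_(fm_dim M, fm_dim F) := \sum_i pi *m act (e i) *m u *m fm_act F (e i).
Let phi : 'M[k]_(fm_dim F) := free_ext F g.
Let phi_hom : is_fhom (M := F) (N := F) phi. Proof. exact: free_ext_hom. Qed.
Let u_phi : u *m phi = g. Proof. exact: free_unit_ext. Qed.
Let act_e (N : fmodR) i j : fm_act N (e i) *m fm_act N (e j) = if i == j then fm_act N (e i) else 0.
Proof. by rewrite -(fm_actM N) td_eM; case: ifP => // _; exact: (lin0 (@fm_linear _ _ _ N)). Qed.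
Let e_g i : act (e i) *m g = pi *m act (e i) *m u *m fm_act F (e i).
Proof.
rewrite mulmx_sumr (bigD1 i) //= !mulmxA bs_pe -(mulmxA pi) act_e eqxx big1 ?addr0 // => j ji.
by rewrite !mulmxA bs_pe -(mulmxA pi) act_e eq_sym (negbTE ji) mulmx0 !mul0mx.
Qed.
Let g_e i : g *m fm_act F (e i) = pi *m act (e i) *m u *m fm_act F (e i).
Proof.
rewrite mulmx_suml (bigD1 i) //= -(mulmxA _ (fm_act F (e i))) act_e eqxx big1 ?addr0 // => j ji.
by rewrite -(mulmxA _ (fm_act F (e j))) act_e (negbTE ji) mulmx0.
Qed.
Let pi_g : pi *m g = g.
Proof. by rewrite mulmx_sumr; apply: eq_bigr => i _; rewrite !mulmxA bs_pp. Qed.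
Let g_ext (N : fmodR) (h : 'M[k]_(fm_dim M, fm_dim N)) :
  (forall i, act (e i) *m h = h *m fm_act N (e i)) -> g *m free_ext N h = pi *m h.
Proof.
move=> he; rewrite mulmx_suml; transitivity (\sum_i pi *m act (e i) *m h).
  apply: eq_bigr => i _; rewrite -mulmxA (free_ext_hom h) mulmxA -(mulmxA _ u) free_unit_ext.
  by rewrite -mulmxA -he mulmxA -(mulmxA pi) act_e eqxx.
by rewrite -mulmx_suml -mulmx_sumr -(lin_sum (@fm_linear _ _ _ M)) td_sum fm_act1 mulmx1.
Qed.
Let phi_phi : phi *m phi = phi.
Proof.
apply: (free_hom_ext (N := F) (fhomM phi_hom phi_hom) phi_hom).
by rewrite mulmxA u_phi -[RHS]pi_g; apply: g_ext => i; rewrite e_g g_e.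
Qed.
Definition nxt_mod : fmodR := im_mod phi_hom phi_phi.
Local Notation N := nxt_mod.
Let r := im_in phi_phi.
Let o := im_out phi_phi.
Let r_hom : is_fhom (M := N) (N := F) r. Proof. exact: im_in_hom. Qed.
Let o_hom : is_fhom (M := F) (N := N) o. Proof. exact: im_out_hom. Qed.
Let ro : r *m o = 1%:M. Proof. exact: im_inK. Qed.
Let o_r : o *m r = phi. Proof. exact: im_outK. Qed.
Let rphi : r *m phi = r. Proof. exact: im_in_idem. Qed.
Let phio : phi *m o = o. Proof. exact: im_out_idem. Qed.

Definition nxt_eta : 'M[k]_(fm_dim M, fm_dim N) := u *m o.
Local Notation eta := nxt_eta.
Lemma nxt_eta_e i : act (e i) *m eta = eta *m fm_act N (e i).
Proof.
rewrite /eta -{1}phio (mulmxA u) u_phi mulmxA e_g -g_e -mulmxA o_hom !mulmxA -u_phi.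
by rewrite -(mulmxA u) phio.
Qed.
Lemma nxt_pi_eta : pi *m eta = eta.
Proof. by rewrite /eta -phio !mulmxA -(mulmxA pi) u_phi pi_g. Qed.

(** The universal property of im(pi) (x) L: a map out of M linear over the idempotents extends, from
    im(pi), to an L-linear map; [nxt_hom_ext] is uniqueness. *)
Definition nxt_ext (Q : fmodR) (h : 'M[k]_(fm_dim M, fm_dim Q)) : 'M[k]_(fm_dim N, fm_dim Q) :=
  r *m free_ext Q h.
Lemma nxt_ext_hom Q h : is_fhom (M := N) (N := Q) (nxt_ext h).
Proof. by apply: (fhomM r_hom); apply: free_ext_hom. Qed.
Lemma nxt_extE Q (h : 'M[k]_(fm_dim M, fm_dim Q)) :
  (forall i, act (e i) *m h = h *m fm_act Q (e i)) -> eta *m nxt_ext h = pi *m h.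
Proof. by move=> he; rewrite /eta /nxt_ext !mulmxA -(mulmxA u) o_r u_phi g_ext. Qed.
Lemma nxt_hom_ext Q (f h : 'M[k]_(fm_dim N, fm_dim Q)) :
  is_fhom (M := N) (N := Q) f -> is_fhom (M := N) (N := Q) h -> eta *m f = eta *m h -> f = h.
Proof.
move=> Hf Hh E; rewrite -[f]mul1mx -[h]mul1mx -ro -!mulmxA; congr (_ *m _).
apply: (free_hom_ext (fhomM o_hom Hf) (fhomM o_hom Hh)).
by rewrite !(mulmxA (free_unit _ _)).
Qed.
Lemma nxt_projective : fm_projective N.
Proof. by apply: im_projective; apply: free_projective. Qed.

Definition nxt_d : 'M[k]_(fm_dim N, fm_dim M) := @nxt_ext M pi.
Lemma nxt_d_hom : is_fhom (M := N) (N := M) nxt_d. Proof. exact: nxt_ext_hom. Qed.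
Lemma nxt_eta_d : eta *m nxt_d = pi.
Proof. by rewrite nxt_extE ?bs_pp //; apply: bs_pe. Qed.

Let W := bs_wt s.
Let V := free_weights W.
Let g_wt i : wt W i *m g = g *m wt V i.
Proof.
rewrite mulmx_sumr mulmx_suml; apply: eq_bigr => j _.
have A (Q : fmodR) (U : weights Q) : fm_act Q (e j) *m wt U i = wt U i *m fm_act Q (e j).
  by rewrite (wt_act U i (td_grade t j)) subr0.
rewrite !mulmxA bs_pw -!(mulmxA pi) -A -(mulmxA (act (e j))) free_unit_wt.
by rewrite -!mulmxA A.
Qed.
Let phi_wt i : wt V i *m phi = phi *m wt V i.
Proof. exact: free_ext_wt g_wt i. Qed.
Definition nxt_wt : weights N := @im_weights F V phi phi_hom phi_phi phi_wt.
Let nxt_wtE i : wt nxt_wt i = r *m wt V i *m o. Proof. by []. Qed.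
Lemma nxt_eta_wt i : wt W i *m eta = eta *m wt nxt_wt i.
Proof.
rewrite nxt_wtE /eta !mulmxA -(mulmxA u) o_r -(mulmxA u) -phi_wt mulmxA -(mulmxA _ phi) phio.
by rewrite -free_unit_wt.
Qed.
Lemma nxt_d_wt i : wt nxt_wt i *m nxt_d = nxt_d *m wt W i.
Proof.
rewrite nxt_wtE /nxt_d /nxt_ext !mulmxA -(mulmxA _ o) o_r -(mulmxA r) phi_wt mulmxA rphi.
by rewrite -(mulmxA r) (free_ext_wt (V := W)) ?mulmxA // => j; apply: bs_pw.
Qed.

(** The new projection 1 - d eta kills the image of the contraction [nxt_eta]. Iterating therefore
    yields the normalized bar resolution relative to the idempotents. *)
Program Definition nxt : bar_stage := @BarStage N (1%:M - nxt_d *m eta) nxt_wt _ _ _.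
Next Obligation.
have xx : nxt_d *m eta *m (nxt_d *m eta) = nxt_d *m eta.
  by rewrite mulmxA -(mulmxA nxt_d) nxt_eta_d -mulmxA nxt_pi_eta.
by rewrite mulmxBl mul1mx mulmxBr mulmx1 xx subrr subr0.
Qed.
Next Obligation.
move=> i; rewrite mulmxBl mulmxBr mul1mx mulmx1; congr (_ - _).
by rewrite mulmxA nxt_d_hom -mulmxA nxt_eta_e mulmxA.
Qed.
Next Obligation.
move=> i; rewrite mulmxBl mulmxBr mul1mx mulmx1; congr (_ - _).
by rewrite mulmxA nxt_d_wt -mulmxA nxt_eta_wt mulmxA.
Qed.
Lemma nxt_eta_pi : eta *m bs_pi nxt = 0.
Proof. by rewrite mulmxBr mulmx1 mulmxA nxt_eta_d nxt_pi_eta subrr. Qed.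


(** Weight 0 of im(pi) (x) L involves only degree 0 of L, hence lies in the image of [nxt_eta],
    which the new projection kills. What the next stage is built on has no weight 0 part. *)
Lemma nxt_wt0_pi : wt nxt_wt 0 *m bs_pi nxt = 0.
Proof.
have Z : eta *m (wt nxt_wt 0 *m bs_pi nxt) = 0.
  by rewrite mulmxA -nxt_eta_wt -mulmxA nxt_eta_pi mulmx0.
have Ze i : eta *m fm_act N (e i) *m (wt nxt_wt 0 *m bs_pi nxt) = 0.
  rewrite -mulmxA (mulmxA (fm_act N (e i))) (wt_act nxt_wt 0 (td_grade t i)) subr0 -mulmxA.
  transitivity (eta *m (wt nxt_wt 0 *m bs_pi nxt) *m fm_act N (e i)); last by rewrite Z mul0mx.
  have P : fm_act N (e i) *m bs_pi nxt = bs_pi nxt *m fm_act N (e i) by exact: (bs_pe nxt i).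
  by transitivity (eta *m (wt nxt_wt 0 *m (bs_pi nxt *m fm_act N (e i)))); [rewrite P|rewrite !mulmxA].
have {Ze}Z0 a : a \in G 0 -> eta *m fm_act N a *m (wt nxt_wt 0 *m bs_pi nxt) = 0.
  move=> /td_grade0-/(_ _ t) ->; rewrite fm_act_sum mulmx_sumr mulmx_suml big1 // => i _.
  by rewrite -scalemxAr -scalemxAl Ze scaler0.
have Zp a c : 0 < c -> a \in G c -> fm_act N a *m (wt nxt_wt 0 *m bs_pi nxt) = 0.
  move=> c_gt0 Ga; rewrite mulmxA (wt_act nxt_wt 0 Ga) wt0 ?mul0mx //.
  by left; move: c_gt0; clear; lia.
move: (wt nxt_wt 0 *m bs_pi nxt) Z0 Zp => z Z0 Zp.
have oz : o *m z = 0; last by rewrite -[z]mul1mx -ro -mulmxA oz mulmx0.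
apply: (tens_homogeneous_ext (G := G)) => v a c Ga; rewrite mulmx0.
have -> : tens v a *m (o *m z) = v *m (eta *m fm_act N a *m z).
  rewrite tensE; transitivity (v *m (u *m (fm_act F a *m o) *m z)); first by rewrite !mulmxA.
  by rewrite o_hom /eta; move: (fm_act N a) => A; rewrite !mulmxA.
case/gr_supp: (Ga) => [->|[j cE _]].
  by rewrite (lin0 (@fm_linear _ _ _ N)) mulmx0 mul0mx mulmx0.
case: (posnP j) => [j0|j_gt0]; first by rewrite Z0 ?mulmx0 // -[0](_ : c = 0) // cE j0.
by rewrite -mulmxA (Zp _ c) ?mulmx0 // cE.
Qed.
End Next.
End RelativelyFree.

(** * Bar resolutions *)

Section Bar.
Variables (k : fieldType) (L : falgType k) (G : nonneg_grading L) (n : nat) (t : top_data G n).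
Local Notation e := (td_e t).
Local Notation fmodR := (fmod L right_side).

(* The augmented bar complex of a simple module: the module sits in degree 1, its
   relatively free resolution in degrees p <= 0, and [be] is a contraction which
   is linear over the subalgebra spanned by the idempotents. *)
Record bar (i : 'I_n) := Bar {
  bX :> int -> fmodR;
  bd : forall p q, p + 1 = q -> 'M[k]_(fm_dim (bX p), fm_dim (bX q));
  be : forall p q, p + 1 = q -> 'M[k]_(fm_dim (bX q), fm_dim (bX p));
  bw : forall p, weights G (bX p);
  b_high : forall p, 1 < p -> fm_dim (bX p) = 0%N;
  b_top_dim : fm_dim (bX 1) = 1%N;
  b_top_act : forall a, fm_act (bX 1) a = (chr (td_S t) i a)%:M;
  b_top_wt : wt (bw 1) 0 = 1%:M;
  bd_hom : forall p q (a : p + 1 = q), is_fhom (M := bX p) (N := bX q) (bd a);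
  be_e : forall p q (a : p + 1 = q) j, fm_act (bX q) (e j) *m be a = be a *m fm_act (bX p) (e j);
  bdd : forall p q r (a : p + 1 = q) (b : q + 1 = r), bd a *m bd b = 0;
  bee : forall p q r (a : p + 1 = q) (b : q + 1 = r), be b *m be a = 0;
  bed : forall p q r (a : p + 1 = q) (b : q + 1 = r), be a *m bd a + bd b *m be b = 1%:M;
  b_ext : forall p q r (a : p + 1 = q) (b : q + 1 = r) (N : fmodR) (h : 'M[k]_(fm_dim (bX q), fm_dim N)),
    p <= 0 -> (forall j, fm_act (bX q) (e j) *m h = h *m fm_act N (e j)) -> be b *m h = 0 ->
    exists2 f : 'M_(fm_dim (bX p), fm_dim N), is_fhom (M := bX p) (N := N) f & be a *m f = h;
  b_uniq : forall p q (a : p + 1 = q) (N : fmodR) (f h : 'M[k]_(fm_dim (bX p), fm_dim N)),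
    p <= 0 -> is_fhom (M := bX p) (N := N) f -> is_fhom (M := bX p) (N := N) h ->
    be a *m f = be a *m h -> f = h;
  b_proj : forall p, p <= 0 -> fm_projective (bX p);
  bw_d : forall p q (a : p + 1 = q) s, wt (bw p) s *m bd a = bd a *m wt (bw q) s;
  bw_e : forall p q (a : p + 1 = q) s, wt (bw q) s *m be a = be a *m wt (bw p) s;
  b_wt0 : forall p q (a : p + 1 = q) m (h : 'M[k]_(fm_dim (bX p), m)),
    p <= 0 -> be a *m h = 0 -> wt (bw p) 0 *m h = 0 }.

Program Definition zero_weights : weights G (zero_fmod L) := @Weights k L G (zero_fmod L) (fun=> 0) 0 _ _ _ _.
Next Obligation. by move=> i j; rewrite mulmx0; case: ifP. Qed.
Next Obligation. by move=> *; apply: dim0_mx. Qed.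
Next Obligation. by []. Qed.
Next Obligation. by move=> *; apply: dim0_mx. Qed.

Program Definition zero_stage : bar_stage t := @BarStage k L G n t (zero_fmod L) 1%:M zero_weights _ _ _.
Next Obligation. by rewrite mulmx1. Qed.
Next Obligation. by move=> *; apply: dim0_mx. Qed.
Next Obligation. by move=> *; apply: dim0_mx. Qed.

Section Simple.
Variable i : 'I_n.
Local Notation S := (td_S t i).

Program Definition simple_weights : weights G S := @Weights k L G S (fun s => if s == 0 then 1%:M else 0) 1 _ _ _ _.
Next Obligation.
move=> a b /=; case: (eqVneq a 0) => [->|_]; last by rewrite mul0mx if_same.
by rewrite mul1mx (eq_sym 0); case: eqP.
Qed.
Next Obligation.
move=> s c a Ga; rewrite (chrE (td_dim t)); case: (ltgtP c 0) => [c_lt0|c_gt0|->]; last 1 first.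
- by rewrite subr0; case: ifP => _; rewrite ?mulmx1 ?mul1mx ?mulmx0 ?mul0mx.
- have -> : a = 0 by apply/eqP; rewrite -memv0 -(gr_neg G c_lt0).
  have -> : chr (td_S t) i 0 = 0 by exact: (lin0 (@chr_linear k L n (td_S t) i)).
  by rewrite raddf0 mulmx0 mul0mx.
- by rewrite (td_chr_pos t i c_gt0 Ga) raddf0 mulmx0 mul0mx.
Qed.
Next Obligation. by move=> s Hs /=; case: eqP => // s0; move: Hs; rewrite s0 => -[]. Qed.
Next Obligation.
move=> m N; rewrite add1n => lt_m; rewrite (bigD1 (Ordinal lt_m)) //= subrr eqxx big1 ?addr0 // => s.
by move/negP => ne; case: eqP => // E; case: ne; apply/eqP/val_inj => /=; move: E; clear; lia.
Qed.

Program Definition simple_stage : bar_stage t := @BarStage k L G n t S 1%:M simple_weights _ _ _.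
Next Obligation. by rewrite mulmx1. Qed.
Next Obligation. by move=> j; rewrite mulmx1 mul1mx. Qed.
Next Obligation. by move=> j; rewrite mulmx1 mul1mx. Qed.

(** Stage m will sit in degree 2 - m: the simple module is stage 1, in degree 1, and the zero stage
    0 closes the complex on top. *)
Definition bT m : bar_stage t :=
  match m with 0%N => zero_stage | m'.+1 => iter m' (@nxt k L G n t) simple_stage end.
Definition bT_eta m : 'M[k]_(fm_dim (bT m), fm_dim (bT m.+1)) :=
  match m with 0%N => 0 | m'.+1 => nxt_eta (bT m'.+1) end.
Definition bT_d m : 'M[k]_(fm_dim (bT m.+1), fm_dim (bT m)) :=
  match m with 0%N => 0 | m'.+1 => nxt_d (bT m'.+1) end.

Lemma bT_pi m : bs_pi (bT m.+1) = 1%:M - bT_d m *m bT_eta m.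
Proof. by case: m => [|m] //=; rewrite mulmx0 subr0. Qed.
Lemma bT_eta_d m : bT_eta m *m bT_d m = bs_pi (bT m).
Proof. by case: m => [|m]; [apply: dim0_mx|apply: nxt_eta_d]. Qed.
Lemma bT_eta_eta m : bT_eta m *m bT_eta m.+1 = 0.
Proof.
case: m => [|m]; first exact: mul0mx.
have := nxt_pi_eta (bT m.+2); rewrite -[bT_eta m.+2]/(nxt_eta (bT m.+2)) => <-.
by rewrite mulmxA nxt_eta_pi mul0mx.
Qed.
Lemma bT_d_hom m : is_fhom (M := bT m.+1) (N := bT m) (bT_d m).
Proof. by case: m => [|m]; [apply: fhom0|apply: nxt_d_hom]. Qed.
(** The inductive form of d d = 0: both sides are L-linear, so they are compared after [nxt_eta],
    where d d becomes pi d = d - d pi. *)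
Lemma bT_d_pi m : bT_d m *m bs_pi (bT m) = bT_d m.
Proof.
case: m => [|m]; first exact: mul0mx.
elim: m => [|m IH]; first exact: mulmx1.
rewrite bT_pi mulmxBr mulmx1 mulmxA [X in X *m bT_eta _](_ : _ = 0) ?mul0mx ?subr0 //.
apply: (nxt_hom_ext (s := bT m.+2)); last rewrite mulmx0.
- exact: (fhomM (@bT_d_hom m.+2) (@bT_d_hom m.+1)).
- exact: fhom0.
by rewrite mulmxA nxt_eta_d bT_pi mulmxBl mul1mx -mulmxA bT_eta_d IH subrr.
Qed.
Lemma bT_dd m : bT_d m.+1 *m bT_d m = 0.
Proof.
case: m => [|m]; first exact: mulmx0.
apply: (nxt_hom_ext (s := bT m.+2)); last rewrite mulmx0.
- exact: (fhomM (@bT_d_hom m.+2) (@bT_d_hom m.+1)).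
- exact: fhom0.
by rewrite mulmxA nxt_eta_d bT_pi mulmxBl mul1mx -mulmxA bT_eta_d bT_d_pi subrr.
Qed.
Lemma bT_eta_e m j : fm_act (bT m) (e j) *m bT_eta m = bT_eta m *m fm_act (bT m.+1) (e j).
Proof. by case: m => [|m]; [rewrite mulmx0 mul0mx|apply: nxt_eta_e]. Qed.
Lemma bT_eta_wt m s : wt (bs_wt (bT m)) s *m bT_eta m = bT_eta m *m wt (bs_wt (bT m.+1)) s.
Proof. by case: m => [|m]; [rewrite mulmx0 mul0mx|apply: nxt_eta_wt]. Qed.
Lemma bT_d_wt m s : wt (bs_wt (bT m.+1)) s *m bT_d m = bT_d m *m wt (bs_wt (bT m)) s.
Proof. by case: m => [|m]; [rewrite mulmx0 mul0mx|apply: nxt_d_wt]. Qed.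

(** Defined for all pairs of stages, and zero unless they are consecutive, so that the indices
    computed from degrees can be rewritten freely. *)
Definition bT_D a b : 'M[k]_(fm_dim (bT a), fm_dim (bT b)) :=
  match a =P b.+1 with
  | ReflectT E => ecast a 'M[k]_(fm_dim (bT a), fm_dim (bT b)) (esym E) (bT_d b)
  | _ => 0 end.
Definition bT_E a b : 'M[k]_(fm_dim (bT a), fm_dim (bT b)) :=
  match b =P a.+1 with
  | ReflectT E => ecast b 'M[k]_(fm_dim (bT a), fm_dim (bT b)) (esym E) (bT_eta a)
  | _ => 0 end.
Lemma bT_DS b : bT_D b.+1 b = bT_d b.
Proof. by rewrite /bT_D; case: eqP => // E; rewrite (eq_irrelevance E erefl). Qed.
Lemma bT_ES b : bT_E b b.+1 = bT_eta b.
Proof. by rewrite /bT_E; case: eqP => // E; rewrite (eq_irrelevance E erefl). Qed.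

Definition bar_index (p : int) : nat := if (2 - p)%R is Posz m then m else 0%N.
Lemma bar_index_case p q : p + 1 = q ->
  (p <= 1 /\ bar_index p = (bar_index q).+1) \/ (1 < p /\ bar_index p = 0%N /\ bar_index q = 0%N).
Proof.
rewrite /bar_index => pq; case Ep : (2 - p) => [a|a]; case Eq : (2 - q) => [b|b]; move: Ep Eq; rewrite -pq.
- by case: (leP p 1) => le_p Ep Eq; [left|right]; split=> //; move: le_p Ep Eq; clear; lia.
- by right; move: Ep Eq; clear; lia.
- by right; move: Ep Eq; clear; lia.
- by right; move: Ep Eq; clear; lia.
Qed.

Definition bar_of : bar i.
Proof.
unshelve refine (@Bar i (fun p => bT (bar_index p)) (fun p q _ => bT_D (bar_index p) (bar_index q))
  (fun p q _ => bT_E (bar_index q) (bar_index p)) (fun p => bs_wt (bT (bar_index p))) _ _ _ _ _ _ _ _ _ _ _ _ _ _ _).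
- move=> p lt_p; have [[le_p _]|[_ [-> _]]] := bar_index_case (erefl (p + 1)) => //.
  by move: lt_p le_p; clear; lia.
- exact: td_dim.
- by move=> a; apply: (chrE (td_dim t)).
- by [].
- move=> p q a; have [[_ ->]|[_ [-> ->]]] := bar_index_case a; first by rewrite bT_DS; apply: bT_d_hom.
  by move=> b; apply: dim0_mx.
- move=> p q a j; have [[_ ->]|[_ [-> ->]]] := bar_index_case a; first by rewrite bT_ES; apply: bT_eta_e.
  by apply: dim0_mx.
- move=> p q r a b; have [[_ ->]|[_ [-> ->]]] := bar_index_case a; last exact: dim0_mx.
  have [[_ ->]|[_ [-> ->]]] := bar_index_case b; first by rewrite !bT_DS; apply: bT_dd.
  by apply: dim0_mxr.
- move=> p q r a b; have [[_ ->]|[_ [-> ->]]] := bar_index_case a; last exact: dim0_mxr.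
  have [[_ ->]|[_ [-> ->]]] := bar_index_case b; first by rewrite !bT_ES; apply: bT_eta_eta.
  by apply: dim0_mx.
- move=> p q r a b; have [[_ ->]|[_ [_ ->]]] := bar_index_case a; last exact: dim0_mx.
  have [[_ ->]|[_ [-> ->]]] := bar_index_case b; last exact: dim0_mx.
  by rewrite !bT_ES !bT_DS bT_eta_d bT_pi subrK.
- move=> p q r a b N h le_p; have [[_ E1]|[lt_p _]] := bar_index_case a; last by move: lt_p le_p; clear; lia.
  have [[_ E2]|[lt_q _]] := bar_index_case b; last by move: lt_q le_p a; clear; lia.
  move: h; rewrite E1 E2 !bT_ES => h he h0; exists (nxt_ext (s := bT (bar_index r).+1) h); first exact: nxt_ext_hom.
  by rewrite nxt_extE // bT_pi mulmxBl mul1mx -mulmxA h0 mulmx0 subr0.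
- move=> p q a N f h le_p; have [[_ E1]|[lt_p _]] := bar_index_case a; last by move: lt_p le_p; clear; lia.
  have [[_ E2]|[lt_q _]] := bar_index_case (erefl (q + 1)); last by move: lt_q le_p a; clear; lia.
  move: f h; rewrite E1 E2 bT_ES => f h; exact: nxt_hom_ext.
- move=> p le_p; have [[_ ->]|[lt_p _]] := bar_index_case (erefl (p + 1)); last by move: lt_p le_p; clear; lia.
  have [[_ ->]|[lt_q _]] := bar_index_case (erefl (p + 1 + 1)); last by move: lt_q le_p; clear; lia.
  exact: nxt_projective.
- move=> p q a s; have [[_ ->]|[_ [-> ->]]] := bar_index_case a; first by rewrite bT_DS; apply: bT_d_wt.
  by apply: dim0_mx.
- move=> p q a s; have [[_ ->]|[_ [-> ->]]] := bar_index_case a; first by rewrite bT_ES; apply: bT_eta_wt.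
  by apply: dim0_mx.
- move=> p q a m h le_p; have [[_ E1]|[lt_p _]] := bar_index_case a; last by move: lt_p le_p; clear; lia.
  have [[_ E2]|[lt_q _]] := bar_index_case (erefl (q + 1)); last by move: lt_q le_p a; clear; lia.
  move: h; rewrite E1 E2 bT_ES => h h0.
  have -> : h = bs_pi (bT (bar_index (q + 1)).+2) *m h by rewrite bT_pi mulmxBl mul1mx -mulmxA h0 mulmx0 subr0.
  by rewrite mulmxA nxt_wt0_pi mul0mx.
Qed.
End Simple.
End Bar.

(** * The Koszul dual category *)

Section VectorSpaces.
Variable k : fieldType.

Program Definition kspace (m : nat) : fmod (k^o : falgType k) right_side :=
  @FMod k (k^o : falgType k) right_side m (fun c => (c : k)%:M) _ _ _.
Next Obligation. by move=> m a x y; apply/matrixP => i j; rewrite !mxE mulrnDl mulrnAr. Qed.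
Next Obligation. by []. Qed.
Next Obligation. by move=> m a b; exact: scalar_mxM. Qed.

Lemma k_act (M : fmod (k^o : falgType k) right_side) c : fm_act M c = (c : k)%:M.
Proof.
have -> : c = (c : k) *: (1 : k^o) by rewrite /GRing.scale /= mulr1.
rewrite (linZ (@fm_linear _ _ _ M)) fm_act1; rewrite scalemx1; congr (_%:M).
by rewrite /GRing.scale /= mulr1.
Qed.
Lemma k_fhom (M N : fmod (k^o : falgType k) right_side) (f : 'M_(fm_dim M, fm_dim N)) : is_fhom f.
Proof. by move=> c; rewrite !k_act scalar_mxC. Qed.
Lemma k_projective (M : fmod (k^o : falgType k) right_side) : fm_projective M.
Proof.
move=> A C g h _ fg _; exists (h *m pinvmx g); first exact: k_fhom.
by rewrite -mulmxA mulVpmx ?mulmx1.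
Qed.
End VectorSpaces.

Lemma contraction_exact (k : fieldType) a b c (D1 : 'M[k]_(a, b)) (D2 : 'M[k]_(b, c)) E1 E2 :
  E1 *m D1 + D2 *m E2 = 1%:M -> (kermx D2 <= D1)%MS.
Proof.
by move=> E; rewrite -[kermx _]mulmx1 -E mulmxDr !mulmxA mulmx_ker mul0mx addr0 submxMl.
Qed.

Section Koszul.
Variables (k : fieldType) (L : falgType k) (G : nonneg_grading L) (n : nat) (t : top_data G n).
Local Notation e := (td_e t).
Local Notation Dk := (Db_dgcat (k^o : falgType k)).
Variable B : forall i, bar t i.

Section Augmented.
Variable i : 'I_n.
(** The action of L is forgotten because the morphisms below are not L-linear into degree 1;
    complexes over k supply their differential and composition. *)
Definition aug_complex : proj_complex (k^o : falgType k).
Proof.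
exists (fun p => kspace k (fm_dim (B i p))) (fun p q a => bd (B i) a).
- by move=> *; apply: k_fhom.
- by move=> *; apply: bdd.
- by move=> p; apply: k_projective.
- by exists 1 => p; apply: b_high.
- exists 0 => p q r a b _; exact: (contraction_exact (bed (B i) a b)).
Defined.
End Augmented.

Local Notation Hom i j m := (@dg_hom k Dk (aug_complex i) (aug_complex j) m).
Definition ent i j m (u : Hom i j m) p q (a : p + m = q) : 'M[k]_(fm_dim (B i p), fm_dim (B j q)) :=
  cxh (u : cx_hom (aug_complex i) (aug_complex j) m) a.
Arguments ent {i j m} u {p q} a.

Definition mk_ent i j m (f : forall p q, p + m = q -> 'M[k]_(fm_dim (B i p), fm_dim (B j q))) : Hom i j m :=
  @mk_cx k _ (aug_complex i) (aug_complex j) m f (fun p q a => @k_fhom k (aug_complex i p) (aug_complex j q) (f p q a)).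
Lemma mk_entE i j m f p q (a : p + m = q) : ent (@mk_ent i j m f) a = f p q a. Proof. by []. Qed.
Lemma entP i j m (u v : Hom i j m) : (forall p q (a : p + m = q), ent u a = ent v a) -> u = v.
Proof. by move=> E; apply: cxhP => p q a; exact: E. Qed.
Lemma ent_zd i j m c (u v : Hom i j m) p q (a : p + m = q) : ent (c *: u + v) a = c *: ent u a + ent v a.
Proof. by []. Qed.
Lemma ent_comp i j l m m' m'' (em : m' + m = m'') (g : Hom j l m') (f : Hom i j m) p q r
    (a : p + m'' = r) (b : p + m = q) (c : q + m' = r) :
  ent (dg_comp em g f : Hom i l m'') a = ent f b *m ent g c.
Proof. exact: (cxh_comp em g f a b c). Qed.
Lemma ent_d i j m m' (em : m + 1 = m') (f : Hom i j m) p q r s (a : p + m' = q)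
    (b : p + m = r) (c : r + 1 = q) (d : p + 1 = s) (d' : s + m = q) :
  ent (dg_d em f : Hom i j m') a = ent f b *m bd (B j) c - (-1 : k) ^ m *: (bd (B i) d *m ent f d').
Proof. exact: (cxh_d em f a b c d d'). Qed.
Lemma ent_id i p (a : p + 0 = p) : ent (dg_id (aug_complex i : Dk) : Hom i i 0) a = 1%:M.
Proof. exact: (@cxh_id0 k _ (aug_complex i) p a). Qed.
Lemma ent0 i j m p q (a : p + m = q) : ent (0 : Hom i j m) a = 0. Proof. by []. Qed.
Lemma entD i j m (u v : Hom i j m) p q (a : p + m = q) : ent (u + v) a = ent u a + ent v a.
Proof. by []. Qed.
Lemma entB i j m (u v : Hom i j m) p q (a : p + m = q) : ent (u - v) a = ent u a - ent v a.
Proof. by []. Qed.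
Lemma entZ i j m c (u : Hom i j m) p q (a : p + m = q) : ent (c *: u) a = c *: ent u a.
Proof. by []. Qed.
#[local] Opaque ent.

Section Conditions.
Variables (i j : 'I_n) (m : int).
Definition e_linear_at p q (f : 'M[k]_(fm_dim (B i p), fm_dim (B j q))) : Prop :=
  forall s, fm_act (B i p) (e s) *m f = f *m fm_act (B j q) (e s).
Definition L_linear_at p q (f : 'M[k]_(fm_dim (B i p), fm_dim (B j q))) : Prop :=
  is_fhom (M := B i p) (N := B j q) f.

(** L-linearity is not imposed into degree 1. There the components are linear over the idempotents
    and kill the image of the contraction, and they determine all others: the morphisms form the
    dual of the bar construction. *)
Definition koszul_subspace : subspace (Hom i j m).
Proof.
exists (fun u => [/\ 0 <= m \/ u = 0,
  forall p p' q q' (a : p + 1 = p') (b : q + 1 = q') (c : p + m = q) (c' : p' + m = q'),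
    be (B i) a *m ent u c = (-1) ^ m *: (ent u c' *m be (B j) b),
  forall p q (a : p + m = q), e_linear_at (ent u a) &
  forall p q (a : p + m = q), q <= 0 -> L_linear_at (ent u a)]).
- split=> [|p p' q q' a b c c'|p q a s|p q a _ s]; rewrite ?ent0 ?mulmx0 ?mul0mx ?scaler0 //.
  by right.
- move=> x u v [u1 u2 u3 u4] [v1 v2 v3 v4]; split=> [|p p' q q' a b c c'|p q a s|p q a le_q s].
  + case: u1 => [|->]; first by left.
    by case: v1 => [|->]; [left|right; rewrite scaler0 addr0].
  + rewrite !ent_zd mulmxDr mulmxDl -scalemxAr -scalemxAl (u2 _ _ _ _ a b c c') (v2 _ _ _ _ a b c c').
    by rewrite scalerDr !scalerA mulrC.
  + by rewrite ent_zd mulmxDr mulmxDl -scalemxAr -scalemxAl u3 v3.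
  + by rewrite ent_zd mulmxDr mulmxDl -scalemxAr -scalemxAl u4 // v4.
Defined.
End Conditions.

(** Since e d + d e = 1 on both complexes, commuting the contraction past the differential of u
    produces u twice, with opposite signs. *)
Lemma koszul_d i j m m' (em : m + 1 = m') u : koszul_subspace i j m u -> koszul_subspace i j m' (dg_d em u).
Proof.
move=> [u1 u2 u3 u4]; split=> [|p p' q q' a b c c'|p q a s|p q a le_q].
- case: u1 => [m_ge0|->]; last by right; rewrite (lin0 (dg_d_linear _)).
  by left; rewrite -em addr_ge0.
- have a1 : p + m + 1 = q by clear -c em; lia.
  have a2 : p' + m = q by clear -c em a; lia.
  have a4 : p' + 1 + m = q' by clear -c' em; lia.
  rewrite (ent_d em u c erefl a1 a a2) (ent_d em u c' a2 b erefl a4).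
  have s1 : (-1 : k) ^ m' = - (-1) ^ m by rewrite -em signD expr1z mulrN1.
  have E1 : be (B j) a1 *m bd (B j) a1 = 1%:M - bd (B j) b *m be (B j) b.
    by rewrite -(bed (B j) a1 b) addrK.
  have E2 : be (B i) a *m bd (B i) a = 1%:M - bd (B i) (erefl (p' + 1)) *m be (B i) erefl.
    by rewrite -(bed (B i) a erefl) addrK.
  rewrite s1 mulmxBr mulmxBl -scalemxAr -scalemxAl !mulmxA (u2 _ _ _ _ a a1 erefl a2) E2.
  rewrite -scalemxAl -(mulmxA (ent u a2)) E1 mulmxBr mulmx1 mulmxBl mul1mx -(mulmxA (bd _ _)).
  rewrite (u2 _ _ _ _ erefl b a2 a4) -scalemxAr !mulmxA scaleNr !scalerBr !scalerA sign_sq !scale1r.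
  by abel.
- rewrite (ent_d em u a erefl (_ : p + m + 1 = q) erefl (_ : p + 1 + m = q)); try by clear -a em; lia.
  move=> a1 a2; rewrite mulmxBr mulmxBl -scalemxAr -scalemxAl !mulmxA u3 bd_hom -!mulmxA.
  by rewrite bd_hom u3.
- have a1 : p + m + 1 = q by clear -a em; lia.
  have a2 : p + 1 + m = q by clear -a em; lia.
  rewrite (ent_d em u a erefl a1 erefl a2); apply: (fhomB (M := B i p) (N := B j q)).
    by apply: (fhomM (N := B j (p + m))); [apply: u4; clear -a1 le_q; lia|exact: bd_hom].
  by apply: (fhomZ (M := B i p) (N := B j q)); apply: (fhomM (N := B i (p + 1))); [exact: bd_hom|exact: u4].
Qed.

Lemma koszul_id i : koszul_subspace i i 0 (dg_id (aug_complex i : Dk)).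
Proof.
split=> [|p p' q q' a b c c'|p q a s|p q a le_q]; first by left.
- have Eq : q = p by rewrite -c addr0.
  have Eq' : q' = p' by rewrite -c' addr0.
  move: b c c'; rewrite Eq Eq' => b c c'; rewrite !ent_id mulmx1 mul1mx expr0z scale1r.
  by rewrite (int_eq_irr a b).
- have Eq : q = p by rewrite -a addr0.
  by move: a; rewrite Eq => a; rewrite ent_id mulmx1 mul1mx.
- have Eq : q = p by rewrite -a addr0.
  by move: a; rewrite Eq => a; rewrite ent_id; exact: fhom1.
Qed.

Lemma koszul_comp i j l m' m m'' (em : m' + m = m'') g f :
  koszul_subspace j l m' g -> koszul_subspace i j m f -> koszul_subspace i l m'' (dg_comp em g f).
Proof.
move=> [g1 g2 g3 g4] [f1 f2 f3 f4]; split=> [|p p' q q' a b c c'|p q a s|p q a le_q].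
- case: g1 => [m'_ge0|->]; last by right; rewrite dg_comp0l.
  case: f1 => [m_ge0|->]; last by right; rewrite dg_comp0r.
  by left; rewrite -em addr_ge0.
- have a1 : p + m + m' = q by clear -c em; lia.
  have a2 : p' + m + m' = q' by clear -c' em; lia.
  have a3 : p + m + 1 = p' + m by clear -a; lia.
  rewrite (ent_comp em g f c erefl a1) (ent_comp em g f c' erefl a2) mulmxA (f2 _ _ _ _ a a3 erefl erefl).
  rewrite -scalemxAl -(mulmxA (ent f erefl) (be (B j) a3)) (g2 _ _ _ _ a3 b a1 a2) -scalemxAr scalerA mulmxA.
  by rewrite -em signD mulrC.
- have a1 : p + m + m' = q by clear -a em; lia.
  by rewrite (ent_comp em g f a erefl a1) mulmxA f3 -mulmxA g3 mulmxA.
- have a1 : p + m + m' = q by clear -a em; lia.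
  rewrite (ent_comp em g f a erefl a1); case: g1 => [m'_ge0|g0]; last first.
    by rewrite g0 ent0 mulmx0; exact: fhom0.
  apply: (fhomM (N := B j (p + m))); last exact: g4.
  by apply: f4; clear -a1 m'_ge0 le_q; lia.
Qed.

Definition koszul : dgcat k := sub_dgcat (o := aug_complex : _ -> Dk) koszul_d koszul_id koszul_comp.
End Koszul.

Arguments ent {k L G n t B i j m} u {p q} a.

(** * From the Koszul dual category to the derived category *)

Section Recursion.
Variables (k : fieldType) (L : falgType k) (G : nonneg_grading L) (n : nat) (t : top_data G n).
Local Notation e := (td_e t).
Local Notation Dk := (Db_dgcat (k^o : falgType k)).
Variables (B : forall i, bar t i) (i j : 'I_n).
Local Notation Hom m := (@dg_hom k Dk (aug_complex B i) (aug_complex B j) m).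
#[local] Opaque ent.

(** An L-linear map out of the term in degree p is determined by its composite with the contraction,
    which the relation expresses through the component out of degree p + 1. *)
Lemma bar_zero m N (c : k) (u : Hom m) : N <= 1 ->
  (forall p q (a : p + m = q), N <= p -> ent u a = 0) ->
  (forall p q (a : p + m = q), p < N -> L_linear_at (ent u a)) ->
  (forall p p' q q' (a : p + 1 = p') (b : q + 1 = q') (d : p + m = q) (d' : p' + m = q'), p < N ->
    be (B i) a *m ent u d = c *: (ent u d' *m be (B j) b)) ->
  u = 0.
Proof.
move=> le_N u0 uL uE; suff H (w : nat) : forall p q (a : p + m = q), N - w%:Z <= p -> ent u a = 0.
  by apply: entP => p q a; rewrite ent0; apply: (H (absz (N - p))); clear; lia.
elim: w => [|w IH] p q a le_p; first by apply: u0; clear -le_p; lia.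
have [le_Np|lt_pN] := leP N p; first exact: u0.
have b : p + 1 + m = q + 1 by clear -a; lia.
apply: (@b_uniq k L G n t i (B i) p _ (erefl (p + 1)) (B j q)); first by clear -lt_pN le_N; lia.
- exact: uL.
- exact: fhom0.
rewrite (uE _ _ _ _ _ (erefl (q + 1)) _ b) // IH ?mul0mx ?mulmx0 ?scaler0 //.
by clear -le_p; lia.
Qed.

(** Existence for the same recursion, with an inhomogeneous term S: zero for Koszul morphisms, e b e
    for the homotopy. The vanishing of S on either side of the contraction makes each right-hand
    side extendable. *)
Lemma bar_rec m m' N (c : k) (base : Hom m) (S : Hom m') : m' + 1 = m -> N <= 1 ->
  (forall p q (a : p + m = q), N <= p -> e_linear_at (ent base a)) ->
  (forall p p' q q' (a : p + 1 = p') (b : q' + 1 = q) (d : p + m = q), N <= p ->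
    be (B i) a *m ent base d *m be (B j) b = 0) ->
  (forall p q (a : p + m' = q), e_linear_at (ent S a)) ->
  (forall p p' q (a : p + 1 = p') (d : p + m' = q), be (B i) a *m ent S d = 0) ->
  (forall p q q' (b : q' + 1 = q) (d : p + m' = q), ent S d *m be (B j) b = 0) ->
  exists f : Hom m, [/\ forall p q (a : p + m = q), N <= p -> ent f a = ent base a,
    forall p q (a : p + m = q), p < N -> L_linear_at (ent f a),
    forall p q (a : p + m = q), e_linear_at (ent f a) &
    forall p p' q q' (a : p + 1 = p') (b : q + 1 = q') (d : p + m = q) (d' : p' + m = q')
      (s : p' + m' = q), p < N ->
      be (B i) a *m ent f d = c *: (ent f d' *m be (B j) b) + ent S s].
Proof.
move=> em le_N base_e base_k S_e S_l S_r.
pose T p := 'M[k]_(fm_dim (B i p), fm_dim (B j (p + m))).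
(* The condition e f e = 0 is carried along because it makes the next right-hand side vanish after
   the contraction, as [b_ext] demands. *)
pose good p (f : T p) := [/\ e_linear_at f, (forall q' (b : q' + 1 = p + m), be (B i) (erefl (p + 1)) *m f *m be (B j) b = 0)
  & p < N -> L_linear_at f].
have e1 p : p + m + 1 = p + 1 + m by clear; lia.
have e2 p : p + 1 + m' = p + m by clear -em; lia.
pose R p (f : T p) (g : T (p + 1)) := p < N ->
  be (B i) (erefl (p + 1)) *m f = c *: (g *m be (B j) (e1 p)) + ent S (e2 p).
have [||F [gF RF FE]] := @descend T good R N (fun p => ent base (erefl (p + m))).
- move=> p le_p; split; last by rewrite /R ltNge le_p.
  by split=> [|q' b|]; [exact: base_e|exact: base_k|rewrite ltNge le_p].
- move=> p x lt_p [xe xk xL]; pose g := c *: (x *m be (B j) (e1 p)) + ent S (e2 p).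
  have [|s||f Hf fE] := @b_ext _ _ _ _ _ _ (B i) p _ _ erefl erefl (B j (p + m)) g.
  + by clear -lt_p le_N; lia.
  + rewrite mulmxDr mulmxDl -scalemxAr -scalemxAl mulmxA xe -mulmxA be_e mulmxA.
    by rewrite S_e.
  + by rewrite mulmxDr -scalemxAr mulmxA xk scaler0 S_l addr0.
  exists f; last by [].
  split=> // q' b.
  by rewrite fE mulmxDl -scalemxAl -mulmxA bee mulmx0 scaler0 S_r addr0.
pose f : Hom m := mk_ent (fun p q a => F p *m pcast (B j) a).
have fE p : ent f (erefl (p + m)) = F p by rewrite mk_entE pcast1 mulmx1.
exists f; split=> [p q a le_p|p q a lt_p|p q a|p p' q q' a b d d' s lt_p].
- by case: q / a; rewrite fE FE.
- by case: q / a; rewrite fE; have [_ _] := gF p; apply.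
- by case: q / a; rewrite fE; have [] := gF p.
- move: b d' s; case: q / d => b d' s; move: b; case: q' / d' => b.
  move: b s; case: p' / a => b s; rewrite !fE (RF p lt_p).
  by rewrite (int_eq_irr b (e1 p)) (int_eq_irr s (e2 p)).
Qed.
End Recursion.

Lemma le0_or_gt0 (q : int) : q <= 0 \/ 0 < q.
Proof. by case: (leP q 0); [left|right]. Qed.

Lemma mask_outT (k : fieldType) (L : falgType k) (c : bool) (M : fmod L right_side) :
  c -> mask_out *m (mask_in : 'M_(fm_dim (mask_mod c M), fm_dim M)) = 1%:M.
Proof. by rewrite mask_outK => ->. Qed.

Section Resolutions.
Variables (k : fieldType) (L : falgType k) (G : nonneg_grading L) (n : nat) (t : top_data G n).
Local Notation e := (td_e t).
Local Notation Dk := (Db_dgcat (k^o : falgType k)).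
Local Notation Db := (Db_dgcat L).
Variable B : forall i, bar t i.
#[local] Opaque ent.

Definition resolution_ob i p := mask_mod (p <= 0) (B i p).
Definition res_d i p q (a : p + 1 = q) : 'M[k]_(fm_dim (resolution_ob i p), fm_dim (resolution_ob i q)) :=
  mask_in *m bd (B i) a *m mask_out.
Lemma res_exact_aux i p q r (a : p + 1 = q) (b : q + 1 = r) (v : 'rV_(fm_dim (resolution_ob i q))) :
  q < 0 -> v *m res_d i b = 0 -> exists w, v = w *m res_d i a.
Proof.
move=> lt_q; have r0 : r <= 0 by clear -b lt_q; lia.
have p0 : p <= 0 by clear -a lt_q; lia.
rewrite /res_d => /(congr1 (fun z => z *m mask_in)); rewrite mul0mx -!mulmxA mask_outK r0 mulmx1 => v0.
exists (v *m mask_in *m be (B i) a *m mask_out); rewrite -!mulmxA (mulmxA mask_out mask_in) mask_outK p0 mul1mx.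
have E : be (B i) a *m bd (B i) a = 1%:M - bd (B i) b *m be (B i) b by rewrite -(bed (B i) a b) addrK.
rewrite (mulmxA (be _ _)) E mulmxBl mul1mx !mulmxBr mask_inK mulmx1 !mulmxA.
by rewrite -(mulmxA v) v0 !mul0mx subr0.
Qed.

Definition res (i : 'I_n) : proj_complex L.
Proof.
exists (resolution_ob i) (res_d i).
- move=> p q a; apply: (fhomM (N := B i q)); last exact: mask_out_hom.
  by apply: (fhomM (N := B i p)); [exact: mask_in_hom|exact: bd_hom].
- move=> p q r a b; rewrite /res_d -!mulmxA (mulmxA mask_out) mask_outK.
  by case: ifP => _; rewrite ?mul0mx ?mulmx0 // mul1mx (mulmxA (bd _ a)) bdd mul0mx mulmx0.
- move=> p; rewrite /resolution_ob /mask_mod; case: ifP => [|_]; [exact: b_proj|exact: fm_projective_dim0].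
- by exists 0 => p lt_p; apply: mask_dim0; left; rewrite -ltNge.
- by apply: pc_bounded_cohomology_of; exists 0 => p q r a b v; apply: res_exact_aux.
Defined.
Lemma res_exact i q : q < 0 -> exact_at (res i) q.
Proof. by move=> lt_q p r a b v; apply: res_exact_aux. Qed.

Local Notation Hom i j m := (@dg_hom k Dk (aug_complex B i) (aug_complex B j) m).
Local Notation RHom i j m := (@dg_hom k Db (res i) (res j) m).
Definition rent i j m (b : RHom i j m) p q (a : p + m = q) :
  'M[k]_(fm_dim (resolution_ob i p), fm_dim (resolution_ob j q)) := cxh (b : cx_hom (res i) (res j) m) a.
Arguments rent {i j m} b {p q} a.
Lemma rentP i j m (u v : RHom i j m) : (forall p q (a : p + m = q), rent u a = rent v a) -> u = v.
Proof. by move=> E; apply: cxhP => p q a; exact: E. Qed.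
Lemma rent_hom i j m (b : RHom i j m) p q (a : p + m = q) :
  is_fhom (M := resolution_ob i p) (N := resolution_ob j q) (rent b a).
Proof. exact: (@cxh_hom k L (res i) (res j) m b p q a). Qed.
Lemma rent_zd i j m c (u v : RHom i j m) p q (a : p + m = q) : rent (c *: u + v) a = c *: rent u a + rent v a.
Proof. by []. Qed.
Lemma rent_comp i j l m m' m'' (em : m' + m = m'') (g : RHom j l m') (f : RHom i j m) p q r
    (a : p + m'' = r) (b : p + m = q) (c : q + m' = r) :
  rent (dg_comp em g f : RHom i l m'') a = rent f b *m rent g c.
Proof. exact: (cxh_comp em g f a b c). Qed.
Lemma rent_d i j m m' (em : m + 1 = m') (f : RHom i j m) p q r s (a : p + m' = q)
    (b : p + m = r) (c : r + 1 = q) (d : p + 1 = s) (d' : s + m = q) :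
  rent (dg_d em f : RHom i j m') a = rent f b *m res_d j c - (-1 : k) ^ m *: (res_d i d *m rent f d').
Proof. exact: (cxh_d em f a b c d d'). Qed.
Lemma rent_id i p (a : p + 0 = p) : rent (dg_id (res i : Db) : RHom i i 0) a = 1%:M.
Proof. exact: (@cxh_id0 k _ (res i) p a). Qed.
#[local] Opaque rent.

(** Extension by zero in degree 1, so that all computations take place between augmented complexes.
    It commutes with the differential only into degrees q <= 0. *)
Definition hat i j m (b : RHom i j m) : Hom i j m := mk_ent (fun p q a => mask_out *m rent b a *m mask_in).
Lemma hatE i j m (b : RHom i j m) p q (a : p + m = q) : ent (hat b) a = mask_out *m rent b a *m mask_in.
Proof. exact: mk_entE. Qed.
Lemma hat0 i j m (b : RHom i j m) p q (a : p + m = q) : 0 < p \/ 0 < q -> ent (hat b) a = 0.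
Proof.
rewrite hatE => -[lt|lt]; first by rewrite (mask_out0 _ (_ : ~~ (p <= 0))) ?mul0mx // -ltNge.
by rewrite (mask_in0 _ (_ : ~~ (q <= 0))) ?mulmx0 // -ltNge.
Qed.
Lemma hat_hom i j m (b : RHom i j m) p q (a : p + m = q) : L_linear_at (ent (hat b) a).
Proof.
rewrite hatE; apply: (fhomM (N := resolution_ob j q)); last exact: mask_in_hom.
by apply: (fhomM (N := resolution_ob i p)); [exact: mask_out_hom|exact: rent_hom].
Qed.
Lemma hatP i j m (u v : RHom i j m) :
  (forall p q (a : p + m = q), p <= 0 -> q <= 0 -> ent (hat u) a = ent (hat v) a) -> u = v.
Proof.
move=> E; apply: rentP => p q a.
have F (w : RHom i j m) : rent w a = mask_in *m ent (hat w) a *m mask_out.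
  by rewrite hatE !mulmxA mask_inK mul1mx -mulmxA mask_inK mulmx1.
rewrite !F; have [le_p|lt_p] := le0_or_gt0 p; last by rewrite !hat0 //; left.
have [le_q|lt_q] := le0_or_gt0 q; last by rewrite !hat0 //; right.
by rewrite E.
Qed.
Lemma hat_zd i j m c (u v : RHom i j m) : hat (c *: u + v) = c *: hat u + hat v.
Proof.
apply: entP => p q a; rewrite ent_zd !hatE rent_zd mulmxDr mulmxDl -scalemxAr -scalemxAl //.
Qed.
Lemma hat_comp i j l m m' m'' (em : m' + m = m'') (g : RHom j l m') (f : RHom i j m) :
  hat (dg_comp em g f : RHom i l m'') = dg_comp em (hat g) (hat f).
Proof.
apply: entP => p q a; have b : p + m + m' = q by clear -a em; lia.
rewrite (ent_comp em _ _ a erefl b) !hatE (rent_comp em _ _ a erefl b) !mulmxA.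
by rewrite -(mulmxA (mask_out *m rent f erefl) mask_in mask_out) mask_inK mulmx1.
Qed.
Lemma hat_d i j m m' (em : m + 1 = m') (b : RHom i j m) p q (a : p + m' = q) : q <= 0 ->
  ent (hat (dg_d em b : RHom i j m')) a = ent (dg_d em (hat b) : Hom i j m') a.
Proof.
move=> le_q; have a1 : p + m + 1 = q by clear -a em; lia.
have a2 : p + 1 + m = q by clear -a em; lia.
rewrite (ent_d em _ a erefl a1 erefl a2) (hatE (dg_d em b)) (rent_d em _ a erefl a1 erefl a2) /res_d.
rewrite mulmxBr mulmxBl -scalemxAr -scalemxAl !mulmxA -(mulmxA _ mask_out mask_in) (mask_outT _ le_q) mulmx1.
congr (_ - _ *: _).
have [le_p|lt_p] := le0_or_gt0 p; first by rewrite (mask_outT _ le_p) mul1mx.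
have lt_p1 : ~~ (p + 1 <= 0) by clear -lt_p; lia.
by rewrite !(mask_out0 _ lt_p1) !mulmx0 !mul0mx.
Qed.

(** Degrees of Koszul morphisms are nonnegative, so nothing goes from degree 1 down to the
    resolution; restriction to degrees <= 0 is therefore a functor. *)
Lemma koszul_source i j m u p q (a : p + m = q) : koszul_subspace B i j m u -> q <= 0 -> 0 < p -> ent u a = 0.
Proof. by move=> [[m_ge0|->] _ _ _] le_q lt_p; rewrite ?ent0 //; clear -a m_ge0 le_q lt_p; lia. Qed.

Section Functor.
Variables (i j : 'I_n) (m : int) (u : Hom i j m) (Hu : koszul_subspace B i j m u).
Let f p q (a : p + m = q) : 'M[k]_(fm_dim (resolution_ob i p), fm_dim (resolution_ob j q)) := mask_in *m ent u a *m mask_out.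
Let f_hom p q (a : p + m = q) : is_fhom (M := resolution_ob i p) (N := resolution_ob j q) (f a).
Proof.
rewrite /f; have [le_q|lt_q] := le0_or_gt0 q; last first.
  by rewrite (mask_out0 _ (_ : ~~ (q <= 0))) ?mulmx0 -?ltNge //; exact: fhom0.
have [_ _ _ H] := Hu; apply: (fhomM (N := B j q)); last exact: mask_out_hom.
by apply: (fhomM (N := B i p)); [exact: mask_in_hom|exact: H].
Qed.
Definition koszul_map : RHom i j m := @mk_cx k L (res i) (res j) m f f_hom.
Lemma hat_koszul_map p q (a : p + m = q) : ent (hat koszul_map) a = if q <= 0 then ent u a else 0.
Proof.
rewrite hatE -[rent _ _]/(mask_in *m ent u a *m mask_out) !mulmxA mask_outK -(mulmxA _ mask_out) mask_outK.
case: (leP q 0) => [le_q|_]; last by rewrite mulmx0.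
rewrite mulmx1; case: (leP p 0) => [_|lt_p]; first by rewrite mul1mx.
by rewrite mul0mx (koszul_source a Hu).
Qed.
End Functor.

Program Definition koszul_functor : dgfunctor (koszul B) Db :=
  @DGFunctor k (koszul B) Db res (fun i j m u => koszul_map (svP u)) _ _ _ _.
Next Obligation.
move=> i j m c u v; apply: hatP => p q a le_p le_q.
by rewrite hat_zd ent_zd !hat_koszul_map le_q.
Qed.
Next Obligation.
move=> i j m m' em u; apply: hatP => p q a le_p le_q; rewrite hat_d // hat_koszul_map le_q /=.
have a1 : p + m + 1 = q by clear -a em; lia.
have a2 : p + 1 + m = q by clear -a em; lia.
rewrite (ent_d em _ a erefl a1 erefl a2) (ent_d em _ a erefl a1 erefl a2) !hat_koszul_map le_q.
by rewrite (_ : p + m <= 0) //; clear -a1 le_q; lia.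
Qed.
Next Obligation.
move=> i; apply: hatP => p q a le_p le_q; rewrite hat_koszul_map le_q /= hatE.
have Eq : q = p by rewrite -a addr0.
by move: a le_q; rewrite Eq => a _; rewrite ent_id rent_id mulmx1 mask_outK le_p.
Qed.
Next Obligation.
move=> i j l m' m m'' em g f; apply: hatP => p q a le_p le_q; rewrite hat_comp hat_koszul_map le_q /=.
have b : p + m + m' = q by clear -a em; lia.
rewrite (ent_comp em _ _ a erefl b) (ent_comp em _ _ a erefl b) !hat_koszul_map le_q.
case: (leP (p + m) 0) => // lt_r; by rewrite (koszul_source b (svP g)) // !mulmx0.
Qed.
End Resolutions.

(** * The Koszul dual category maps isomorphically to the resolutions *)

Arguments rent {k L G n t B i j m} b {p q} a.

Lemma sign_cases (k : fieldType) (m : int) : (-1 : k) ^ m = 1 \/ (-1 : k) ^ m = -1.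
Proof.
have : ((-1 : k) ^ m - 1) * ((-1 : k) ^ m + 1) == 0.
  by rewrite mulrDr mulr1 mulrBl mul1r sign_sq subrKA subrr.
by rewrite mulf_eq0 subr_eq0 addr_eq0 => /orP[/eqP|/eqP]; [left|right].
Qed.

Section Retraction.
Variables (k : fieldType) (L : falgType k) (G : nonneg_grading L) (n : nat) (t : top_data G n).
Local Notation e := (td_e t).
Local Notation Dk := (Db_dgcat (k^o : falgType k)).
Local Notation Db := (Db_dgcat L).
Variable B : forall i, bar t i.
#[local] Opaque ent rent.
Local Notation Hom i j m := (@dg_hom k Dk (aug_complex B i) (aug_complex B j) m).
Local Notation RHom i j m := (@dg_hom k Db (res B i) (res B j) m).
Local Notation kos := (koszul_subspace B).

(** The component into degree 1 determines the rest by [bar_zero]; with [koszul_lift] this describes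
    all Koszul morphisms. *)
Lemma koszul_ext i j m (u v : Hom i j m) : kos i j m u -> kos i j m v ->
  (forall p (a : p + m = 1), ent u a = ent v a) -> u = v.
Proof.
move=> Ku Kv E; apply/eqP; rewrite -subr_eq0; apply/eqP.
have [H1 H2 H3 H4] := subspaceB Ku Kv; have [m_ge0|//] := H1.
(* The component out of degree 1 - m is the one into degree 1; those out of higher degrees have zero
   target. *)
apply: (@bar_zero k L G n t B i j m (1 - m) ((-1) ^ m)).
- by clear -m_ge0; lia.
- move=> p q a le_p; rewrite entB; have [lt_q|le_q] := ltP 1 q.
    by apply: dim0_mxr; apply: b_high.
  have Eq : q = 1 by clear -a le_p le_q; lia.
  by move: a; rewrite Eq => a; rewrite E subrr.
- by move=> p q a lt_p; apply: H4; clear -a lt_p; lia.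
- by move=> p p' q q' a b d d' _; apply: H2.
Qed.

(** The given component into degree 1 is extended downwards by [bar_rec] with S = 0. *)
Lemma koszul_lift i j m (base : Hom i j m) : 0 <= m ->
  (forall p q (a : p + m = q), e_linear_at (ent base a)) ->
  (forall p p' q (a : p + 1 = p') (d : p + m = q), be (B i) a *m ent base d = 0) ->
  exists2 f, kos i j m f & forall p (a : p + m = 1), ent f a = ent base a.
Proof.
move=> m_ge0 base_e base_k.
have [||||||f [f1 f2 f3 f4]] := @bar_rec k L G n t B i j m (m - 1) (1 - m) ((-1) ^ m) base 0 (subrK 1 m).
- by clear -m_ge0; lia.
- by move=> p q a _; apply: base_e.
- by move=> p p' q q' a b d _; rewrite base_k mul0mx.
- by move=> p q a s; rewrite ent0 mulmx0 mul0mx.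
- by move=> *; rewrite ent0 mulmx0.
- by move=> *; rewrite ent0 mul0mx.
exists f; last by move=> p a; apply: f1; clear -a; lia.
split=> [|p p' q q' a b d d'|//|p q a le_q]; first by left.
  have [le_p|lt_p] := leP (1 - m) p; last first.
    have s : p' + (m - 1) = q by clear -a d; lia.
    by rewrite (f4 _ _ _ _ a b d d' s) // ent0 addr0.
  rewrite f1 // base_k [ent f d'](_ : _ = 0) ?mul0mx ?scaler0 //.
  by apply: dim0_mxr; apply: b_high; clear -le_p b d; lia.
by apply: f2; clear -a le_q; lia.
Qed.

Lemma hat_e i j m (b : RHom i j m) p q (a : p + m = q) : e_linear_at (ent (hat b) a).
Proof. by move=> s; apply: (hat_hom b a). Qed.

Section Retract.
Variables (i j : 'I_n) (m : int).
Let a1 p : p - 1 + 1 = p :> int. Proof. by rewrite subrK. Qed.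
Let a2 p q : p + m = q -> p - 1 + m = q - 1 :> int. Proof. by clear; lia. Qed.
(** A Koszul morphism u has component (-1)^m e u d into degree 1, because it commutes with the
    contraction and e d = 1 in degree 1. The same formula is taken as the definition for an
    arbitrary morphism of resolutions. *)
Definition retract_top (b : RHom i j m) : Hom i j m := mk_ent (fun p q a =>
  (-1) ^ m *: (be (B i) (a1 p) *m ent (hat b) (a2 a) *m bd (B j) (a1 q))).
Lemma retract_topE b p q p' q' (a : p + m = q) (c : p' + 1 = p) (d : q' + 1 = q) (d' : p' + m = q') :
  ent (retract_top b) a = (-1) ^ m *: (be (B i) c *m ent (hat b) d' *m bd (B j) d).
Proof.
have Ep : p' = p - 1 by clear -c; lia.
have Eq : q' = q - 1 by clear -d; lia.
move: c d d'; rewrite Ep Eq => c d d'; rewrite mk_entE.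
by rewrite (int_eq_irr c (a1 p)) (int_eq_irr d (a1 q)) (int_eq_irr d' (a2 a)).
Qed.

Lemma retract_exists (b : RHom i j m) : exists f : Hom i j m, [/\ kos i j m f,
  0 <= m -> forall p (a : p + m = 1), ent f a = ent (retract_top b) a & m < 0 -> f = 0].
Proof.
have [m_ge0|m_lt0] := leP 0 m; last by exists 0; split=> //; exact: (subspace0 (kos i j m)).
have [|p q a s|p p' q a d|f Hf fE] := @koszul_lift i j m (retract_top b); last by exists f; split.
- by [].
- rewrite (retract_topE b a (a1 p) (a1 q) (a2 a)) -scalemxAl -scalemxAr; congr (_ *: _).
  have := hat_e b (a2 a) s; move: (ent (hat b) (a2 a)) => h E.
  by rewrite !mulmxA be_e -(mulmxA _ (fm_act _ _)) E -!mulmxA bd_hom.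
- have c : p - 1 + 1 = p by rewrite subrK.
  by rewrite (retract_topE b d c (a1 q) (a2 d)) -scalemxAr !mulmxA bee !mul0mx scaler0.
Qed.
Definition retract b : Hom i j m := sval (boolp.cid (retract_exists b)).
Let retractP b := svalP (boolp.cid (retract_exists b)).
Lemma retract_koszul b : kos i j m (retract b). Proof. by have [] := retractP b. Qed.
Lemma retract_neg b : m < 0 -> retract b = 0. Proof. by have [_ _] := retractP b. Qed.
Lemma retractE b p p' (a : p + m = 1) (c : p' + 1 = p) (d' : p' + m = 0) : 0 <= m ->
  ent (retract b) a = (-1) ^ m *: (be (B i) c *m ent (hat b) d' *m bd (B j) (add0r 1)).
Proof. by move=> m_ge0; have [_ H _] := retractP b; rewrite H // (retract_topE b a c (add0r 1) d'). Qed.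
End Retract.

Lemma retract_linear i j m : linear (@retract i j m).
Proof.
move=> x u v; have [m_ge0|m_lt0] := leP 0 m; last by rewrite !retract_neg // scaler0 addr0.
apply: koszul_ext; first exact: retract_koszul.
  by apply: subspaceZD; apply: retract_koszul.
move=> p a; have c : p - 1 + 1 = p by rewrite subrK.
have d : p - 1 + m = 0 by clear -a; lia.
rewrite ent_zd !(retractE _ a c d) // hat_zd ent_zd mulmxDr mulmxDl -scalemxAr -scalemxAl.
by rewrite scalerDr !scalerA mulrC.
Qed.

Lemma retract_id i : retract (dg_id (res B i : Db)) = dg_id (aug_complex B i : Dk).
Proof.
apply: koszul_ext; [exact: retract_koszul|exact: koszul_id|move=> p a].
have Ep : p = 1 by clear -a; lia.
move: a; rewrite Ep => a; rewrite (retractE _ a (add0r 1) (addr0 0)) // expr0z scale1r ent_id.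
rewrite hatE rent_id mulmx1 mask_outT // mulmx1.
have := bed (B i) (add0r 1) (erefl (1 + 1)); rewrite [bd _ erefl](_ : _ = 0) ?mul0mx ?addr0 //.
by apply: dim0_mxr; apply: b_high.
Qed.

(** Both sides are L-linear, and after the contraction they agree by the definition of the
    retraction. It is what makes the retraction a chain map. *)
Lemma retract_bd i j m (b : RHom i j m) p (a : p + m = 0) : 0 <= m ->
  ent (retract b) a *m bd (B j) (add0r 1) = ent (hat b) a *m bd (B j) (add0r 1).
Proof.
move=> m_ge0; have [_ K2 _ K4] := retract_koszul b.
have c : p + 1 + m = 1 by clear -a; lia.
apply: (@b_uniq _ _ _ _ _ _ (B i) p _ erefl (B j 1)).
- by clear -a m_ge0; lia.
- by apply: (fhomM (N := B j 0)); [exact: K4|exact: bd_hom].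
- by apply: (fhomM (N := B j 0)); [exact: hat_hom|exact: bd_hom].
rewrite mulmxA (K2 _ _ _ _ _ (add0r 1) _ c) (retractE b c erefl a) // -!scalemxAl scalerA.
rewrite sign_sq scale1r -(mulmxA _ (be (B j) (add0r 1)) (bd _ _)) -(mulmxA _ (bd _ _) (_ *m _)) (mulmxA (bd _ _)).
rewrite -(mulmxA (bd _ _)).
have := bed (B j) (add0r 1) (erefl (1 + 1)); rewrite [bd _ erefl](_ : _ = 0) ?mul0mx ?addr0 ?mulmx1; last first.
  by apply: dim0_mxr; apply: b_high.
by move=> ->; rewrite mulmx1 mulmxA.
Qed.

Lemma retract_d i j m m' (em : m + 1 = m') (b : RHom i j m) :
  retract (dg_d em b) = dg_d em (retract b).
Proof.
have [m'_ge0|m'_lt0] := leP 0 m'; last first.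
  by rewrite !retract_neg // ?(lin0 (dg_d_linear _)) //; clear -em m'_lt0; lia.
apply: koszul_ext; [exact: retract_koszul|exact: koszul_d (retract_koszul b)|move=> p a].
have c : p - 1 + 1 = p by rewrite subrK.
have d : p - 1 + m' = 0 by clear -a; lia.
have d1 : p - 1 + m = -1 by clear -a em; lia.
have d2 : p + m = 0 by clear -a em; lia.
have d3 : p + 1 + m = 1 by clear -a em; lia.
have LHS : ent (retract (dg_d em b)) a = be (B i) c *m bd (B i) c *m ent (hat b) d2 *m bd (B j) (add0r 1).
  rewrite (retractE _ a c d) // hat_d // (ent_d em _ d d1 (addNr 1) c d2) mulmxBr mulmxBl.
  rewrite -!mulmxA bdd !mulmx0 sub0r scalerN -scalemxAl -!scalemxAr scalerA.
  have -> : (-1 : k) ^ m' = - (-1) ^ m by rewrite -em signD expr1z mulrN1.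
  by rewrite mulNr sign_sq scaleN1r opprK !mulmxA.
rewrite {}LHS (ent_d em _ a d2 (add0r 1) erefl d3).
have [m_ge0|m_lt0] := leP 0 m; last first.
  rewrite retract_neg // !ent0 mul0mx mulmx0 scaler0 subrr hat0 ?mulmx0 ?mul0mx //.
  by left; clear -m_lt0 d2; lia.
rewrite retract_bd // (retractE _ d3 erefl d2) // -scalemxAr scalerA sign_sq scale1r.
have E : be (B i) c *m bd (B i) c = 1%:M - bd (B i) (erefl (p + 1)) *m be (B i) erefl.
  by rewrite -(bed (B i) c erefl) addrK.
by rewrite E !mulmxBl mul1mx !mulmxA.
Qed.

Lemma hat_koszul_comp i j l m m' m'' (em : m' + m = m'') (b : RHom j l m') (a : Hom i j m) (Ha : kos i j m a)
  p q r (d : p + m'' = r) (d1 : p + m = q) (d2 : q + m' = r) :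
  ent (hat (dg_comp em b (koszul_map Ha) : RHom i l m'')) d = ent a d1 *m ent (hat b) d2.
Proof.
rewrite hat_comp (ent_comp em _ _ d d1 d2) hat_koszul_map.
by case: (leP q 0) => // lt_q; rewrite (hat0 b) ?mulmx0 //; left.
Qed.

Lemma retract_comp i j l m m' m'' (em : m' + m = m'') (b : RHom j l m') (a : Hom i j m) (Ha : kos i j m a) :
  retract (dg_comp em b (koszul_map Ha) : RHom i l m'') = dg_comp em (retract b) a.
Proof.
have [K1 K2 _ _] := Ha.
have Kc := koszul_comp em (retract_koszul b) Ha.
have [m''_ge0|m''_lt0] := leP 0 m''; last first.
  by rewrite retract_neg //; case: Kc => -[le|-> //] _ _ _; clear -le m''_lt0; lia.
apply: koszul_ext => [||p d]; [exact: retract_koszul|exact: Kc|].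
have c : p - 1 + 1 = p by rewrite subrK.
have d0 : p - 1 + m'' = 0 by clear -d; lia.
have d1 : p - 1 + m + m' = 0 by clear -d em; lia.
have d2 : p - 1 + m + 1 = p + m by clear; lia.
have d3 : p + m + m' = 1 by clear -d em; lia.
rewrite (retractE _ d c d0) // (hat_koszul_comp em b Ha d0 erefl d1) (ent_comp em _ _ d erefl d3).
rewrite mulmxA (K2 _ _ _ _ c d2 erefl erefl) -!scalemxAl scalerA -em signD -mulrA sign_sq mulr1.
have [m'_ge0|m'_lt0] := leP 0 m'; first by rewrite (retractE b d3 d2 d1) // -scalemxAr !mulmxA.
rewrite retract_neg // ent0 mulmx0 (hat0 b) ?mulmx0 ?mul0mx ?scaler0 //.
by left; clear -d1 m'_lt0; lia.
Qed.
End Retraction.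

(** * The contracting homotopy of the Koszul retraction *)

Section Homotopy.
Variables (k : fieldType) (L : falgType k) (G : nonneg_grading L) (n : nat) (t : top_data G n).
Local Notation e := (td_e t).
Local Notation Dk := (Db_dgcat (k^o : falgType k)).
Local Notation Db := (Db_dgcat L).
Variable B : forall i, bar t i.
#[local] Opaque ent rent hat.
Local Notation Hom i j m := (@dg_hom k Dk (aug_complex B i) (aug_complex B j) m).
Local Notation RHom i j m := (@dg_hom k Db (res B i) (res B j) m).
Local Notation kos := (koszul_subspace B).

Lemma hat_linear i j m : linear (@hat _ _ _ _ _ B i j m). Proof. by move=> c u v; apply: hat_zd. Qed.

Lemma unhat i j m (u : Hom i j m) : (forall p q (a : p + m = q), L_linear_at (ent u a)) ->
  (forall p q (a : p + m = q), 0 < p \/ 0 < q -> ent u a = 0) -> exists y : RHom i j m, hat y = u.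
Proof.
move=> uL u0; pose f (p q : int) (a : p + m = q) : 'M[k]_(fm_dim (resolution_ob B i p), fm_dim (resolution_ob B j q)) :=
  mask_in *m ent u a *m mask_out.
have f_hom p q (a : p + m = q) : is_fhom (M := resolution_ob B i p) (N := resolution_ob B j q) (f p q a).
  apply: (fhomM (N := B j q)); last exact: mask_out_hom.
  by apply: (fhomM (N := B i p)); [exact: mask_in_hom|exact: uL].
pose y : RHom i j m := @mk_cx k L (res B i) (res B j) m f f_hom.
exists y; apply: entP => p q a; rewrite hatE (_ : rent y a = f p q a) // /f.
have [le_p|lt_p] := le0_or_gt0 p; last first.
  by rewrite (mask_out0 _ (_ : ~~ (p <= 0))) -?ltNge // !mul0mx u0 //; left.
have [le_q|lt_q] := le0_or_gt0 q; last first.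
  by rewrite (mask_in0 _ (_ : ~~ (q <= 0))) -?ltNge // mulmx0 u0 //; right.
by rewrite !mulmxA (mask_outT _ le_p) mul1mx -mulmxA (mask_outT _ le_q) mulmx1.
Qed.

Section Exists.
Variables (i j : 'I_n) (m m' : int) (em : m' + 1 = m) (b : RHom i j m).
(** The homotopy is specified by an equation rather than a formula: its graded commutator with the
    contraction is e b e, and it vanishes into degrees >= 0. Linearity and compatibility with
    composition then follow from uniqueness. *)
Definition homotopy_spec (y : RHom i j m') : Prop :=
  (forall p q (a : p + m' = q), 0 <= q -> ent (hat y) a = 0) /\
  forall p p' q q' (a : p + 1 = p') (b' : q + 1 = q') (d : p + m' = q) (d' : p' + m' = q') (c : p + m = q'),
    be (B i) a *m ent (hat y) d =
    (-1) ^ m' *: (ent (hat y) d' *m be (B j) b') + be (B i) a *m ent (hat b) c *m be (B j) b'.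

Let a1 p : p - 1 + 1 = p :> int. Proof. by rewrite subrK. Qed.
Let a2 p q : p + (m' - 1) = q -> p - 1 + m = q + 1 :> int. Proof. by clear -em; lia. Qed.
Let S : Hom i j (m' - 1) := mk_ent (fun p q a => be (B i) (a1 p) *m ent (hat b) (a2 a) *m be (B j) (erefl (q + 1))).
Let SE p p' q q' (a : p' + 1 = p) (b' : q + 1 = q') (s : p + (m' - 1) = q) (c : p' + m = q') :
  ent S s = be (B i) a *m ent (hat b) c *m be (B j) b'.
Proof.
have Ep : p' = p - 1 by clear -a; lia.
move: a c; rewrite Ep; case: q' / b' => a c; rewrite mk_entE.
by rewrite (int_eq_irr a (a1 p)) (int_eq_irr c (a2 s)).
Qed.

Lemma homotopy_exists : exists y, homotopy_spec y.
Proof.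
(* Components with p >= 1 lie outside the resolution, and those with q = p + m' >= 0 are prescribed
   to be zero. *)
have N1 : Num.min 1 (- m') <= 1 by rewrite ge_min lexx.
have [||p q a s|||f [f1 f2 f3 f4]] := @bar_rec k L G n t B i j m' (m' - 1) (Num.min 1 (- m')) ((-1) ^ m') 0 S (subrK 1 m') N1.
- by move=> p q a _ s; rewrite ent0 mulmx0 mul0mx.
- by move=> p p' q q' a b' d _; rewrite ent0 mulmx0 mul0mx.
- have := hat_e b (a2 a) s; rewrite (SE (a1 p) erefl a (a2 a)); move: (ent (hat b) _) => h E.
  by rewrite !mulmxA be_e -(mulmxA _ (fm_act _ _)) E -!mulmxA be_e.
- by move=> p p' q a d; rewrite (SE (a1 p) erefl d (a2 d)) !mulmxA bee !mul0mx.
- by move=> p q q' b' d; rewrite (SE (a1 p) erefl d (a2 d)) -!mulmxA bee !mulmx0.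
have f0 p q (a : p + m' = q) : 0 <= q -> ent f a = 0.
  have [le_N|lt_N] := leP (Num.min 1 (- m')) p; first by rewrite f1.
  by move: lt_N; rewrite lt_min => /andP[_ lt_p] le_q; exfalso; clear -a lt_p le_q; lia.
have [p q a|p q a lt|y yE] := @unhat i j m' f.
- have [le_N|lt_N] := leP (Num.min 1 (- m')) p; first by rewrite f1 // ent0; exact: fhom0.
  exact: f2.
- case: lt => [lt|lt]; last by apply: f0; exact: ltW.
  by rewrite f1 // ge_min (_ : 1 <= p) //; clear -lt; lia.
exists y; rewrite /homotopy_spec yE; split=> // p p' q q' a b' d d' c.
have s : p' + (m' - 1) = q by clear -a d; lia.
rewrite -(SE a b' s c); have [le_N|lt_N] := leP (Num.min 1 (- m')) p; last exact: f4.
have le_N' : Num.min 1 (- m') <= p' by apply: (le_trans le_N); clear -a; lia.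
rewrite f1 // f1 // !ent0 mulmx0 mul0mx scaler0 add0r (SE a b' s c) hat0 ?mulmx0 ?mul0mx //.
by move: le_N; rewrite ge_min => /orP[le|le]; [left|right]; clear -le em c; lia.
Qed.
Definition homotopy : RHom i j m' := sval (boolp.cid homotopy_exists).
Lemma homotopyP : homotopy_spec homotopy. Proof. exact: svalP (boolp.cid homotopy_exists). Qed.

Lemma homotopy_unique y y' : homotopy_spec y -> homotopy_spec y' -> y = y'.
Proof.
move=> [y0 yE] [y0' yE']; apply/eqP; rewrite -subr_eq0; apply/eqP.
suff E : hat (y - y') = 0 by apply: hatP => p q a _ _; rewrite E (lin0 (@hat_linear i j m')).
rewrite (linB (@hat_linear i j m')).
apply: (@bar_zero k L G n t B i j m' (Num.min 1 (- m')) ((-1) ^ m')).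
- by rewrite ge_min lexx.
- move=> p q a; rewrite ge_min entB => /orP[le|le].
    by rewrite !hat0 ?subrr //; left; clear -le; lia.
  by rewrite y0 ?y0' ?subrr //; clear -a le; lia.
- by move=> p q a _; rewrite entB; apply: (fhomB (M := B i p) (N := B j q)); exact: hat_hom.
- move=> p p' q q' a b' d d' _; have c : p + m = q' by clear -em b' d; lia.
  by rewrite !entB mulmxBr mulmxBl scalerBr (yE _ _ _ _ a b' d d' c) (yE' _ _ _ _ a b' d d' c); abel.
Qed.
End Exists.

Lemma homotopy_linear i j m m' (em : m' + 1 = m) : linear (@homotopy i j m m' em).
Proof.
move=> x u v; apply: (homotopy_unique em (homotopyP em _)).
have [u0 uE] := homotopyP em u; have [v0 vE] := homotopyP em v.
split=> [p q a le_q|p p' q q' a b' d d' c].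
  by rewrite hat_zd ent_zd u0 ?v0 // scaler0 addr0.
rewrite !hat_zd !ent_zd mulmxDr mulmxDl -scalemxAr -scalemxAl (uE _ _ _ _ a b' d d' c) (vE _ _ _ _ a b' d d' c).
rewrite mulmxDr mulmxDl -scalemxAr -scalemxAl !scalerDr !scalerA (mulrC x); abel.
Qed.

Lemma homotopy_comp i j l m m' r s s' (em : m' + 1 = m) (es : s' + 1 = s) (e1 : m + r = s) (e2 : m' + r = s')
    (b : RHom j l m) (a : Hom i j r) (Ha : kos i j r a) :
  homotopy es (dg_comp e1 b (koszul_map Ha) : RHom i l s) = dg_comp e2 (homotopy em b) (koszul_map Ha).
Proof.
have [K1 K2 _ _] := Ha; have [y0 yE] := homotopyP em b.
apply: (homotopy_unique es (homotopyP es _)); split=> [p q d le_q|p p' q q' c b' d d' f].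
  have d2 : p + r + m' = q by clear -d e2; lia.
  by rewrite (hat_koszul_comp e2 _ Ha d erefl d2) y0 ?mulmx0.
have d2 : p + r + m' = q by clear -d e2; lia.
have d3 : p' + r + m' = q' by clear -d' e2; lia.
have d4 : p + r + m = q' by clear -f e1; lia.
have d5 : p + r + 1 = p' + r by clear -c; lia.
rewrite (hat_koszul_comp e2 _ Ha d erefl d2) (hat_koszul_comp e2 _ Ha d' erefl d3) (hat_koszul_comp e1 _ Ha f erefl d4).
have := yE _ _ _ _ d5 b' d2 d3 d4; have := K2 _ _ _ _ c d5 erefl erefl.
move: (ent (hat (homotopy em b)) d2) (ent (hat (homotopy em b)) d3) (ent (hat b) d4) (ent a _) (ent a _).
move=> h1 h2 h3 u v K Y; rewrite !mulmxA K -!scalemxAl -(mulmxA u _ h1) Y mulmxDr -scalemxAr scalerDr scalerA.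
by rewrite !mulmxA -e2 signD (mulrC _ ((-1) ^ r)).
Qed.

(** The computation behind [homotopy_formula] with degrees removed: the defect of the homotopy
    identity again commutes with the contraction up to sign. Primes mark the components out of
    neighbouring degrees. *)
Lemma homotopy_algebra (s sh : k) (a b c q q1 q' : nat) (sE : s = 1 \/ s = -1) (eta : 'M[k]_(a, b)) (dB : 'M_(b, a))
    (e' : 'M_(c, a)) (dB' : 'M_(a, c)) (D1 : 'M_(q1, q)) (E1 : 'M_(q, q1)) (Dq : 'M_(q, q')) (Eq : 'M_(q', q))
    (u r z : 'M_(b, q)) (u' r' z' : 'M_(a, q')) (y : 'M_(b, q1)) (y' : 'M_(a, q)) (y'' : 'M_(c, q')) :
  sh = - s ->
  eta *m z = s *: (z' *m Eq) + eta *m (u *m Dq - s *: (dB *m u')) *m Eq ->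
  eta *m y = sh *: (y' *m E1) + eta *m u *m E1 ->
  e' *m y' = sh *: (y'' *m Eq) + e' *m u' *m Eq ->
  eta *m r = s *: (r' *m Eq) -> eta *m dB + dB' *m e' = 1%:M -> E1 *m D1 + Dq *m Eq = 1%:M ->
  eta *m (u - r - (y *m D1 - sh *: (dB *m y')) - z) =
  s *: ((u' - r' - (y' *m Dq - sh *: (dB' *m y'')) - z') *m Eq).
Proof.
move=> -> Hz Hy Hy' Hr Ei Ej.
have F1 : eta *m y *m D1 = - s *: (y' - y' *m Dq *m Eq) + (eta *m u - eta *m u *m Dq *m Eq).
  have -> : y' - y' *m Dq *m Eq = y' *m (E1 *m D1) by rewrite -[E1 *m D1](addrK (Dq *m Eq)) Ej mulmxBr mulmx1 mulmxA.
  have -> : eta *m u - eta *m u *m Dq *m Eq = eta *m u *m (E1 *m D1).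
    by rewrite -[E1 *m D1](addrK (Dq *m Eq)) Ej mulmxBr mulmx1 !mulmxA.
  by rewrite Hy mulmxDl -scalemxAl !mulmxA.
have F2 : eta *m dB *m y' = y' + s *: (dB' *m y'' *m Eq) - u' *m Eq + eta *m dB *m u' *m Eq.
  have -> : eta *m dB *m y' = y' - dB' *m (e' *m y') by rewrite mulmxA -{2}[y']mul1mx -mulmxBl -Ei addrK.
  have -> : eta *m dB *m u' *m Eq = u' *m Eq - dB' *m (e' *m u' *m Eq).
    rewrite -(mulmxA e') (mulmxA dB') -[dB' *m e'](addKr (eta *m dB)) Ei mulmxDl mulNmx mul1mx !mulmxA.
    by abel.
  by rewrite Hy' mulmxDr scaleNr mulmxN -scalemxAr !mulmxA; abel.
rewrite !mulmxBr !mulmxBl Hr Hz -!scalemxAr -!scalemxAl !mulmxA F1 F2 mulmxBr -!scalemxAr mulmxBl -!scalemxAl !mulmxA.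
by case: sE => ->; rewrite ?scaleNr ?opprK ?scale1r; abel.
Qed.

(** The defect D satisfies the homogeneous relation with the contraction and vanishes in high
    degrees, so [bar_zero] kills it. *)
Lemma homotopy_formula i j h m m' (eh : h + 1 = m) (em : m + 1 = m') (b : RHom i j m) :
  b - koszul_map (retract_koszul b) = dg_d eh (homotopy eh b) + homotopy em (dg_d em b).
Proof.
have [y0 yE] := homotopyP eh b; have [z0 zE] := homotopyP em (dg_d em b : RHom i j m').
move: (homotopy eh b) (homotopy em (dg_d em b : RHom i j m')) y0 yE z0 zE => y z y0 yE z0 zE.
have Kr := retract_koszul b; have [_ K2 _ _] := Kr.
apply/eqP; rewrite -subr_eq0; apply/eqP; set D := _ - _.
suff E : hat D = 0 by apply: hatP => p q a _ _; rewrite E (lin0 (@hat_linear i j m)).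
have DE p q (a : p + m = q) r s (a1 : p + h = r) (a2 : r + 1 = q) (a3 : p + 1 = s) (a4 : s + h = q) : q <= 0 ->
    ent (hat D) a = ent (hat b) a - ent (retract b) a - (ent (hat y) a1 *m bd (B j) a2
      - (-1) ^ h *: (bd (B i) a3 *m ent (hat y) a4)) - ent (hat z) a.
  move=> le_q; rewrite /D !(linB (@hat_linear i j m)) (linD (@hat_linear i j m)) !entB entD hat_koszul_map le_q.
  by rewrite hat_d // (ent_d eh _ a a1 a2 a3 a4) opprD addrA.
have sh : (-1 : k) ^ h = - (-1) ^ m by rewrite -eh signD expr1z mulrN1 opprK.
have N1 : Num.min 1 (1 - m) <= 1 by rewrite ge_min lexx.
apply: (@bar_zero k L G n t B i j m (Num.min 1 (1 - m)) ((-1) ^ m)) => //.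
- move=> p q a; rewrite ge_min => /orP[le|le]; first by apply: hat0; left; clear -le; lia.
  by apply: hat0; right; clear -le a; lia.
- by move=> p q a _; exact: hat_hom.
move=> p p' q q' a b' d d'; rewrite lt_min => /andP[lt_p lt_q].
have le_p : p <= 0 by clear -lt_p; lia.
have le_q : q <= 0 by clear -lt_q d; lia.
have c1 : p + h + 1 = q by clear -d eh; lia.
have c2 : p' + h = q by clear -c1 a; lia.
have c3 : p' + 1 + h = q' by clear -c2 b'; lia.
have c4 : p + m' = q' by clear -d em b'; lia.
rewrite (DE _ _ d _ _ erefl c1 a c2 le_q).
have zq := zE _ _ _ _ a b' d d' c4.
have yp := yE _ _ _ _ a c1 erefl c2 d.
have yp' := yE _ _ _ _ (erefl (p' + 1)) b' c2 c3 d'.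
have Ei := bed (B i) a (erefl (p' + 1)); have Ej := bed (B j) c1 b'.
have [lt_q0|ge_q] := ltP q 0.
  have le_q' : q' <= 0 by clear -lt_q0 b'; lia.
  move: zq; rewrite hat_d // (ent_d em _ c4 d b' a d') => zq.
  rewrite (DE _ _ d' _ _ c2 b' erefl c3 le_q').
  exact: (homotopy_algebra (sign_cases k m) sh zq yp yp' (K2 _ _ _ _ a b' d d') Ei Ej).
(* The boundary case: targets in degree 1 are cut off by [hat], and the identity holds because of
   the value chosen for the retraction there. *)
have q0 : q = 0 by clear -ge_q le_q; lia.
have q'1 : q' = 1 by clear -q0 b'; lia.
have lt_q' : 0 < q' by rewrite q'1.
move: zq yp; rewrite (hat0 D d') ?(hat0 z d') ?(hat0 (dg_d em b : RHom i j m') c4); try by right.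
rewrite mul0mx scaler0 !mulmx0 mul0mx addr0 (y0 _ _ c2 ge_q) mul0mx scaler0 add0r => zq yp.
rewrite !mulmxBr zq ?(mulmx0, scaler0, subr0) (mulmxA _ (ent (hat y) _)) yp (K2 _ _ _ _ a b' d d').
have [m_ge0|m_lt0] := leP 0 m; last first.
  by rewrite retract_neg // ent0 mul0mx scaler0 (hat0 b d) ?mulmx0 ?mul0mx ?subrr //; left; clear -d m_lt0 q0; lia.
have d1 : p + m = 0 by rewrite d.
have -> : ent (retract b) d' = (-1) ^ m *: (be (B i) a *m ent (hat b) d *m bd (B j) b').
  move: b' d d' {D DE K2 Kr zq yp yp' zE yE z0 y0 c1 c2 c3 c4 Ei Ej lt_p le_q lt_q'}; rewrite q0 q'1 => b' d d'.
  by rewrite (retractE _ d' a d) // (int_eq_irr b' (add0r 1)).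
rewrite -scalemxAl scalerA sign_sq scale1r -!(mulmxA (be (B i) a *m _)).
set w := be _ _ *m _; rewrite -{1}[w]mulmx1 -Ej mulmxDr; abel.
Qed.

Program Definition koszul_retraction (j : 'I_n) : hom_retraction (koszul_functor B) j :=
  @HomRetraction k _ _ (koszul_functor B) j
    (fun i m b => mks (retract_koszul (b : RHom i j m)))
    (fun i m m' em b => homotopy em (b : RHom i j m)) _ _ _ _ _ _ _.
Next Obligation. by move=> j i m c u v; apply: sv_inj; exact: retract_linear. Qed.
Next Obligation. by move=> j i m m' em c u v; exact: homotopy_linear. Qed.
Next Obligation. by move=> j i m m' em b; apply: sv_inj; exact: retract_d. Qed.
Next Obligation. by move=> j i i' m l s es b a; apply: sv_inj; exact: retract_comp. Qed.
Next Obligation. by move=> j i i' m m' r s s' e1 em es e2 b a; exact: homotopy_comp. Qed.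
Next Obligation. by move=> j; apply: sv_inj; exact: retract_id. Qed.
Next Obligation.
move=> j i h m m' eh em b; rewrite -(homotopy_formula eh em b) /=; congr (_ - _).
by apply: hatP => p q a le_p le_q; rewrite !hat_koszul_map.
Qed.
End Homotopy.

(** * The resolutions of the simple modules generate *)

(** The comparison lemma: a map in the top degree of a complex of projectives extends downwards into
    a complex that is exact there. *)
Lemma complex_lift (k : fieldType) (L : falgType k) (X Y : proj_complex L) (a : int)
    (f0 : 'M[k]_(fm_dim (X a), fm_dim (Y a))) :
  is_fhom (M := X a) (N := Y a) f0 -> (forall q, a < q -> fm_dim (X q) = 0%N) ->
  (forall q, q < a -> exact_at Y q) -> (forall r (e : a + 1 = r), f0 *m pc_d Y e = 0) ->
  (forall p (e : p + 1 = a), (pc_d X e *m f0 <= pc_d Y e)%MS) ->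
  exists2 f : @dg_hom k (Db_dgcat L) X Y 0, dg_closed f & cxh (f : cx_hom X Y 0) (addr0 a) = f0.
Proof.
move=> f0_hom X0 exY f0_d d_f0.
pose T p := 'M[k]_(fm_dim (X p), fm_dim (Y p)).
pose good p (x : T p) := is_fhom (M := X p) (N := Y p) x /\
  forall r (e : r + 1 = p), (pc_d X e *m x <= pc_d Y e)%MS.
pose R p (x : T p) (y : T (p + 1)) := x *m pc_d Y (erefl (p + 1)) = pc_d X (erefl (p + 1)) *m y.
pose base p : T p := match pselect (a = p) with left E => ecast p (T p) E f0 | right _ => 0 end.
have baseE : base a = f0 by rewrite /base; case: pselect => // E; rewrite (int_eq_irr E erefl).
have base0 p : a < p -> base p = 0 by move=> lt_p; apply: dim0_mx; apply: X0.
have [|p x lt_p [x_hom xd]|f [gf Rf fE]] := @descend T good R a base.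
- move=> p le_p; rewrite /R (base0 (p + 1)) ?mulmx0; last by clear -le_p; lia.
  have [Ep|ne_p] := pselect (a = p); last first.
    rewrite base0; last by clear -le_p ne_p; lia.
    rewrite mul0mx; split=> //; split; first exact: fhom0.
    by move=> r e; rewrite mulmx0 sub0mx.
  by case: p / Ep le_p => _; rewrite baseE; split.
- have dY : (pc_d X (erefl (p + 1)%R) *m x <= pc_d Y (erefl (p + 1)%R))%MS by apply: xd.
  have [|y y_hom yE] := proj_lift (@pc_projective _ _ X p) (@pc_d_hom _ _ Y _ _ (erefl (p + 1))) _ dY.
    by apply: (fhomM (N := X (p + 1))); [exact: pc_d_hom|exact: x_hom].
  exists y; last exact: yE.
  split=> // r e; apply: submx_trans (proj2 (exact_atP _ e (erefl (p + 1))) (exY _ lt_p)).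
  by apply/sub_kermxP; rewrite -mulmxA yE mulmxA pc_dd mul0mx.
have f_hom p : is_fhom (M := X p) (N := Y p) (f p) by have [] := gf p.
exists (diag_cx f_hom); last by rewrite diag_cxE fE.
by apply: diag_cx_closed => p q e; case: q / e; exact: Rf.
Qed.

Lemma shift_exact (k : fieldType) (L : falgType k) (X : proj_complex L) m q :
  exact_at X (q + m) -> exact_at (shift_complex X m) q.
Proof.
move=> exX p r c d v; have c' : p + m + 1 = q + m by clear -c; lia.
have d' : q + m + 1 = r + m by clear -d; lia.
rewrite (shift_dE _ c c') (shift_dE _ d d') => v0; have [|w ->] := exX _ _ c' d' v.
  by rewrite -[_ *m _]scale1r -(sign_sq k m) -scalerA scalemxAr v0 scaler0.
by exists ((-1) ^ m *: w); rewrite -scalemxAl -scalemxAr scalerA sign_sq scale1r.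
Qed.

Section Generation.
Variables (k : fieldType) (L : falgType k) (G : nonneg_grading L) (n : nat) (t : top_data G n).
Local Notation e := (td_e t).
Local Notation Db := (Db_dgcat L).
Variable B : forall i, bar t i.

Lemma bar_top (i : 'I_n) q : q = 1 -> exists (w : 'M[k]_(fm_dim (B i q), 1)) (w' : 'M[k]_(1, fm_dim (B i q))),
  [/\ w *m w' = 1%:M, w' *m w = 1%:M & forall a, fm_act (B i q) a = (chr (td_S t) i a)%:M].
Proof.
move=> ->; move: (b_top_act (B i)); have := b_top_dim (B i).
by move: (fm_act _) => A E; move: A; rewrite E => A HA; exists 1%:M, 1%:M; split=> //; exact: mulmx1.
Qed.

(** The lowest cohomology of Y contains a simple submodule. A shifted resolution of it maps to Y,
    inducing the inclusion of this submodule on cohomology, which is what [generation] asks for. *)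
Theorem resolutions_generate : thick_generated (koszul_functor B).
Proof.
move=> Q thQ Qres; apply: generation => // Y p a pa v exY v0 nv.
pose C := pc_d Y pa; pose K := kermx (pc_d Y (erefl (a + 1))).
have stC x : (C *m fm_act (Y a) x <= C)%MS by rewrite -pc_d_hom submxMl.
have stK x : (K *m fm_act (Y a) x <= K)%MS.
  by apply/sub_kermxP; rewrite -mulmxA pc_d_hom mulmxA mulmx_ker mul0mx.
have [|i [v1 [v1K v1C v1E]]] := td_eigen t stC stK.
  by apply: contra nv; apply: submx_trans; apply/sub_kermxP; apply: v0.
(* Multiplying by e_i changes v1 only by a boundary and makes it an honest eigenvector of all the
   idempotents, so that it can serve in [b_ext]. *)
pose v2 := v1 *m fm_act (Y a) (e i); pose pi := quot_proj C.
have pi_hom : is_fhom (M := Y a) (N := quot_mod stC) pi := quot_proj_hom stC.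
have v2E : v2 *m pi = v1 *m pi.
  have := v1E (e i); rewrite td_chr_e eqxx scale1r (quot_proj0 C) mulmxBl subr_eq0 => /eqP ->.
  by [].
have v2C : v2 *m pi != 0 by rewrite v2E -(quot_proj0 C).
have v2d r (c : a + 1 = r) : v2 *m pc_d Y c = 0.
  case: r / c; rewrite -mulmxA pc_d_hom mulmxA.
  by move/sub_kermxP: v1K => ->; rewrite mul0mx.
have v2e j : v2 *m fm_act (Y a) (e j) = (j == i)%:R *: v2.
  rewrite -mulmxA -(fm_actM (Y a)) td_eM (eq_sym j); case: eqP => _; first by rewrite scale1r.
  by rewrite scale0r (lin0 (@fm_linear _ _ _ _)) mulmx0.
(* The term of the shifted resolution in degree a is indexed by a + -a; taking all bar data at z
   avoids a transport to 0. *)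
clearbody v2; pose z := a + - a; have z0 : z = 0 by rewrite /z subrr.
have z1 : z + 1 = 1 by rewrite z0.
have [w [w' [ww' w'w w_act]]] := @bar_top i (z + 1) z1.
have le_z : z <= 0 by rewrite z0.
have high r : z + 1 < r -> fm_dim (B i r) = 0%N by rewrite z1; apply: b_high.
have z2 : z + 1 < z + 1 + 1 by rewrite ltrDl.
have be2 : be (B i) (erefl (z + 1 + 1)) = 0 by apply: dim0_mx; apply: high.
have [s||g g_hom gE] := @b_ext _ _ _ _ _ _ (B i) z _ _ erefl erefl (Y a) (w *m v2) le_z.
- by rewrite w_act -mulmxA v2e td_chr_e eq_sym mul_scalar_mx scalemxAr.
- by rewrite be2 mul0mx.
set b := erefl _ in gE.
have bed1 : be (B i) b *m bd (B i) b = 1%:M by rewrite -(bed (B i) b erefl) be2 mulmx0 addr0.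
(* Modulo boundaries g is the augmentation followed by the class of v2: both maps are L-linear and
   agree after the contraction. *)
have gpi : g *m pi = bd (B i) b *m w *m v2 *m pi.
  apply: (@b_uniq _ _ _ _ _ _ (B i) z _ b (quot_mod stC)) => //.
  - by apply: (fhomM (N := Y a)).
  - rewrite -!mulmxA; apply: (fhomM (N := B i (z + 1))); first exact: bd_hom.
    move=> x; rewrite w_act mul_scalar_mx -(mulmxA w) v2E.
    have -> : v1 *m pi *m fm_act (quot_mod stC) x = chr (td_S t) i x *: (v1 *m pi).
      have := v1E x; rewrite (quot_proj0 C) mulmxBl subr_eq0 -scalemxAl => /eqP <-.
      by rewrite -(mulmxA v1) -(mulmxA v1) pi_hom.
    by rewrite scalemxAr.
  by rewrite !mulmxA gE bed1 mul1mx.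
pose X := shift_complex (res B i) (- a).
pose f0 : 'M[k]_(fm_dim (X a), fm_dim (Y a)) := mask_in *m g.
have in_out : mask_out *m (mask_in : 'M_(fm_dim (X a), _)) = 1%:M := mask_outT _ le_z.
have b0 : p - a + 1 = z by rewrite /z -pa; clear; lia.
have le_p : p - a <= 0 by clear -pa; lia.
have dX : pc_d X pa = (-1) ^ (- a) *: (mask_in *m bd (B i) b0 *m mask_out) := shift_dE _ pa b0.
have X0 q : a < q -> fm_dim (X q) = 0%N.
  by move=> lt_q; apply: mask_dim0; left; rewrite -ltNge subr_gt0.
have [||q lt_q|r c|q c|f cf fE] := @complex_lift k L X Y a f0.
- by apply: (fhomM (N := B i z)); [exact: mask_in_hom|exact: g_hom].
- exact: X0.
- exact: exY.
- rewrite -mulmxA [g *m _](_ : _ = 0) ?mulmx0 //.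
  apply: (@b_uniq _ _ _ _ _ _ (B i) z _ b (Y r)) => //.
  + by apply: (fhomM (N := Y a)); [exact: g_hom|exact: pc_d_hom].
  + exact: fhom0.
  by rewrite mulmxA gE -mulmxA v2d !mulmx0.
- have Eq : q = p by clear -c pa; lia.
  subst q; rewrite (int_eq_irr c pa) (quot_proj0 C) dX /f0 -scalemxAl -!mulmxA (mulmxA mask_out) in_out mul1mx.
  by rewrite -scalemxAl -!mulmxA gpi -!(mulmxA (bd _ b)) (mulmxA (bd _ b0)) bdd mul0mx mulmx0 scaler0 eqxx.
exists X, f, (w' *m be (B i) b *m mask_out); split=> //.
- by apply: (@thick_shift k L Q (res B i)) => //; exact: (Qres i).
- split=> // q lt_q; apply: shift_exact; apply: res_exact; by rewrite subr_lt0.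
- rewrite fE /f0 -!mulmxA (mulmxA mask_out) in_out mul1mx gE mulmxA w'w mul1mx (quot_proj0 C).
  exact: v2C.
move=> x'; rewrite fE (quot_proj0 C) /f0 -!mulmxA gpi => /eqP E.
(* The class of v2 is nonzero, so if x' maps to a boundary its augmentation vanishes, and exactness
   of the bar complex makes x' itself a boundary. *)
have s0 : x' *m (mask_in *m (bd (B i) b *m w)) = 0.
  have : x' *m (mask_in *m (bd (B i) b *m w)) *m (v2 *m pi) = 0 by rewrite -E !mulmxA.
  move: (x' *m _) (v2 *m pi) v2C => s y y0; rewrite [s]mx11_scalar mul_scalar_mx => /eqP.
  by rewrite scaler_eq0 (negbTE y0) orbF => /eqP ->; rewrite raddf0.
have d0 : x' *m mask_in *m bd (B i) b = 0.
  by rewrite -[_ *m bd _ _]mulmx1 -ww' mulmxA -(mulmxA x') -(mulmxA x') -(mulmxA mask_in) s0 mul0mx.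
have /submxP[D DE] : (x' *m mask_in <= bd (B i) b0)%MS.
  by apply: submx_trans (contraction_exact (bed (B i) b0 b)); apply/sub_kermxP.
have -> : x' = (-1) ^ (- a) *: (D *m mask_out) *m pc_d X pa.
  rewrite dX -scalemxAl -scalemxAr scalerA sign_sq scale1r -!mulmxA (mulmxA mask_out) (mask_outT _ le_p) mul1mx.
  by rewrite (mulmxA D) -DE -mulmxA mask_inK mulmx1.
exact: submxMl.
Qed.
End Generation.

(** * Weight decompositions of spaces of homomorphisms *)

Lemma int_sum_widen (V : nmodType) (F : int -> V) (lo lo' : int) (c c' : nat) :
  lo' <= lo -> lo + c%:Z <= lo' + c'%:Z -> (forall t, t < lo \/ lo + c%:Z <= t -> F t = 0) ->
  \sum_(s < c') F (lo' + s%:Z) = \sum_(s < c) F (lo + s%:Z).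
Proof.
move=> le1 le2 F0; have [m mE] : exists m : nat, lo = lo' + m%:Z by exists (absz (lo - lo')); lia.
have le_c : (m + c <= c')%N by lia.
rewrite -(big_mkord predT (fun s => F (lo' + s%:Z))) -(big_mkord predT (fun s => F (lo + s%:Z))).
rewrite (@big_cat_nat _ _ _ m) //=; last by lia.
rewrite (@big_cat_nat _ _ _ (m + c) m) //=; last by lia.
rewrite big_nat big1 ?add0r; last by move=> s Hs; apply: F0; left; lia.
rewrite addrC big_nat big1 ?add0r; last by move=> s Hs; apply: F0; right; lia.
rewrite -{1}[m]add0n big_addn addKn; apply: eq_bigr => s _; congr F; lia.
Qed.

Lemma int_sum_eq (V : nmodType) (F : int -> V) (lo lo' : int) (c c' : nat) :
  (forall t, t < lo \/ lo + c%:Z <= t -> F t = 0) ->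
  (forall t, t < lo' \/ lo' + c'%:Z <= t -> F t = 0) ->
  \sum_(s < c) F (lo + s%:Z) = \sum_(s < c') F (lo' + s%:Z).
Proof.
move=> H H'; pose b := (absz lo + absz lo')%N; pose e := (c + c' + b + b)%N.
rewrite -(@int_sum_widen _ F lo (- b%:Z) c e) //; try by rewrite /e /b; lia.
by rewrite -(@int_sum_widen _ F lo' (- b%:Z) c' e) //; rewrite /e /b; lia.
Qed.

(** In contrast to [weights], the window is symmetric about 0, so that the sign of a grading can be
    reversed. *)
Record grading (k : fieldType) (m : nat) := Grading {
  gw :> int -> 'M[k]_m;
  gb : nat;
  gw_orth : forall i j, gw i *m gw j = if i == j then gw i else 0;
  gw0 : forall i, i < - gb%:Z \/ - gb%:Z + (2 * gb + 1)%N%:Z <= i -> gw i = 0;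
  gw_sum : \sum_(s < (2 * gb + 1)%N) gw (- gb%:Z + s%:Z) = 1%:M }.

Section Blocks.
Variables (k : fieldType) (m n : nat) (V : grading k m) (W : grading k n).
Implicit Types u : 'M[k]_(m, n).

Lemma block_ext u v : (forall a b, V a *m u *m W b = V a *m v *m W b) -> u = v.
Proof.
move=> E; rewrite -[u]mulmx1 -[v]mulmx1 -(gw_sum W) !mulmx_sumr; apply: eq_bigr => s _.
rewrite -[u]mul1mx -[v]mul1mx -(gw_sum V) !mulmx_suml; apply: eq_bigr => s' _; exact: E.
Qed.

Definition block_weight (N : int) u : 'M[k]_(m, n) :=
  \sum_(s < (2 * gb V + 1)%N) V (- (gb V)%:Z + s%:Z) *m u *m W (- (gb V)%:Z + s%:Z + N).

Lemma block_weightE N u a b :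
  V a *m block_weight N u *m W b = if b == a + N then V a *m u *m W b else 0.
Proof.
rewrite /block_weight mulmx_sumr mulmx_suml.
pose F t := V a *m (V t *m u *m W (t + N)) *m W b.
have FE t : F t = if (a == t) && (b == t + N) then V a *m u *m W b else 0.
  rewrite /F !mulmxA gw_orth -(mulmxA _ (W _)) gw_orth eq_sym (eq_sym b); case: eqP => [->|_]; last by rewrite !mul0mx.
  by case: eqP => [->|_] //; rewrite mulmx0.
rewrite -[LHS]/(\sum_(s < (2 * gb V + 1)%N) F (- (gb V)%:Z + s%:Z)).
rewrite (@int_sum_eq _ F _ a _ 1%N).
- by rewrite big_ord1 addr0 FE eqxx.
- by move=> t Ht; rewrite /F (gw0 Ht) !mul0mx mulmx0 mul0mx.
- by move=> t Ht; rewrite FE; case: eqP => // E; exfalso; lia.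
Qed.

Lemma block_weight_linear N : linear (block_weight N).
Proof.
move=> c u v; rewrite scaler_sumr -big_split; apply: eq_bigr => s _ /=.
by rewrite mulmxDr mulmxDl -scalemxAr -scalemxAl.
Qed.
End Blocks.

Lemma block_mul (k : fieldType) (m n r : nat) (V : grading k n) (x : 'M[k]_(m, n)) (y : 'M[k]_(n, r)) (a : int) (N : nat) :
  (forall t, t < a -> x *m V t = 0) -> (forall t, a + N%:Z < t -> V t *m y = 0) ->
  x *m y = \sum_(s < N.+1) x *m V (a + N%:Z - s%:Z) *m y.
Proof.
move=> x0 y0; rewrite -{1}[x]mulmx1 -(gw_sum V) mulmx_sumr mulmx_suml.
rewrite (@int_sum_eq _ (fun t => x *m V t *m y) _ a _ N.+1).
- rewrite (reindex_inj rev_ord_inj); apply: eq_bigr => s _ /=; congr (_ *m V _ *m _).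
  by have := ltn_ord s; lia.
- by move=> t Ht; rewrite (gw0 Ht) mulmx0 mul0mx.
- move=> t [lt_t|le_t]; first by rewrite x0 ?mul0mx.
  by rewrite -mulmxA y0 ?mulmx0 //; lia.
Qed.

Section ComplexWeights.
Variables (k : fieldType) (L : falgType k) (ob : Type) (o : ob -> proj_complex L).
Variable V : forall X p, grading k (fm_dim (o X p)).
Local Notation Dk := (Db_dgcat L).
Local Notation Hom X Y m := (@dg_hom k Dk (o X) (o Y) m).
Local Notation c f := (cxh (f : cx_hom (o _) (o _) _)).
Hypothesis V_hom : forall X Y p q N (f : 'M_(fm_dim (o X p), fm_dim (o Y q))),
  is_fhom f -> is_fhom (M := o X p) (N := o Y q) (block_weight (V X p) (V Y q) N f).
Hypothesis V_d : forall X p q (e : p + 1 = q) a, V X p a *m pc_d (o X) e = pc_d (o X) e *m V X q a.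

Definition cx_weight (N : int) X Y m (u : Hom X Y m) : Hom X Y m :=
  @mk_cx k L (o X) (o Y) m (fun p q a => block_weight (V X p) (V Y q) N (c u a))
    (fun p q a => V_hom N (@cxh_hom k L (o X) (o Y) m u p q a)).

Lemma cx_weightE N X Y m (u : Hom X Y m) p q (e : p + m = q) a b :
  V X p a *m c (cx_weight N u) e *m V Y q b = if b == a + N then V X p a *m c u e *m V Y q b else 0.
Proof. exact: block_weightE. Qed.

Lemma cx_block_ext X Y m (u v : Hom X Y m) :
  (forall p q (e : p + m = q) a b, V X p a *m c u e *m V Y q b = V X p a *m c v e *m V Y q b) -> u = v.
Proof. by move=> E; apply: cxhP => p q e; apply: block_ext; exact: E. Qed.

Lemma cx_weight_linear N X Y m : linear (@cx_weight N X Y m).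
Proof. by move=> x u v; apply: cxhP => p q e; exact: block_weight_linear. Qed.

Lemma cx_weight_d N X Y m m' (e : m + 1 = m') (u : Hom X Y m) :
  cx_weight N (dg_d e u) = dg_d e (cx_weight N u).
Proof.
apply: cx_block_ext => p q ep a b; rewrite cx_weightE.
have a1 : p + m + 1 = q by clear -e ep; lia.
have a2 : p + 1 + m = q by clear -e ep; lia.
have L1 x : V X p a *m (x *m pc_d (o Y) a1) *m V Y q b = V X p a *m x *m V Y (p + m) b *m pc_d (o Y) a1.
  by rewrite !mulmxA -(mulmxA _ (pc_d _ _)) -V_d !mulmxA.
have L2 x : V X p a *m (pc_d (o X) (erefl (p + 1)) *m x) *m V Y q b = pc_d (o X) erefl *m (V X (p + 1) a *m x *m V Y q b).
  by rewrite mulmxA V_d !mulmxA.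
rewrite !(cxh_d e _ ep erefl a1 erefl a2) !mulmxBr !mulmxBl -!scalemxAr -!scalemxAl !L1 !L2 !cx_weightE.
by case: ifP => _; rewrite ?(mulmx0, mul0mx) ?scaler0 ?subrr.
Qed.

Lemma cx_weight_id X : cx_weight 0 (dg_id (o X : Dk)) = dg_id (o X : Dk).
Proof.
apply: cx_block_ext => p q e a b; rewrite cx_weightE addr0; case: eqP => // ne.
have Eq : q = p by rewrite -e addr0.
by move: e; rewrite Eq => e; rewrite [cxh _ e](@cxh_id0 k L (o X) p e) mulmx1 gw_orth eq_sym; case: eqP.
Qed.

Lemma cx_weight_idem N N' X Y m (u : Hom X Y m) :
  cx_weight N (cx_weight N' u) = if N == N' then cx_weight N' u else 0.
Proof.
apply: cx_block_ext => p q e a b; rewrite !cx_weightE.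
have [->|ne] := eqVneq N N'; first by rewrite cx_weightE; case: ifP => // ->.
rewrite -[c 0 e]/(0 : 'M_(_, _)) mulmx0 mul0mx; case: eqP => // ->; case: eqP => // E.
by move/eqP: ne; case; apply: (addrI a).
Qed.

Section Sub.
Variable S : forall X Y i, subspace (Hom X Y i).
Hypothesis Sd : forall X Y i j (e : i + 1 = j) f, S X Y i f -> S X Y j (dg_d e f).
Hypothesis S1 : forall X, S X X 0 (dg_id (o X : Dk)).
Hypothesis SM : forall X Y Z i j l (e : i + j = l) g f,
  S Y Z i g -> S X Y j f -> S X Z l (dg_comp e g f).
Hypothesis Sw : forall N X Y i f, S X Y i f -> S X Y i (cx_weight N f).
Hypothesis S_neg : forall N X Y i f, N < 0 -> S X Y i f -> cx_weight N f = 0.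
Hypothesis S_fin : forall X Y i f, S X Y i f -> exists K : nat, forall N, K%:Z <= N -> cx_weight N f = 0.

Let A : dgcat k := sub_dgcat (o := o : _ -> Dk) Sd S1 SM.
Definition sub_weight (N : nat) (X Y : A) i (f : dg_hom X Y i) : dg_hom X Y i := mks (Sw N (svP f)).

Lemma S_low X Y i f p q (e : p + i = q) a b : S X Y i f -> b < a -> V X p a *m c f e *m V Y q b = 0.
Proof.
move=> Sf lt_b; have := cx_weightE (b - a) f e a b; rewrite (addrC a) subrK eqxx => <-.
by rewrite (S_neg _ Sf) ?subr_lt0 // mulmx0 mul0mx.
Qed.

Lemma sub_weight_linear N X Y i : linear (@sub_weight N X Y i).
Proof. by move=> x u v; apply: sv_inj; exact: cx_weight_linear. Qed.
Lemma sub_weight_d N X Y i j (e : i + 1 = j) (f : @dg_hom k A X Y i) :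
  sub_weight N (dg_d e f) = dg_d e (sub_weight N f).
Proof. by apply: sv_inj; exact: cx_weight_d. Qed.
Lemma sub_weight_id X : sub_weight 0 (dg_id (X : A)) = dg_id (X : A).
Proof. by apply: sv_inj; exact: cx_weight_id. Qed.
Lemma sub_weight_idem N M X Y i (f : @dg_hom k A X Y i) :
  sub_weight N (sub_weight M f) = if N == M then sub_weight M f else 0.
Proof. by apply: sv_inj; rewrite /= cx_weight_idem eqz_nat; case: eqP. Qed.
Lemma sub_weight_fin X Y i (f : @dg_hom k A X Y i) :
  exists K, forall N, (K <= N)%N -> sub_weight N f = 0.
Proof. by have [K HK] := S_fin (svP f); exists K => N le_N; apply: sv_inj; apply: HK. Qed.
Lemma sub_weight_sum X Y i (f : @dg_hom k A X Y i) K :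
  (forall N, (K <= N)%N -> sub_weight N f = 0) -> \sum_(N < K) sub_weight N f = f.
Proof.
move=> fK; apply: sv_inj; apply: cx_block_ext => p q e a b.
have -> : c (sv (\sum_(N < K) sub_weight N f)) e = \sum_(N < K) c (cx_weight N (sv f)) e.
  have add : {morph (fun g : @dg_hom k A X Y i => c (sv g) e) : g h / g + h} by [].
  exact: (big_morph _ add).
rewrite mulmx_sumr mulmx_suml; have [lt_b|le_a] := ltP b a.
  rewrite (S_low e (svP f) lt_b); apply: big1 => N _; rewrite cx_weightE; case: eqP => // E.
  exact: (S_low e (svP f) lt_b).
pose N := absz (b - a); have bE : b = a + N%:Z by rewrite /N; clear -le_a; lia.
have H (N' : nat) : V X p a *m c (cx_weight N' (sv f)) e *m V Y q b =
    if N' == N then V X p a *m c (sv f) e *m V Y q b else 0.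
  rewrite cx_weightE {1}bE; congr (if _ then _ else _).
  by apply/eqP/eqP => [/addrI[->]|->].
have [lt_N|le_N] := ltnP N K.
  rewrite (bigD1 (Ordinal lt_N)) //= H eqxx big1 ?addr0 // => s ne; rewrite H; case: eqP => // E.
  by case/negP: ne; apply/eqP/val_inj.
have := H N; rewrite eqxx => <-; have -> : cx_weight N (sv f) = 0 := congr1 (fun h => sv h) (fK N le_N).
rewrite -[c _ e]/(0 : 'M_(_, _)) mulmx0 mul0mx; apply: big1 => s _; rewrite H.
by case: eqP => // E; move: le_N; rewrite -E leqNgt ltn_ord.
Qed.

(** Neither factor lowers the grading, so between grades a and a + N only the N + 1 intermediate
    grades contribute. *)
Lemma sub_weight_comp N X Y Z i j l (e : i + j = l) (g : @dg_hom k A Y Z i) (f : @dg_hom k A X Y j) :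
  sub_weight N (dg_comp e g f) = \sum_(s < N.+1) dg_comp e (sub_weight s g) (sub_weight (N - s) f).
Proof.
apply: sv_inj; apply: cx_block_ext => p q ep a b.
have e1 : p + j + i = q by clear -e ep; lia.
have -> : c (sv (\sum_(s < N.+1) dg_comp e (sub_weight s g) (sub_weight (N - s) f))) ep =
    \sum_(s < N.+1) c (cx_weight (N - s)%N (sv f)) (erefl (p + j)) *m c (cx_weight s (sv g)) e1.
  have add : {morph (fun h : @dg_hom k A X Z l => c (sv h) ep) : h h' / h + h'} by [].
  rewrite (big_morph _ add (erefl : c (sv 0) ep = 0)); apply: eq_bigr => s _.
  exact: (cxh_comp e _ _ ep erefl e1).
rewrite cx_weightE mulmx_sumr mulmx_suml.
have H (s : 'I_N.+1) : V X p a *m (c (cx_weight (N - s)%N (sv f)) (erefl (p + j)) *m c (cx_weight s (sv g)) e1) *m V Z q b =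
    if b == a + N%:Z then V X p a *m c (sv f) (erefl (p + j)) *m V Y (p + j) (a + N%:Z - s%:Z) *m (c (sv g) e1 *m V Z q b) else 0.
  have E1 t := cx_weightE (N - s)%N (sv f) (erefl (p + j)) a t; have E2 t := cx_weightE s (sv g) e1 t b.
  move: (c (cx_weight (N - s)%N (sv f)) (erefl (p + j))) (c (cx_weight s (sv g)) e1) E1 E2 => x y E1 E2.
  have le_s := ltn_ord s; rewrite -{1}[x]mulmx1 -(gw_sum (V Y (p + j))).
  pose F t := V X p a *m x *m V Y (p + j) t *m y *m V Z q b.
  transitivity (\sum_(r < (2 * gb (V Y (p + j)) + 1)%N) F (- (gb (V Y (p + j)))%:Z + r%:Z)).
    rewrite mulmx_sumr mulmx_suml mulmx_sumr mulmx_suml; apply: eq_bigr => r _.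
    by rewrite /F !mulmxA.
  have FE t : F t = if (t == a + (N - s)%N%:Z) && (b == t + s%:Z)
      then V X p a *m c (sv f) (erefl (p + j)) *m V Y (p + j) t *m (c (sv g) e1 *m V Z q b) else 0.
    have -> : F t = V X p a *m x *m V Y (p + j) t *m (V Y (p + j) t *m y *m V Z q b).
      by rewrite /F !mulmxA -(mulmxA _ (V Y (p + j) t) (V Y (p + j) t)) gw_orth eqxx.
    rewrite E1 E2; case: eqP => _; last by rewrite mul0mx.
    case: eqP => _; last by rewrite mulmx0.
    by rewrite -!mulmxA (mulmxA (V Y (p + j) t) (V Y (p + j) t)) gw_orth eqxx.
  rewrite (@int_sum_eq _ F _ (a + (N - s)%N%:Z) _ 1%N).
  - rewrite big_ord1 addr0 FE eqxx /= (_ : a + (N - s)%N%:Z = a + N%:Z - s%:Z) ?subrK //.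
    by clear -le_s; lia.
  - move=> t Ht; rewrite FE (gw0 Ht) mulmx0 mul0mx; by case: ifP.
  - by move=> t Ht; rewrite FE; case: eqP => // E; exfalso; clear -E Ht; lia.
case: (b =P a + N%:Z) => [bE|ne]; last by rewrite big1 // => s _; rewrite H; case: eqP.
rewrite (cxh_comp e _ _ ep erefl e1) mulmxA -(mulmxA _ _ (V Z q b)).
rewrite (@block_mul _ _ _ _ (V Y (p + j)) _ _ a N).
- by apply: eq_bigr => s _; rewrite H bE eqxx.
- by move=> t lt_t; apply: (S_low _ (svP f) lt_t).
- by move=> t lt_t; rewrite mulmxA; apply: (S_low _ (svP g)); rewrite bE.
Qed.

Definition weight0_category : dgcat k := weight0_dgcat sub_weight_linear sub_weight_d sub_weight_id sub_weight_comp.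
Definition weight0_functor : dgfunctor weight0_category A :=
  weight0_inclusion sub_weight_linear sub_weight_d sub_weight_id sub_weight_comp.
End Sub.
End ComplexWeights.

(** * Discrete categories and the weight zero part of the Koszul dual *)

Section Discrete.
Variables (k : fieldType) (A : dgcat k).

(** Identities are required to be nonzero so that the scalar of an endomorphism is unique. *)
Definition discrete : Prop :=
  [/\ forall X Y i (f : @dg_hom k A X Y i), ~ (X = Y /\ i = 0) -> f = 0,
      forall X (f : @dg_hom k A X X 0), exists c, f = c *: dg_id X
    & forall X : A, dg_id X <> 0].

Hypothesis D : discrete.
Let mor X Y i c : @dg_hom k A X Y i := scalar_mor (A := A) (B := A) id X Y i c.
Let spec X Y i (f : @dg_hom k A X Y i) c := (~ (X = Y /\ i = 0) -> c = 0) /\ f = mor X Y i c.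

Lemma discrete_coef_exists X Y i (f : @dg_hom k A X Y i) : exists c, spec f c.
Proof.
have [D0 D1 _] := D; have [[XY i0]|ne] := pselect (X = Y /\ i = 0); last first.
  by exists 0; split=> //; rewrite /mor scalar_mor0; apply: D0.
subst Y i; have [c ->] := D1 _ f; exists c; split; first by case.
by rewrite /mor scalar_mor_id.
Qed.
Definition discrete_coef X Y i (f : @dg_hom k A X Y i) : k := sval (boolp.cid (discrete_coef_exists f)).
Let coefP X Y i (f : @dg_hom k A X Y i) : spec f (discrete_coef f).
Proof. exact: svalP (boolp.cid (discrete_coef_exists f)). Qed.
Let coef_unique X Y i (f : @dg_hom k A X Y i) c : spec f c -> discrete_coef f = c.
Proof.
have [_ _ D2] := D; move=> [c0 cE]; have [f0 fE] := coefP f.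
have [[XY i0]|ne] := pselect (X = Y /\ i = 0); last by rewrite c0 ?f0.
subst Y i; move: cE; rewrite {1}fE /mor !scalar_mor_id => /eqP.
rewrite -subr_eq0 -scalerBl scaler_eq0 subr_eq0 => /orP[/eqP//|/eqP id0].
by case: (D2 X id0).
Qed.
Lemma discrete_coefE X Y i (f : @dg_hom k A X Y i) : f = scalar_mor (A := A) (B := A) id X Y i (discrete_coef f).
Proof. by have [] := coefP f. Qed.
Lemma discrete_coef_id X : discrete_coef (dg_id X) = 1.
Proof. by apply: coef_unique; split; [case|rewrite /mor scalar_mor_id scale1r]. Qed.

Program Definition discrete_kscalar : kscalar A := @KScalar k A (fun X Y i f => discrete_coef f) _ _ _ _.
Next Obligation.
move=> X Y i x u v; apply: coef_unique; have [u0 uE] := coefP u; have [v0 vE] := coefP v; split.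
  by move=> ne; rewrite u0 // v0 // scaler0 addr0.
by rewrite {1}uE {1}vE /mor (@scalar_mor_linear k A A id X Y i).
Qed.
Next Obligation.
move=> X Y i j e f; have [D0 D1 _] := D; apply: coef_unique; split=> //; rewrite /mor scalar_mor0.
have [[XY i0]|ne] := pselect (X = Y /\ i = 0); last by rewrite (D0 _ _ _ f) // (lin0 (dg_d_linear _)).
by subst Y i; have [c ->] := D1 _ f; rewrite (linZ (dg_d_linear _)) dg_id_closed scaler0.
Qed.
Next Obligation.
move=> X Y Z i j l e g f; have [D0 D1 _] := D; apply: coef_unique.
have [[YZ i0]|ne] := pselect (Y = Z /\ i = 0); last first.
  have [g0 _] := coefP g; rewrite (g0 ne) mul0r (D0 _ _ _ g ne) dg_comp0l.
  by split=> //; rewrite /mor scalar_mor0.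
have [[XY j0]|ne] := pselect (X = Y /\ j = 0); last first.
  have [f0 _] := coefP f; rewrite (f0 ne) mulr0 (D0 _ _ _ f ne) dg_comp0r.
  by split=> //; rewrite /mor scalar_mor0.
subst Y Z i j l; split; first by case.
have [_ gE] := coefP g; have [_ fE] := coefP f; rewrite {1}gE {1}fE /mor !scalar_mor_id.
by rewrite (linZ (dg_comp_linear_l _ _)) (linZ (dg_comp_linear_r _ _)) dg_comp1l scalerA.
Qed.
Next Obligation.
move=> X Y i f /eqP nz; apply: contrapT => ne; apply: nz; have [f0 _] := coefP f; exact: f0.
Qed.

Lemma discrete_functor_id (B : dgcat k) (F : A -> B) X :
  ks_coef discrete_kscalar (dg_id X) *: dg_id (F X) = dg_id (F X).
Proof. by rewrite [ks_coef _ _]discrete_coef_id scale1r. Qed.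
Definition discrete_functor (B : dgcat k) (F : A -> B) : dgfunctor A B :=
  scalar_functor (discrete_functor_id F).

Lemma discrete_functor_idf : dgf_iso (discrete_functor (id : A -> A)) (dgf_idf A).
Proof.
exists (fun a => dg_id _), (fun a => dg_id _); split=> [a|a|a|a b i f].
- by split; apply: dg_id_closed.
- by rewrite dg_comp1l.
- by rewrite dg_comp1l.
by rewrite dg_comp1l dg_comp1r /= [RHS]discrete_coefE.
Qed.
Lemma discrete_functor_comp (B C : dgcat k) (F : A -> B) (H : dgfunctor B C) (F' : A -> C) :
  (forall X, H (F X) = F' X) -> dgf_iso (dgf_compf H (discrete_functor F)) (discrete_functor F').
Proof. exact: scalar_functor_comp. Qed.
End Discrete.

(** Functors out of a discrete category are determined by their object maps, so a bijection on
    objects is an isomorphism. *)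
Lemma Em_discrete (k : fieldType) (T : triangulated) (E : functor (DGcat k) (tr_cat T)) (A B : dgcat k)
    (DA : discrete A) (DB : discrete B) (F : A -> B) (F' : B -> A) :
  cancel F F' -> cancel F' F -> @is_iso (tr_cat T) _ _ (Em E (discrete_functor DA F)).
Proof.
move=> FK F'K; exists (Em E (discrete_functor DB F')).
split; rewrite -[_ \oc _]Em_comp.
- rewrite (Em_iso E (@discrete_functor_comp _ A DA _ _ F (discrete_functor DB F') id FK)) (Em_iso E (discrete_functor_idf DA)) Em_id.
  exact: ceq_refl.
- rewrite (Em_iso E (@discrete_functor_comp _ B DB _ _ F' (discrete_functor DA F) id F'K)) (Em_iso E (discrete_functor_idf DB)) Em_id.
  exact: ceq_refl.
Qed.

Section ModuleGradings.
Variables (k : fieldType) (L : falgType k) (G : nonneg_grading L).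
Implicit Types M N : fmod L right_side.

Lemma fhom_graded M N (f : 'M_(fm_dim M, fm_dim N)) :
  (forall c a, a \in G c -> fm_act M a *m f = f *m fm_act N a) -> is_fhom f.
Proof.
move=> H a; rewrite -(gr_comp_sum G a) !(lin_sum (@fm_linear _ _ _ _)) mulmx_suml mulmx_sumr.
by apply: eq_bigr => i _; apply: H (gr_comp_mem G _ _).
Qed.

Section OfWeights.
Variables (neg : bool) (M : fmod L right_side) (W : weights G M).
Let g (a : int) := wt W (if neg then - a else a).
Program Definition grading_of : grading k (fm_dim M) := @Grading k (fm_dim M) g (wt_bound W) _ _ _.
Next Obligation.
move=> i j; rewrite /g wt_orth; case: neg => //; rewrite (_ : (- i == - j) = (i == j)) //.
by apply/eqP/eqP => [|->//]; clear; lia.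
Qed.
Next Obligation.
move=> i Hi; rewrite /g; apply: wt0; case: neg => /=.
  by move: Hi; clear; lia.
by move: Hi; clear; lia.
Qed.
Next Obligation.
have E := @wt_sum _ _ _ _ W (wt_bound W) (2 * wt_bound W + 1) _.
rewrite /g; case: neg => /=; rewrite -[RHS]E; try by lia.
- rewrite (reindex_inj rev_ord_inj); apply: eq_bigr => s _ /=; congr (wt W _).
  by have := ltn_ord s; lia.
- by apply: eq_bigr => s _; rewrite addrC.
Qed.
Lemma grading_act a c x : x \in G c ->
  fm_act M x *m grading_of a = grading_of (a - if neg then - c else c) *m fm_act M x.
Proof.
by move=> Gx; rewrite /= /g (wt_act W _ Gx); case: neg => //; congr (wt W _ *m _); lia.
Qed.
End OfWeights.

(** Homogeneous elements of L shift both gradings by the same amount, so linearity can be checked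
    block by block. *)
Lemma block_weight_hom neg M N (W : weights G M) (W' : weights G N) s (f : 'M_(fm_dim M, fm_dim N)) :
  is_fhom f -> is_fhom (M := M) (N := N) (block_weight (grading_of neg W) (grading_of neg W') s f).
Proof.
move=> Hf; apply: fhom_graded => c x Gx; apply: (block_ext (V := grading_of neg W) (W := grading_of neg W')) => a b.
set V := grading_of neg W; set V' := grading_of neg W'; pose d := if neg then - c else c.
have A1 a' : V a' *m fm_act M x = fm_act M x *m V (a' + d).
  by rewrite (grading_act neg W _ Gx) addrK.
have A2 b' : fm_act N x *m V' b' = V' (b' - d) *m fm_act N x by apply: grading_act.
have E := block_weightE V V' s f; move: (block_weight V V' s f) E => h E.
rewrite mulmxA A1 -!(mulmxA (fm_act M x)) E -!mulmxA A2 !mulmxA E.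
rewrite (_ : (b - d == a + s) = (b == a + d + s)); last by apply/eqP/eqP; lia.
case: eqP => _; last by rewrite mulmx0 mul0mx.
by rewrite !mulmxA -A1 -(mulmxA (V a)) Hf -!mulmxA A2 !mulmxA.
Qed.
End ModuleGradings.

Section KoszulWeights.
Variables (k : fieldType) (L : falgType k) (G : nonneg_grading L) (n : nat) (t : top_data G n).
Local Notation e := (td_e t).
Local Notation Dk := (Db_dgcat (k^o : falgType k)).
Variable B : forall i, bar t i.
#[local] Opaque ent.
Local Notation Hom i j m := (@dg_hom k Dk (aug_complex B i) (aug_complex B j) m).
Local Notation kos := (koszul_subspace B).

(* The Koszul dual lowers the weights of the bar resolutions, whence the sign. *)
Definition koszul_grading i p : grading k (fm_dim (aug_complex B i p)) := grading_of true (bw (B i) p).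
Local Notation V := koszul_grading.
Lemma koszul_grading_d i p q (a : p + 1 = q) s : V i p s *m pc_d (aug_complex B i) a = pc_d (aug_complex B i) a *m V i q s.
Proof. exact: bw_d. Qed.
Lemma koszul_grading_hom i j p q N (f : 'M_(fm_dim (aug_complex B i p), fm_dim (aug_complex B j q))) :
  is_fhom f -> is_fhom (M := aug_complex B i p) (N := aug_complex B j q) (block_weight (V i p) (V j q) N f).
Proof. by move=> _; apply: k_fhom. Qed.
Local Notation cxw := (cx_weight koszul_grading_hom).
Lemma koszul_gradingE i j N m (u : Hom i j m) p q (a : p + m = q) r s :
  V i p r *m ent (cxw N u) a *m V j q s = if s == r + N then V i p r *m ent u a *m V j q s else 0.
Proof. exact: (cx_weightE koszul_grading_hom N u a r s). Qed.
Lemma ent_block_ext p q i j (u v : 'M[k]_(fm_dim (B i p), fm_dim (B j q))) :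
  (forall a b, V i p a *m u *m V j q b = V i p a *m v *m V j q b) -> u = v.
Proof. exact: (@block_ext k _ _ (V i p) (V j q)). Qed.

Lemma koszul_weight N i j m (u : Hom i j m) : kos i j m u -> kos i j m (cxw N u).
Proof.
move=> [u1 u2 u3 u4]; split=> [|p p' q q' a b c c'|p q a s|p q a le_q].
- by case: u1 => [|->]; [left|right; rewrite (lin0 (@cx_weight_linear _ _ _ _ _ koszul_grading_hom N i j m))].
- apply: ent_block_ext => r s; have E1 := koszul_gradingE N u c r s; have E2 := koszul_gradingE N u c' r s.
  have W1 : V i p' r *m be (B i) a = be (B i) a *m V i p r by apply: bw_e.
  have W2 : V j q' s *m be (B j) b = be (B j) b *m V j q s by apply: bw_e.
  move: E1 E2; move: (ent (cxw N u) c) (ent (cxw N u) c') => x y E1 E2.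
  rewrite mulmxA W1 -(mulmxA (be _ _)) -(mulmxA (be _ _)) E1 -scalemxAr -scalemxAl mulmxA -(mulmxA _ (be _ _)) -W2 !mulmxA E2.
  case: eqP => _; last by rewrite mulmx0 mul0mx scaler0.
  by rewrite !mulmxA -W1 -(mulmxA (V i p' r) (be _ _)) (u2 _ _ _ _ a b c c') -scalemxAr -scalemxAl !mulmxA -(mulmxA _ (be _ _)) -W2 !mulmxA.
- have W1 c : V i p c *m fm_act (B i p) (e s) = fm_act (B i p) (e s) *m V i p c.
    by rewrite (grading_act true (bw (B i) p) c (td_grade t s)) oppr0 addr0.
  have W2 c : V j q c *m fm_act (B j q) (e s) = fm_act (B j q) (e s) *m V j q c.
    by rewrite (grading_act true (bw (B j) q) c (td_grade t s)) oppr0 addr0.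
  apply: ent_block_ext => r r'; have E1 := koszul_gradingE N u a r r'; move: E1; move: (ent (cxw N u) a) => x E1.
  have F1 y : V i p r *m (fm_act (B i p) (e s) *m y) *m V j q r' = fm_act (B i p) (e s) *m (V i p r *m y *m V j q r').
    by rewrite mulmxA W1 !mulmxA.
  have F2 y : V i p r *m (y *m fm_act (B j q) (e s)) *m V j q r' = V i p r *m y *m V j q r' *m fm_act (B j q) (e s).
    by rewrite !mulmxA -(mulmxA _ (fm_act (B j q) (e s))) -W2 !mulmxA.
  rewrite F1 F2 E1; case: eqP => _; last by rewrite mulmx0 mul0mx.
  by rewrite -F1 u3 F2.
- exact: (block_weight_hom true (bw (B i) p) (bw (B j) q) N (u4 p q a le_q)).
Qed.

Lemma koszul_grading_top i q a : q = 1 -> a != 0 -> V i q a = 0.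
Proof.
move=> -> a0; rewrite -[LHS]mulmx1 -(b_top_wt (B i)) -[wt _ 0]/(V i 1 (- 0)) oppr0 gw_orth.
by rewrite (negbTE a0).
Qed.

(** Only the component into degree 1 matters. Its target has weight 0 and its source weights >= 0,
    which in the reversed grading leaves only nonnegative differences. *)
Lemma koszul_weight_neg N i j m (u : Hom i j m) : N < 0 -> kos i j m u -> cxw N u = 0.
Proof.
move=> N_neg Ku; apply: (koszul_ext (koszul_weight N Ku) (subspace0 _)) => p a.
apply: ent_block_ext => r s; rewrite koszul_gradingE ent0 mulmx0 mul0mx; case: eqP => // sE.
have [s0|s0] := eqVneq s 0; last by rewrite (koszul_grading_top j erefl s0) mulmx0.
rewrite [V i p r](_ : _ = 0) ?mul0mx //; rewrite /= wt0 //; left; clear -N_neg sE s0; lia.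
Qed.
(** The component into degree 1 has a finite dimensional source, so its weights are bounded even
    though those of the whole bar complex need not be. *)
Lemma koszul_weight_fin i j m (u : Hom i j m) : kos i j m u ->
  exists K : nat, forall N, K%:Z <= N -> cxw N u = 0.
Proof.
move=> Ku; exists (wt_bound (bw (B i) (1 - m))) => N le_N.
apply: (koszul_ext (koszul_weight N Ku) (subspace0 _)) => p a.
apply: ent_block_ext => r s; rewrite koszul_gradingE ent0 mulmx0 mul0mx; case: eqP => // sE.
have [s0|s0] := eqVneq s 0; last by rewrite (koszul_grading_top j erefl s0) mulmx0.
have Ep : p = 1 - m by clear -a; lia.
subst p; rewrite [V i _ r](_ : _ = 0) ?mul0mx //= wt0 //; right; clear -le_N sE s0; lia.
Qed.

Definition koszul0 : dgcat k := weight0_category koszul_grading_d (koszul_d (B := B)) (koszul_id B)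
  (koszul_comp (B := B)) koszul_weight koszul_weight_neg.
Definition koszul0_functor : dgfunctor koszul0 (koszul B) := weight0_functor koszul_grading_d (koszul_d (B := B))
  (koszul_id B) (koszul_comp (B := B)) koszul_weight koszul_weight_neg.

Lemma koszul0_iso (T : triangulated) (E : functor (DGcat k) (tr_cat T)) : A1_homotopy_invariant E ->
  @is_iso (tr_cat T) _ _ (Em E koszul0_functor).
Proof.
move=> E_A1; apply: (Em_weight0 E_A1).
- exact: sub_weight_idem.
- exact: sub_weight_fin koszul_weight_fin.
- exact: sub_weight_sum koszul_weight_neg.
Qed.

(** For m > 0 the component into degree 1 kills the image of the contraction, which by [b_wt0]
    leaves no weight 0. For m = 0 it is a map between characters, and the idempotents separate
    these. *)
Lemma koszul_weight0 (i j : 'I_n) m (u : Hom i j m) :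
  kos i j m u -> cxw 0 u = u -> m <> 0 \/ i <> j -> u = 0.
Proof.
move=> Ku w0 ne; have [K1 K2 K3 _] := Ku; apply: (koszul_ext Ku (subspace0 _)) => p a; rewrite ent0.
have [m0|m0] := pselect (m = 0).
  have p1 : p = 1 by clear -a m0; lia.
  have [_ [_ [_ _ Ai]]] := bar_top B i p1; have [_ [_ [_ _ Aj]]] := bar_top B j (erefl (1 : int)).
  have := K3 p 1 a i; rewrite Ai Aj !td_chr_e eqxx mul1mx => ->.
  case: eqP => [E|_]; last by rewrite raddf0 mulmx0.
  by case: ne => // -[]; rewrite E.
have [m_ge0|u0] := K1; last by rewrite u0 ent0.
have a2 : p + 1 + m = 1 + 1 by clear -a; lia.
have h0 : be (B i) (erefl (p + 1)) *m ent u a = 0.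
  rewrite (K2 _ _ _ _ erefl (erefl (1 + 1)) a a2) [ent u a2](_ : _ = 0) ?mul0mx ?scaler0 //.
  by apply: dim0_mxr; apply: b_high.
have le_p : p <= 0 by clear -a m0 m_ge0; lia.
apply: ent_block_ext => r s; rewrite mulmx0 mul0mx.
have [->|s0] := eqVneq s 0; last by rewrite (koszul_grading_top j erefl s0) mulmx0.
have := koszul_gradingE 0 u a r 0; rewrite w0 addr0 => ->; case: eqP => // <-.
by rewrite -[V i p 0]/(wt (bw (B i) p) (- 0)) oppr0 (b_wt0 le_p h0) mul0mx.
Qed.

Lemma koszul_scalar i (u : Hom i i 0) : kos i i 0 u -> exists c, u = c *: dg_id (aug_complex B i : Dk).
Proof.
move=> Ku; have [c cE] : exists c, ent u (addr0 1) = c%:M.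
  move: (ent _ _); rewrite (b_top_dim (B i)) => x; exists (x 0 0); exact: mx11_scalar.
exists c; apply: (koszul_ext Ku (subspaceZ _ (koszul_id B i))) => p a.
have Ep : p = 1 by clear -a; lia.
by move: a; rewrite Ep => a; rewrite (int_eq_irr a (addr0 1)) cE entZ ent_id scalemx1.
Qed.

Lemma koszul_id_neq0 i : dg_id (aug_complex B i : Dk) <> 0.
Proof.
move/(congr1 (fun u : Hom i i 0 => ent u (addr0 1))); rewrite ent_id ent0.
by move/(congr1 mxrank); rewrite mxrank1 mxrank0 b_top_dim.
Qed.

Lemma koszul0_discrete : discrete koszul0.
Proof.
split=> [i j m f ne|i f|i E].
- apply: sv_inj; apply: sv_inj; apply: (koszul_weight0 (svP (sv f)) (congr1 (fun g => sv g) (svP f))).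
  by have [m0|m0] := eqVneq m 0; [right=> ij; apply: ne|left; apply/eqP].
- by have [c cE] := koszul_scalar (svP (sv f)); exists c; apply: sv_inj; apply: sv_inj.
- exact: (koszul_id_neq0 (congr1 (fun g => sv (sv g)) E)).
Qed.

Definition koszul0_ob (i : 'I_n) : koszul0 := i.
Definition koszul0_ix (X : koszul0) : 'I_n := X.
Definition koszul0_to_Db : dgfunctor koszul0 (Db_dgcat L) := dgf_compf (koszul_functor B) koszul0_functor.
Lemma koszul0_to_Db_iso (T : triangulated) (E : functor (DGcat k) (tr_cat T)) : A1_homotopy_invariant E ->
  @is_iso (tr_cat T) _ _ (Em E koszul0_to_Db).
Proof.
move=> E_A1.
have i1 : @is_iso (tr_cat T) _ _ (Em E (koszul_functor B)).
  exact: (Em_morita E_A1 (@derived_morita_criterion k _ _ (koszul_functor B) (koszul_retraction B) (@resolutions_generate _ _ _ _ _ B))).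
by rewrite /koszul0_to_Db Em_comp; exact: (is_iso_comp i1 (koszul0_iso E_A1)).
Qed.
End KoszulWeights.

(** * The perfect side *)

Lemma dim1_const (k : fieldType) d : d = 1%N ->
  (const_mx 1 : 'M[k]_(1, d)) *m (const_mx 1 : 'M_(d, 1)) = 1%:M /\
  (const_mx 1 : 'M[k]_(d, 1)) *m (const_mx 1 : 'M_(1, d)) = 1%:M.
Proof.
by move=> ->; split; apply/matrixP => i j; rewrite !ord1 !mxE big_ord1 !mxE mulr1.
Qed.

Section Projectives.
Variables (k : fieldType) (L : falgType k) (G : nonneg_grading L) (n : nat) (t : top_data G n).
Local Notation e := (td_e t).
Local Notation fmodR := (fmod L right_side).
Variable B : forall i, bar t i.

Definition proj_cover i : fmodR := B i 0.
Local Notation P := proj_cover.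
(** The image of the simple module under the contraction, playing the role of e_i in e_i L. *)
Definition proj_gen i : 'rV[k]_(fm_dim (P i)) := const_mx 1 *m be (B i) (add0r 1).
Let top i : fm_dim (B i 1) = 1%N := b_top_dim (B i).
Let be2 i (a : 1 + 1 = 1 + 1 :> int) : be (B i) a = 0.
Proof. by apply: dim0_mx; apply: b_high. Qed.

Lemma proj_cover_projective i : fm_projective (P i). Proof. exact: b_proj. Qed.

Lemma proj_gen_ext i (N : fmodR) (f h : 'M_(fm_dim (P i), fm_dim N)) :
  is_fhom f -> is_fhom h -> proj_gen i *m f = proj_gen i *m h -> f = h.
Proof.
move=> Hf Hh E; apply: (@b_uniq _ _ _ _ _ _ (B i) 0 _ (add0r 1) N) => //.
have [_ K] := dim1_const k (top i).
by rewrite -[be _ _]mul1mx -K -!mulmxA; congr (_ *m _); rewrite !mulmxA.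
Qed.

Lemma proj_gen_e i j : proj_gen i *m fm_act (P i) (e j) = (j == i)%:R *: proj_gen i.
Proof.
rewrite -mulmxA -be_e (b_top_act (B i)) td_chr_e mul_scalar_mx -scalemxAr; congr (_ *: _).
by rewrite eq_sym.
Qed.

Lemma proj_gen_lift i (N : fmodR) (v : 'rV_(fm_dim N)) :
  exists2 f : 'M_(fm_dim (P i), fm_dim N), is_fhom f & proj_gen i *m f = v *m fm_act N (e i).
Proof.
have [K1 K2] := dim1_const k (top i).
have [s||f Hf fE] := @b_ext _ _ _ _ _ _ (B i) 0 _ _ (add0r 1) (erefl (1 + 1)) N
  (const_mx 1 *m (v *m fm_act N (e i))) (lexx 0).
- rewrite (b_top_act (B i)) mul_scalar_mx td_chr_e -!mulmxA -(fm_actM N) td_eM eq_sym.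
  case: eqP => _; first by rewrite scale1r.
  by rewrite scale0r (lin0 (@fm_linear _ _ _ N)) !mulmx0.
- by rewrite be2 mul0mx.
by exists f => //; rewrite -mulmxA fE mulmxA K1 mul1mx.
Qed.

(** M splits off the free module on its underlying space; decomposing each free generator by the
    idempotents makes the identity a sum of maps through the covers. *)
Lemma proj_dual_basis (M : fmodR) : fm_projective M ->
  exists (f : forall u : 'I_n * 'I_(fm_dim M), 'M[k]_(fm_dim M, fm_dim (P u.1)))
    (g : forall u : 'I_n * 'I_(fm_dim M), 'M[k]_(fm_dim (P u.1), fm_dim M)),
  [/\ forall u, is_fhom (M := M) (N := P u.1) (f u), forall u, is_fhom (M := P u.1) (N := M) (g u)
    & \sum_u f u *m g u = 1%:M].
Proof.
move=> pM; pose F := free_mod L (fm_dim M); pose c : 'M_(fm_dim F, fm_dim M) := free_ext M 1%:M.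
have c1 : free_unit L (fm_dim M) *m c = 1%:M by apply: free_unit_ext.
have c_hom : is_fhom (M := F) (N := M) c by apply: free_ext_hom.
have [|s s_hom sE] := pM F M c 1%:M c_hom _ (@fhom1 _ _ _ M); first by apply/row_fullP; exists (free_unit L (fm_dim M)).
pose c' (u : 'I_n * 'I_(fm_dim M)) : 'M_(fm_dim F, fm_dim (P u.1)) :=
  free_ext (P u.1) (delta_mx u.2 0 *m proj_gen u.1).
have H u := cid2 (@proj_gen_lift u.1 M (delta_mx 0 u.2)).
exists (fun u => s *m c' u), (fun u : 'I_n * 'I_(fm_dim M) => s2val (H u)); split=> [u|u|].
- by apply: (fhomM (N := F)) => //; apply: free_ext_hom.
- exact: (s2valP (H u)).
rewrite -sE; transitivity (s *m (\sum_u c' u *m s2val (H u))).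
  by rewrite mulmx_sumr; apply: eq_bigr => u _; rewrite mulmxA.
congr (s *m _); apply: (free_hom_ext (N := M)) => //.
  apply: (big_ind (fun f => is_fhom (M := F) (N := M) f)); first exact: fhom0.
    by move=> f g; apply: fhomD.
  by move=> u _; apply: (fhomM (N := P u.1)); [exact: free_ext_hom|exact: (s2valP (H u))].
rewrite c1 mulmx_sumr; transitivity (\sum_(u : 'I_n * 'I_(fm_dim M)) delta_mx u.2 u.2 *m fm_act M (e u.1)).
  apply: eq_bigr => u _; rewrite mulmxA free_unit_ext -mulmxA (s2valP' (H u)) mulmxA.
  by rewrite mul_delta_mx.
rewrite -(pair_big predT predT (fun a s => delta_mx s s *m fm_act M (e a))) /= exchange_big /=.
under eq_bigr => i _ do rewrite -mulmx_sumr -(lin_sum (@fm_linear _ _ _ M)) td_sum fm_act1 mulmx1.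
by apply/matrixP => i j; rewrite summxE (bigD1 i) //= big1 ?addr0 => [|r ne]; rewrite !mxE ?eqxx ?(eq_sym i) // (negbTE ne).
Qed.
End Projectives.
Arguments proj_cover_projective {k L G n t} B i.

(** * Weights on the projective covers of the simple modules *)

Section PerfectSide.
Variables (k : fieldType) (L : falgType k) (G : nonneg_grading L) (n : nat) (t : top_data G n).
Local Notation e := (td_e t).
Local Notation Db := (Db_dgcat L).
Variable B : forall i, bar t i.
Local Notation P := (proj_cover B).
Local Notation gen := (proj_gen B).

Definition mask_weights c (M : fmod L right_side) (W : weights G M) : weights G (mask_mod c M) :=
  if c return weights G (mask_mod c M) then W else zero_weights G.

Definition cover_complex i : proj_complex L := stalk (proj_cover_projective B i).
Local Notation R := cover_complex.
Local Notation Hom i j m := (@dg_hom k Db (R i) (R j) m).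
Definition cover_grading i p : grading k (fm_dim (R i p)) := grading_of false (mask_weights (p == 0) (bw (B i) 0)).
Local Notation V := cover_grading.

Lemma cover_grading_hom i j p q N (f : 'M_(fm_dim (R i p), fm_dim (R j q))) :
  is_fhom f -> is_fhom (M := R i p) (N := R j q) (block_weight (V i p) (V j q) N f).
Proof. exact: block_weight_hom. Qed.
Lemma cover_grading_d i p q (a : p + 1 = q) s : V i p s *m pc_d (R i) a = pc_d (R i) a *m V i q s.
Proof. by rewrite mulmx0 mul0mx. Qed.
Local Notation cxw := (cx_weight cover_grading_hom).

Lemma gen_wt i s : gen i *m wt (bw (B i) 0) s = if s == 0 then gen i else 0.
Proof.
rewrite -mulmxA -bw_e; have := wt_orth (bw (B i) 1) s 0; rewrite (b_top_wt (B i)) mulmx1 => ->.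
by case: (s =P 0) => [->|_]; rewrite ?(b_top_wt (B i)) ?mul1mx // mul0mx mulmx0.
Qed.

Lemma gen_neq0 i : gen i != 0.
Proof.
apply/eqP => /(congr1 (fun x => x *m bd (B i) (add0r 1))); rewrite mul0mx -mulmxA.
have := bed (B i) (add0r 1) (erefl (1 + 1)); rewrite [bd _ erefl](_ : _ = 0) ?mul0mx ?addr0; last first.
  by apply: dim0_mxr; apply: b_high.
move=> ->; rewrite mulmx1 => /(congr1 (fun x => x *m (const_mx 1 : 'M_(_, 1)))).
rewrite (proj1 (dim1_const k (b_top_dim (B i)))) mul0mx => /matrixP/(_ 0 0); rewrite !mxE eqxx => /eqP.
by rewrite oner_eq0.
Qed.

Definition comp0 i j (f : Hom i j 0) : 'M[k]_(fm_dim (P i), fm_dim (P j)) :=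
  cxh (f : cx_hom (R i) (R j) 0) (addr0 0).
Lemma comp0_hom i j (f : Hom i j 0) : is_fhom (M := P i) (N := P j) (comp0 f).
Proof. exact: (@cxh_hom k L (R i) (R j) 0 f 0 0 (addr0 0)). Qed.

Lemma cover_hom0 i j m (f : Hom i j m) : m <> 0 -> f = 0.
Proof.
move=> m0; apply: cxhP => p q a; have [p0|p0] := eqVneq p 0.
  by apply: dim0_mxr; apply: mask_dim0; left; apply/eqP => q0; apply: m0; move: a p0 q0; clear; lia.
by apply: dim0_mx; apply: mask_dim0; left.
Qed.
Lemma cover_homP i j (f g : Hom i j 0) : gen i *m comp0 f = gen i *m comp0 g -> f = g.
Proof.
move=> /(proj_gen_ext (comp0_hom f) (comp0_hom g)) E; apply: cxhP => p q a.
have [p0|p0] := eqVneq p 0; last by apply: dim0_mx; apply: mask_dim0; left.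
have q0 : q = 0 by clear -a p0; lia.
by move: a; rewrite p0 q0 => a; rewrite (int_eq_irr a (addr0 0)).
Qed.

(** The generator has weight 0, so in the defining sum only the block starting at 0 survives. *)
Lemma gen_block_weight i j N (h : 'M[k]_(fm_dim (P i), fm_dim (P j))) :
  gen i *m block_weight (grading_of false (bw (B i) 0)) (grading_of false (bw (B j) 0)) N h =
  gen i *m h *m wt (bw (B j) 0) N.
Proof.
rewrite /block_weight mulmx_sumr; set V := grading_of false _; set V' := grading_of false _.
pose F s := gen i *m (V s *m h *m V' (s + N)).
have F0 s : s != 0 -> F s = 0.
  by move=> s0; rewrite /F !mulmxA [gen i *m _](_ : _ = 0) ?mul0mx // gen_wt (negbTE s0).
rewrite -[LHS]/(\sum_(s < (2 * gb V + 1)%N) F (- (gb V)%:Z + s%:Z)).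
rewrite (@int_sum_eq _ F _ 0 _ 1%N).
- by rewrite big_ord1 addr0 /F add0r !mulmxA [gen i *m _](gen_wt i 0).
- by move=> s Hs; rewrite /F (gw0 Hs) !mul0mx mulmx0.
- by move=> s Hs; apply: F0; apply/eqP => s0; move: Hs; rewrite s0; clear; lia.
Qed.
Lemma gen_weight i j N (f : Hom i j 0) :
  gen i *m comp0 (cxw N f) = gen i *m comp0 f *m wt (bw (B j) 0) N.
Proof. exact: gen_block_weight. Qed.

(** The weight construction is stated for subcategories of morphisms; here every morphism is
    kept. *)
Let total (i j : 'I_n) m : subspace (Hom i j m) := @Subspace k (Hom i j m) (fun _ => True) I (fun _ _ _ _ _ => I).
Let total_d i j m m' (em : m + 1 = m') f : total i j m f -> total i j m' (dg_d em f). Proof. by []. Qed.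
Let total_id i : total i i 0 (dg_id (R i : Db)). Proof. by []. Qed.
Let total_comp i j l m m' m'' (em : m + m' = m'') g f :
  total j l m g -> total i j m' f -> total i l m'' (dg_comp em g f). Proof. by []. Qed.
Let total_weight N i j m f : total i j m f -> total i j m (cxw N f). Proof. by []. Qed.

Lemma cover_weight_neg N i j m (f : Hom i j m) : N < 0 -> total i j m f -> cxw N f = 0.
Proof.
move=> N_neg _; have [m0|m0] := pselect (m = 0); last exact: cover_hom0.
subst m; apply: cover_homP; rewrite gen_weight -[comp0 0]/(0 : 'M_(_, _)) mulmx0 wt0 ?mulmx0 //.
by left.
Qed.
Lemma cover_weight_fin i j m (f : Hom i j m) : total i j m f ->
  exists K : nat, forall N, K%:Z <= N -> cxw N f = 0.
Proof.
move=> _; exists (wt_bound (bw (B j) 0)) => N le_N.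
have [m0|m0] := pselect (m = 0); last exact: cover_hom0.
subst m; apply: cover_homP; rewrite gen_weight -[comp0 0]/(0 : 'M_(_, _)) mulmx0 wt0 ?mulmx0 //.
by right.
Qed.

Definition cover_dgcat : dgcat k := sub_dgcat (o := R : _ -> Db) total_d total_id total_comp.
Definition cover0 : dgcat k := weight0_category cover_grading_d total_d total_id total_comp total_weight cover_weight_neg.
Definition cover0_functor : dgfunctor cover0 cover_dgcat :=
  weight0_functor cover_grading_d total_d total_id total_comp total_weight cover_weight_neg.

Lemma cover0_iso (T : triangulated) (E : functor (DGcat k) (tr_cat T)) : A1_homotopy_invariant E ->
  @is_iso (tr_cat T) _ _ (Em E cover0_functor).
Proof.
move=> E_A1; apply: (Em_weight0 E_A1).
- exact: sub_weight_idem.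
- exact: sub_weight_fin cover_weight_fin.
- exact: sub_weight_sum cover_weight_neg.
Qed.

(** By [b_wt0] the weight 0 part of a cover is the line spanned by its generator. *)
Lemma cover_weight0 i j (f : Hom i j 0) : cxw 0 f = f -> exists c, gen i *m comp0 f = c *: gen j.
Proof.
move=> /(congr1 (fun h => gen i *m comp0 h)); rewrite gen_weight => <-.
have a : 0 + 1 = 1 :> int by [].
have h0 : be (B j) a *m (1%:M - bd (B j) a *m be (B j) a) = 0.
  rewrite mulmxBr mulmx1 mulmxA; have := bed (B j) a (erefl (1 + 1)); rewrite [bd _ erefl](_ : _ = 0) ?mul0mx ?addr0.
    by move=> ->; rewrite mul1mx subrr.
  by apply: dim0_mxr; apply: b_high.
have := b_wt0 (lexx 0) h0; rewrite mulmxBr mulmx1 => /eqP; rewrite subr_eq0 => /eqP ->.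
rewrite (int_eq_irr a (add0r 1)) !mulmxA; move: (gen i *m _ *m _ *m _) => y.
exists ((y *m (const_mx 1 : 'M_(_, 1))) 0 0); have [_ K] := dim1_const k (b_top_dim (B j)).
by rewrite -mul_scalar_mx -mx11_scalar mulmxA -(mulmxA y) K mulmx1.
Qed.

Lemma cover0_discrete : discrete cover0.
Proof.
split=> [i j m f ne|i f|i E].
- apply: sv_inj; apply: sv_inj; have [m0|m0] := pselect (m = 0); last exact: cover_hom0.
  subst m; have [c cE] := cover_weight0 (congr1 (fun g => sv g) (svP f)); apply: cover_homP.
  have := congr1 (fun x => x *m fm_act (P j) (e i)) cE.
  rewrite -mulmxA -comp0_hom mulmxA proj_gen_e eqxx scale1r -scalemxAl proj_gen_e.
  case: eqP => [ij|_]; first by case: ne.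
  by rewrite scale0r scaler0 => ->; rewrite -[comp0 0]/(0 : 'M_(_, _)) mulmx0.
- have [c cE] := cover_weight0 (congr1 (fun g => sv g) (svP f)).
  exists c; apply: sv_inj; apply: sv_inj; apply: cover_homP; rewrite [LHS]cE.
  rewrite -[comp0 _]/(c *: cxh (dg_id (R i : Db) : cx_hom (R i) (R i) 0) (addr0 0)) -scalemxAr.
  by rewrite [cxh _ _](@cxh_id0 k L (R i) 0 (addr0 0)) mulmx1.
- have := congr1 (fun g => comp0 (sv (sv g))) E.
  rewrite [LHS](@cxh_id0 k L (R i) 0 (addr0 0)) => id0; apply/(negP (gen_neq0 i))/eqP.
  by rewrite -[gen i]mulmx1 [1%:M]id0 -[comp0 _]/(0 : 'M_(_, _)) mulmx0.
Qed.

Lemma cover_perfect i : perfect (R i : Db).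
Proof. by apply: perfect_of_bounded; apply: stalk_bounded. Qed.
Definition cover_functor : dgfunctor cover_dgcat (full_dgcat (@perfect k L)) :=
  @DGFunctor k cover_dgcat (full_dgcat (@perfect k L)) (fun i => exist _ (R i : Db) (cover_perfect i))
   (fun i j m f => sv f) (fun i j m a u v => erefl) (fun i j m m' e f => erefl) (fun i => erefl)
   (fun i j l a b c e g f => erefl).

Program Definition cover_retraction (j : 'I_n) : hom_retraction cover_functor j :=
  @HomRetraction k _ _ cover_functor j (fun i m b => @mks _ _ (total i j m) b I) (fun i m m' em b => 0) _ _ _ _ _ _ _.
Next Obligation. by move=> j i m c u v; apply: sv_inj. Qed.
Next Obligation. by move=> j i m m' em c u v; rewrite scaler0 addr0. Qed.
Next Obligation. by move=> j i m m' em b; apply: sv_inj. Qed.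
Next Obligation. by move=> j i i' m l s es b a; apply: sv_inj. Qed.
Next Obligation. by move=> *; rewrite dg_comp0l. Qed.
Next Obligation. by move=> j; apply: sv_inj. Qed.
Next Obligation. by move=> j i h m m' eh em b; rewrite subrr (lin0 (dg_d_linear _)) addr0. Qed.

(** A perfect complex is a homotopy retract of a bounded one, which is built from its terms; each
    term splits off a sum of covers by [proj_dual_basis]. *)
Lemma cover_generate : thick_generated cover_functor.
Proof.
move=> Q thQ QF [Y pY].
have thQ' := thick_full_extend (@thick_perfect k L) thQ.
suff [pY' QY] : exists PX, Q (exist _ Y PX) by rewrite (Prop_irrelevance pY pY').
have [X bX [f [g [gf fg]]]] := pY; have [_ _ _ Q4] := thQ'.
apply: (Q4 Y X f g gf); apply: (bounded_generation thQ' _ bX) => {X f g gf fg bX} X b cX.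
have [f [g [Hf Hg fg]]] := proj_dual_basis B (@pc_projective _ _ X b).
apply: (thick_concentrated (pP := fun u => proj_cover_projective B u.1) thQ' _ cX Hf Hg fg) => u.
by exists (cover_perfect u.1); apply: QF.
Qed.

Definition cover0_ob (i : 'I_n) : cover0 := i.
Definition cover0_ix (X : cover0) : 'I_n := X.
Definition cover0_to_perfect : dgfunctor cover0 (full_dgcat (@perfect k L)) := dgf_compf cover_functor cover0_functor.
Lemma cover0_to_perfect_iso (T : triangulated) (E : functor (DGcat k) (tr_cat T)) : A1_homotopy_invariant E ->
  @is_iso (tr_cat T) _ _ (Em E cover0_to_perfect).
Proof.
move=> E_A1.
have i1 : @is_iso (tr_cat T) _ _ (Em E cover_functor).
  exact: (Em_morita E_A1 (@derived_morita_criterion k _ _ cover_functor cover_retraction cover_generate)).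
by rewrite /cover0_to_perfect Em_comp; exact: (is_iso_comp i1 (cover0_iso E_A1)).
Qed.
End PerfectSide.

(** * Families of objects indexed by a discrete category *)

Section PointedBase.
Variable k : fieldType.

Lemma base_discrete : discrete (base_dgcat k).
Proof.
split=> [[] [] i f ne|[] f|[] /(congr1 (fun h => sv h)) /eqP]; last by rewrite oner_eq0.
- by apply: sv_inj; case: (svP f) => // i0; case: ne.
- by exists (sv f : k); apply: sv_inj; rewrite /= /GRing.scale /= mulr1.
Qed.

(* The object [true] has endomorphism algebra k, the object [false] is zero. *)
Program Definition pointed_subspace (a b : bool) (i : int) : subspace (k^o) :=
  @Subspace k (k^o) (fun x => (a && b /\ i = 0) \/ x = 0) _ _.
Next Obligation. by right. Qed.
Next Obligation.
by move=> a b i x u v [H|->]; [left|case=> [H|->]; [left|right; rewrite scaler0 addr0]].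
Qed.
Lemma pointed_id a : pointed_subspace a a 0 (a%:R : k).
Proof. by case: a; [left|right]. Qed.
Lemma pointed_mul a b c i j l : i + j = l -> forall x y,
  pointed_subspace b c i x -> pointed_subspace a b j y -> pointed_subspace a c l (x * y).
Proof.
move=> <- x y [[/andP[-> ->] ->]|->]; last by right; rewrite mul0r.
by case=> [[/andP[-> _] ->]|->]; [left|right; rewrite mulr0].
Qed.

Program Definition pointed_dgcat : dgcat k :=
  @DGCat k bool (fun a b i => subspace_type (pointed_subspace a b i)) (fun _ _ _ _ _ _ => 0)
    (fun a => mks (pointed_id a)) (fun a b c i j l e g f => mks (pointed_mul e (svP g) (svP f))) _ _ _ _ _ _ _ _.
Next Obligation. by move=> X Y i j e a u v; rewrite scaler0 addr0. Qed.
Next Obligation.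
move=> X Y Z i j l e f a u v; apply: sv_inj; rewrite -[LHS]/((a *: sv u + sv v) * sv f).
by rewrite mulrDl -scalerAl.
Qed.
Next Obligation.
move=> X Y Z i j l e f a u v; apply: sv_inj; rewrite -[LHS]/(sv f * (a *: sv u + sv v)).
by rewrite mulrDr -scalerAr.
Qed.
Next Obligation. by []. Qed.
Next Obligation. by move=> *; apply: sv_inj; rewrite addrC sv_linear /= mulr0 mul0r scaler0 addr0. Qed.
Next Obligation. by move=> *; apply: sv_inj; rewrite /= mulrA. Qed.
Next Obligation.
move=> a [] i e f; apply: sv_inj; first exact: mul1r.
by case: (svP f) => [[/andP[_ //]]|f0]; rewrite /= f0 mulr0.
Qed.
Next Obligation.
move=> [] b i e f; apply: sv_inj; first exact: mulr1.
by case: (svP f) => [[/andP[//]]|f0]; rewrite /= f0 mul0r.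
Qed.

Program Definition pointed_kscalar : kscalar pointed_dgcat :=
  @KScalar k pointed_dgcat (fun a b i f => sv f) _ _ _ _.
Next Obligation. by []. Qed.
Next Obligation. by []. Qed.
Next Obligation. by []. Qed.
Next Obligation.
move=> a b i f nz; case: (svP f) => [[/andP[a1 b1] i0]|f0]; first by split=> //; rewrite a1 b1.
by move: nz; rewrite f0 eqxx.
Qed.

Section FunctorFromPointed.
Variables (A : dgcat k) (O Z : A) (O0 : dg_is_zero O).
Lemma pointed_functor_id (b : pointed_dgcat) :
  ks_coef pointed_kscalar (dg_id b) *: dg_id (if b then Z else O) = dg_id (if b then Z else O).
Proof. by case: b => /=; rewrite ?scale1r // O0 scaler0. Qed.
Definition pointed_functor : dgfunctor pointed_dgcat A :=
  scalar_functor (X := fun b : pointed_dgcat => if b then Z else O) pointed_functor_id.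
End FunctorFromPointed.

Definition point (A : dgcat k) (Z : A) : dgfunctor (base_dgcat k) A :=
  discrete_functor base_discrete (fun _ => Z).

Lemma point_comp (A B : dgcat k) (F : dgfunctor A B) Z : dgf_iso (dgf_compf F (point Z)) (point (F Z)).
Proof. exact: discrete_functor_comp. Qed.

Section FullyFaithful.
Variables (A B : dgcat k) (F : dgfunctor A B).
Variable inv : forall X Y i, dg_hom (F X) (F Y) i -> dg_hom X Y i.
Hypothesis invK : forall X Y i (f : dg_hom (F X) (F Y) i), dgf_hom F (inv f) = f.
Hypothesis F_inj : forall X Y i (f g : dg_hom X Y i), dgf_hom F f = dgf_hom F g -> f = g.
Program Definition fully_faithful_retraction (Y : A) : hom_retraction F Y :=
  @HomRetraction k A B F Y (fun X i b => inv b) (fun _ _ _ _ _ => 0) _ _ _ _ _ _ _.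
Next Obligation. by move=> Y X i a u v; apply: F_inj; rewrite dgf_linear !invK. Qed.
Next Obligation. by move=> Y X i j e a u v; rewrite scaler0 addr0. Qed.
Next Obligation. by move=> Y X i j e b; apply: F_inj; rewrite dgf_d !invK. Qed.
Next Obligation. by move=> Y X X' i j l e b a; apply: F_inj; rewrite dgf_comp !invK. Qed.
Next Obligation. by move=> *; rewrite dg_comp0l. Qed.
Next Obligation. by move=> Y; apply: F_inj; rewrite dgf_id !invK. Qed.
Next Obligation. by move=> Y X h i j eh e b; rewrite invK subrr (lin0 (dg_d_linear _)) addr0. Qed.
End FullyFaithful.

Definition pointed_point : dgfunctor (base_dgcat k) pointed_dgcat := point (true : pointed_dgcat).

Lemma pointed_pointE X Y i (f : @dg_hom k (base_dgcat k) X Y i) : sv (dgf_hom pointed_point f) = sv f.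
Proof.
have [D0 D1 _] := base_discrete; have [i0|ne] := pselect (i = 0); last first.
  by rewrite (D0 _ _ _ f) ?dgf0 //; case.
subst i; case: X f => f; case: Y f => f; have [c ->] := D1 _ f.
rewrite (linZ (@dgf_linear _ _ _ pointed_point _ _ _)) dgf_id.
by rewrite -[sv (c *: _)]/(c *: (1 : k^o)).
Qed.

(** Adding a zero object changes nothing up to derived Morita equivalence. It is added because a
    functor that picks one object of a discrete category must send the others somewhere. *)
Lemma pointed_point_morita : derived_morita (pointed_point : @chom (DGcat k) _ _).
Proof.
have sub (X Y : base_dgcat k) i (f : @dg_hom k pointed_dgcat true true i) : unit_subspace k i (sv f).
  by case: (svP f) => [[_ i0]|f0]; [left|right].
apply: derived_morita_criterion => [Y|Q [Q1 _ _ _] QF [|]].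
- apply: (@fully_faithful_retraction _ _ pointed_point (fun X Y i f => mks (sub X Y i f))).
    by move=> X Z i f; apply: sv_inj; rewrite pointed_pointE.
  by move=> X Z i f g /(congr1 (fun h => sv h)); rewrite !pointed_pointE => /sv_inj.
- exact: (QF tt).
- by apply: Q1; apply: sv_inj.
Qed.
End PointedBase.

Section Families.
Variables (k : fieldType) (T : triangulated) (E : functor (DGcat k) (tr_cat T)).
Hypothesis E_A1 : A1_homotopy_invariant E.
Local Notation "g \ot f" := (tr_comp g f) (at level 40, left associativity).
Variables (n : nat) (D : dgcat k) (DD : discrete D) (ix : D -> 'I_n).
Local Notation base := (base_dgcat k).

Let kap_iso := Em_morita E_A1 (pointed_point_morita k).
(** The i-th coordinate E(D) -> E(k): the indicator of i into the pointed category, followed by the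
    inverse of E(k) -> E(pointed category). *)
Definition family_coord (i : 'I_n) : tr_hom (E D : T) (E base : T) :=
  (sval (boolp.cid kap_iso) : tr_hom (E (pointed_dgcat k) : T) (E base : T)) \ot
  Em E (discrete_functor DD (fun j => (ix j == i) : pointed_dgcat k)).

Variables (A : dgcat k) (prA : strongly_pretriangulated A) (O : A) (O0 : dg_is_zero O).

Lemma Em_indicator i (Z : A) :
  Em E (discrete_functor DD (fun j => if ix j == i then Z else O)) = Em E (point Z) \ot family_coord i.
Proof.
have <- : Em E (dgf_compf (pointed_functor Z O0) (pointed_point k)) = Em E (point Z).
  exact: Em_iso (point_comp (pointed_functor Z O0) (true : pointed_dgcat k)).
rewrite Em_comp tr_compA /family_coord -(tr_compA (Em E (pointed_point k))).
have [_ K] := svalP (boolp.cid kap_iso); rewrite [Em E (pointed_point k) \ot _]K tr_comp1l -Em_comp.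
by symmetry; apply: Em_iso; apply: discrete_functor_comp.
Qed.

Lemma discrete_biproduct (X F F' : D -> A) : (forall j, biproduct (F j) (F' j) (X j)) ->
  functor_biproduct (discrete_functor DD X) (discrete_functor DD F) (discrete_functor DD F').
Proof.
move=> b; exists b => X' Y' i f; rewrite /= -[discrete_coef DD f]/(ks_coef (discrete_kscalar DD) f).
- have [->|/ks_supp[? ?]] := eqVneq (ks_coef (discrete_kscalar DD) f) 0.
    by rewrite !scalar_mor0 dg_comp0l dg_comp0r.
  subst Y' i; rewrite !scalar_mor_id (linZ (dg_comp_linear_l _ _)) (linZ (dg_comp_linear_r _ _)).
  by rewrite dg_comp1l dg_comp1r.
- have [->|/ks_supp[? ?]] := eqVneq (ks_coef (discrete_kscalar DD) f) 0.
    by rewrite !scalar_mor0 dg_comp0l dg_comp0r.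
  subst Y' i; rewrite !scalar_mor_id (linZ (dg_comp_linear_l _ _)) (linZ (dg_comp_linear_r _ _)).
  by rewrite dg_comp1l dg_comp1r.
Qed.

Let closed0 X Y : dg_closed (0 : @dg_hom k A X Y 0).
Proof. by move=> j e; rewrite (lin0 (dg_d_linear _)). Qed.
Definition biproduct_zero_r (X : A) : biproduct X O X.
Proof.
exists (dg_id X) 0 (dg_id X) 0; try exact: dg_id_closed; try exact: closed0;
  by rewrite ?dg_comp1l ?dg_comp0r ?dg_comp0l ?O0 ?addr0.
Defined.
Definition biproduct_zero_l (X : A) : biproduct O X X.
Proof.
exists 0 (dg_id X) 0 (dg_id X); try exact: dg_id_closed; try exact: closed0;
  by rewrite ?dg_comp1l ?dg_comp0r ?dg_comp0l ?O0 ?add0r.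
Defined.

(** X is the sum of its restrictions to single indices, extended by zero. They are added one at a
    time, E being additive on direct sums of functors. *)
Theorem Em_family (X : D -> A) (Y : 'I_n -> A) : (forall j, X j = Y (ix j)) ->
  Em E (discrete_functor DD X) = \sum_i Em E (point (Y i)) \ot family_coord i.
Proof.
move=> XY; pose Xm m (j : D) := if (ix j < m)%N then X j else O.
have H m : (m <= n)%N -> Em E (discrete_functor DD (Xm m)) =
    \sum_(i < n | (i < m)%N) Em E (point (Y i)) \ot family_coord i.
  elim: m => [|m IH] le_m.
    by rewrite big_pred0 //; apply: (Em_contractible E_A1 O0) => j; exact: zero_contractible O0.
  pose i := Ordinal le_m; rewrite (bigD1 i) //= addrC -Em_indicator.
  rewrite (eq_bigl (fun s : 'I_n => (s < m)%N)) => [|s]; last first.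
    by rewrite ltnS -val_eqE /=; lia.
  rewrite -IH 1?ltnW //; apply: (Em_biproduct E_A1 prA O0); apply: discrete_biproduct => j.
  rewrite /Xm ltnS; have [Ej|ne] := eqVneq (ix j) i.
    have -> : (ix j < m)%N = false by rewrite Ej /= ltnn.
    have -> : (ix j <= m)%N by rewrite Ej.
    by rewrite -Ej -XY; exact: biproduct_zero_l.
  have -> : (ix j <= m)%N = (ix j < m)%N.
    by move: ne; rewrite -val_eqE /=; lia.
  exact: biproduct_zero_r.
have -> : X = Xm n by apply: funext => j; rewrite /Xm ltn_ord.
by rewrite H //; apply: eq_bigl => i; rewrite ltn_ord.
Qed.
End Families.

(** * Classes of complexes of vector spaces *)

Section Splitting.
Variables (k : fieldType) (L : falgType k).
Local Notation Db := (Db_dgcat L).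
Implicit Types X Y Z : proj_complex L.

Lemma concentrated_hom0 X Y m (f : @dg_hom k Db X Y m) :
  concentrated 0 X -> concentrated 0 Y -> m <> 0 -> f = 0.
Proof.
move=> cX cY m0; apply: cxhP => p q a; have [p0|p0] := eqVneq p 0; last by apply: dim0_mx; apply: cX.
by apply: dim0_mxr; apply: cY; apply/eqP => q0; apply: m0; move: a p0 q0; clear; lia.
Qed.

Lemma split_biproduct (A : dgcat k) (X Y Z : A) (i : dg_hom X Z 0) (j : dg_hom Y Z 0) (p : dg_hom Z X 0) (q : dg_hom Z Y 0) :
  dg_closed i -> dg_closed j -> dg_closed p -> dg_closed q ->
  dg_comp (addr0 0) p i = dg_id X -> dg_comp (addr0 0) q j = dg_id Y ->
  dg_comp (addr0 0) i p + dg_comp (addr0 0) j q = dg_id Z -> biproduct X Y Z.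
Proof.
move=> ci cj cp cq pi qj E; exists i j p q => //.
  have : dg_comp (addr0 0) (dg_comp (addr0 0) i p + dg_comp (addr0 0) j q) j = j by rewrite E dg_comp1l.
  rewrite (linD (dg_comp_linear_l _ _)) (dg_compA _ _ (addr0 0) (addr0 0)) (dg_compA _ _ (addr0 0) (addr0 0)).
  rewrite qj dg_comp1r -[RHS]add0r => /addIr /(congr1 (dg_comp (addr0 0) p)).
  by rewrite -(dg_compA (addr0 0) (addr0 0)) pi dg_comp1l dg_comp0r.
have : dg_comp (addr0 0) (dg_comp (addr0 0) i p + dg_comp (addr0 0) j q) i = i by rewrite E dg_comp1l.
rewrite (linD (dg_comp_linear_l _ _)) (dg_compA _ _ (addr0 0) (addr0 0)) (dg_compA _ _ (addr0 0) (addr0 0)).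
rewrite pi dg_comp1r -[RHS]addr0 => /addrI /(congr1 (dg_comp (addr0 0) q)).
by rewrite -(dg_compA (addr0 0) (addr0 0)) qj dg_comp1l dg_comp0r.
Qed.

Section Idempotent.
Variables (Z : proj_complex L) (e : @dg_hom k Db Z Z 0) (ce : dg_closed e) (ee : dg_comp (addr0 0) e e = e).

Lemma id_sub_closed : dg_closed (dg_id (Z : Db) - e).
Proof. by move=> j E; rewrite (linB (dg_d_linear _)) ce dg_id_closed subrr. Qed.
Lemma id_sub_idem : dg_comp (addr0 0) (dg_id (Z : Db) - e) (dg_id (Z : Db) - e) = dg_id (Z : Db) - e.
Proof.
by rewrite (linB (dg_comp_linear_l _ _)) dg_comp1l (linB (dg_comp_linear_r _ _)) dg_comp1r ee subrr subr0.
Qed.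

Definition im_biproduct : @biproduct k Db (im_complex ce ee) (im_complex id_sub_closed id_sub_idem) Z.
Proof.
have [a1 a2 a3 a4] := im_complexP ce ee; have [b1 b2 b3 b4] := im_complexP id_sub_closed id_sub_idem.
by apply: (split_biproduct a1 b1 a2 b2 a3 b3); rewrite a4 b4 addrC subrK.
Defined.

Lemma im_complex_dim p : fm_dim (im_complex ce ee p) = \rank (cxh (e : cx_hom Z Z 0) (addr0 p)).
Proof. by []. Qed.

Lemma im_complex_exact q :
  (forall p r (a : p + 1 = q) (b : q + 1 = r) (v : 'rV_(fm_dim (Z q))), v *m cxh (e : cx_hom Z Z 0) (addr0 q) = v ->
    v *m pc_d Z b = 0 -> exists w, v = w *m pc_d Z a) -> exact_at (im_complex ce ee) q.
Proof.
have [ci co oi io] := im_complexP ce ee; move=> H p r a b v v0.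
pose R s := cxh (im_complex_in ce ee : cx_hom _ _ 0) (addr0 s).
pose S s := cxh (im_complex_out ce ee : cx_hom _ _ 0) (addr0 s).
have RS s : R s *m S s = 1%:M.
  have := congr1 (fun u : @dg_hom k Db (im_complex ce ee) (im_complex ce ee) 0 => cxh (u : cx_hom _ _ 0) (addr0 s)) oi.
  by rewrite /= cxh_comp0 cxh_id0.
have SR s : S s *m R s = cxh (e : cx_hom Z Z 0) (addr0 s).
  have := congr1 (fun u : @dg_hom k Db Z Z 0 => cxh (u : cx_hom _ _ 0) (addr0 s)) io.
  by rewrite /= cxh_comp0.
have Rd s u (c : s + 1 = u) : R s *m pc_d Z c = pc_d (im_complex ce ee) c *m R u := cx_closed0 ci _ _ _ _.
have Sd s u (c : s + 1 = u) : S s *m pc_d (im_complex ce ee) c = pc_d Z c *m S u := cx_closed0 co _ _ _ _.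
have [||w wE] := H p r a b (v *m R q).
- by rewrite -SR -mulmxA (mulmxA (R q)) RS mul1mx.
- by rewrite -mulmxA Rd mulmxA v0 mul0mx.
by exists (w *m S p); rewrite -mulmxA Sd mulmxA -wE -mulmxA RS mulmx1.
Qed.
End Idempotent.
End Splitting.

Section PointClasses.
Variables (k : fieldType) (T : triangulated) (E : functor (DGcat k) (tr_cat T)).
Hypothesis E_A1 : A1_homotopy_invariant E.
Local Notation "g \ot f" := (tr_comp g f) (at level 40, left associativity).
Local Notation kk := (k^o : falgType k).
Local Notation Dk := (Db_dgcat kk).
Local Notation pt Z := (Em E (point (Z : Dk))).

Lemma point_biproduct (X Y Z : Dk) : biproduct X Y Z -> pt Z = pt X + pt Y.
Proof.
move=> b; apply: (Em_biproduct E_A1 (@Db_strongly_pretriangulated k kk) (@zero_complex_zero k kk)).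
exact: (discrete_biproduct (base_discrete k) (fun _ => b)).
Qed.
Lemma point_contractible (Z : Dk) : contractible Z -> pt Z = 0.
Proof. by move=> cZ; apply: (Em_contractible E_A1 (@zero_complex_zero k kk)) => X; exact: cZ. Qed.

Definition line : proj_complex kk := stalk (@k_projective k (kspace k 1)).
Lemma stalk_concentrated (L : falgType k) (M : fmod L right_side) (pM : fm_projective M) : concentrated 0 (stalk pM).
Proof. by move=> p p0; apply: mask_dim0; left. Qed.

(** A d-dimensional space is a sum of d lines, and E is additive on direct sums. *)
Lemma point_concentrated (d : nat) (Z : proj_complex kk) : concentrated 0 Z -> fm_dim (Z 0) = d -> pt Z = pt line *+ d.
Proof.
elim: d Z => [|d IH] Z cZ Zd.
  rewrite mulr0n; apply: point_contractible; apply: exact_contractible => q p r a b v _.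
  exists 0; apply: dim0_mxr; have [->//|] := eqVneq q 0; exact: cZ.
pose Z' := stalk (@k_projective k (kspace k d)).
have cZ' : concentrated 0 Z' := stalk_concentrated _; have cK : concentrated 0 line := stalk_concentrated _.
have [i1 [i2 [p1 [p2 [E1 E2 E3]]]]] : exists (i1 : 'M[k]_(fm_dim (line 0), fm_dim (Z 0))) (i2 : 'M[k]_(fm_dim (Z' 0), fm_dim (Z 0)))
    (p1 : 'M[k]_(fm_dim (Z 0), fm_dim (line 0))) (p2 : 'M[k]_(fm_dim (Z 0), fm_dim (Z' 0))),
    [/\ i1 *m p1 = 1%:M, i2 *m p2 = 1%:M & p1 *m i1 + p2 *m i2 = 1%:M].
  rewrite Zd -[fm_dim (line 0)]/1%N -[fm_dim (Z' 0)]/d -[d.+1]/(1 + d)%N.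
  exists (row_mx 1%:M 0), (row_mx 0 1%:M), (col_mx 1%:M 0), (col_mx 0 1%:M).
  rewrite !mul_row_col !mul_col_row ?(mulmx1, mulmx0, mul0mx) ?(addr0, add0r) add_block_mx ?(addr0, add0r).
  by rewrite -scalar_mx_block.
have hom (X Y : proj_complex kk) (g : 'M_(fm_dim (X 0), fm_dim (Y 0))) : is_fhom (M := X 0) (N := Y 0) g by apply: k_fhom.
rewrite mulrS -(IH Z' cZ' erefl); apply: point_biproduct.
apply: (@split_biproduct k Dk line Z' Z (at_hom (hom _ _ i1)) (at_hom (hom _ _ i2)) (at_hom (hom _ _ p1)) (at_hom (hom _ _ p2)));
  try exact: at_hom_closed.
- by apply: (at_homP cK); rewrite cxh_comp0 !diag_cxE !at_mxE cxh_id0.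
- by apply: (at_homP cZ'); rewrite cxh_comp0 !diag_cxE !at_mxE cxh_id0.
- by apply: (at_homP cZ); rewrite cxhD !cxh_comp0 !diag_cxE !at_mxE cxh_id0.
Qed.

(** Over a field the complex splits into its cohomology, which sits in degree 0, and a contractible
    complement. *)
Theorem point_cohomology (Z : proj_complex kk) : (forall q, 0 < q -> fm_dim (Z q) = 0%N) ->
  (forall q, q < 0 -> exact_at Z q) ->
  pt Z = pt line *+ (fm_dim (Z 0) - \rank (pc_d Z (addNr 1))).
Proof.
(* N is an idempotent with the row space of C, so [pi0] projects onto a complement of the boundaries
   in degree 0. *)
move=> Z_hi Z_ex; pose C := pc_d Z (addNr 1); pose N := pinvmx C *m C; pose pi0 := 1%:M - N.
have CN : C *m N = C by rewrite /N mulmxA mulmxKpV.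
have NN : N *m N = N by rewrite {1}/N -mulmxA CN.
have pi0_hom : is_fhom (M := Z 0) (N := Z 0) pi0 by apply: k_fhom.
pose e : @dg_hom k Dk Z Z 0 := at_hom pi0_hom.
have eE p : cxh (e : cx_hom Z Z 0) (addr0 p) = at_mx pi0 p by rewrite /e /at_hom diag_cxE.
have ce : dg_closed e.
  apply: diag_cx_closed => p q a; have [p0|p0] := eqVneq p 0.
    by apply: dim0_mxr; apply: Z_hi; clear -a p0; lia.
  have -> : at_mx pi0 p = 0 by rewrite /at_mx; case: eqP => // E0; case/eqP: p0.
  rewrite mul0mx; have [q0|q0] := eqVneq q 0; last first.
    by rewrite (_ : at_mx pi0 q = 0) ?mulmx0 // /at_mx; case: eqP => // E0; case/eqP: q0.
  have p1 : p = -1 by clear -a q0; lia.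
  move: a; rewrite p1 q0 => a; rewrite at_mxE (int_eq_irr a (addNr 1)) -/C mulmxBr mulmx1 CN subrr //.
have ee : dg_comp (addr0 0) e e = e.
  apply: cx_deg0P => p; rewrite cxh_comp0 eE; have [->|p0] := eqVneq p 0.
    by rewrite at_mxE /pi0 mulmxBr mulmx1 mulmxBl mul1mx NN subrr subr0.
  have -> : at_mx pi0 p = 0 by rewrite /at_mx; case: eqP => // E0; case/eqP: p0.
  by rewrite mulmx0.
rewrite (point_biproduct (im_biproduct ce ee)) [X in _ + X]point_contractible ?addr0; last first.
  apply: exact_contractible => q; apply: im_complex_exact => p r a b v ve vd.
  have [lt_q|le_q] := ltP q 0; first exact: (Z_ex q lt_q p r a b v vd).
  have [lt_q|ge_q] := ltP 0 q; first by exists 0; apply: dim0_mxr; apply: Z_hi.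
  have q0 : q = 0 by apply/eqP; rewrite eq_le ge_q le_q.
  have p1 : p = -1 by clear -a q0; lia.
  move: a v ve {b vd}; rewrite q0 p1 => a v; rewrite cxhB cxh_id0 eE at_mxE /pi0 opprB addrC subrK => <-.
  by exists (v *m pinvmx C); rewrite /N mulmxA (int_eq_irr a (addNr 1)).
rewrite (@point_concentrated (fm_dim (Z 0) - \rank C)) //.
  move=> p p0; rewrite im_complex_dim eE /at_mx; case: eqP => [E0|_]; first by case/eqP: p0.
  exact: mxrank0.
rewrite im_complex_dim eE at_mxE.
have -> : \rank C = \rank N.
  by apply/eqP; rewrite eqn_leq mxrankM_maxr -{1}CN mxrankM_maxr.
rewrite -mxrank_ker; apply: eqmx_rank; apply/andP; split.
  by apply/sub_kermxP; rewrite mulmxBl mul1mx NN subrr.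
by rewrite -[kermx N]mulmx1 -[1%:M](subrK N) mulmxDr mulmx_ker addr0 submxMl.
Qed.

Lemma line_generate : thick_generated (point (line : Dk)).
Proof.
move=> Q thQ QF; have Qline : Q line := QF tt; apply: generation => // Y p a pa v exY v0 nv.
pose X := shift_complex line (- a).
have Xd q r (c : q + 1 = r) : pc_d X c = 0 by rewrite -[LHS]/(_ *: 0) scaler0.
have Xa : fm_dim (X a) = 1%N by rewrite -[fm_dim (X a)]/(fm_dim (mask_mod (a - a == 0) (kspace k 1))) subrr.
pose f0 : 'M[k]_(fm_dim (X a), fm_dim (Y a)) := const_mx 1 *m v.
have [||||q c|f cf fE] := @complex_lift k kk X Y a f0.
- exact: k_fhom.
- by move=> q lt_q; apply: stalk_concentrated; rewrite subr_eq0 gt_eqF.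
- exact: exY.
- by move=> r c; rewrite -mulmxA v0 mulmx0.
- by rewrite Xd mul0mx sub0mx.
have [K1 K2] := dim1_const k Xa.
exists X, f, (const_mx 1); split=> //.
- exact: thick_shift.
- split=> q lt_q; first by apply: stalk_concentrated; rewrite subr_eq0 gt_eqF.
  by move=> p' r c d u _; exists 0; apply: dim0_mxr; apply: stalk_concentrated; rewrite subr_eq0 lt_eqF.
- by rewrite fE mulmxA K1 mul1mx.
move=> x'; rewrite fE /f0 mulmxA => sub; have -> : x' = 0; last exact: sub0mx.
suff E0 : x' *m (const_mx 1 : 'M_(_, 1)) = 0 by rewrite -[x']mulmx1 -K2 mulmxA E0 mul0mx.
move: (x' *m _) sub => y; rewrite [y]mx11_scalar mul_scalar_mx => sub.
have [->|y0] := eqVneq (y 0 0) 0; first by rewrite raddf0.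
by case/negP: nv; rewrite -[v]scale1r -(mulVf y0) -scalerA scalemx_sub.
Qed.

Lemma line_scalar (f : @dg_hom k Dk line line 0) : exists c, f = c *: dg_id (line : Dk).
Proof.
exists ((cxh (f : cx_hom line line 0) (addr0 0) : 'M[k]_1) 0 0).
apply: (at_homP (@stalk_concentrated kk (kspace k 1) (@k_projective k (kspace k 1)))).
by rewrite cxhZ cxh_id0 [LHS](mx11_scalar (_ : 'M[k]_1)) scalemx1.
Qed.

Lemma line_iso : @is_iso (tr_cat T) _ _ (pt line).
Proof.
have cK : concentrated 0 line := stalk_concentrated _.
have [D0 D1 _] := base_discrete k.
have surj X Y i (f : @dg_hom k Dk (point (line : Dk) X) (point (line : Dk) Y) i) :
    exists g : @dg_hom k (base_dgcat k) X Y i, dgf_hom (point (line : Dk)) g = f.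
  have [i0|ne] := pselect (i = 0); last by exists 0; rewrite (@concentrated_hom0 _ _ _ _ _ f) // dgf0.
  subst i; case: X f => f; case: Y f => f; have [c ->] := line_scalar f; exists (c *: dg_id _).
  by rewrite (linZ (@dgf_linear _ _ _ (point (line : Dk)) _ _ _)) dgf_id.
apply: (Em_morita E_A1); apply: derived_morita_criterion line_generate => Y.
apply: (@fully_faithful_retraction _ _ _ _ (fun X Y i f => sval (boolp.cid (surj X Y i f)))).
  by move=> X Z i f; exact: svalP (boolp.cid (surj X Z i f)).
move=> X Z i f g fg; apply/eqP; rewrite -subr_eq0; apply/eqP.
have {fg} : dgf_hom (point (line : Dk)) (f - g) = 0 by rewrite (linB (@dgf_linear _ _ _ _ _ _ _)) fg subrr.
move: (f - g) => {f g} f; have [i0|ne] := pselect (i = 0); last by move=> _; apply: D0; case.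
subst i; case: X f => f; case: Z f => f; have [c ->] := D1 _ f.
rewrite (linZ (@dgf_linear _ _ _ (point (line : Dk)) _ _ _)) dgf_id => /eqP; rewrite scaler_eq0 => /orP[/eqP ->|/eqP].
  by rewrite scale0r.
move/(congr1 (fun u : @dg_hom k Dk line line 0 => cxh (u : cx_hom line line 0) (addr0 0))).
by rewrite cxh_id0 cxh0 => /matrixP/(_ 0 0); rewrite !mxE eqxx => /eqP; rewrite oner_eq0.
Qed.
End PointClasses.

(** * Isotypic parts of complexes *)

Section IdempotentPart.
Variables (k : fieldType) (L : falgType k) (ea : L).
Hypothesis ea_idem : ea * ea = ea.
Local Notation kk := (k^o : falgType k).
Implicit Types M N P : fmod L right_side.

Let act_idem M : fm_act M ea *m fm_act M ea = fm_act M ea.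
Proof. by rewrite -(fm_actM M) ea_idem. Qed.
Definition part_in M := (s2val (idem_factor (act_idem M))).1.
Definition part_out M := (s2val (idem_factor (act_idem M))).2.
Lemma part_inK M : part_in M *m part_out M = 1%:M. Proof. exact: (s2valP (idem_factor (act_idem M))). Qed.
Lemma part_outK M : part_out M *m part_in M = fm_act M ea. Proof. exact: (s2valP' (idem_factor (act_idem M))). Qed.
Lemma part_in_act M : part_in M *m fm_act M ea = part_in M.
Proof. by rewrite -[X in _ *m X](part_outK M) mulmxA part_inK mul1mx. Qed.
Lemma part_out_act M : fm_act M ea *m part_out M = part_out M.
Proof. by rewrite -[X in X *m _](part_outK M) -mulmxA part_inK mulmx1. Qed.

Definition part_mx M N (f : 'M[k]_(fm_dim M, fm_dim N)) := part_in M *m f *m part_out N.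
Lemma part_in_mx M N f : is_fhom (M := M) (N := N) f -> part_mx f *m part_in N = part_in M *m f.
Proof. by move=> Hf; rewrite /part_mx -mulmxA part_outK -mulmxA -Hf mulmxA part_in_act. Qed.
Lemma part_out_mx M N f : is_fhom (M := M) (N := N) f -> part_out M *m part_mx f = f *m part_out N.
Proof. by move=> Hf; rewrite /part_mx !mulmxA part_outK Hf -mulmxA part_out_act. Qed.
Lemma part_mxM M N P f g : is_fhom (M := M) (N := N) f ->
  part_mx (M := M) (N := N) f *m part_mx (M := N) (N := P) g = part_mx (f *m g).
Proof. by move=> Hf; rewrite /part_mx mulmxA mulmxA [X in X *m _ *m _]part_in_mx // !mulmxA. Qed.
Lemma part_mx_linear M N : linear (@part_mx M N).
Proof. by move=> c f g; rewrite /part_mx mulmxDr mulmxDl -scalemxAr -scalemxAl. Qed.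

Definition part_mod M := kspace k (\rank (fm_act M ea)).

Lemma part_exact_aux M N P (f : 'M[k]_(fm_dim M, fm_dim N)) (g : 'M[k]_(fm_dim N, fm_dim P)) (v : 'rV_(\rank (fm_act N ea))) :
  is_fhom (M := M) (N := N) f -> is_fhom (M := N) (N := P) g ->
  (forall u : 'rV_(fm_dim N), u *m g = 0 -> exists w, u = w *m f) ->
  v *m part_mx g = 0 -> exists w, v = w *m part_mx f.
Proof.
move=> Hf Hg ex v0; have [|w wE] := ex (v *m part_in N).
  by rewrite -mulmxA -part_in_mx // mulmxA v0 mul0mx.
by exists (w *m part_out M); rewrite -mulmxA part_out_mx // mulmxA -wE -mulmxA part_inK mulmx1.
Qed.

Definition part_complex (X : proj_complex L) : proj_complex kk.
Proof.
exists (fun p => part_mod (X p)) (fun p q a => part_mx (pc_d X a)).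
- by move=> *; apply: k_fhom.
- by move=> p q r a b; rewrite part_mxM ?pc_dd; [exact: (lin0 (@part_mx_linear _ _))|exact: pc_d_hom].
- by move=> p; apply: k_projective.
- have [N HN] := pc_bounded_above X; exists N => p /HN X0.
  by apply/eqP; rewrite -leqn0 -X0 rank_leq_row.
- apply: pc_bounded_cohomology_of; have [N HN] := pc_exact_low X.
  exists N => p q r a b v lt_q.
  apply: part_exact_aux; [exact: pc_d_hom|exact: pc_d_hom|exact: (HN q lt_q)].
Defined.

Lemma part_exact X q : exact_at X q -> exact_at (part_complex X) q.
Proof.
by move=> exX p r a b v; apply: part_exact_aux; [exact: pc_d_hom|exact: pc_d_hom|exact: exX].
Qed.

Section OnMorphisms.
Variables (X Y : proj_complex L) (m : int) (f : @dg_hom k (Db_dgcat L) X Y m).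
Definition part_hom : @dg_hom k (Db_dgcat kk) (part_complex X) (part_complex Y) m :=
  @mk_cx k kk (part_complex X) (part_complex Y) m (fun p q a => part_mx (cxh (f : cx_hom X Y m) a))
    (fun p q a => @k_fhom k (part_mod (X p)) (part_mod (Y q)) _).
Lemma part_homE p q (a : p + m = q) : cxh (part_hom : cx_hom (part_complex X) (part_complex Y) m) a = part_mx (cxh (f : cx_hom X Y m) a).
Proof. by []. Qed.
End OnMorphisms.

Program Definition part_functor : dgfunctor (Db_dgcat L) (Db_dgcat kk) :=
  @DGFunctor k (Db_dgcat L) (Db_dgcat kk) part_complex part_hom _ _ _ _.
Next Obligation. by move=> X Y m c u v; apply: cxhP => p q a; exact: part_mx_linear. Qed.
Next Obligation.
move=> X Y m m' em f; apply: cxhP => p q a; rewrite part_homE.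
have a1 : p + m + 1 = q by clear -a em; lia.
have a2 : p + 1 + m = q by clear -a em; lia.
rewrite (cxh_d em f a erefl a1 erefl a2) (cxh_d em (part_hom f) a erefl a1 erefl a2) !part_homE.
rewrite (linB (@part_mx_linear _ _)) (linZ (@part_mx_linear _ _)) !part_mxM //; [exact: pc_d_hom|exact: cxh_hom].
Qed.
Next Obligation.
move=> X; apply: cx_deg0P => p; rewrite part_homE !cxh_id0 /part_mx mulmx1.
exact: part_inK.
Qed.
Next Obligation.
move=> X Y Z m m' m'' em g f; apply: cxhP => p q a; rewrite part_homE.
have b : p + m' + m = q by clear -a em; lia.
rewrite (cxh_comp em g f a erefl b) (cxh_comp em (part_hom g) (part_hom f) a erefl b) !part_homE part_mxM //.
exact: cxh_hom.
Qed.
End IdempotentPart.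

Section IsotypicClasses.
Variables (k : fieldType) (L : falgType k) (G : nonneg_grading L) (n : nat) (t : top_data G n).
Variable B : forall i, bar t i.
Local Notation e := (td_e t).
Variables (T : triangulated) (E : functor (DGcat k) (tr_cat T)).
Hypothesis E_A1 : A1_homotopy_invariant E.
Local Notation "g \ot f" := (tr_comp g f) (at level 40, left associativity).

Lemma e_idem a : e a * e a = e a. Proof. by rewrite td_eM eqxx. Qed.
Definition isotypic a : dgfunctor (Db_dgcat L) (Db_dgcat (k^o : falgType k)) := part_functor (e_idem a).

Lemma isotypic_cover a b : Em E (isotypic a) \ot Em E (point (cover_complex B b : Db_dgcat L)) =
  Em E (point (line k : Db_dgcat (k^o : falgType k))) *+ \rank (fm_act (proj_cover B b) (e a)).
Proof.
rewrite -Em_comp (Em_iso E (point_comp _ _)); apply: (point_concentrated E_A1) => // p p0.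
apply/eqP; rewrite -leqn0 -(mask_dim0 (c := p == 0) (M := proj_cover B b) (or_introl p0)).
exact: rank_leq_row.
Qed.

(** The part at e_a of the resolution of S_j resolves S_j e_a, which has dimension 1 if a = j and 0
    otherwise. *)
Lemma isotypic_res a j : Em E (isotypic a) \ot Em E (point (res B j : Db_dgcat L)) =
  Em E (point (line k : Db_dgcat (k^o : falgType k))) *+ (a == j).
Proof.
rewrite -Em_comp (Em_iso E (point_comp _ _)) (point_cohomology E_A1).
- congr (_ *+ _); set Z := isotypic a _.
  pose R0 := resolution_ob B j 0.
  (* The augmentation restricted to the part at e_a. Its kernel is the image of the last
     differential, so the dimension sought is its rank. *)
  pose D : 'M[k]_(\rank (fm_act R0 (e a)), fm_dim (B j 1)) := part_in (e_idem a) R0 *m (mask_in *m bd (B j) (add0r 1)).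
  have D_hom : is_fhom (M := R0) (N := B j 1) (mask_in *m bd (B j) (add0r 1)).
    by apply: (fhomM (N := B j 0)); [exact: mask_in_hom|exact: bd_hom].
  pose C := part_mx (e_idem a) (res_d B j (addNr 1)).
  have R_hom : is_fhom (M := resolution_ob B j (-1)) (N := R0) (res_d B j (addNr 1)) by exact: (@pc_d_hom _ _ (res B j) _ _ (addNr 1)).
  have le0 : (0 : int) <= 0 by []. have le1 : (-1 : int) <= 0 by [].
  have CD : (C <= kermx D)%MS.
    apply/sub_kermxP; rewrite /D mulmxA part_in_mx // -mulmxA /res_d -!mulmxA (mulmxA mask_out) (mask_outT _ le0).
    by rewrite [1%:M *m bd _ _]mul1mx bdd !mulmx0.
  have DC : (kermx D <= C)%MS.
    apply/rV_subP => u /sub_kermxP u0.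
    have /submxP[w wE] : (u *m part_in (e_idem a) R0 *m mask_in <= bd (B j) (addNr 1))%MS.
      apply: submx_trans (contraction_exact (bed (B j) (addNr 1) (add0r 1))); apply/sub_kermxP.
      by rewrite -!mulmxA.
    suff -> : u = w *m mask_out *m part_out (e_idem a) _ *m C by exact: submxMl.
    rewrite -mulmxA part_out_mx // /res_d -!mulmxA (mulmxA mask_out) (mask_outT _ le1) [1%:M *m _]mul1mx !(mulmxA w) -wE.
    by rewrite -!mulmxA (mulmxA mask_in) mask_inK [1%:M *m _]mul1mx part_inK mulmx1.
  have -> : \rank (pc_d Z (addNr 1)) = \rank (kermx D).
    by apply: eqmx_rank; apply/andP; split.
  rewrite mxrank_ker subKn ?rank_leq_row //.
  have DE : part_out (e_idem a) R0 *m D = mask_in *m bd (B j) (add0r 1) *m (a == j)%:R%:M.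
    by rewrite /D mulmxA part_outK D_hom (b_top_act (B j)) td_chr_e eq_sym.
  have {}DE : D = part_in (e_idem a) R0 *m (mask_in *m bd (B j) (add0r 1) *m (a == j)%:R%:M).
    by rewrite -DE mulmxA part_inK mul1mx.
  have [aj|aj] := eqVneq a j; last by rewrite DE (negbTE aj) raddf0 !mulmx0 mxrank0.
  have r1 : (\rank D <= 1)%N by apply: leq_trans (rank_leq_col D) _; rewrite b_top_dim.
  apply/eqP; rewrite eqn_leq r1 lt0n mxrank_eq0.
  apply/eqP => D0.
  have : part_out (e_idem a) R0 *m D = 0 by rewrite D0 mulmx0.
  rewrite /D mulmxA part_outK D_hom (b_top_act (B j)) td_chr_e aj eqxx mulmx1.
  move/(congr1 (fun x => be (B j) (add0r 1) *m (mask_out *m x))); rewrite !mulmx0 !mulmxA.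
  rewrite -(mulmxA _ mask_out) (mask_outT _ le0) [_ *m 1%:M]mulmx1.
  have := bed (B j) (add0r 1) (erefl (1 + 1)); rewrite [bd _ erefl](_ : _ = 0) ?mul0mx ?addr0; last first.
    by apply: dim0_mxr; apply: b_high.
  by move=> -> /(congr1 mxrank); rewrite mxrank1 mxrank0 b_top_dim.
- move=> q lt_q; apply/eqP; rewrite -leqn0.
  have <- : fm_dim (resolution_ob B j q) = 0%N by apply: mask_dim0; left; rewrite -ltNge.
  exact: rank_leq_row.
- by move=> q lt_q; apply: part_exact; apply: res_exact.
Qed.
End IsotypicClasses.

(** * The Cartan matrix *)

Section Cartan.
Variables (k : fieldType) (L : falgType k) (G : nonneg_grading L) (n : nat) (t : top_data G n).
Variable B : forall i, bar t i.
Local Notation e := (td_e t).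
Local Notation Q := (proj_cover B).
Local Notation gen := (proj_gen B).

Lemma hom_inverse (M N : fmod L right_side) (f : 'M_(fm_dim M, fm_dim N)) g :
  is_fhom f -> f *m g = 1%:M -> g *m f = 1%:M -> is_fhom (M := N) (N := M) g.
Proof.
move=> Hf fg gf a; rewrite -[fm_act N a]mul1mx -gf -!mulmxA (mulmxA f) -Hf.
by rewrite -!mulmxA fg mulmx1.
Qed.

(* f is unipotent with respect to the filtration by weights. *)
Lemma cover_endo_inj i (f : 'M[k]_(fm_dim (Q i))) : is_fhom (M := Q i) (N := Q i) f ->
  f *m bd (B i) (add0r 1) = bd (B i) (add0r 1) -> row_free f.
Proof.
move=> Hf fd; pose W := bw (B i) 0; pose h := f - 1%:M.
have h_hom : is_fhom (M := Q i) (N := Q i) h by apply: (fhomB Hf); exact: fhom1.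
pose V := grading_of false W.
have be0 : be (B i) (add0r 1) *m (1%:M - bd (B i) (add0r 1) *m be (B i) (add0r 1)) = 0.
  rewrite mulmxBr mulmx1 mulmxA; have := bed (B i) (add0r 1) (erefl (1 + 1)); rewrite [bd _ erefl](_ : _ = 0) ?mul0mx ?addr0.
    by move=> ->; rewrite mul1mx subrr.
  by apply: dim0_mxr; apply: b_high.
have wt0E : wt W 0 = wt W 0 *m bd (B i) (add0r 1) *m be (B i) (add0r 1).
  by have := b_wt0 (lexx 0) be0; rewrite mulmxBr mulmx1 mulmxA => /eqP; rewrite subr_eq0 => /eqP.
have h0 s : s <= 0 -> gen i *m h *m wt W s = 0.
  rewrite le_eqVlt => /orP[/eqP ->|lt_s]; last by rewrite wt0 ?mulmx0 //; left.
  rewrite wt0E (bw_d (B i)) (b_top_wt (B i)) mulmx1 mulmxA -(mulmxA (gen i)) /h mulmxBl fd mul1mx subrr.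
  by rewrite mulmx0 mul0mx.
have low r s : s <= r -> wt W r *m h *m wt W s = 0.
  move=> le_s; have := block_weightE V V (s - r) h r s; rewrite (addrC r) subrK eqxx => <-.
  suff -> : block_weight V V (s - r) h = 0 by rewrite mulmx0 mul0mx.
  apply: (proj_gen_ext (block_weight_hom false W W (s - r) h_hom) (@fhom0 _ _ _ (Q i) (Q i))).
  by rewrite gen_block_weight mulmx0 h0 // subr_le0.
rewrite -kermx_eq0; apply/eqP/row_matrixP => r; rewrite row0; set v := row r _.
have vE : v = - (v *m h).
  have : v *m f = 0 by apply/sub_kermxP; exact: row_sub.
  by rewrite /h mulmxBr mulmx1 opprB => ->; rewrite subr0.
have H (m : nat) : forall s : int, s < m%:Z -> v *m wt W s = 0.
  elim: m => [|m IH] s lt_s; first by rewrite wt0 ?mulmx0 //; left.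
  have -> : v *m wt W s = - \sum_(x < (2 * gb V + 1)%N) v *m V (- (gb V)%:Z + x%:Z) *m h *m wt W s.
    by rewrite -mulmx_suml -mulmx_suml -mulmx_sumr gw_sum mulmx1 {1}vE mulNmx.
  rewrite big1 ?oppr0 // => x _; have [le_s|lt_x] := leP s (- (gb V)%:Z + x%:Z).
    by have := low _ _ le_s; rewrite -!mulmxA => ->; rewrite mulmx0.
  by rewrite [v *m _]IH ?mul0mx //; clear -lt_x lt_s; lia.
rewrite -[v]mulmx1 -(gw_sum V) mulmx_sumr big1 // => x _.
by apply: (H (absz (- (gb V)%:Z + x%:Z)).+1); lia.
Qed.

Section Iso.
Variables (i : 'I_n) (P : fmod L right_side).
Hypotheses (P_proj : fm_projective P) (P_ind : fm_indecomposable P) (P_top : has_top P (td_S t i)).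

(** P and the bar term in degree 0 both surject onto S_i. The composite of the two lifts is
    compatible with the augmentation, hence invertible by [cover_endo_inj], so the bar term is a
    summand of P. *)
Lemma cover_iso : exists (f : 'M_(fm_dim P, fm_dim (Q i))) (g : 'M_(fm_dim (Q i), fm_dim P)),
  [/\ is_fhom (M := P) (N := Q i) f, is_fhom (M := Q i) (N := P) g, f *m g = 1%:M & g *m f = 1%:M].
Proof.
have [f0 [f0_hom f0_full _]] := P_top; pose d := bd (B i) (add0r 1).
have d_hom : is_fhom (M := Q i) (N := B i 1) d by exact: bd_hom.
have bed1 : be (B i) (add0r 1) *m d = 1%:M.
  have := bed (B i) (add0r 1) (erefl (1 + 1)); rewrite [bd _ erefl](_ : _ = 0) ?mul0mx ?addr0 //.
  by apply: dim0_mxr; apply: b_high.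
have [u [u' [uu' u'u]]] : exists (u : 'M[k]_(fm_dim (td_S t i), fm_dim (B i 1))) (u' : 'M_(fm_dim (B i 1), fm_dim (td_S t i))),
    u *m u' = 1%:M /\ u' *m u = 1%:M.
  by rewrite (td_dim t i) (b_top_dim (B i)); exists 1%:M, 1%:M; rewrite mulmx1.
have u_hom : is_fhom (M := td_S t i) (N := B i 1) u.
  by move=> a; rewrite (b_top_act (B i)) (chrE (td_dim t)) scalar_mxC.
pose f := f0 *m u.
have f_hom : is_fhom (M := P) (N := B i 1) f := fhomM f0_hom u_hom.
have f_full : row_full f.
  have /row_fullP[x xE] := f0_full; apply/row_fullP; exists (u' *m x).
  by rewrite /f mulmxA -(mulmxA u') xE mulmx1.
have d_full : row_full d by apply/row_fullP; exists (be (B i) (add0r 1)).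
have [h1 h1_hom h1E] := proj_cover_projective B i _ _ f d f_hom f_full d_hom.
have [h2 h2_hom h2E] := @P_proj (Q i) (B i 1) d f d_hom d_full f_hom.
pose phi := h1 *m h2.
have phi_free : row_free phi.
  by apply: cover_endo_inj; [apply: (fhomM h1_hom h2_hom)|rewrite /phi -mulmxA h2E h1E].
have phi_unit : phi \in unitmx by rewrite -row_free_unit.
pose g := invmx phi *m h1.
have gh2 : g *m h2 = 1%:M by rewrite /g -mulmxA mulVmx.
have Q0 : (0 < fm_dim (Q i))%N.
  rewrite lt0n; apply/eqP => Q0; case/eqP: (gen_neq0 B i); exact: dim0_mxr.
have [_ ind] := P_ind; pose V := kermx h2.
(* P is the direct sum of the image of h1 and the kernel of h2, since g h2 = 1; indecomposability
   makes the kernel zero. *)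
have [||||U0|V0] := ind <<h1>>%MS V.
- by move=> a; rewrite (eqmxMr _ (genmxE h1)) genmxE -h1_hom submxMl.
- by move=> a; apply/sub_kermxP; rewrite -mulmxA h2_hom mulmxA mulmx_ker mul0mx.
- rewrite -sub1mx -[1%:M](subrK (h2 *m g)) addmx_sub //; last first.
    by apply: submx_trans (addsmxSl _ _); rewrite genmxE /g mulmxA submxMl.
  apply: submx_trans (addsmxSr _ _); apply/sub_kermxP.
  by rewrite mulmxBl mul1mx -mulmxA gh2 mulmx1 subrr.
- apply/eqP; rewrite -submx0; apply/rV_subP => x; rewrite sub_capmx genmxE => /andP[/submxP[w ->] /sub_kermxP].
  rewrite -mulmxA => /(congr1 (fun z => z *m invmx phi)); rewrite mul0mx -mulmxA mulmxV // mulmx1 => ->.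
  by rewrite mul0mx sub0mx.
- have h10 : h1 = 0 by apply/eqP; rewrite -submx0 -U0 genmxE.
  move: phi_free; rewrite /phi h10 mul0mx /row_free mxrank0 => /eqP Q00; by rewrite -Q00 in Q0.
have h2g : h2 *m g = 1%:M.
  have h2_free : row_free h2 by rewrite -kermx_eq0; apply/eqP.
  by apply: (row_free_inj h2_free); rewrite -mulmxA gh2 mulmx1 mul1mx.
exists h2, g; split=> //; exact: (hom_inverse h2_hom).
Qed.
End Iso.

(** A map out of the cover of S_i is determined by the image of its generator, which may be any
    element of the target fixed by e_i. *)
Theorem dim_hom_cover (P : 'I_n -> fmod L right_side) (i j : 'I_n) :
  (forall i, fm_projective (P i)) -> (forall i, fm_indecomposable (P i)) ->
  (forall i, has_top (P i) (td_S t i)) ->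
  \dim (fhom_vspace (P i) (P j)) = \rank (fm_act (Q j) (e i)).
Proof.
move=> pP iP tP; have [fi [gi [fi_hom gi_hom fgi gfi]]] := cover_iso (pP i) (iP i) (tP i).
have [fj [gj [fj_hom gj_hom fgj gfj]]] := cover_iso (pP j) (iP j) (tP j).
pose r := \rank (fm_act (Q j) (e i)).
pose phi (f : 'M[k]_(fm_dim (P i), fm_dim (P j))) : 'rV[k]_(fm_dim (Q j)) := gen i *m gi *m f *m fj.
have phi_lin : linear phi by move=> c f g; rewrite /phi mulmxDr mulmxDl -scalemxAr -scalemxAl.
pose psi (u : 'rV[k]_r) : 'rV[k]_(fm_dim (Q j)) := u *m part_in (e_idem t i) (Q j).
have psi_lin : linear psi by move=> c f g; rewrite /psi mulmxDl -scalemxAl.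
pose phil := GRing.isLinear.Build k _ _ _ _ phi_lin.
pose psil := GRing.isLinear.Build k _ _ _ _ psi_lin.
pose phiL : {linear _ -> _} := HB.pack phi phil.
pose psiL : {linear _ -> _} := HB.pack psi psil.
have phiE f : linfun phi f = phi f by exact: (lfunE phiL).
have psiE f : linfun psi f = psi f by exact: (lfunE psiL).
have <- : \dim (linfun phi @: fhom_vspace (P i) (P j)) = \dim (fhom_vspace (P i) (P j)).
  apply: limg_dim_eq; apply/eqP; rewrite -subv0; apply/subvP => f.
  rewrite memv_cap memv_ker phiE memv0 => /andP[/mem_fhom_vspace Hf /eqP f0]; apply/eqP.
  have : gi *m f *m fj = 0.
    apply: (proj_gen_ext (B := B) (i := i) (N := Q j)).
    - by apply: (fhomM (N := P j)) => //; apply: (fhomM (N := P i)).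
    - exact: fhom0.
    - by rewrite mulmx0 -f0 /phi !mulmxA.
  move/(congr1 (fun x => fi *m x *m gj)); rewrite !mulmxA fgi mul1mx mulmx0 mul0mx -mulmxA fgj mulmx1.
  by [].
have -> : (linfun phi @: fhom_vspace (P i) (P j))%VS = limg (linfun psi).
  apply/vspaceP => v; apply/memv_imgP/memv_imgP => -[x].
    move=> /mem_fhom_vspace Hx ->; rewrite phiE; exists (phi x *m part_out (e_idem t i) (Q j)); first exact: memvf.
    rewrite psiE /psi -mulmxA part_outK.
    have Hy : is_fhom (M := Q i) (N := Q j) (gi *m x *m fj).
      by apply: (fhomM (N := P j)) => //; apply: (fhomM (N := P i)).
    have -> : phi x = gen i *m (gi *m x *m fj) by rewrite /phi !mulmxA.
    by rewrite -(mulmxA (gen i)) -Hy (mulmxA (gen i) (fm_act _ _)) proj_gen_e eqxx scale1r.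
  move=> _ ->; rewrite psiE; have [F F_hom FE] := @proj_gen_lift k L G n t B i (Q j) (psi x).
  exists (fi *m F *m gj).
    apply/mem_fhom_vspace; apply: (fhomM (N := Q j)) => //.
    by apply: (fhomM (N := Q i)).
  rewrite phiE /phi !mulmxA -(mulmxA (gen i)) gfi mulmx1 FE -(mulmxA _ gj) gfj mulmx1.
  by rewrite /psi -mulmxA part_in_act.
rewrite limg_dim_eq ?dimvf; first by rewrite /dim /= mul1n.
apply/eqP; rewrite -subv0; apply/subvP => u; rewrite memv_cap memv_ker psiE memv0 => /andP[_ /eqP u0].
by rewrite -[u]mulmx1 -(part_inK (e_idem t i) (Q j)) mulmxA [u *m _]u0 mul0mx.
Qed.
End Cartan.

(** * The cone of the Cartan matrix *)

Section Assembly.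
Variables (k : fieldType) (L : falgType k) (G : nonneg_grading L) (n : nat) (t : top_data G n).
Variables (T : triangulated) (E : functor (DGcat k) (tr_cat T)).
Hypothesis E_A1 : A1_homotopy_invariant E.
Local Notation "g \ot f" := (tr_comp g f) (at level 40, left associativity).
Local Notation e := (td_e t).
Local Notation Db := (Db_dgcat L).
Variable B : forall i, bar t i.
Variables (D : dgcat k) (DD : discrete D) (ob : 'I_n -> D) (ix : D -> 'I_n).
Hypotheses (obK : cancel ob ix) (ixK : cancel ix ob).
Variable F : dgfunctor D Db.
Hypotheses (F_ob : forall X, F X = res B (ix X)) (F_iso : @is_iso (tr_cat T) _ _ (Em E F)).
Variables (D' : dgcat k) (DD' : discrete D') (ob' : 'I_n -> D') (ix' : D' -> 'I_n).
Hypotheses (ob'K : cancel ob' ix') (ix'K : cancel ix' ob').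
Variable F' : dgfunctor D' (full_dgcat (@perfect k L)).
Hypotheses (F'_ob : forall X, sval (F' X) = cover_complex B (ix' X)) (F'_iso : @is_iso (tr_cat T) _ _ (Em E F')).
Local Notation base := (base_dgcat k).
Let prDb := @Db_strongly_pretriangulated k L.
Let O0 : @dg_is_zero k Db (zero_complex L) := @zero_complex_zero k L.

Let q (i : 'I_n) : tr_hom (E D : T) (E base : T) := family_coord E_A1 DD ix i.
Let pt (i : 'I_n) : tr_hom (E base : T) (E D : T) := Em E (point (ob i)).
Let x (i : 'I_n) : tr_hom (E base : T) (E Db : T) := Em E (point (res B i : Db)).
Let y (i : 'I_n) : tr_hom (E base : T) (E Db : T) := Em E (point (cover_complex B i : Db)).
(** Both J and J' start from E(D), which puts simples and projectives in the same coordinates: J is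
    an isomorphism because the simples generate, and J' is the inclusion of perfect complexes up to
    an isomorphism. *)
Let J : tr_hom (E D : T) (E Db : T) := Em E (discrete_functor DD (fun X => res B (ix X) : Db)).
Let J' : tr_hom (E D : T) (E Db : T) := Em E (discrete_functor DD (fun X => cover_complex B (ix X) : Db)).
Let K : tr_hom (E base : T) _ := Em E (point (line k : Db_dgcat (k^o : falgType k))).
Let phi (i : 'I_n) := Em E (isotypic t i).

Let JE : J = \sum_i x i \ot q i. Proof. exact: (@Em_family k T E E_A1 n D DD ix Db prDb _ O0 (fun X => res B (ix X)) (res B) (fun _ => erefl)). Qed.
Let J'E : J' = \sum_i y i \ot q i. Proof. exact: (@Em_family k T E E_A1 n D DD ix Db prDb _ O0 (fun X => cover_complex B (ix X)) (cover_complex B) (fun _ => erefl)). Qed.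
Let J_pt i : J \ot pt i = x i.
Proof. by rewrite -Em_comp /x -{2}(obK i); apply: Em_iso; apply: point_comp. Qed.

Let J_iso : @is_iso (tr_cat T) _ _ J.
Proof.
suff -> : J = Em E F by [].
rewrite -[RHS]tr_comp1r -Em_id -(Em_iso E (discrete_functor_idf DD)) -Em_comp.
by symmetry; apply: Em_iso; exact: discrete_functor_comp.
Qed.

Let K_iso : @is_iso (tr_cat T) _ _ K. Proof. exact: line_iso. Qed.
Let K_inj X (f g : tr_hom X (E base : T)) : K \ot f = K \ot g -> f = g.
Proof. exact: (is_iso_inj K_iso). Qed.
Let J_inj X (f g : tr_hom X (E D : T)) : J \ot f = J \ot g -> f = g.
Proof. exact: (is_iso_inj J_iso). Qed.

(** The functor V |-> V e_a kills every simple but the a-th, so through J it reads off the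
    coordinate a; the biproduct relations follow from this. *)
Let phi_J a : phi a \ot J = K \ot q a.
Proof.
rewrite JE tr_comp_sumr (bigD1 a) //= big1 ?addr0 => [|i ia].
  by rewrite -tr_compA [X in X \ot _]isotypic_res // eqxx.
by rewrite -tr_compA [X in X \ot _]isotypic_res // eq_sym (negbTE ia) mulr0n tr_comp0l.
Qed.
Let q_pt a b : q a \ot pt b = if a == b then tr_id _ else 0.
Proof.
apply: K_inj; rewrite -tr_compA -phi_J tr_compA J_pt [LHS]isotypic_res //.
by case: eqP => _; rewrite ?mulr1n ?tr_comp1r // mulr0n tr_comp0r.
Qed.
Let pt_q : \sum_i pt i \ot q i = tr_id (E D : T).
Proof.
apply: J_inj; rewrite tr_comp_sumr tr_comp1r JE; apply: eq_bigr => i _.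
by rewrite -tr_compA -JE J_pt.
Qed.

Let c a b := (\rank (fm_act (proj_cover B b) (e a)))%:Z.
(** The coordinates of the class of P_b in the classes of the simples are the dimensions of the
    spaces P_b e_a. *)
Let yE b : y b = \sum_a x a *~ c a b.
Proof.
have [Ji [_ JJi]] := J_iso; have {}JJi : J \ot Ji = tr_id _ by exact: JJi.
have qE a : q a \ot (Ji \ot y b) = tr_id _ *~ c a b.
  apply: K_inj; rewrite -tr_compA -phi_J tr_compA -(tr_compA J) JJi tr_comp1l tr_compMzr tr_comp1r.
  by rewrite [LHS]isotypic_cover // /c pmulrn.
rewrite -[LHS]tr_comp1l -JJi tr_compA {1}JE tr_comp_suml; apply: eq_bigr => a _.
by rewrite tr_compA qE tr_compMzr tr_comp1r.
Qed.

(** The discrete categories of simples and of projectives have objects indexed by the same set, so E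
    identifies them. *)
Let J'_factor : exists2 u : tr_hom (E D : T) (E (full_dgcat (@perfect k L)) : T),
  @is_iso (tr_cat T) _ _ u & J' = Em E (full_inclusion (@perfect k L)) \ot u.
Proof.
pose H := discrete_functor DD (fun X => ob' (ix X)).
exists (Em E F' \ot Em E H).
  apply: is_iso_comp => //; apply: (Em_discrete E DD DD' (F' := fun X => ob (ix' X))) => X.
    by rewrite ob'K ixK.
  by rewrite obK ix'K.
rewrite -!Em_comp; symmetry; apply: Em_iso.
apply: (@discrete_functor_comp _ D DD D' Db _ (dgf_compf (full_inclusion (@perfect k L)) F')) => X.
by rewrite -[LHS]/(sval (F' (ob' (ix X)))) F'_ob ob'K.
Qed.

Variables (stmod : DGcat k) (Q : dgfunctor Db stmod).
Hypothesis Q_quotient : dg_verdier_quotient (@perfect k L) Q.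
Variables (Ekn : T) (inj : 'I_n -> tr_hom (E base : T) Ekn) (proj : 'I_n -> tr_hom Ekn (E base : T)).
Hypothesis Ekn_power : is_power inj proj.
Variables (C : 'M[int]_n) (Z : T).
Hypothesis C_rank : forall a b, C a b = (\rank (fm_act (proj_cover B b) (e a)))%:Z.
Hypothesis Z_cone : is_cone (matrix_action inj proj C) Z.

(** [theta] identifies E(k)^n with E(D). Through it the Cartan matrix and the inclusion of perfect
    complexes form a commutative square with invertible vertical maps, so their cones are
    isomorphic. *)
Theorem verdier_quotient_cone : @isomorphic (tr_cat T) (E stmod) Z.
Proof.
have [proj_inj inj_proj] := Ekn_power; have [u u_iso J'u] := J'_factor; have [g [h Zgh]] := Z_cone.
have [h' tri] := Em_verdier (F := dgf_idf _) E_A1 prDb (@thick_perfect k L) Q_quotient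
  (fmor_iso (to_Hmo k) (@is_iso_id (DGcat k) (full_dgcat (@perfect k L)))).
pose theta := \sum_i pt i \ot proj i; pose theta' := \sum_i inj i \ot q i.
have theta_inj a : theta \ot inj a = pt a.
  rewrite tr_comp_suml (bigD1 a) //= big1 ?addr0 => [|i ia]; first by rewrite tr_compA proj_inj eqxx tr_comp1r.
  by rewrite tr_compA proj_inj (negbTE ia) tr_comp0r.
have q_theta a : q a \ot theta = proj a.
  rewrite tr_comp_sumr (bigD1 a) //= big1 ?addr0 => [|i ia]; first by rewrite -tr_compA q_pt eqxx tr_comp1l.
  by rewrite -tr_compA q_pt eq_sym (negbTE ia) tr_comp0l.
have theta_iso : @is_iso (tr_cat T) _ _ theta.
  exists theta'; split.
    rewrite -[_ =c _]/(theta' \ot theta = tr_id _) -inj_proj tr_comp_suml; apply: eq_bigr => i _.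
    by rewrite tr_compA q_theta.
  rewrite -[_ =c _]/(theta \ot theta' = tr_id _) -pt_q tr_comp_sumr; apply: eq_bigr => i _.
  by rewrite -tr_compA theta_inj.
have E1 : J' \ot theta = J \ot theta \ot matrix_action inj proj C.
  transitivity (\sum_a \sum_b (x a \ot proj b) *~ C a b).
    rewrite J'E tr_comp_suml exchange_big; apply: eq_bigr => b _ /=.
    rewrite tr_compA q_theta yE tr_comp_suml; apply: eq_bigr => a _.
    by rewrite tr_compMzl /c C_rank.
  rewrite /matrix_action tr_comp_sumr; apply: eq_bigr => a _; rewrite tr_comp_sumr; apply: eq_bigr => b _.
  by rewrite tr_compMzr -tr_compA (tr_compA J) theta_inj J_pt.
have [f [f' ff']] : @isomorphic (tr_cat T) Z (E stmod).
  apply: (cone_isomorphic Zgh tri (is_iso_comp u_iso theta_iso) (is_iso_comp J_iso theta_iso)).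
  transitivity (J' \ot theta); first exact: esym E1.
  by rewrite J'u tr_compA Em_comp Em_id tr_comp1r.
by exists f'; exists f; case: ff' => ff' f'f; split.
Qed.
End Assembly.

Theorem theorem3p4p2 (k : fieldType) (L : falgType k) (G : nonneg_grading L)
  (L_basic : basic L)
  (L_ASG : AS_Gorenstein G)
  (L0_top : degree0_is_top G)
  (n : nat)
  (S : 'I_n -> fmod L right_side)
  (S_simple : forall i, fm_simple (S i))
  (S_distinct : forall i j, fm_iso (S i) (S j) -> i = j)
  (S_complete : forall M : fmod L right_side, fm_simple M -> exists i, fm_iso M (S i))
  (S_dim1 : forall i, fm_dim (S i) = 1%N)
  (P : 'I_n -> fmod L right_side)
  (P_projective : forall i, fm_projective (P i))
  (P_indecomposable : forall i, fm_indecomposable (P i))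
  (P_top : forall i, has_top (P i) (S i))
  (T : triangulated) (E : functor (DGcat k) (tr_cat T))
  (E_A1 : A1_homotopy_invariant E)
  (stmod : DGcat k) (Q : dgfunctor (Db_dgcat L) stmod)
  (Q_quotient : dg_verdier_quotient (@perfect k L) Q)
  (Ekn : T) (inj : 'I_n -> tr_hom (E (base_dgcat k) : T) Ekn)
  (proj : 'I_n -> tr_hom Ekn (E (base_dgcat k) : T))
  (Ekn_power : is_power inj proj)
  (Z : T)
  (Z_cone : is_cone (matrix_action inj proj (cartan_matrix P)) Z) :
  @isomorphic (tr_cat T) (E stmod) Z.

Proof.
have [t tS] := top_data_exists L0_top S_distinct S_complete S_dim1.
have P_top' i : has_top (P i) (td_S t i) by rewrite tS.
pose B := bar_of t.
(* Both numbers are the dimension of P_b e_a, the multiplicity of S_a in P_b. *)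
have rankE a b : cartan_matrix P a b = (\rank (fm_act (proj_cover B b) (td_e t a)))%:Z.
  by rewrite mxE (dim_hom_cover B a b P_projective P_indecomposable P_top').
have F_ob X : koszul0_to_Db B X = res B (koszul0_ix X) by [].
have F'_ob X : sval (cover0_to_perfect B X) = cover_complex B (cover0_ix X) by [].
have obK : cancel (koszul0_ob B) (@koszul0_ix _ _ _ _ _ B) by [].
have ixK : cancel (@koszul0_ix _ _ _ _ _ B) (koszul0_ob B) by [].
have ob'K : cancel (cover0_ob B) (@cover0_ix _ _ _ _ _ B) by [].
have ix'K : cancel (@cover0_ix _ _ _ _ _ B) (cover0_ob B) by [].
exact: (verdier_quotient_cone E_A1 (koszul0_discrete B) obK ixK F_ob (koszul0_to_Db_iso B E_A1)
  (cover0_discrete B) ob'K ix'K F'_ob (cover0_to_perfect_iso B E_A1) Q_quotient Ekn_power rankE Z_cone).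
Qed.
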